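(* Let $T\in\mathcal L(L^2(\mathbb R^2))$ be an operator with a $CZX$ kernel with parameters $\theta_1\in(0,1]$ and $\theta_2=1$. Then for every $p\in(1,\infty)$ there is a constant $C=C(p,T)$ such that for every $w\in A_p(\mathbb R^2)$ the operator $T$ extends boundedly to $L^p(w)$ with norm $$\|T\|_{\mathcal L(L^p(w))}\le C\,[w]_{A_p}^{p'},\qquad p'=\frac p{p-1}.$$ Moreover, if $p\in(1,\infty)$, $w,\lambda\in A_p(\mathbb R^2)$, $\nu=w^{1/p}\lambda^{-1/p}$, and $b\in L^1_{\mathrm{loc}}(\mathbb R^2)$ satisfies $$\|b\|_{\mathrm{BMO}_\nu}:=\sup_I\frac1{\nu(I)}\int_I|b-\langle b\rangle_I|<\infty,$$ where the supremum is over cubes $I\subset\mathbb R^2$, then the commutator $[b,T]f:=bTf-T(bf)$ satisfies $$\|[b,T]\|_{L^p(w)\to L^p(\lambda)}\le C'\|b\|_{\mathrm{BMO}_\nu},$$ where $C'$ depends only on $p$, $T$, $w$ and $\lambda$ (not on $b$).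
   Context: Write points of $\mathbb R^2$ as $x=(x^1,x^2)$. For $\theta_2\in(0,1]$ and $x^1\ne y^1$, $x^2\ne y^2$ put $$D_{\theta_2}(x,y):=\Big(\frac{|x^1-y^1|}{|x^2-y^2|}+\frac{|x^2-y^2|}{|x^1-y^1|}\Big)^{-\theta_2}.$$ Let $\theta_1,\theta_2\in(0,1]$. A function $K:\{(x,y)\in\mathbb R^2\times\mathbb R^2: x^1\neq y^1 \text{ and } x^2\ne y^2\}\to\mathbb C$ is a $CZX$ kernel with parameters $\theta_1,\theta_2$ if there is a constant $C_K$ such that (a) size: $|K(x,y)|\le C_K\frac{1}{|x^1-y^1|}\frac1{|x^2-y^2|}D_{\theta_2}(x,y)$; (b) mixed Hölder and size: $|K(x,y)-K((w^1,x^2),y)|\le C_K\frac{|x^1-w^1|^{\theta_1}}{|x^1-y^1|^{1+\theta_1}}\frac1{|x^2-y^2|}D_{\theta_2}(x,y)$ whenever $|x^1-w^1|\le|x^1-y^1|/2$, and $|K(x,y)-K((x^1,w^2),y)|\le C_K\frac{1}{|x^1-y^1|}\frac{|x^2-w^2|^{\theta_1}}{|x^2-y^2|^{1+\theta_1}}D_{\theta_2}(x,y)$ whenever $|x^2-w^2|\le|x^2-y^2|/2$; (c) the two estimates in (b) also hold for the kernel $(x,y)\mapsto K(y,x)$. $T\in\mathcal L(L^2(\mathbb R^2))$ has kernel $K$ if $\langle Tf,g\rangle=\iint K(x,y)f(y)g(x)\,dx\,dy$ whenever $f,g$ are finite linear combinations of indicators of cubes with $\{f\ne0\}\cap\{g\neq0\}=\varnothing$,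 where $\langle f,g\rangle=\int fg$. Cubes in $\mathbb R^2$ are axes-parallel half-open squares. A weight is an a.e. positive locally integrable function $w$; $w\in A_p(\mathbb R^2)$ means $[w]_{A_p}:=\sup_J\langle w\rangle_J\langle w^{-1/(p-1)}\rangle_J^{p-1}<\infty$, the supremum over all cubes $J\subset\mathbb R^2$, with $\langle f\rangle_J=\frac1{|J|}\int_Jf$. $\|f\|_{L^p(w)}=(\int|f|^pw)^{1/p}$, $\nu(I)=\int_I\nu$. $T$ extends boundedly to $L^p(w)$ with norm at most $C$ if $\|Tf\|_{L^p(w)}\le C\|f\|_{L^p(w)}$ for all $f\in L^2(\mathbb R^2)\cap L^p(w)$. The commutator norm bound means $\|[b,T]f\|_{L^p(\lambda)}\le C'\|b\|_{\mathrm{BMO}_\nu}\|f\|_{L^p(w)}$ for all bounded compactly supported $f$ (for such $f$, $bf\in L^1$, and $T(bf)$ is understood through the extension of $T$ from $L^1$ to $L^{1,\infty}$). *)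

(* Defs.v *)
From HB Require Import structures.
From mathcomp Require Import all_boot all_order all_algebra.
From mathcomp Require Import all_classical all_reals all_analysis.
From mathcomp Require Import complex.

Set Implicit Arguments.
Unset Strict Implicit.
Unset Printing Implicit Defensive.
Import Order.TTheory GRing.Theory Num.Theory.
Import numFieldNormedType.Exports.
Local Open Scope classical_set_scope.
Local Open Scope ring_scope.
Local Open Scope complex_scope.

(** [measurableTypeR R] is the carrier of [R] with its Borel sets, in the form
    on which [lebesgue_measure] is defined. *)
Notation borel2 R := (measurableTypeR R * measurableTypeR R)%type.

Definition leb2 (R : realType) : set (borel2 R) -> \bar R :=
  (@lebesgue_measure R \x @lebesgue_measure R)%E.

HB.instance Definition _ (R : realType) := Measure.on (@leb2 R).

(** The library's sigma-finite instance on products is not found by inference. *)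
Lemma leb2_sigma_finite (R : realType) : sigma_finite setT (@leb2 R).
Proof.
have /sigma_finiteP[F [TF ndF Foo]] := sigma_finiteT (@lebesgue_measure R).
exists (fun n => F n `*` F n).
  rewrite -setXTT TF predeqE => -[x y]; split.
    move=> [/= [n _ Fnx] [k _ Fky]]; exists (maxn n k) => //; split.
    - by move: x Fnx; exact/subsetPset/ndF/leq_maxl.
    - by move: y Fky; exact/subsetPset/ndF/leq_maxr.
  by move=> [n _ []/= ? ?]; split; exists n.
move=> k; have [? ?] := Foo k.
split; first exact: measurableX.
by rewrite /leb2 product_measure1E// lte_mul_pinfty// ge0_fin_numE.
Qed.

HB.instance Definition _ (R : realType) :=
  Measure_isSigmaFinite.Build _ _ _ (@leb2 R) (@leb2_sigma_finite R).

(** Complex-valued functions. The library has no measurable or normed structure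
    on [R[i]] for an abstract [R : realType], so measurability and integration
    are taken componentwise; [cmod] is the real-valued modulus. *)

Definition cmod (R : realType) (z : R[i]) : R :=
  Num.sqrt (complex.Re z ^+ 2 + complex.Im z ^+ 2).

Definition cmeasurable (R : realType) (f : R * R -> R[i]) : Prop :=
  measurable_fun setT (fun x : borel2 R => complex.Re (f x)) /\
  measurable_fun setT (fun x : borel2 R => complex.Im (f x)).

Definition cintegral d (X : measurableType d) (R : realType)
    (mu : {measure set X -> \bar R}) (D : set X) (f : X -> R[i]) : R[i] :=
  Complex (\int[mu]_(x in D) complex.Re (f x))
          (\int[mu]_(x in D) complex.Im (f x)).

(** [f \in L^q(R^2)]. Functions are Borel representatives. *)
Definition inL (R : realType) (q : R) (f : R * R -> R[i]) : Prop :=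
  cmeasurable f /\ ('N[@leb2 R]_(q%:E)[EFin \o (@cmod R \o f)] < +oo)%E.

Definition Lnormw (R : realType) (p : R) (w : R * R -> R) (f : R * R -> R[i]) :
    \bar R :=
  ((\int[@leb2 R]_x (cmod (f x) `^ p * w x)%:E) `^ p^-1)%E.

Definition inLw (R : realType) (p : R) (w : R * R -> R) (f : R * R -> R[i]) :
    Prop :=
  cmeasurable f /\ (Lnormw p w f < +oo)%E.

(** The axes-parallel half-open square with lower left corner [a] and side
    length [l]; it is a cube when [0 < l]. *)
Definition square (R : realType) (a : R * R) (l : R) : set (R * R)%type :=
  `[a.1, a.1 + l[%classic `*` `[a.2, a.2 + l[%classic.

Definition is_cube (R : realType) (I : set (R * R)%type) : Prop :=
  exists a l, 0 < l /\ I = square a l.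

Definition avg (R : realType) (I : set (R * R)%type) (f : R * R -> R) : \bar R :=
  ((@leb2 R I)^-1 * \int[@leb2 R]_(x in I) (f x)%:E)%E.

Definition cavg (R : realType) (I : set (R * R)%type) (f : R * R -> R[i]) : R[i] :=
  ((fine (@leb2 R I))^-1)%:C * cintegral (@leb2 R) I f.

Definition is_weight (R : realType) (w : R * R -> R) : Prop :=
  [/\ measurable_fun setT (w : borel2 R -> R),
      {ae @leb2 R, forall x, 0 < w x} &
      forall A, compact A -> (\int[@leb2 R]_(x in A) `|(w x)%:E| < +oo)%E].

Definition Ap_const (R : realType) (p : R) (w : R * R -> R) : \bar R :=
  ereal_sup [set (avg J w * (avg J (fun x => w x `^ (- (p - 1)^-1))%R) `^ (p - 1))%E
            | J in @is_cube R].

Definition in_Ap (R : realType) (p : R) (w : R * R -> R) : Prop :=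
  is_weight w /\ (Ap_const p w < +oo)%E.

Definition L1loc (R : realType) (b : R * R -> R[i]) : Prop :=
  cmeasurable b /\
  forall A, compact A -> (\int[@leb2 R]_(x in A) (cmod (b x))%:E < +oo)%E.

Definition bmo_norm (R : realType) (nu : R * R -> R) (b : R * R -> R[i]) :
    \bar R :=
  ereal_sup [set ((\int[@leb2 R]_(x in I) (nu x)%:E)^-1 *
                  \int[@leb2 R]_(x in I) (cmod (b x - cavg I b))%:E)%E
            | I in @is_cube R].

(** Kernels are total functions, used only on [offdiag]. *)

Definition offdiag (R : realType) : set ((R * R) * (R * R))%type :=
  [set z | z.1.1 != z.2.1 /\ z.1.2 != z.2.2].

Definition Dfac (R : realType) (theta2 : R) (x y : R * R) : R :=
  (`|x.1 - y.1| / `|x.2 - y.2| + `|x.2 - y.2| / `|x.1 - y.1|) `^ (- theta2).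

Definition size_bound (R : realType) (theta2 C : R)
    (K : R * R -> R * R -> R[i]) : Prop :=
  forall x y, offdiag (x, y) ->
    cmod (K x y) <= C * (1 / `|x.1 - y.1|) * (1 / `|x.2 - y.2|) * Dfac theta2 x y.

Definition mixed_bound (R : realType) (theta1 theta2 C : R)
    (K : R * R -> R * R -> R[i]) : Prop :=
  (forall x y w1, offdiag (x, y) -> `|x.1 - w1| <= `|x.1 - y.1| / 2 ->
     cmod (K x y - K (w1, x.2) y) <=
       C * (`|x.1 - w1| `^ theta1 / `|x.1 - y.1| `^ (1 + theta1)) *
       (1 / `|x.2 - y.2|) * Dfac theta2 x y) /\
  (forall x y w2, offdiag (x, y) -> `|x.2 - w2| <= `|x.2 - y.2| / 2 ->
     cmod (K x y - K (x.1, w2) y) <=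
       C * (1 / `|x.1 - y.1|) *
       (`|x.2 - w2| `^ theta1 / `|x.2 - y.2| `^ (1 + theta1)) * Dfac theta2 x y).

Definition CZX_kernel (R : realType) (theta1 theta2 : R)
    (K : R * R -> R * R -> R[i]) : Prop :=
  exists C, [/\ size_bound theta2 C K, mixed_bound theta1 theta2 C K &
                mixed_bound theta1 theta2 C (fun x y => K y x)].

(** A bounded linear operator on complex [L^2(R^2)], acting on representatives.
    Linearity and boundedness make it respect almost everywhere equality. *)
Definition L2_operator (R : realType)
    (T : (R * R -> R[i]) -> (R * R -> R[i])) : Prop :=
  [/\ forall f, inL 2 f -> inL 2 (T f),
      forall (a : R[i]) f g, inL 2 f -> inL 2 g ->
        {ae @leb2 R, forall x, T (fun t => a * f t + g t) x = a * T f x + T g x} &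
      exists M : R, forall f, inL 2 f ->
        ('N[@leb2 R]_(2%:E)[EFin \o (@cmod R \o T f)] <=
         M%:E * 'N[@leb2 R]_(2%:E)[EFin \o (@cmod R \o f)])%E].

Definition simple_cube_fun (R : realType) (f : R * R -> R[i]) : Prop :=
  exists (n : nat) (c : 'I_n -> R[i]) (I : 'I_n -> set (R * R)%type),
    (forall k, is_cube (I k)) /\
    f = (fun x => \sum_(k < n) c k * (\1_(I k) x)%:C).

Definition has_kernel (R : realType)
    (T : (R * R -> R[i]) -> (R * R -> R[i])) (K : R * R -> R * R -> R[i]) : Prop :=
  forall f g, simple_cube_fun f -> simple_cube_fun g ->
    [set x | f x != 0] `&` [set x | g x != 0] = set0 ->
    cintegral (@leb2 R) setT (fun x => T f x * g x) =
    cintegral (@leb2 R \x @leb2 R)%E (@offdiag R)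
      (fun z => K z.1 z.2 * f z.2 * g z.1).

(** [T1] is the continuous extension [L^1 -> L^{1,oo}] of [T]: it is linear, of
    weak type (1,1), and agrees with [T] on the dense subspace [L^1 cap L^2]. Up
    to almost everywhere equality there is at most one such [T1]. *)
Definition weak11_extension (R : realType)
    (T T1 : (R * R -> R[i]) -> (R * R -> R[i])) : Prop :=
  [/\ forall f, inL 1 f -> cmeasurable (T1 f),
      forall (a : R[i]) f g, inL 1 f -> inL 1 g ->
        {ae @leb2 R, forall x, T1 (fun t => a * f t + g t) x = a * T1 f x + T1 g x},
      exists M : R, forall f, inL 1 f -> forall t : R, 0 < t ->
        (t%:E * @leb2 R [set x | (t < cmod (T1 f x))%R] <=
         M%:E * 'N[@leb2 R]_(1%:E)[EFin \o (@cmod R \o f)])%E &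
      forall f, inL 1 f -> inL 2 f ->
        {ae @leb2 R, forall x, T1 f x = T f x}].

Definition bounded_compact_support (R : realType) (f : R * R -> R[i]) : Prop :=
  [/\ cmeasurable f,
      exists M : R, forall x, cmod (f x) <= M &
      exists A : set (R * R)%type, compact A /\ forall x, ~ A x -> f x = 0].

(** [b T f - T (b f)], where [T1] is the extension of [T] to [L^1]. *)
Definition commutator (R : realType)
    (T T1 : (R * R -> R[i]) -> (R * R -> R[i])) (b f : R * R -> R[i]) :
    R * R -> R[i] :=
  fun x => b x * T f x - T1 (fun t => b t * f t) x.

(* Main.v *)
Require Import Defs.
From HB Require Import structures.
From mathcomp Require Import all_boot all_order all_algebra.
From mathcomp Require Import all_classical all_reals all_analysis.
From mathcomp Require Import complex.
From mathcomp Require Import measurable_realfun zify ring lra.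

Set Implicit Arguments.
Unset Strict Implicit.
Unset Printing Implicit Defensive.
Import Order.TTheory GRing.Theory Num.Theory.
Import numFieldNormedType.Exports.
Local Open Scope classical_set_scope.
Local Open Scope ring_scope.

(** The parameter [theta_2 = 1] makes the kernel a standard one apart from the missing
    cancellation in each variable separately: the size bound becomes [C / |x - y|^2], and a
    change of one coordinate by [d] gains only [(d / |x^1 - y^1|)^theta_1]. Summed over the
    dyadic squares of a given size the loss in thin strips converges, because the size decays
    quadratically in the larger coordinate. Hence the matrix of the real or imaginary part of
    the operator on the [2^L x 2^L] cells of a square maps a mean zero function on a dyadic
    block to something summable away from the neighbours of the block, with a constant that
    does not depend on [L]. Calderon--Zygmund stopping on this finite grid gives the weak type
    bound and a bilinear sparse domination; the latter yields the weighted estimate through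
    Doob maximal functions with respect to the weights, and the two-weight commutator estimate
    through the oscillation of [b] on stopping blocks. Conditional expectations onto finer and
    finer grids, truncation and Fatou's lemma carry the estimates to the plane, where they are
    tested by duality. The extension to [L^1] is the limit along any sequence converging
    fast in [L^1], by the weak type bound and the Borel--Cantelli lemma. *)

(** Near the diagonal nothing but the $L^2$ bound is known, so only two facts about the matrix are
    kept: the $L^2$ bound, which handles bounded functions and adjacent blocks, and cancellation
    outside of the 3 by 3 neighbourhood of a block. The obstacle is that dyadic blocks may touch
    without a small common ancestor. Instead of shifted grids, stopping sets are replaced by Whitney
    blocks, whose adjacent members have comparable sizes, and pairs of adjacent blocks of one
    generation are kept together. The pairs of cells that are adjacent in one generation but not in
    the next exhaust all pairs, the diagonal included. The resulting sparse form therefore has two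
    adjacent cubes where the usual one has a single cube. The exponent of the weight constant: with
    $c=[w]_{A_p}^{1/p}$ and $q=p'$ the cube condition costs $c$ and the two Carleson embeddings cost
    $c^{q/p}$ and $c^{p/q}$, altogether $[w]_{A_p}$ to the power $1+1/(p(p-1))\le p'$. Doob's
    inequality enters with a constant that does not depend on the weight. *)

(** * Dyadic blocks of cells and their neighbourhoods *)

Definition cell (L : nat) := ('I_(2 ^ L) * 'I_(2 ^ L))%type.

(** Blocks are not objects of their own: a level and any cell of the block stand for it. [nb 0 k] is
    membership in the same block of level [k]; [nb 1 k] and [nb 2 k] are the 3 by 3 and 5 by 5
    neighbourhoods. *)
Definition nb (L r k : nat) (x y : cell L) : bool :=
  [&& (x.1 %/ 2 ^ k <= y.1 %/ 2 ^ k + r)%N, (y.1 %/ 2 ^ k <= x.1 %/ 2 ^ k + r)%N,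
      (x.2 %/ 2 ^ k <= y.2 %/ 2 ^ k + r)%N & (y.2 %/ 2 ^ k <= x.2 %/ 2 ^ k + r)%N].

Section Neighbours.
Variable L : nat.
Implicit Types x y z : cell L.

Lemma nbxx r k x : nb r k x x.
Proof. by rewrite /nb !leq_addr. Qed.

Lemma nbC r k x y : nb r k x y = nb r k y x.
Proof. by rewrite /nb; do 4 case: leq => //. Qed.

Lemma nb_trans r s k x y z : nb r k x y -> nb s k y z -> nb (r + s) k x z.
Proof. by rewrite /nb => /and4P[? ? ? ?] /and4P[? ? ? ?]; apply/and4P; split; lia. Qed.

Lemma nb_leq r s k x y : (r <= s)%N -> nb r k x y -> nb s k x y.
Proof. by rewrite /nb => ? /and4P[? ? ? ?]; apply/and4P; split; lia. Qed.

Lemma div2S (m k : nat) : (m %/ 2 ^ k.+1 = (m %/ 2 ^ k) %/ 2)%N.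
Proof. by rewrite expnSr divnMA. Qed.

Lemma nb_up0 k x y : nb 0 k x y -> nb 0 k.+1 x y.
Proof.
by rewrite /nb !div2S => /and4P[? ? ? ?]; apply/and4P; split; lia.
Qed.

(** Halving turns an index distance of at most 2 into one of at most 1. One level of slack thus pays
    for the passage from 5 by 5 to 3 by 3 neighbourhoods, on which the nesting arguments below
    rest. *)
Lemma nb_up2 k x y : nb 2 k x y -> nb 1 k.+1 x y.
Proof.
by rewrite /nb !div2S => /and4P[? ? ? ?]; apply/and4P; split; lia.
Qed.

Lemma nb0_mono k K x y : (k <= K)%N -> nb 0 k x y -> nb 0 K x y.
Proof.
move=> /subnK <-; elim: (K - k)%N => // d ih /ih; exact: nb_up0.
Qed.

Lemma nb1_mono k K x y : (k <= K)%N -> nb 1 k x y -> nb 1 K x y.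
Proof.
move=> /subnK <-; elim: (K - k)%N => // d ih /ih h.
by apply: nb_up2; apply: nb_leq h.
Qed.

Lemma nb21 k K x y : (k < K)%N -> nb 2 k x y -> nb 1 K x y.
Proof. by move=> kK /nb_up2; exact: nb1_mono. Qed.

Lemma nb2_mono k K x y : (k <= K)%N -> nb 2 k x y -> nb 2 K x y.
Proof.
rewrite leq_eqVlt => /orP[/eqP-> //|/nb21 h /h]; exact: nb_leq.
Qed.

Lemma nb0_congr k r x x' y : nb 0 k x x' -> nb r k x y = nb r k x' y.
Proof.
move=> h; apply/idP/idP => h'; first by rewrite -[r]add0n; apply: nb_trans h'; rewrite nbC.
by rewrite -[r]add0n; exact: nb_trans h'.
Qed.

Lemma nb0_congrr k r x y y' : nb 0 k y y' -> nb r k x y = nb r k x y'.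
Proof. by move=> h; rewrite ![nb _ _ x _]nbC; exact: nb0_congr. Qed.

Lemma nb00 x y : nb 0 0 x y = (x == y).
Proof.
rewrite /nb expn0 !divn1; apply/and4P/eqP => [[? ? ? ?]|->]; last by split; lia.
by rewrite [x]surjective_pairing [y]surjective_pairing; congr (_, _); apply/val_inj => /=; lia.
Qed.

Lemma nbL x y : nb 0 L x y.
Proof. by rewrite /nb !divn_small. Qed.

Lemma count_itv (n a b : nat) : (\sum_(i < n) ((a <= i) && (i < b)) <= b - a)%N.
Proof.
suff -> : (\sum_(i < n) ((a <= i) && (i < b)) = minn n b - a)%N by lia.
elim: n => [|n ih]; first by rewrite big_ord0; lia.
by rewrite big_ord_recr /= ih; case: (leqP a n); case: (ltnP n b) => /=; lia.
Qed.

Lemma count_itv_eq (n a b : nat) : (b <= n)%N ->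
  (\sum_(i < n) ((a <= i) && (i < b)) = b - a)%N.
Proof.
move=> bn.
suff -> : (\sum_(i < n) ((a <= i) && (i < b)) = minn n b - a)%N by lia.
elim: n {bn} => [|n ih]; first by rewrite big_ord0; lia.
by rewrite big_ord_recr /= ih; case: (leqP a n); case: (ltnP n b) => /=; lia.
Qed.

Lemma card_pairs (p q : pred 'I_(2 ^ L)) :
  (\sum_(y : cell L | p y.1 && q y.2) 1 = (\sum_(i | p i) 1) * (\sum_(i | q i) 1))%N.
Proof.
by rewrite big_distrlr /= pair_big /=.
Qed.

(** An inequality, because the neighbourhood of a block at the border sticks out of the grid; the
    truncated subtraction in [a1] and [a2] allows for this. *)
Lemma card_nb r k x : (\sum_(y : cell L | nb r k x y) 1 <= (2 * r + 1) ^ 2 * 4 ^ k)%N.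
Proof.
pose I (a b : nat) := fun i : 'I_(2 ^ L) => ((a <= i) && (i < b))%N.
pose a1 := ((x.1 %/ 2 ^ k - r) * 2 ^ k)%N; pose a2 := ((x.2 %/ 2 ^ k - r) * 2 ^ k)%N.
pose b1 := ((x.1 %/ 2 ^ k + r + 1) * 2 ^ k)%N; pose b2 := ((x.2 %/ 2 ^ k + r + 1) * 2 ^ k)%N.
have k0 : (0 < 2 ^ k)%N by rewrite expn_gt0.
apply: (@leq_trans (\sum_(y : cell L | I a1 b1 y.1 && I a2 b2 y.2) 1)).
  rewrite big_mkcond [X in (_ <= X)%N]big_mkcond /=; apply: leq_sum => y _.
  case: ifP => // /and4P[h1 h2 h3 h4].
  rewrite /I /a1 /a2 /b1 /b2 -!leq_divRL // -!ltn_divLR //.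
  rewrite ifT // !leq_subLR ![(r + _)%N]addnC h1 h3 /=.
  by apply/andP; split; lia.
rewrite card_pairs.
have h a b : (\sum_(i | I a b i) 1 <= b - a)%N.
  rewrite big_mkcond /=; apply: leq_trans (count_itv (2 ^ L) a b).
  by apply: leq_sum => i _; rewrite /I; case: ifP.
have e : (4 ^ k = 2 ^ k * 2 ^ k)%N by rewrite -expnMn.
have E (u : nat) : ((u + r + 1) * 2 ^ k - (u - r) * 2 ^ k <= (2 * r + 1) * 2 ^ k)%N.
  by rewrite -mulnBl leq_mul2r; apply/orP; right; lia.
apply: leq_trans (leq_mul (h _ _) (h _ _)) _.
apply: leq_trans (leq_mul (E _) (E _)) _.
by rewrite e; apply: eq_leq; ring.
Qed.

Lemma card_nb0 k x : (k <= L)%N -> (\sum_(y : cell L | nb 0 k x y) 1 = 4 ^ k)%N.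
Proof.
move=> kL.
pose I (a : nat) := fun i : 'I_(2 ^ L) => ((a * 2 ^ k <= i) && (i < a.+1 * 2 ^ k))%N.
have k0 : (0 < 2 ^ k)%N by rewrite expn_gt0.
rewrite (eq_bigl (fun y : cell L => I (x.1 %/ 2 ^ k)%N y.1 && I (x.2 %/ 2 ^ k)%N y.2)); last first.
  move=> y; rewrite /nb /I -!leq_divRL // -!ltn_divLR //.
  by apply/and4P/idP => [[? ? ? ?]|/andP[/andP[? ?] /andP[? ?]]];
    [apply/andP; split; apply/andP|]; split; lia.
rewrite card_pairs.
have h (i : 'I_(2 ^ L)) : (\sum_(j | I (i %/ 2 ^ k)%N j) 1 = 2 ^ k)%N.
  rewrite big_mkcond /=.
  transitivity (\sum_(j < 2 ^ L) ((i %/ 2 ^ k * 2 ^ k <= j) && (j < (i %/ 2 ^ k).+1 * 2 ^ k)))%N.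
    by apply: eq_bigr => j _; rewrite /I; case: ifP.
  rewrite count_itv_eq; first by rewrite -mulnBl subSnn mul1n.
  have e : (2 ^ (L - k) * 2 ^ k = 2 ^ L)%N by rewrite -expnD subnK.
  by rewrite -[leqRHS]e leq_mul2r ltn_divLR // e ltn_ord orbT.
by rewrite !h -expnMn.
Qed.

End Neighbours.

(** * Averages over dyadic blocks *)

Section Averages.
Variables (R : realType) (L : nat).
Implicit Types (x y z : cell L) (f g h : cell L -> R).

Definition av (k : nat) f x : R := (4%:R ^+ k)^-1 * \sum_(y | nb 0 k x y) f y.

Lemma pow4_gt0 k : 0 < 4%:R ^+ k :> R.
Proof. by rewrite exprn_gt0. Qed.

Lemma pow4_neq0 k : 4%:R ^+ k != 0 :> R.
Proof. by rewrite gt_eqF ?pow4_gt0. Qed.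

Lemma pow4V_ge0 k : 0 <= (4%:R ^+ k)^-1 :> R.
Proof. by rewrite invr_ge0 ltW ?pow4_gt0. Qed.

Lemma sum_nb0 k x : (k <= L)%N -> \sum_(y : cell L | nb 0 k x y) (1 : R) = 4%:R ^+ k.
Proof. by move=> /card_nb0 h; rewrite -natrX -(h x) natr_sum. Qed.

Lemma sum_nb r k x :
  \sum_(y : cell L | nb r k x y) (1 : R) <= ((2 * r + 1) ^ 2)%:R * 4%:R ^+ k.
Proof. by rewrite -natrX -natrM (le_trans _ (_ : (\sum_(y | nb r k x y) 1)%N%:R <= _)) ?ler_nat ?card_nb // natr_sum. Qed.

Lemma av_congr k f x x' : nb 0 k x x' -> av k f x = av k f x'.
Proof.
by move=> h; congr (_ * _); apply: eq_bigl => y; exact: nb0_congr.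
Qed.

Lemma av_ge0 k f x : (forall y, 0 <= f y) -> 0 <= av k f x.
Proof.
by move=> h; rewrite mulr_ge0 ?pow4V_ge0 // sumr_ge0.
Qed.

Lemma eq_av k f g x : (forall y, nb 0 k x y -> f y = g y) -> av k f x = av k g x.
Proof. by move=> h; congr (_ * _); apply: eq_bigr => y; exact: h. Qed.

Lemma le_av k f g x : (forall y, nb 0 k x y -> f y <= g y) -> av k f x <= av k g x.
Proof.
by move=> h; rewrite ler_wpM2l ?pow4V_ge0 // ler_sum.
Qed.

Lemma avD k f g x : av k (fun y => f y + g y) x = av k f x + av k g x.
Proof. by rewrite /av big_split mulrDr. Qed.

Lemma avZ k (c : R) f x : av k (fun y => c * f y) x = c * av k f x.
Proof. by rewrite /av -mulr_sumr mulrCA. Qed.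

Lemma avN k f x : av k (fun y => - f y) x = - av k f x.
Proof. by rewrite /av sumrN mulrN. Qed.

Lemma av_cst k (c : R) x : (k <= L)%N -> av k (fun=> c) x = c.
Proof.
move=> kL; rewrite /av -[c]mulr1 -mulr_sumr sum_nb0 //.
by rewrite mulr1 mulrCA mulVf ?mulr1 ?pow4_neq0.
Qed.

Lemma av0 f x : av 0 f x = f x.
Proof.
rewrite /av expr0 invr1 mul1r (eq_bigl (pred1 x)) ?big_pred1_eq // => y.
by rewrite nb00 eq_sym.
Qed.

Lemma ler_norm_av k f x : `|av k f x| <= av k (fun y => `|f y|) x.
Proof.
by rewrite normrM ger0_norm ?pow4V_ge0 // ler_wpM2l ?pow4V_ge0 // ler_norm_sum.
Qed.

Lemma av_mono k f x : (forall y, 0 <= f y) -> av k f x <= 4%:R * av k.+1 f x.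
Proof.
move=> f0; rewrite /av exprS invfM -!mulrA mulVKf ?pnatr_eq0 // ler_wpM2l ?pow4V_ge0 //.
rewrite [leRHS](bigID (nb 0 k x)) /= [X in _ <= X + _](eq_bigl (nb 0 k x)).
  by rewrite lerDl sumr_ge0.
by move=> y; apply/andP/idP => [[]//|h]; rewrite h nb_up0.
Qed.

End Averages.

(* A family of disjoint dyadic cubes is encoded by the set [c] it covers and the
   level [l x] of the cube containing [x]; sums over the cubes become sums over
   cells. *)
Record stopping (L : nat) (c : pred (cell L)) (l : cell L -> nat) : Prop := Stopping {
  stopping_le : forall x, (l x <= L)%N;
  stopping_congr : forall x y, c x -> nb 0 (l x) x y -> c y /\ l y = l x }.

(** * Families of disjoint blocks and their conditional expectations *)

Section Stopping.
Variables (R : realType) (L : nat) (c : pred (cell L)) (l : cell L -> nat).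
Hypothesis st : stopping c l.
Implicit Types (x y z : cell L) (f g h : cell L -> R).

Lemma st_sym x y : c x && nb 0 (l x) x y = c y && nb 0 (l y) y x.
Proof.
by apply/andP/andP => -[cx h]; have [cy e] := stopping_congr st cx h;
  split => //; rewrite e nbC.
Qed.

Lemma sum_exch (F : cell L -> cell L -> R) :
  \sum_(x | c x) \sum_(y | nb 0 (l x) x y) F x y =
  \sum_(x | c x) \sum_(y | nb 0 (l x) x y) F y x.
Proof.
rewrite !pair_big_dep /= (reindex_inj (h := fun p => (p.2, p.1))) /=; last first.
  by move=> [? ?] [? ?] [-> ->].
by apply: eq_bigl => -[x y] /=; rewrite st_sym.
Qed.

(** Lying in the same block of the family is a symmetric relation, so double sums over it may be
    exchanged; each cell then receives its own value with total weight one. *)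
Lemma sum_av f : \sum_(x | c x) f x = \sum_(x | c x) av (l x) f x.
Proof.
transitivity (\sum_(x | c x) \sum_(y | nb 0 (l x) x y) (4%:R ^+ l x)^-1 * f x).
  apply: eq_bigr => x _; rewrite -[X in \sum_(_ | _) X]mulr1 -mulr_sumr.
  by rewrite sum_nb0 ?(stopping_le st) // mulrAC mulVf ?mul1r ?pow4_neq0.
rewrite sum_exch; apply: eq_bigr => x cx; rewrite /av mulr_sumr; apply: eq_bigr => y nxy.
by rewrite (stopping_congr st cx nxy).2.
Qed.

Definition stconst (G : cell L -> R) := forall x y, c x -> nb 0 (l x) x y -> G y = G x.

Lemma sum_avM f G : stconst G ->
  \sum_(x | c x) f x * G x = \sum_(x | c x) av (l x) f x * G x.
Proof.
move=> Gc; rewrite sum_av; apply: eq_bigr => x cx.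
rewrite mulrC -avZ; apply: eq_av => y nxy.
by rewrite (Gc x y) // mulrC.
Qed.

Lemma stconst_av f : stconst (fun x => av (l x) f x).
Proof.
by move=> x y cx nxy /=; rewrite (stopping_congr st cx nxy).2; apply: av_congr; rewrite nbC.
Qed.

(** The good part of the Calderon--Zygmund decomposition: the conditional expectation that averages
    on the blocks of the family and leaves the other cells alone. *)
Definition proj f x := if c x then av (l x) f x else f x.

Lemma proj_av f x : c x -> av (l x) (proj f) x = av (l x) f x.
Proof.
move=> cx; rewrite -[RHS](av_cst _ x (stopping_le st x)); apply: eq_av => y nxy.
rewrite /proj (stopping_congr st cx nxy).1 (stopping_congr st cx nxy).2.
by apply: av_congr; rewrite nbC.
Qed.

Lemma sum_proj_diff f x : c x -> \sum_(y | nb 0 (l x) x y) (f y - proj f y) = 0.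
Proof.
move=> cx; rewrite sumrB; have := proj_av f cx; rewrite /av => /mulfI <-.
- by rewrite subrr.
- by rewrite invr_neq0 // pow4_neq0.
Qed.

Lemma proj_ge0 f : (forall y, 0 <= f y) -> forall x, 0 <= proj f x.
Proof. by move=> h x; rewrite /proj; case: ifP => // _; exact: av_ge0. Qed.

Lemma ler_norm_proj f x : `|proj f x| <= proj (fun y => `|f y|) x.
Proof. by rewrite /proj; case: ifP => // _; exact: ler_norm_av. Qed.

Lemma sum_proj f : \sum_x proj f x = \sum_x f x.
Proof.
rewrite [LHS](bigID c) [RHS](bigID c) /=; congr (_ + _); last first.
  by apply: eq_bigr => x /negbTE h; rewrite /proj h.
by rewrite [RHS]sum_av; apply: eq_bigr => x cx; rewrite /proj cx.
Qed.

End Stopping.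

(** * Whitney decomposition of a set of cells *)

Section Whitney.
Variables (L : nat) (Om : pred (cell L)).
Implicit Types (x y z : cell L).

(** The 5 by 5 neighbourhood of the level [k] block of [x] lies in [Om], neighbours off the grid
    being ignored. The largest such level gives a Whitney covering, not of [Om] but of [core], the
    cells whose own 5 by 5 neighbourhood lies in [Om]. Off [core] the maximum runs over the empty
    set and [lev] is 0. *)
Definition inside k x : bool := [forall y, nb 2 k x y ==> Om y].
Definition core x : bool := inside 0 x.
Definition lev x : nat := \max_(k < L.+1 | inside k x) k.

Lemma insideP k x : reflect (forall y, nb 2 k x y -> Om y) (inside k x).
Proof.
by apply: (iffP forallP) => h y; [move/implyP: (h y)|apply/implyP; exact: h].
Qed.

Lemma inside_mono k K x : (k <= K)%N -> inside K x -> inside k x.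
Proof.
by move=> kK /insideP h; apply/insideP => y /(nb2_mono kK) /h.
Qed.

Lemma inside_congr k x y : nb 0 k x y -> inside k x = inside k y.
Proof.
by move=> h; apply/insideP/insideP => H z hz; apply: H;
  rewrite ?(nb0_congr _ _ h) // -(nb0_congr _ _ h).
Qed.

Lemma lev_le x : (lev x <= L)%N.
Proof. by apply/bigmax_leqP => i _; rewrite -ltnS. Qed.

Lemma inside_lev x : core x -> inside (lev x) x.
Proof.
move=> cx.
have [i ii ->] : exists2 i : 'I_L.+1, inside i x & lev x = i.
  have h : (0 < #|[pred i : 'I_L.+1 | inside i x]|)%N.
    by apply/card_gt0P; exists ord0; rewrite inE.
  by have [i ii e] := eq_bigmax_cond (fun i : 'I_L.+1 => i : nat) h; exists i; [exact: ii|exact: e].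
exact: ii.
Qed.

Lemma le_lev k x : (k <= L)%N -> inside k x -> (k <= lev x)%N.
Proof.
move=> kL ik; have kL' : (k < L.+1)%N by [].
exact: (@leq_bigmax_cond _ _ (fun i : 'I_L.+1 => i : nat) (Ordinal kL')).
Qed.

Lemma core_Om x : core x -> Om x.
Proof. by move=> /insideP; apply; exact: nbxx. Qed.

Lemma core_stopping : stopping core lev.
Proof.
split; first exact: lev_le.
move=> x y cx nxy.
have iy : inside (lev x) y by rewrite -(inside_congr nxy); exact: inside_lev.
have cy : core y by exact: inside_mono iy.
split => //; apply/eqP; rewrite eqn_leq (le_lev (lev_le _) iy) andbT.
have xy := le_lev (lev_le _) iy.
apply: le_lev; first exact: lev_le.
by rewrite (@inside_congr _ x y) ?inside_lev //; exact: nb0_mono nxy.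
Qed.

(** Adjacency of Whitney blocks: they touch or coincide once the smaller one is replaced by its
    ancestor at the level of the larger. *)
Definition near x y : bool := [&& core x, core y & nb 1 (maxn (lev x) (lev y)) x y].

Lemma nearC x y : near x y = near y x.
Proof. by rewrite /near maxnC nbC; case: (core x); case: (core y). Qed.

Lemma nearxx x : core x -> near x x.
Proof. by move=> cx; rewrite /near cx nbxx. Qed.

(** If the block of [y] has level [k.+1] and is adjacent to that of [x], the 5 by 5 neighbourhood of
    [x] at level [k] lies in its 3 by 3 neighbourhood at level [k.+1], hence in the 5 by 5
    neighbourhood of [y], hence in [Om]. So the level of [x] is at least [k]. *)
Lemma near_lev x y : near x y -> (lev y <= (lev x).+1)%N.
Proof.
move=> /and3P[cx cy]; case: (leqP (lev y) (lev x)) => [|xy]; first by move=> *; lia.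
case e : (lev y) xy => [//|k] xy nxy.
have /insideP iy := inside_lev cy.
have kL : (k <= L)%N by have := lev_le y; lia.
rewrite ltnS; apply: le_lev => //; apply/insideP => z xz; apply: iy.
have yx : nb 1 k.+1 y x by rewrite nbC.
by rewrite e; apply: (nb_trans yx); exact: nb21 xz.
Qed.

Lemma near_nb x y : near x y -> nb 1 (lev x).+1 x y.
Proof.
move=> nxy; have := near_lev nxy; case/and3P: nxy => _ _ h ?.
by apply: nb1_mono h; lia.
Qed.

Lemma near_congr x x' y : core x -> nb 0 (lev x) x x' -> near x y = near x' y.
Proof.
move=> cx h; have [cx' e] := stopping_congr core_stopping cx h.
rewrite /near cx cx' e /=; congr (_ && _); apply: nb0_congr.
by apply: nb0_mono h; exact: leq_maxl.
Qed.

(** The 5 by 5 cells around a cell [y] that neighbours a block of positive level stay in the 5 by 5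
    neighbourhood of that block, so [y] is in [core] and adjacent. Cells that are not adjacent are
    therefore off the 3 by 3 neighbourhood, where cancellation can be used. *)
Lemma not_near x y : core x -> (0 < lev x)%N -> ~~ near x y -> ~~ nb 1 (lev x) x y.
Proof.
move=> cx l0; apply: contra => n1; have /insideP ix := inside_lev cx.
have cy : core y.
  apply/insideP => z yz; apply: ix; apply: (nb_trans (r := 1) (s := 1)) n1 _.
  exact: nb21 yz.
by rewrite /near cx cy /=; apply: nb1_mono n1; exact: leq_maxl.
Qed.

(** Counts the adjacent blocks, the cells of each having total weight 1. All of them lie in nine
    blocks of level [(lev x).+1], that is in at most [36 * 4 ^ lev x] cells, each of weight at most
    [4 / 4 ^ lev x]; hence 144. *)
Lemma near_card (R : realType) x : core x ->
  \sum_(y | near x y) (4%:R ^+ lev y)^-1 <= 144%:R :> R.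
Proof.
move=> cx.
apply: (@le_trans _ _ (\sum_(y | nb 1 (lev x).+1 x y) (4%:R * (4%:R ^+ lev x)^-1 : R))).
  rewrite [leLHS]big_mkcond [leRHS]big_mkcond /=; apply: ler_sum => y _.
  case: ifP => nxy; last by case: ifP => // _; rewrite mulr_ge0 // invr_ge0 exprn_ge0.
  rewrite near_nb // -[X in X * _]invrK -invfM lef_pV2 ?posrE; last 2 first.
  - exact: pow4_gt0.
  - by rewrite mulr_gt0 ?invr_gt0 ?pow4_gt0.
  have h : (lev x <= (lev y).+1)%N by apply: near_lev; rewrite nearC.
  by rewrite mulrC ler_pdivrMr // -exprSr ler_weXn2l // ler1n.
rewrite -[X in \sum_(_ | _) X]mulr1 -mulr_sumr.
apply: le_trans (ler_wpM2l _ (sum_nb _ _ _ _)) _; first by rewrite mulr_ge0 // invr_ge0 exprn_ge0.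
rewrite exprS le_eqVlt; apply/orP; left; apply/eqP; field.
by rewrite pow4_neq0.
Qed.

End Whitney.

(** * Weak type bound for the enlarged dyadic maximal function *)

Section WeakMaximal.
Variables (R : realType) (L : nat).
Implicit Types (x y z : cell L) (f g h : cell L -> R).

Definition overlev (T : R) f k z : bool := T < av k f z.
Definition over T f z : bool := [exists k : 'I_L.+1, overlev T f k z].
Definition toplev T f z : nat := \max_(k < L.+1 | overlev T f k z) k.
Definition overnb T f x : bool :=
  [exists z, [exists k : 'I_L.+1, overlev T f k z && nb 2 k z x]].

Lemma toplev_le T f x : (toplev T f x <= L)%N.
Proof. by apply/bigmax_leqP => i _; rewrite -ltnS. Qed.

Lemma le_toplev T f k x : (k <= L)%N -> overlev T f k x -> (k <= toplev T f x)%N.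
Proof.
move=> kL ik; have kL' : (k < L.+1)%N by [].
exact: (@leq_bigmax_cond _ _ (fun i : 'I_L.+1 => i : nat) (Ordinal kL')).
Qed.

Lemma overlev_toplev T f x : over T f x -> overlev T f (toplev T f x) x.
Proof.
move=> /existsP[k0 k0x].
have [i ii ->] : exists2 i : 'I_L.+1, overlev T f i x & toplev T f x = i.
  have h : (0 < #|[pred i : 'I_L.+1 | overlev T f i x]|)%N.
    by apply/card_gt0P; exists k0; rewrite inE.
  by have [i ii e] := eq_bigmax_cond (fun i : 'I_L.+1 => i : nat) h;
    exists i; [exact: ii|exact: e].
exact: ii.
Qed.

Lemma over_intro T f k x : (k <= L)%N -> overlev T f k x -> over T f x.
Proof. by move=> kL h; apply/existsP; exists (Ordinal (kL : (k < L.+1)%N)). Qed.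

Lemma overlev_congr T f k x y : nb 0 k x y -> overlev T f k x = overlev T f k y.
Proof. by rewrite /overlev => /(av_congr f) ->. Qed.

Lemma over_stopping T f : stopping (over T f) (toplev T f).
Proof.
split; first exact: toplev_le.
move=> x y cx nxy.
have iy : overlev T f (toplev T f x) y by rewrite -(overlev_congr _ _ nxy) overlev_toplev.
have cy : over T f y by apply: over_intro iy; exact: toplev_le.
split => //; have xy := le_toplev (toplev_le T f x) iy.
apply/eqP; rewrite eqn_leq xy andbT.
apply: le_toplev; first exact: toplev_le.
by rewrite (@overlev_congr _ _ _ x y) ?overlev_toplev //; exact: nb0_mono nxy.
Qed.

(** The maximal blocks with average above [T] are disjoint, and the number of cells of each is less
    than the sum of [f] over it divided by [T]. The neighbourhood of a smaller block with large
    average lies in that of the maximal block containing it, and 25 = 5 ^ 2 pays for the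
    enlargement. *)
Lemma weak_maximal (T : R) f : 0 < T -> (forall x, 0 <= f x) ->
  \sum_(x | overnb T f x) (1 : R) <= 25%:R * (\sum_x f x) / T.
Proof.
move=> T0 f0; pose tl := toplev T f; pose tc := over T f.
have st := over_stopping T f : stopping tc tl.
apply: (@le_trans _ _ (\sum_x \sum_(z | tc z && nb 2 (tl z) z x) (4%:R ^+ tl z)^-1)).
  rewrite big_mkcond /=; apply: ler_sum => x _.
  case: ifP => [|_]; last by rewrite sumr_ge0 // => z _; exact: pow4V_ge0.
  move=> /existsP[z /existsP[k /andP[kz nzx]]].
  have cz : tc z by apply: over_intro kz; rewrite -ltnS.
  have ktl : (k <= tl z)%N by apply: le_toplev kz; rewrite -ltnS.
  (* The cells of the maximal block of [z] have total weight one, and [x] lies in the 5 by 5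
     neighbourhood of each. *)
  apply: (@le_trans _ _ (\sum_(y | nb 0 (tl z) z y) (4%:R ^+ tl z)^-1)).
    rewrite -[X in \sum_(_ | _) X]mulr1 -mulr_sumr sum_nb0 ?toplev_le //.
    by rewrite mulVf ?pow4_neq0.
  rewrite [leLHS]big_mkcond [leRHS]big_mkcond /=; apply: ler_sum => y _.
  case: ifP => nzy; last by case: ifP => // _; exact: pow4V_ge0.
  have [cy e] := stopping_congr st cz nzy.
  rewrite cy e /= -(@nb0_congr _ _ 2 z) // (nb2_mono ktl) //.
rewrite (exchange_big_dep tc) /=; last by move=> x z _ /andP[].
apply: (@le_trans _ _ (\sum_(z | tc z) 25%:R * (av (tl z) f z / T))).
  apply: ler_sum => z cz; rewrite cz /=.
  rewrite -[X in \sum_(_ | _) X]mulr1 -mulr_sumr.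
  apply: le_trans (ler_wpM2l (pow4V_ge0 _ _) (sum_nb _ _ _ _)) _.
  rewrite mulrCA mulVf ?pow4_neq0 // mulr1 -[leLHS]mulr1 ler_pM ?ler0n //.
  by rewrite ler_pdivlMr // mul1r ltW //; exact: (overlev_toplev cz).
rewrite -mulr_sumr -mulrA ler_wpM2l ?ler0n // -mulr_suml ler_wpM2r ?invr_ge0 ?(ltW T0) //.
by rewrite -(sum_av st) [leRHS](bigID tc) /= lerDl sumr_ge0.
Qed.

End WeakMaximal.

(** * One stopping step *)

Section NextGeneration.
Variables (R : realType) (L : nat) (A : R) (phis : seq (cell L -> R)) (Om : pred (cell L)).
Implicit Types (x y z : cell L) (f g h : cell L -> R).

Notation lv := (lev Om).
Notation cr := (core Om).

(** A block strictly inside the Whitney block of [z] on which the average of a controlled function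
    jumps by the factor [A]. Taking 5 by 5 neighbourhoods in [next] makes every bad block satisfy
    [inside next]. *)
Definition bad k z : bool :=
  [&& cr z, (k < lv z)%N & has (fun f => A * av (lv z) f z < av k f z) phis].

Definition next x : bool := [exists z, [exists k : 'I_L.+1, bad k z && nb 2 k z x]].

Lemma bad_next k z x : bad k z -> nb 2 k z x -> next x.
Proof.
move=> b n; have kL : (k < L.+1)%N by have /and3P[_ kz _] := b; have := lev_le Om z; lia.
by apply/existsP; exists z; apply/existsP; exists (Ordinal kL); rewrite b.
Qed.

Lemma next_sub x : next x -> Om x.
Proof.
move=> /existsP[z /existsP[k /andP[/and3P[cz kz _] nzx]]].
have /insideP := inside_mono (ltnW kz) (inside_lev cz); exact.
Qed.

Lemma inside_next k x : inside next k x -> inside Om k x.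
Proof. by move=> /insideP h; apply/insideP => y /h /next_sub. Qed.

Lemma core_next x : core next x -> cr x.
Proof. exact: inside_next. Qed.

Lemma lev_next x : core next x -> (lev next x <= lv x)%N.
Proof.
move=> cx; apply: le_lev; first exact: lev_le.
by apply: inside_next; exact: inside_lev.
Qed.

Lemma near_next x y : near next x y -> near Om x y.
Proof.
move=> /and3P[cx cy h]; rewrite /near !core_next //=.
apply: nb1_mono h; have := lev_next cx; have := lev_next cy; lia.
Qed.

Lemma core_next_next x : core next x -> next x.
Proof. exact: core_Om. Qed.

Lemma near_count x : cr x -> \sum_(z | near Om x z) (1 : R) <= 36%:R * 4%:R ^+ lv x.
Proof.
move=> cx; apply: (@le_trans _ _ (\sum_(z | nb 1 (lv x).+1 x z) 1)).
  rewrite [leLHS]big_mkcond [leRHS]big_mkcond /=; apply: ler_sum => z _.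
  by case: ifP => [/near_nb ->|_] //; case: ifP.
apply: le_trans (sum_nb _ _ _ _) _; rewrite exprS mulrA ler_wpM2r ?exprn_ge0 //.
by rewrite -natrM ler_nat.
Qed.

Hypothesis phis_ge0 : forall i x, 0 <= nth (fun=> 0) phis i x.
Hypothesis A_large : 1800%:R * (size phis)%:R <= A.
Hypothesis A_ge1 : 1 <= A.

(* The stopping rule: averages over the cubes of the next generation, and values
   outside of these, are controlled by averages over the present cubes. *)
Lemma proj_next_le i x : cr x ->
  proj (core next) (lev next) (nth (fun=> 0) phis i) x
    <= 4%:R * A * av (lv x) (nth (fun=> 0) phis i) x.
Proof.
move=> cx; set f := nth _ _ _.
have f0 y : 0 <= f y by exact: phis_ge0.
have a0 k y : 0 <= av k f y by exact: av_ge0.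
have A0 : 0 <= A by rewrite (le_trans _ A_ge1).
have A41 : 1 <= 4%:R * A by have := A_ge1; lra.
have nb_av k : (k < lv x)%N -> ~~ bad k x -> av k f x <= A * av (lv x) f x.
  move=> kl nb; rewrite leNgt; apply: contra nb => h; rewrite /bad cx kl /=.
  case: (ltnP i (size phis)) => ip; first by apply/hasP; exists f; rewrite // mem_nth.
  by move: h; rewrite /f nth_default // !av_cst ?lev_le ?mulr0 ?ltxx // (leq_trans (ltnW kl)) ?lev_le.
rewrite /proj; case: ifPn => cx'; last first.
  have [l0|l0] := posnP (lv x); first by rewrite l0 av0 ler_peMl.
  (* Off [core next] the cell [x] is itself a block of level 0 that is not bad. *)
  rewrite -[leLHS]av0; apply: le_trans (nb_av 0%N l0 _) _.
    by apply: contra cx' => b; apply/insideP => y; exact: (bad_next b).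
  by rewrite -mulrA; have := mulr_ge0 A0 (a0 (lv x) x); lra.
set k := lev next x; have := lev_next cx'; rewrite leq_eqVlt => /orP[/eqP e|kl].
  by rewrite /k e ler_peMl.
(* By maximality of [lev next x] the parent block, of level [k.+1], is not bad, since the
   neighbourhood of a bad block lies in [next]. Passing to the parent costs the factor 4. *)
apply: le_trans (av_mono _ _ f0) _; rewrite -mulrA ler_wpM2l //.
move: kl; rewrite leq_eqVlt => /orP[/eqP <-|kl]; first by rewrite ler_peMl.
apply: nb_av => //; apply/negP => b.
suff : (k.+1 <= k)%N by rewrite ltnn.
have kL : (k.+1 <= L)%N by exact: leq_trans (ltnW kl) (lev_le Om x).
apply: (le_lev kL); apply/insideP => y; exact: (bad_next b).
Qed.

(** A bad block whose neighbourhood meets the block of [x] lies in an adjacent Whitney block. In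
    each of these, and for each controlled function, [weak_maximal] bounds the enlarged bad set by
    the fraction [25 / A]. The adjacent blocks have at most [36 * 4 ^ lv x] cells, and
    [25 * 36 * 2 = 1800] is the condition on [A]. *)
Lemma next_small x : cr x ->
  \sum_(y | nb 0 (lv x) x y && next y) (1 : R) <= 4%:R ^+ lv x / 2%:R.
Proof.
move=> cx.
(* Only averages at levels below [lv z] matter, so [f] may be cut off outside of the block of [z]
   before the maximal bound is applied. *)
pose loc f z y : R := if nb 0 (lv z) z y then f y else 0.
pose U f z := overnb (A * av (lv z) f z) (loc f z).
have A0 : 0 < A by rewrite (lt_le_trans _ A_ge1).
have av_loc f z k : (k <= lv z)%N -> av k (loc f z) z = av k f z.
  by move=> kl; apply: eq_av => y h; rewrite /loc (nb0_mono kl h).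
have U_le f z : (forall y, 0 <= f y) -> \sum_(y | U f z y) (1 : R) <= 25%:R / A * 4%:R ^+ lv z.
  move=> f0; have l0 y : 0 <= loc f z y by rewrite /loc; case: ifP.
  have sl : \sum_y loc f z y = 4%:R ^+ lv z * av (lv z) f z.
    by rewrite /av mulrA mulfV ?pow4_neq0 // mul1r [RHS]big_mkcond.
  (* If the average of [f] on the block vanishes, the threshold is 0; but then [f] vanishes on the
     block and no average exceeds it. *)
  have := av_ge0 (lv z) z f0; rewrite le_eqVlt => /orP[/eqP e|pos].
    have C0 : 0 <= 25%:R / A * 4%:R ^+ lv z.
      by apply: mulr_ge0; rewrite ?exprn_ge0 // divr_ge0 // ltW.
    rewrite big_pred0 // => y.
    apply/negbTE/negP => /existsP[t /existsP[k /andP[+ _]]].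
    rewrite /overlev -e mulr0 ltNge => /negP; apply.
    rewrite -[leRHS](mulr0 (4%:R ^+ k)^-1) ler_wpM2l ?pow4V_ge0 //.
    move: sl; rewrite -e mulr0 => sl0.
    by rewrite -[leRHS]sl0 [leRHS](bigID (nb 0 k t)) /= lerDl sumr_ge0.
  apply: le_trans (weak_maximal _ l0) _; first by rewrite mulr_gt0.
  rewrite sl invfM le_eqVlt; apply/orP; left; apply/eqP.
  by field; rewrite !gt_eqF.
apply: (@le_trans _ _ (\sum_y \sum_(z | near Om x z)
    (4%:R ^+ lv z)^-1 * \sum_(f <- phis) (if U f z y then 1 else 0))).
  have nn z y : 0 <= (4%:R ^+ lv z)^-1 * \sum_(f <- phis) (if U f z y then 1 else 0) :> R.
    by rewrite mulr_ge0 ?pow4V_ge0 // sumr_ge0 // => f _; case: ifP.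
  rewrite [leLHS]big_mkcond /=; apply: ler_sum => y _.
  case: ifP => [/andP[nxy]|_]; last by rewrite sumr_ge0.
  move=> /existsP[z /existsP[k /andP[/and3P[cz kz /hasP[f fp fb]] nzy]]].
  have nxz : near Om x z.
    rewrite /near cx cz /=; apply: (nb_trans (r := 0) (s := 1) (y := y)).
      by apply: nb0_mono nxy; exact: leq_maxl.
    by rewrite nbC; apply: nb1_mono (nb21 kz nzy); exact: leq_maxr.
  apply: (@le_trans _ _ (\sum_(t | nb 0 (lv z) z t) (4%:R ^+ lv z)^-1)).
    rewrite -[X in \sum_(_ | _) X]mulr1 -mulr_sumr sum_nb0 ?lev_le //.
    by rewrite mulVf ?pow4_neq0.
  rewrite [leLHS]big_mkcond [leRHS]big_mkcond /=; apply: ler_sum => t _.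
  case: ifPn => nzt; last by case: ifP.
  have [ct e] := stopping_congr (core_stopping Om) cz nzt.
  have nxt : near Om x t by rewrite nearC -(near_congr _ cz nzt) nearC.
  rewrite nxt e -[leLHS]mulr1 ler_wpM2l ?pow4V_ge0 //.
  have Uft : U f t y.
    apply/existsP; exists z; apply/existsP; exists k.
    have -> : loc f t = loc f z.
      by apply/funext => s; rewrite /loc e (@nb0_congr _ _ 0 z t).
    by rewrite /overlev av_loc ?(ltnW kz) // e -(av_congr _ nzt) fb nzy.
  rewrite (big_rem f) //= Uft lerDl sumr_ge0 // => g _; case: ifP => //.
rewrite exchange_big /=.
under eq_bigr do rewrite -mulr_sumr exchange_big /=.
apply: (@le_trans _ _ (\sum_(z | near Om x z) (size phis)%:R * (25%:R / A))).
  apply: ler_sum => z _; rewrite mulrC ler_pdivrMr ?pow4_gt0 //.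
  apply: (@le_trans _ _ (\sum_(f <- phis) 25%:R / A * 4%:R ^+ lv z)).
    rewrite !big_seq; apply: ler_sum => f fp; rewrite -big_mkcond; apply: U_le => y.
    by have := phis_ge0 (index f phis) y; rewrite nth_index.
  rewrite big_const_seq count_predT iter_addr_0 -[leLHS]mulr_natl mulrA //.
rewrite -[X in \sum_(_ | _) X]mulr1 -mulr_sumr.
apply: le_trans (ler_wpM2l _ (near_count cx)) _.
  by rewrite mulr_ge0 ?ler0n // divr_ge0 ?ltW.
rewrite [leLHS]mulrA [leRHS]mulrC ler_wpM2r ?exprn_ge0 //.
set m := (size phis)%:R.
have -> : m * (25%:R / A) * 36%:R = m * 900%:R / A by field; rewrite gt_eqF.
by rewrite ler_pdivrMr //; have := A_large; rewrite -/m; lra.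
Qed.

Lemma next_drop x : cr x -> exists2 y, nb 0 (lv x) x y & ~~ next y.
Proof.
move=> cx; case: (pickP (fun y => nb 0 (lv x) x y && ~~ next y)) => [y /andP[]|h].
  by exists y.
have := next_small cx; rewrite (eq_bigl (nb 0 (lv x) x)) => [|y].
  by rewrite sum_nb0 ?lev_le //; have := pow4_gt0 R (lv x); lra.
by have := h y; case: (nb 0 (lv x) x y); case: (next y).
Qed.

End NextGeneration.

(** * Discrete Calderon--Zygmund forms *)

Definition bil (R : realType) L (beta : cell L -> cell L -> R) (f g : cell L -> R) : R :=
  \sum_x \sum_y f x * g y * beta x y.

(** Minimising over [s] gives the bound by [2 * M] times the product of the l2 norms; the free
    parameter avoids square roots. *)
Definition l2_bounded (R : realType) L (beta : cell L -> cell L -> R) (M : R) : Prop :=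
  forall f g (s : R), 0 < s ->
    `|bil beta f g| <= M * (s * (\sum_x f x ^+ 2) + s^-1 * (\sum_y g y ^+ 2)).

(** The discrete form of Hormander's condition: the effect of a mean zero function on one block,
    seen from a cell outside of the 3 by 3 neighbourhood of the block. *)
Definition cancels (R : realType) L (kap : nat -> cell L -> cell L -> R)
    (beta : cell L -> cell L -> R) : Prop :=
  forall k x0 b y, (k <= L)%N -> (forall x, ~~ nb 0 k x0 x -> b x = 0) ->
    \sum_x b x = 0 -> ~~ nb 1 k x0 y ->
    `|\sum_x b x * beta x y| <= kap k x0 y * \sum_x `|b x|.

Record summable_kernel (R : realType) L (kap : nat -> cell L -> cell L -> R) (Ck : R) :
    Prop := SummableKernel {
  kap_ge0 : forall k x y, 0 <= kap k x y;
  kap_congr : forall k x y y', nb 0 k y y' -> kap k x y = kap k x y';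
  kap_sum : forall k x, (k <= L)%N -> \sum_(y | ~~ nb 1 k x y) kap k x y <= Ck }.

Section NearSums.
Variables (R : realType) (L : nat) (O : pred (cell L)).
Notation c := (core O).
Notation l := (lev O).

(** Adjacency depends on the two Whitney blocks only. The weights make every pair of blocks count
    once although the outer sums run over pairs of cells. *)
Lemma near_sum (H : cell L -> cell L -> R) :
  \sum_(x | c x) \sum_(y | near O x y) H x y =
  \sum_(x | c x) \sum_(y | near O x y) (4%:R ^+ l x)^-1 * (4%:R ^+ l y)^-1 *
     \sum_(z | nb 0 (l x) x z) \sum_(t | nb 0 (l y) y t) H z t.
Proof.
have st := core_stopping O.
rewrite (sum_av st); apply: eq_bigr => x cx.
rewrite /av (eq_bigr (fun z => \sum_(y | near O x y) H z y)); last first.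
  by move=> z nz; apply: eq_bigl => y; rewrite (near_congr _ cx nz).
have E z : \sum_(y | near O x y) H z y = \sum_(y | near O x y) av (l y) (H z) y.
  have cn y : near O x y = c y && near O x y by rewrite /near; case: (c y); rewrite ?andbT ?andbF.
  rewrite (eq_bigl _ _ cn) [RHS](eq_bigl _ _ cn) !big_mkcondr /=.
  rewrite (eq_bigr (fun y => H z y * (near O x y)%:R)); last first.
    by move=> y _; case: ifP; rewrite ?mulr1 ?mulr0.
  rewrite (sum_avM st) => [|y t cy nt]; last by rewrite !(nearC O x) (near_congr _ cy nt).
  by apply: eq_bigr => y _; case: ifP; rewrite ?mulr1 ?mulr0.
under eq_bigr do rewrite E.
rewrite exchange_big /= mulr_sumr; apply: eq_bigr => y _.
by rewrite /av -mulr_sumr mulrA.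
Qed.

End NearSums.

Section Bilinear.
Variables (R : realType) (L : nat) (beta : cell L -> cell L -> R) (M : R).
Hypothesis M0 : 0 <= M.
Hypothesis hL2 : l2_bounded beta M.
Implicit Types (x y z : cell L) (f g h : cell L -> R).

(** The choice [s = b / a] balances the two sums of squares, which are at most [a ^ 2 * u] and
    [b ^ 2 * v]. *)
Lemma l2_bounded_bil f g (a b u v : R) : 0 <= a -> 0 <= b -> 0 <= u -> 0 <= v ->
  (forall x, `|f x| <= a) -> (forall y, `|g y| <= b) ->
  \sum_x `|f x| <= a * u -> \sum_y `|g y| <= b * v ->
  `|bil beta f g| <= M * (a * b * (u + v)).
Proof.
move=> a0 b0 u0 v0 fa gb fu gv.
have sq h (d w : R) : (forall x, `|h x| <= d) -> \sum_x `|h x| <= d * w -> 0 <= d ->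
    \sum_x h x ^+ 2 <= d * (d * w).
  move=> hd hw d0; apply: (@le_trans _ _ (\sum_x d * `|h x|)).
    by apply: ler_sum => x _; rewrite -real_normK ?num_real // expr2 ler_wpM2r.
  by rewrite -mulr_sumr ler_wpM2l.
have R0 : 0 <= M * (a * b * (u + v)) by rewrite !mulr_ge0 ?addr_ge0.
move: a0; rewrite le_eqVlt => /orP[/eqP a0|a0].
  rewrite /bil big1 ?normr0 // => x _.
  have /eqP -> : f x == 0 by rewrite -normr_le0 a0.
  by rewrite big1 // => y _; rewrite !mul0r.
move: b0; rewrite le_eqVlt => /orP[/eqP b0|b0].
  rewrite /bil big1 ?normr0 // => x _.
  rewrite big1 // => y _; have /eqP -> : g y == 0 by rewrite -normr_le0 b0.
  by rewrite mulr0 mul0r.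
apply: le_trans (hL2 f g (divr_gt0 b0 a0)) _; rewrite ler_wpM2l //.
have := sq f a u fa fu (ltW a0); have := sq g b v gb gv (ltW b0) => hg hf.
apply: (@le_trans _ _ (b / a * (a * (a * u)) + (b / a)^-1 * (b * (b * v)))).
  by rewrite lerD // ler_wpM2l // ?invr_ge0 ltW // divr_gt0.
by rewrite le_eqVlt; apply/orP; left; apply/eqP; field; rewrite !gt_eqF.
Qed.

End Bilinear.

(** * Bad parts tested away from their blocks *)

Section Cancellation.
Variables (R : realType) (L : nat) (kap : nat -> cell L -> cell L -> R) (Ck : R).
Hypothesis kapP : summable_kernel kap Ck.
Hypothesis Ck0 : 0 <= Ck.
Variable O : pred (cell L).
Notation c := (core O).
Notation l := (lev O).
Let st := core_stopping O.
Implicit Types (x y z : cell L) (f g h : cell L -> R).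

Notation P := (proj c l).
Definition osc f x := f x - P f x.

Lemma osc_out f x : ~~ c x -> osc f x = 0.
Proof. by rewrite /osc /proj => /negbTE ->; rewrite subrr. Qed.

Lemma sum_osc f : \sum_x `|osc f x| <= 2%:R * \sum_x `|f x|.
Proof.
apply: (@le_trans _ _ (\sum_x (`|f x| + P (fun y => `|f y|) x))).
  by apply: ler_sum => x _; apply: le_trans (ler_normB _ _) _; rewrite lerD2l ler_norm_proj.
by rewrite big_split /= sum_proj // mulr_natl mulr2n.
Qed.

(** The sum over [x] is averaged over Whitney blocks and exchanged with the sum over [y]. On each
    block the oscillation has mean zero, so the cancellation estimate applies to every [y] off the 3
    by 3 neighbourhood. The factor 2 is the price of [osc] in the l1 norm. *)
Lemma cancel_sum (beta : cell L -> cell L -> R) (f h : cell L -> R) (rho : rel (cell L)) (B : R) :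
  cancels kap beta -> 0 <= B ->
  (forall x y, rho x y -> c x) ->
  (forall x y, rho x y -> (0 < l x)%N -> ~~ nb 1 (l x) x y) ->
  (forall x x' y, c x -> nb 0 (l x) x x' -> rho x y = rho x' y) ->
  (forall x, c x ->
     \sum_(y | rho x y && ~~ nb 1 (l x) x y) `|h y| * kap (l x) x y <= B) ->
  `|\sum_x \sum_(y | rho x y) osc f x * h y * beta x y| <= B * (2%:R * \sum_x `|f x|).
Proof.
move=> can B0 rc rn rcg hB.
pose Phi x := \sum_(y | rho x y) osc f x * h y * beta x y.
have -> : \sum_x Phi x = \sum_(x | c x) Phi x.
  rewrite [RHS]big_mkcond; apply: eq_bigr => x _; case: ifPn => // nc.
  by rewrite /Phi big1 // => y /rc; rewrite (negbTE nc).
rewrite (sum_av st); apply: le_trans (ler_norm_sum _ _ _) _.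
apply: (@le_trans _ _ (\sum_(x | c x) B * av (l x) (fun y => `|osc f y|) x)); last first.
  rewrite -mulr_sumr ler_wpM2l // -(sum_av st); apply: le_trans (sum_osc f).
  by rewrite [leRHS](bigID c) /= lerDl sumr_ge0.
apply: ler_sum => x cx.
pose b z := if nb 0 (l x) x z then osc f z else 0.
have -> : av (l x) Phi x =
    (4%:R ^+ l x)^-1 * \sum_(y | rho x y) h y * \sum_z b z * beta z y.
  congr (_ * _).
  rewrite (eq_bigr (fun z => \sum_(y | rho x y) osc f z * h y * beta z y)); last first.
    by move=> z nz; apply: eq_bigl => y; rewrite (rcg x z).
  rewrite exchange_big /=; apply: eq_bigr => y _; rewrite mulr_sumr.
  rewrite [LHS]big_mkcond /=; apply: eq_bigr => z _; rewrite /b.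
  by case: ifP => _; rewrite ?mul0r ?mulr0 // mulrA [h y * _]mulrC.
rewrite normrM ger0_norm ?pow4V_ge0 // /av mulrCA ler_wpM2l ?pow4V_ge0 //.
have b_sum : \sum_z `|b z| = \sum_(z | nb 0 (l x) x z) `|osc f z|.
  by rewrite [RHS]big_mkcond; apply: eq_bigr => z _; rewrite /b; case: ifP; rewrite ?normr0.
apply: le_trans (ler_norm_sum _ _ _) _; rewrite -b_sum.
(* A block of level 0 is one cell, on which the oscillation vanishes; hence [rho] has to avoid the
   neighbourhoods of larger blocks only. *)
have [l0|l0] := posnP (l x).
  rewrite big1 ?mulr_ge0 ?sumr_ge0 // => y _.
  rewrite big1 ?mulr0 ?normr0 // => z _; rewrite /b l0 nb00; case: ifP => [/eqP <-|_].
    by rewrite /osc /proj cx l0 av0 subrr mul0r.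
  by rewrite mul0r.
apply: (@le_trans _ _ ((\sum_(y | rho x y && ~~ nb 1 (l x) x y) `|h y| * kap (l x) x y) *
   \sum_z `|b z|)); last by rewrite ler_wpM2r ?sumr_ge0 // hB.
rewrite mulr_suml (eq_bigl (fun y => rho x y && ~~ nb 1 (l x) x y)); last first.
  by move=> y; case E : (rho x y) => //=; rewrite (rn _ _ E l0).
apply: ler_sum => y /andP[_ ny]; rewrite normrM -mulrA ler_wpM2l //.
apply: can => //; first exact: lev_le.
  by move=> z /negbTE; rewrite /b => ->.
by rewrite /b -big_mkcond /=; apply: sum_proj_diff.
Qed.

Lemma cancel_bounded beta f h (b : R) : cancels kap beta -> 0 <= b ->
  (forall y, `|h y| <= b) ->
  `|\sum_x \sum_(y | ~~ near O x y) osc f x * h y * beta x y|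
     <= b * Ck * (2%:R * \sum_x `|f x|).
Proof.
move=> can b0 hb.
rewrite (eq_bigr (fun x => \sum_(y | c x && ~~ near O x y) osc f x * h y * beta x y)); last first.
  move=> x _; case: (boolP (c x)) => //= nc; rewrite big_pred0_eq big1 // => y _.
  by rewrite osc_out // !mul0r.
apply: (@cancel_sum beta f h (fun x y => c x && ~~ near O x y)) => //.
- by rewrite mulr_ge0.
- by move=> x y /andP[].
- by move=> x y /andP[cx nn] l0; exact: not_near.
- move=> x x' y cx nx; rewrite (near_congr _ cx nx) cx.
  by rewrite (stopping_congr st cx nx).1.
- move=> x cx; apply: (@le_trans _ _ (\sum_(y | ~~ nb 1 (l x) x y) b * kap (l x) x y)).
    rewrite [leLHS]big_mkcond [leRHS]big_mkcond /=; apply: ler_sum => y _.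
    have k0 := kap_ge0 kapP (l x) x y.
    case: ifP => [/andP[_ ->]|_]; first by rewrite ler_wpM2r.
    by case: ifP => // _; rewrite mulr_ge0.
  by rewrite -mulr_sumr ler_wpM2l // (kap_sum kapP) // lev_le.
Qed.

(* Both functions oscillate: the cancellation is used on the larger of the two
   cubes, and [kap] being constant at that scale, the other function may be
   replaced by its averages. *)
Lemma cancel_osc beta f g (b : R) (r : rel nat) : cancels kap beta -> 0 <= b ->
  (forall i j, r i j -> (i <= j)%N) ->
  (forall y, P (fun t => `|g t|) y <= b) ->
  `|\sum_x \sum_(y | ~~ near O x y && r (l y) (l x)) osc f x * osc g y * beta x y|
     <= 2%:R * b * Ck * (2%:R * \sum_x `|f x|).
Proof.
move=> can b0 rle gb.
pose Q x y := ~~ near O x y && r (l y) (l x).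
rewrite (eq_bigr (fun x => \sum_(y | [&& c x, c y & Q x y])
    osc f x * osc g y * beta x y)); last first.
  move=> x _; rewrite big_mkcond [RHS]big_mkcond /=; apply: eq_bigr => y _; rewrite -/(Q x y).
  case: (boolP (c x)) => cx; last by rewrite osc_out // !mul0r; case: ifP.
  by case: (boolP (c y)) => cy //=; rewrite (osc_out g cy) mulr0 mul0r; case: ifP.
apply: (@cancel_sum beta f (osc g) (fun x y => [&& c x, c y & Q x y])) => //.
- by rewrite !mulr_ge0.
- by move=> x y /andP[].
- by move=> x y /and3P[cx _ /andP[nn _]] l0; exact: not_near.
- move=> x x' y cx nx; rewrite /Q (near_congr _ cx nx) cx.
  by rewrite (stopping_congr st cx nx).1 (stopping_congr st cx nx).2.
- move=> x cx; pose G y : R := if Q x y && ~~ nb 1 (l x) x y then kap (l x) x y else 0.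
  have G0 y : 0 <= G y by rewrite /G; case: ifP => // _; exact: (kap_ge0 kapP).
  have Gst : stconst c l G.
    move=> y t cy nt; rewrite /G /Q !(nearC O x) -(near_congr _ cy nt).
    rewrite (stopping_congr st cy nt).2.
    case: (boolP (r (l y) (l x))) => [/rle yx|]; last by rewrite !andbF.
    have nt' := nb0_mono yx nt.
    by rewrite -(nb0_congrr _ _ nt') -(kap_congr kapP x nt').
  have -> : \sum_(y | [&& c x, c y & Q x y] && ~~ nb 1 (l x) x y) `|osc g y| * kap (l x) x y
      = \sum_(y | c y) `|osc g y| * G y.
    rewrite cx big_mkcond [RHS]big_mkcond /=; apply: eq_bigr => y _; rewrite /G.
    by case: (c y) => //=; case: ifP; rewrite ?mulr0.
  apply: (@le_trans _ _ (\sum_(y | c y) (`|g y| * G y + b * G y))).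
    apply: ler_sum => y cy; rewrite -mulrDl ler_wpM2r //.
    by apply: le_trans (ler_normB _ _) _; rewrite lerD2l (le_trans (ler_norm_proj _ _ _ _)).
  rewrite big_split /= (sum_avM st) //.
  apply: (@le_trans _ _ (\sum_(y | c y) b * G y + \sum_(y | c y) b * G y)).
    rewrite lerD2r; apply: ler_sum => y cy; rewrite ler_wpM2r //.
    by have := gb y; rewrite /proj cy.
  suff key : \sum_(y | c y) G y <= Ck by rewrite -mulr_sumr; have := ler_wpM2l b0 key; lra.
  apply: le_trans (kap_sum kapP x (lev_le O x)).
  rewrite [leLHS]big_mkcond [leRHS]big_mkcond /=; apply: ler_sum => y _.
  have k0 := kap_ge0 kapP (l x) x y.
  rewrite /G; case: (nb 1 (l x) x y); rewrite ?andbF ?andbT /=; first by case: ifP.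
  by case: (c y) => //; case: ifP.
Qed.

End Cancellation.

(** * The form on pairs of cells that are not adjacent *)

Section OneStep.
Variables (R : realType) (L : nat) (kap : nat -> cell L -> cell L -> R) (Ck M : R).
Variable beta : cell L -> cell L -> R.
Hypothesis kapP : summable_kernel kap Ck.
Hypothesis Ck0 : 0 <= Ck.
Hypothesis M0 : 0 <= M.
Hypothesis hL2 : l2_bounded beta M.
Hypothesis can : cancels kap beta.
Hypothesis canT : cancels kap (fun x y => beta y x).
Variable O : pred (cell L).
Notation c := (core O).
Notation l := (lev O).
Notation P := (proj c l).
Let st := core_stopping O.
Implicit Types (x y z : cell L) (f g h : cell L -> R).

(** On two adjacent blocks the projections are constant and the l2 bound applies. The sizes are
    comparable up to 4, which gives [1 + 4 = 5]; with 144 from [near_card] this makes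
    [5 * 144 = 720]. *)
Lemma near_bil f g (a b u : R) : 0 <= a -> 0 <= b -> 0 <= u ->
  (forall x, P (fun t => `|f t|) x <= a) -> (forall x, P (fun t => `|g t|) x <= b) ->
  \sum_x `|f x| <= a * u ->
  `|\sum_(x | c x) \sum_(y | near O x y) P f x * P g y * beta x y| <= 720%:R * M * (a * b * u).
Proof.
move=> a0 b0 u0 fa gb fu; rewrite near_sum.
pose pf := P (fun t => `|f t|).
have pf0 x : 0 <= pf x by exact: proj_ge0.
have blk h x y : c x -> nb 0 (l x) x y -> P h y = P h x.
  by move=> cx nxy; rewrite /proj cx (stopping_congr st cx nxy).1; exact: (stconst_av st h cx nxy).
apply: le_trans (ler_norm_sum _ _ _) _.
apply: (@le_trans _ _ (\sum_(x | c x) \sum_(y | near O x y)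
    (M * b * 5%:R * pf x) * (4%:R ^+ l y)^-1)).
  apply: ler_sum => x cx; apply: le_trans (ler_norm_sum _ _ _) _; apply: ler_sum => y nxy.
  have cy : c y by have /and3P[] := nxy.
  pose ind k x h z : R := if nb 0 k x z then h z else 0.
  have := @l2_bounded_bil _ _ _ _ M0 hL2 (ind (l x) x (P f)) (ind (l y) y (P g)) (pf x) b
    (4%:R ^+ l x) (4%:R ^+ l y) (pf0 x) b0 (ltW (pow4_gt0 _ _)) (ltW (pow4_gt0 _ _)).
  have -> : bil beta (ind (l x) x (P f)) (ind (l y) y (P g)) =
      \sum_(z | nb 0 (l x) x z) \sum_(t | nb 0 (l y) y t) P f z * P g t * beta z t.
    rewrite /bil [RHS]big_mkcond; apply: eq_bigr => z _; rewrite /ind; case: ifP => _; last first.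
      by rewrite big1 // => t _; rewrite !mul0r.
    rewrite [RHS]big_mkcond; apply: eq_bigr => t _; case: ifP => // _.
    by rewrite mulr0 mul0r.
  have p4 k : 0 <= 4%:R ^+ k :> R by rewrite ltW ?pow4_gt0.
  have indP h k z (d : R) : (k <= L)%N -> 0 <= d ->
    (forall t, nb 0 k z t -> `|P h t| <= d) ->
     (forall t, `|ind k z (P h) t| <= d) /\ \sum_t `|ind k z (P h) t| <= d * 4%:R ^+ k.
    move=> kL d0 H; split=> [t|]; first by rewrite /ind; case: ifP => [/H//|]; rewrite normr0.
    rewrite -(sum_nb0 R z kL) mulr_sumr [leRHS]big_mkcond /=.
    by apply: ler_sum => t _; rewrite /ind; case: ifP => [/H|]; rewrite ?normr0 ?mulr1.
  have [|f1 f2] := indP f (l x) x (pf x) (lev_le _ _) (pf0 x).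
    by move=> t nt; rewrite (blk f x t) // ler_norm_proj.
  have [|g1 g2] := indP g (l y) y b (lev_le _ _) b0.
    by move=> t nt; rewrite (le_trans (ler_norm_proj _ _ _ _)).
  move=> /(_ f1 g1 f2 g2) => H; rewrite normrM ger0_norm; last by rewrite mulr_ge0 ?pow4V_ge0.
  apply: le_trans (ler_wpM2l _ H) _; first by rewrite mulr_ge0 ?pow4V_ge0.
  have h : (4%:R ^+ l y : R) <= 4%:R * 4%:R ^+ l x.
    by rewrite -exprS ler_weXn2l ?ler1n // near_lev.
  have h' : (4%:R ^+ l x : R) <= 4%:R * 4%:R ^+ l y.
    by rewrite -exprS ler_weXn2l ?ler1n // near_lev // nearC.
  have -> : (4 ^+ l x)^-1 * (4 ^+ l y)^-1 * (M * (pf x * b * (4 ^+ l x + 4 ^+ l y))) =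
      M * b * pf x * ((4 ^+ l x + 4 ^+ l y) / 4 ^+ l x) * (4 ^+ l y)^-1 by ring.
  rewrite ler_wpM2r ?pow4V_ge0 // [leRHS]mulrAC ler_wpM2l ?mulr_ge0 //.
  rewrite ler_pdivrMr ?pow4_gt0 // (_ : 5%:R = 1 + 4%:R :> R); last by rewrite -(natrD R 1 4).
  by rewrite mulrDl mul1r lerD2l.
apply: (@le_trans _ _ (\sum_(x | c x) (M * b * 5%:R * pf x) * 144%:R)).
  apply: ler_sum => x cx; rewrite -mulr_sumr ler_wpM2l ?near_card //.
  by rewrite !mulr_ge0.
rewrite -mulr_suml -mulr_sumr.
have : \sum_(x | c x) pf x <= a * u.
  apply: le_trans fu; rewrite -(sum_proj st (fun x => `|f x|)).
  by rewrite [leRHS](bigID c) /= lerDl sumr_ge0.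
move=> /(ler_wpM2l (mulr_ge0 M0 b0)) h.
rewrite [leRHS](_ : _ = M * b * (a * u) * 5%:R * 144%:R); last by ring.
rewrite ler_wpM2r // [leLHS]mulrAC ler_wpM2r //.
Qed.

(** Both functions are split into projection and oscillation. Two projections give the whole form
    minus its adjacent part, [(1 + 720) * M]; the two mixed terms give [2 * Ck], one on [u] and one
    on [v]; two oscillations give [4 * Ck]. The adjacent pairs left out are what the next generation
    takes up. *)
Lemma one_step f g (a b u v : R) : 0 <= a -> 0 <= b -> 0 <= u -> 0 <= v ->
  (forall x, P (fun t => `|f t|) x <= a) -> (forall x, P (fun t => `|g t|) x <= b) ->
  \sum_x `|f x| <= a * u -> \sum_x `|g x| <= b * v ->
  `|\sum_x \sum_(y | ~~ near O x y) f x * g y * beta x y|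
    <= (721%:R * M + 6%:R * Ck) * (a * b * (u + v)).
Proof.
move=> a0 b0 u0 v0 fa gb fu gv.
have tr (F : cell L -> cell L -> R) (rho : rel (cell L)) :
    \sum_x \sum_(y | rho x y) F x y = \sum_y \sum_(x | rho x y) F x y.
  under eq_bigr do rewrite big_mkcond; rewrite exchange_big /=.
  by apply: eq_bigr => y _; rewrite -big_mkcond.
pose S f g := \sum_x \sum_(y | ~~ near O x y) f x * g y * beta x y.
have split_f : S f g = S (P f) (P g) + S (osc O f) (P g) + S (P f) (osc O g) + S (osc O f) (osc O g).
  rewrite /S -!big_split /=; apply: eq_bigr => x _; rewrite -!big_split /=.
  by apply: eq_bigr => y _; rewrite /osc; ring.
have PNa h x : `|P h x| <= P (fun t => `|h t|) x by exact: ler_norm_proj.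
have sumP h : \sum_x `|P h x| <= \sum_x `|h x|.
  by rewrite -(sum_proj st (fun x => `|h x|)); apply: ler_sum => x _.
have e1 : `|S (P f) (P g)| <= 721%:R * M * (a * b * (u + v)).
  have -> : S (P f) (P g) = bil beta (P f) (P g) -
      \sum_(x | c x) \sum_(y | near O x y) P f x * P g y * beta x y.
    rewrite /S /bil; apply/eqP; rewrite -subr_eq opprK; apply/eqP.
    rewrite [X in _ + X]big_mkcond -big_split; apply: eq_bigr => x _.
    rewrite [RHS](bigID (near O x)) /= addrC; congr (_ + _).
    case: ifPn => // nc; rewrite big1 // => y /and3P[cx]; by rewrite cx in nc.
  apply: le_trans (ler_normB _ _) _.
  have h1 : `|bil beta (P f) (P g)| <= M * (a * b * (u + v)).
    apply: (l2_bounded_bil M0 hL2) => //.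
    - by move=> x; exact: le_trans (PNa _ _) (fa x).
    - by move=> x; exact: le_trans (PNa _ _) (gb x).
    - exact: le_trans (sumP f) fu.
    - exact: le_trans (sumP g) gv.
  have h2 := near_bil a0 b0 u0 fa gb fu.
  have h3 : M * (a * b * u) <= M * (a * b * (u + v)).
    by rewrite ler_wpM2l // ler_wpM2l ?mulr_ge0 // lerDl.
  rewrite (_ : 721%:R * M * (a * b * (u + v)) =
    M * (a * b * (u + v)) + 720%:R * (M * (a * b * (u + v)))); last by ring.
  apply: lerD; first exact: h1.
  by apply: le_trans h2 _; rewrite -mulrA; apply: ler_wpM2l h3; exact: ler0n.
have e2 : `|S (osc O f) (P g)| <= 2%:R * Ck * (a * b * u).
  have := @cancel_bounded _ _ _ _ kapP Ck0 O beta f (P g) b can b0 (fun y => le_trans (PNa g y) (gb y)).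
  move=> /le_trans; apply.
  rewrite [leLHS](_ : _ = 2%:R * Ck * (b * \sum_x `|f x|)); last by ring.
  rewrite ler_wpM2l ?mulr_ge0 // (_ : a * b * u = b * (a * u)); last by ring.
  by rewrite ler_wpM2l.
have e3 : `|S (P f) (osc O g)| <= 2%:R * Ck * (a * b * v).
  have := @cancel_bounded _ _ _ _ kapP Ck0 O (fun x y => beta y x) g (P f) a canT a0 (fun y => le_trans (PNa f y) (fa y)).
  have -> : S (P f) (osc O g) = \sum_x \sum_(y | ~~ near O x y) osc O g x * P f y * beta y x.
    rewrite /S tr; apply: eq_bigr => y _; rewrite (eq_bigl (fun x => ~~ near O y x)); last first.
      by move=> x; rewrite nearC.
    by apply: eq_bigr => x _; rewrite [P f x * _]mulrC.
  move=> /le_trans; apply.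
  rewrite [leLHS](_ : _ = 2%:R * Ck * (a * \sum_x `|g x|)); last by ring.
  rewrite ler_wpM2l ?mulr_ge0 // (_ : a * b * v = a * (b * v)); last by ring.
  by rewrite ler_wpM2l.
have e4 : `|S (osc O f) (osc O g)| <= 4%:R * Ck * (a * b * (u + v)).
  (* The cancellation of the larger block is used. Blocks of equal level must be counted once, hence
     [<=] in one sum and [<] in the other. *)
  have -> : S (osc O f) (osc O g) =
      (\sum_x \sum_(y | ~~ near O x y && (l y <= l x)%N) osc O f x * osc O g y * beta x y) +
      \sum_x \sum_(y | ~~ near O x y && (l y < l x)%N) osc O g x * osc O f y * beta y x.
    rewrite [X in _ = _ + X](_ : _ = \sum_x \sum_(y | ~~ near O x y && (l x < l y)%N)
       osc O f x * osc O g y * beta x y); last first.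
      rewrite [RHS]tr; apply: eq_bigr => y _.
      rewrite (eq_bigl (fun x => ~~ near O x y && (l x < l y)%N)) => [|x]; last by rewrite nearC.
      by apply: eq_bigr => x _; rewrite [osc O f x * _]mulrC.
    rewrite /S -big_split; apply: eq_bigr => x _.
    by rewrite (bigID (fun y => (l y <= l x)%N)) /=; congr (_ + _); apply: eq_bigl => y; rewrite ltnNge.
  apply: le_trans (ler_normD _ _) _.
  have h1 := @cancel_osc _ _ _ _ kapP Ck0 O beta f g b leq can b0 (fun i j ij => ij) gb.
  have h2 := @cancel_osc _ _ _ _ kapP Ck0 O (fun x y => beta y x) g f a ltn canT a0
    (fun i j ij => ltnW ij) fa.
  apply: le_trans (lerD h1 h2) _.
  rewrite [leLHS](_ : _ = 4%:R * Ck * (b * \sum_x `|f x| + a * \sum_x `|g x|)); last by ring.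
  rewrite ler_wpM2l ?mulr_ge0 //.
  rewrite [leRHS](_ : _ = b * (a * u) + a * (b * v)); last by ring.
  by apply: lerD; rewrite ler_wpM2l.
rewrite -/(S f g) split_f.
apply: le_trans (ler_normD _ _) _; apply: le_trans (lerD (ler_normD _ _) e4) _.
apply: le_trans (lerD (lerD (ler_normD _ _) e3) (lexx _)) _.
apply: le_trans (lerD (lerD (lerD e1 e2) (lexx _)) (lexx _)) _.
rewrite le_eqVlt; apply/orP; left; apply/eqP; ring.
Qed.

End OneStep.

Lemma block_arith (R : realType) (s C u v X Y : R) : 0 <= s -> 0 <= C -> 0 <= u -> 0 <= v ->
  0 < X -> 0 < Y -> Y <= 4%:R * X ->
  X^-1 * Y^-1 * (C * ((4%:R * s * u) * (4%:R * s * v) * (X + Y)))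
    <= 5%:R * (16%:R * s ^+ 2 * C) * (Y^-1 * u * v).
Proof.
move=> s0 C0 u0 v0 X0 Y0 XY.
rewrite [leLHS](_ : _ = 16%:R * s ^+ 2 * C * (Y^-1 * u * v) * ((X + Y) / X)); last by ring.
rewrite [leRHS](_ : _ = 16%:R * s ^+ 2 * C * (Y^-1 * u * v) * 5%:R); last by ring.
apply: ler_wpM2l; last by rewrite ler_pdivrMr //; lra.
have s2 : 0 <= s ^+ 2 by exact: exprn_ge0.
have Y1 : 0 <= Y^-1 by rewrite invr_ge0 ltW.
by apply: mulr_ge0; [apply: mulr_ge0 => //; apply: mulr_ge0|apply: mulr_ge0 => //; apply: mulr_ge0].
Qed.

(** * Generations of stopping blocks and sparse domination *)

Section Generations.
Variables (R : realType) (L : nat) (b f g : cell L -> R).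
Hypothesis f0 : forall x, 0 <= f x.
Hypothesis g0 : forall x, 0 <= g x.
Implicit Types (x y z t : cell L).

Definition dev (O : pred (cell L)) x : R := `|b x - av (lev O x) b x|.

(** The functions whose averages the stopping rule controls: the first two for the bilinear form,
    the products with [dev] for the commutator, and [dev] itself for the recursion that follows the
    oscillation of [b] through later generations. They are referred to by position. *)
Definition controlled (O : pred (cell L)) : seq (cell L -> R) :=
  [:: f; g; fun x => dev O x * f x; fun x => dev O x * g x; dev O].

(** [9000 = 1800 * 5], for five controlled functions; locked so that the numeral is not unfolded. *)
Definition stopA : R := locked 9000%:R.

(** Generation 0 is the whole grid, a single Whitney block of level [L], so that all pairs of cells
    are adjacent in it. *)
Fixpoint gen (j : nat) : pred (cell L) :=
  if j is j'.+1 then next stopA (controlled (gen j')) (gen j') else xpredT.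

Definition lv j := lev (gen j).
Definition cr j := core (gen j).
Definition nr j := near (gen j).

Lemma controlled_ge0 O i x : 0 <= nth (fun=> 0) (controlled O) i x.
Proof.
have d0 y : 0 <= dev O y by exact: normr_ge0.
case: i => [|[|[|[|[|i]]]]] //=; rewrite ?mulr_ge0 //.
by rewrite nth_nil.
Qed.

Lemma stopA_large O : 1800%:R * (size (controlled O))%:R <= stopA.
Proof. by rewrite -natrM /stopA -lock ler_nat. Qed.

Lemma stopA_ge1 : 1 <= stopA.
Proof. by rewrite /stopA -lock ler1n. Qed.

Lemma stopA_ge0 : 0 <= stopA.
Proof. by rewrite (le_trans _ stopA_ge1). Qed.

Lemma crS j x : cr j.+1 x -> cr j x.
Proof. exact: core_next. Qed.

Lemma cr_le i j x : (i <= j)%N -> cr j x -> cr i x.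
Proof. by move=> /subnK <-; elim: (j - i)%N => // d ih /crS. Qed.

Lemma lv_le i j x : (i <= j)%N -> cr j x -> (lv j x <= lv i x)%N.
Proof.
move=> /subnK <-; elim: (j - i)%N => // d ih h.
by apply: leq_trans (lev_next h) (ih (crS h)).
Qed.

Lemma cr0 x : cr 0 x.
Proof. by apply/insideP. Qed.

Lemma lv0 x : lv 0 x = L.
Proof.
by apply/eqP; rewrite eqn_leq lev_le le_lev //; apply/insideP.
Qed.

Lemma nr0 x y : nr 0 x y.
Proof.
rewrite /nr /near -/(cr 0 x) -/(cr 0 y) !cr0 -/(lv 0 x) -/(lv 0 y) !lv0 maxnn /=.
by apply: nb_leq (nbL x y).
Qed.

Lemma gen_drop j x : cr j x -> exists2 y, nb 0 (lv j x) x y & ~~ cr j.+1 y.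
Proof.
move=> cx; have [y nxy ny] := next_drop (@controlled_ge0 (gen j)) (stopA_large _) stopA_ge1 cx.
by exists y => //; apply: contra ny; exact: core_next_next.
Qed.

Lemma gen_small j x : cr j x ->
  \sum_(y | nb 0 (lv j x) x y && cr j.+1 y) (1 : R) <= 4%:R ^+ lv j x / 2%:R.
Proof.
move=> cx; apply: le_trans (next_small (@controlled_ge0 (gen j)) (stopA_large _) stopA_ge1 cx).
rewrite [leLHS]big_mkcond [leRHS]big_mkcond /=; apply: ler_sum => y _.
case: (nb 0 _ _ _) => //=; case: ifP => [/core_next_next ->//|_].
by case: ifP.
Qed.

Definition genN := #|{: cell L}|.+1.

(** By [gen_drop] every block of a generation has a cell outside of the next core, so the number of
    cells in the core drops at each step until none is left; [genN] exceeds the number of cells. *)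
Lemma gen_end x : ~~ cr genN x.
Proof.
suff h j : (j <= genN)%N -> (exists y, cr j y) -> (j + #|[pred y | cr j y]| <= #|{: cell L}|)%N.
  by apply/negP => cx; have := h _ (leqnn _) (ex_intro _ x cx); rewrite /genN; lia.
elim: j => [|j ih] jN [y cy]; first by rewrite add0n max_card.
have cyj := crS cy; have {ih} := ih (ltnW jN) (ex_intro _ y cyj).
suff : (#|[pred y | cr j.+1 y]| < #|[pred y | cr j y]|)%N by lia.
apply: proper_card; apply/fintype.properP; split.
  by apply/fintype.subsetP => z; rewrite !inE; exact: crS.
have [z nyz nz] := gen_drop cyj; exists z; rewrite !inE //.
exact: (stopping_congr (core_stopping _) cyj nyz).1.
Qed.

(** In terms of blocks this is the sum of $|Q|\langle u\rangle_Q\langle v\rangle_{Q'}$ over adjacent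
    blocks $Q,Q'$ of one generation: the cells repeat each pair $|Q||Q'|$ times and the weight
    removes $|Q'|$. *)
Definition Lam (u v : cell L -> R) : R :=
  \sum_(j < genN) \sum_(x | cr j x) \sum_(y | nr j x y)
    (4%:R ^+ lv j y)^-1 * av (lv j x) u x * av (lv j y) v y.

Section Form.
Variables (kap : nat -> cell L -> cell L -> R) (Ck M : R).
Variable beta : cell L -> cell L -> R.
Hypothesis kapP : summable_kernel kap Ck.
Hypothesis Ck0 : 0 <= Ck.
Hypothesis M0 : 0 <= M.
Hypothesis hL2 : l2_bounded beta M.
Hypothesis can : cancels kap beta.
Hypothesis canT : cancels kap (fun x y => beta y x).

(** A factor [4 * stopA] from the stopping rule for each of the two functions, the constant of
    [one_step], and 5 for $(|Q|+|Q'|)/|Q|$ on adjacent blocks. *)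
Definition sparseC : R := 5%:R * (16%:R * stopA ^+ 2 * (721%:R * M + 6%:R * Ck)).

Lemma sparseC_ge0 : 0 <= sparseC.
Proof.
have h1 : 0 <= stopA ^+ 2 by rewrite exprn_ge0 ?stopA_ge0.
have h2 := addr_ge0 (mulr_ge0 (ler0n R 721) M0) (mulr_ge0 (ler0n R 6) Ck0).
exact: mulr_ge0 (ler0n R 5) (mulr_ge0 (mulr_ge0 (ler0n R 16) h1) h2).
Qed.

Definition far j z t := ~~ nr j.+1 z t.

(** [one_step] for the Whitney family of generation [j.+1], applied to [phi] and [psi] cut off to
    two adjacent blocks of generation [j]. Since their absolute values are controlled functions
    there, the stopping rule bounds their projections by [4 * stopA] times their averages over these
    blocks. *)
Lemma block_step j x y (i k : nat) (phi psi : cell L -> R) : nr j x y ->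
  (forall z, nb 0 (lv j x) x z -> `|phi z| = nth (fun=> 0) (controlled (gen j)) i z) ->
  (forall z, nb 0 (lv j y) y z -> `|psi z| = nth (fun=> 0) (controlled (gen j)) k z) ->
  (4%:R ^+ lv j x)^-1 * (4%:R ^+ lv j y)^-1 *
  `|\sum_(z | nb 0 (lv j x) x z) \sum_(t | nb 0 (lv j y) y t)
      (if far j z t then phi z * psi t * beta z t else 0)|
  <= sparseC * ((4%:R ^+ lv j y)^-1 * av (lv j x) (fun z => `|phi z|) x *
       av (lv j y) (fun z => `|psi z|) y).
Proof.
move=> nxy hphi hpsi; have /and3P[cx cy _] := nxy.
pose loc (h : cell L -> R) s z : R := if nb 0 (lv j s) s z then h z else 0.
have st := core_stopping (gen j); have st' := core_stopping (gen j.+1).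
have main s (h : cell L -> R) m : cr j s ->
  (forall z, nb 0 (lv j s) s z -> `|h z| = nth (fun=> 0) (controlled (gen j)) m z) ->
  let a := 4%:R * stopA * av (lv j s) (fun z => `|h z|) s in
  [/\ 0 <= a, forall z, proj (cr j.+1) (lv j.+1) (fun z => `|loc h s z|) z <= a &
      \sum_z `|loc h s z| <= a * 4%:R ^+ lv j s].
  move=> cs hh a.
  have a0 : 0 <= a.
    by apply: mulr_ge0; [rewrite mulr_ge0 ?stopA_ge0|exact: av_ge0].
  split=> // [z|].
    have [nz|nz] := boolP (nb 0 (lv j s) s z).
      have [cz ez] := stopping_congr st cs nz.
      have -> : proj (cr j.+1) (lv j.+1) (fun z => `|loc h s z|) z =
          proj (cr j.+1) (lv j.+1) (nth (fun=> 0) (controlled (gen j)) m) z.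
        rewrite /proj; case: ifPn => cz'; last by rewrite /loc nz hh.
        apply: eq_av => t nzt; have nst : nb 0 (lv j s) s t.
          apply: (nb_trans nz); rewrite /lv -ez; apply: nb0_mono nzt; exact: lev_next.
        by rewrite /loc nst hh.
      have := proj_next_le (@controlled_ge0 (gen j)) stopA_ge1 m cz.
      move=> /le_trans; apply; rewrite /a ler_wpM2l ?mulr_ge0 ?stopA_ge0 //.
      rewrite ez -(av_congr _ nz); apply: le_av => t nt; by rewrite hh.
    (* A block of the next generation that meets the block of [s] is contained in it, so off the
       block of [s] the projection of the cut-off function vanishes too. *)
    suff -> : proj (cr j.+1) (lv j.+1) (fun z => `|loc h s z|) z = 0 by [].
    rewrite /proj /loc (negbTE nz) normr0; case: ifPn => // cz'.
    rewrite -[RHS](@av_cst R L (lv j.+1 z) 0 z (lev_le _ _)); apply: eq_av => t nzt.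
    case: ifPn => [nst|]; last by rewrite normr0.
    case/negP: nz; have cz := crS cz'.
    have nzt' : nb 0 (lv j z) z t by apply: nb0_mono nzt; exact: lev_next.
    have [_ e1] := stopping_congr st cs nst; have [_ e2] := stopping_congr st cz nzt'.
    by apply: (nb_trans nst); rewrite nbC /lv -e1 e2.
  rewrite (_ : \sum_z `|loc h s z| = 4%:R ^+ lv j s * av (lv j s) (fun z => `|h z|) s).
    rewrite mulrC ler_wpM2r ?exprn_ge0 // /a ler_peMl ?av_ge0 //.
    by have := stopA_ge1; lra.
  rewrite /av mulrA mulfV ?pow4_neq0 // mul1r [RHS]big_mkcond; apply: eq_bigr => z _.
  by rewrite /loc; case: ifP; rewrite ?normr0.
have [a0 fa fu] := main x phi i cx hphi.
have [b0 gb gv] := main y psi k cy hpsi.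
have p4 s : 0 <= 4%:R ^+ lv j s :> R by rewrite exprn_ge0.
have := @one_step _ _ _ _ _ _ kapP Ck0 M0 hL2 can canT (gen j.+1) _ _ _ _ _ _
  a0 b0 (p4 x) (p4 y) fa gb fu gv.
rewrite [X in `|X| <= _](_ : _ = \sum_(z | nb 0 (lv j x) x z) \sum_(t | nb 0 (lv j y) y t)
      (if far j z t then phi z * psi t * beta z t else 0)); last first.
  rewrite [RHS]big_mkcond; apply: eq_bigr => z _; rewrite /loc; case: ifP => _; last first.
    by rewrite big1 // => t _; rewrite !mul0r.
  rewrite [LHS]big_mkcond [RHS]big_mkcond; apply: eq_bigr => t _.
  rewrite /far /nr; case: (near _ z t) => /=; first by case: ifP.
  by case: ifP => // _; rewrite mulr0 mul0r.
move=> H; apply: le_trans (ler_wpM2l _ H) _; first by rewrite mulr_ge0 ?pow4V_ge0.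
set u := av _ _ x; set v := av _ _ y.
have u0 : 0 <= u by exact: av_ge0.
have v0 : 0 <= v by exact: av_ge0.
apply: block_arith; [exact: stopA_ge0| |exact: u0|exact: v0|exact: pow4_gt0|exact: pow4_gt0|].
  exact: addr_ge0 (mulr_ge0 (ler0n R 721) M0) (mulr_ge0 (ler0n R 6) Ck0).
by rewrite -exprS ler_weXn2l ?ler1n // near_lev.
Qed.

(** Telescoping: all pairs of cells are adjacent in generation 0, none in generation [genN], and
    pairs adjacent in generation [j.+1] are adjacent in generation [j]. *)
Lemma sum_gen (H : cell L -> cell L -> R) :
  \sum_x \sum_y H x y = \sum_(j < genN) \sum_(x | cr j x) \sum_(y | nr j x y)
    (4%:R ^+ lv j x)^-1 * (4%:R ^+ lv j y)^-1 *
    \sum_(z | nb 0 (lv j x) x z) \sum_(t | nb 0 (lv j y) y t)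
      (if far j z t then H z t else 0).
Proof.
pose N j := \sum_(x | cr j x) \sum_(y | nr j x y) H x y.
have -> : \sum_x \sum_y H x y = N 0%N.
  by apply: eq_big => [x|x _]; [rewrite cr0|apply: eq_bigl => y; rewrite nr0].
have -> : N 0%N = N 0%N - N genN.
  rewrite [X in _ - X]/N big_pred0 ?subr0 // => x; exact/negbTE/gen_end.
have tel : forall n, N 0%N - N n = \sum_(j < n) (N j - N j.+1).
  by elim => [|n ih]; rewrite ?big_ord0 ?subrr // big_ord_recr /= -ih; ring.
rewrite tel; apply: eq_bigr => j _; rewrite -near_sum.
rewrite /N [X in _ - X](_ : _ = \sum_(x | cr j x) \sum_(y | nr j x y)
   (if far j x y then 0 else H x y)).
  rewrite -sumrB; apply: eq_bigr => x _; rewrite -sumrB; apply: eq_bigr => y _.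
  by case: ifP; rewrite ?subr0 ?subrr.
rewrite big_mkcond [RHS]big_mkcond; apply: eq_bigr => x _ /=.
case: ifPn => cx; last first.
  case: ifP => // cx'; rewrite big1 // => y; rewrite /far; case: ifPn => // /negPn /and3P[c'].
  by rewrite (c' : cr j.+1 x) in cx.
rewrite (crS cx) big_mkcond [RHS]big_mkcond; apply: eq_bigr => y _ /=; rewrite /far.
case: ifPn => h /=; last by case: ifP.
by rewrite (near_next h : nr j x y).
Qed.

Lemma sparse_form : `|bil beta f g| <= sparseC * Lam f g.
Proof.
rewrite /bil sum_gen /Lam mulr_sumr; apply: le_trans (ler_norm_sum _ _ _) _.
apply: ler_sum => j _; rewrite mulr_sumr; apply: le_trans (ler_norm_sum _ _ _) _.
apply: ler_sum => x cx; rewrite mulr_sumr; apply: le_trans (ler_norm_sum _ _ _) _.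
apply: ler_sum => y nxy; rewrite normrM ger0_norm; last by rewrite mulr_ge0 ?pow4V_ge0.
have := @block_step j x y 0 1 f g nxy.
rewrite (@eq_av _ _ _ (fun z => `|f z|) f) => [|z _]; last by rewrite ger0_norm.
rewrite (@eq_av _ _ _ (fun z => `|g z|) g) => [|z _]; last by rewrite ger0_norm.
by apply=> z _ /=; rewrite ger0_norm.
Qed.

Definition avb j x := av (lv j x) b x.
Definition dv j x := dev (gen j) x.

(** On a pair of blocks [b y - b x] is the deviation of [b y] from its block average, minus that of
    [b x], plus the difference of the averages. Each of the three falls under [block_step] with its
    own controlled functions. *)
Lemma sparse_commutator : `|\sum_x \sum_y (b y - b x) * (f x * g y * beta x y)| <=
  sparseC * \sum_(j < genN) \sum_(x | cr j x) \sum_(y | nr j x y)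
    (4%:R ^+ lv j y)^-1 *
    (av (lv j x) f x * av (lv j y) (fun t => dv j t * g t) y +
     av (lv j x) (fun z => dv j z * f z) x * av (lv j y) g y +
     `|avb j x - avb j y| * (av (lv j x) f x * av (lv j y) g y)).
Proof.
rewrite sum_gen mulr_sumr; apply: le_trans (ler_norm_sum _ _ _) _.
apply: ler_sum => j _; rewrite mulr_sumr; apply: le_trans (ler_norm_sum _ _ _) _.
apply: ler_sum => x cx; rewrite mulr_sumr; apply: le_trans (ler_norm_sum _ _ _) _.
apply: ler_sum => y nxy; rewrite normrM ger0_norm; last by rewrite mulr_ge0 ?pow4V_ge0.
have /and3P[_ cy _] := nxy; have st := core_stopping (gen j).
pose bx z := b z - avb j x; pose by_ z := b z - avb j y.
have dvE s z : cr j s -> nb 0 (lv j s) s z -> `|b z - avb j s| = dv j z.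
  move=> cs ns; have [_ e] := stopping_congr st cs ns.
  by rewrite /dv /dev /avb /lv e (av_congr _ ns).
have := @block_step j x y 0 3 f (fun t => by_ t * g t) nxy.
have := @block_step j x y 2 1 (fun z => bx z * f z) g nxy.
have := @block_step j x y 0 1 f g nxy.
have -> : av (lv j x) (fun z => `|f z|) x = av (lv j x) f x.
  by apply: eq_av => z _; rewrite ger0_norm.
have -> : av (lv j y) (fun z => `|g z|) y = av (lv j y) g y.
  by apply: eq_av => z _; rewrite ger0_norm.
have -> : av (lv j x) (fun z => `|bx z * f z|) x = av (lv j x) (fun z => dv j z * f z) x.
  by apply: eq_av => z nz; rewrite normrM (ger0_norm (f0 z)) dvE.
have -> : av (lv j y) (fun z => `|by_ z * g z|) y = av (lv j y) (fun z => dv j z * g z) y.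
  by apply: eq_av => z nz; rewrite normrM (ger0_norm (g0 z)) dvE.
set S1 := \sum_(z | _) _; set S2 := \sum_(z | _) _; set S3 := \sum_(z | _) _.
move=> H1 H2 H3.
have {}H1 := H1 (fun z _ => ger0_norm (f0 z)) (fun z _ => ger0_norm (g0 z)).
have {}H2 : _ := H2 _ (fun z _ => ger0_norm (g0 z)).
have {}H3 : _ := H3 (fun z _ => ger0_norm (f0 z)) _.
have {}H2 := H2 (fun z nz => etrans (normrM _ _) (congr2 *%R (dvE x z cx nz) (ger0_norm (f0 z)))).
have {}H3 := H3 (fun z nz => etrans (normrM _ _) (congr2 *%R (dvE y z cy nz) (ger0_norm (g0 z)))).
rewrite [X in _ * `|X|](_ : _ = S3 - S2 + (avb j y - avb j x) * S1); last first.
  rewrite /S1 /S2 /S3 mulr_sumr -sumrB -big_split; apply: eq_bigr => z _ /=.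
  rewrite mulr_sumr -sumrB -big_split; apply: eq_bigr => t _ /=.
  by case: ifP; rewrite /bx /by_ => _; ring.
set w := _^-1 * _^-1.
have w0 : 0 <= w by rewrite mulr_ge0 ?pow4V_ge0.
apply: (@le_trans _ _ (w * (`|S3| + `|S2| + `|avb j x - avb j y| * `|S1|))).
  rewrite ler_wpM2l // (le_trans (ler_normD _ _)) // normrM (distrC (avb j y)) lerD2r.
  exact: ler_normB.
rewrite !mulrDr; apply: lerD; first apply: lerD.
- by apply: le_trans H3 _; rewrite -!mulrA.
- by apply: le_trans H2 _; rewrite -!mulrA.
have d0 : 0 <= `|avb j x - avb j y| by [].
have := ler_wpM2l d0 H1; rewrite /w.
set D := `|_ - _|; set r := (leRHS); set l := (leLHS) => h.
apply: le_trans (_ : l <= _); first by rewrite /l le_eqVlt; apply/orP; left; apply/eqP; ring.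
by apply: le_trans h _; rewrite /r le_eqVlt; apply/orP; left; apply/eqP; ring.
Qed.

End Form.
End Generations.

(** * Hoelder's inequality for finite sums *)

Section FiniteHoelder.
Variables (R : realType) (p q : R).
Hypothesis p0 : 0 < p.
Hypothesis q0 : 0 < q.
Hypothesis pq : p^-1 + q^-1 = 1.

Lemma powR_le (a x y : R) : 0 <= a -> 0 <= x -> x <= y -> x `^ a <= y `^ a.
Proof. by move=> a0 x0 xy; apply: ge0_ler_powR; rewrite ?nnegrE // (le_trans x0). Qed.

Lemma powRVK (x : R) : 0 <= x -> (x `^ p^-1) `^ p = x.
Proof. by move=> x0; rewrite -powRrM mulVf ?gt_eqF // powRr1. Qed.

Lemma powRKV (x : R) : 0 <= x -> (x `^ p) `^ p^-1 = x.
Proof. by move=> x0; rewrite -powRrM mulfV ?gt_eqF // powRr1. Qed.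

Lemma powR_conj (x : R) : 0 < x -> x `^ p^-1 * x `^ q^-1 = x.
Proof. by move=> x0; rewrite -powRD ?pq ?powRr1 ?(ltW x0) // oner_eq0. Qed.

Lemma conj_divr : p / q = p - 1.
Proof.
have -> : q^-1 = 1 - p^-1 by rewrite -pq; ring.
by field; rewrite gt_eqF.
Qed.

Lemma conj_mulB1 : (p - 1) * q = p.
Proof. by rewrite -conj_divr mulfVK // gt_eqF. Qed.

Lemma hoelder_sum (I : finType) (a b : I -> R) :
  (forall i, 0 <= a i) -> (forall i, 0 <= b i) ->
  \sum_i a i * b i <= (\sum_i a i `^ p) `^ p^-1 * (\sum_i b i `^ q) `^ q^-1.
Proof.
move=> a0 b0.
set A := \sum_i a i `^ p; set B := \sum_i b i `^ q.
have A0 : 0 <= A by apply: sumr_ge0 => i _; exact: powR_ge0.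
have B0 : 0 <= B by apply: sumr_ge0 => i _; exact: powR_ge0.
have z (c : I -> R) r : 0 < r -> (forall i, 0 <= c i) -> \sum_i c i `^ r = 0 -> forall i, c i = 0.
  move=> r0 c0 /eqP; rewrite psumr_eq0 => [|i _]; last exact: powR_ge0.
  by move=> /allP h i; have := h i (mem_index_enum i); rewrite powR_eq0 => /andP[/eqP].
have RH0 : 0 <= A `^ p^-1 * B `^ q^-1 by rewrite mulr_ge0 ?powR_ge0.
move: A0; rewrite le_eqVlt => /orP[/eqP/esym Az|A0].
  by rewrite big1 // => i _; rewrite (z a p) ?mul0r.
move: B0; rewrite le_eqVlt => /orP[/eqP/esym Bz|B0].
  by rewrite big1 // => i _; rewrite (z b q) ?mulr0.
have [X [X0 XA ->]] : exists X, [/\ 0 < X, X `^ p = A & A `^ p^-1 = X].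
  by exists (A `^ p^-1); split; rewrite ?powR_gt0 // powRVK // ltW.
have [Y [Y0 YB ->]] : exists Y, [/\ 0 < Y, Y `^ q = B & B `^ q^-1 = Y].
  exists (B `^ q^-1); split; rewrite ?powR_gt0 //.
  by rewrite -powRrM mulVf ?gt_eqF // powRr1 // ltW.
have dv (x y r : R) : 0 <= x -> 0 < y -> (x / y) `^ r = x `^ r / y `^ r.
  by move=> x0 y0; rewrite powRM ?invr_ge0 ?(ltW y0) // -powR_inv1 ?ltW // -powRrM mulN1r powRN.
have XY0 : 0 < X * Y by rewrite mulr_gt0.
rewrite -[leRHS]mul1r -ler_pdivrMr // mulr_suml.
apply: (@le_trans _ _ (\sum_i ((a i `^ p / A) / p + (b i `^ q / B) / q))).
  apply: ler_sum => i _; rewrite invfM mulrACA -XA -YB -!dv //.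
  by apply: conjugate_powR => //; rewrite divr_ge0 ?a0 ?b0 ?(ltW X0) ?(ltW Y0).
by rewrite big_split /= -!mulr_suml -/A -/B !mulfV ?gt_eqF // !mul1r pq.
Qed.

Lemma whoelder_sum (I : finType) (m a b : I -> R) :
  (forall i, 0 <= m i) -> (forall i, 0 <= a i) -> (forall i, 0 <= b i) ->
  \sum_i m i * (a i * b i) <=
  (\sum_i m i * a i `^ p) `^ p^-1 * (\sum_i m i * b i `^ q) `^ q^-1.
Proof.
move=> m0 a0 b0.
have := @hoelder_sum I (fun i => m i `^ p^-1 * a i) (fun i => m i `^ q^-1 * b i).
rewrite [leLHS](_ : _ = \sum_i m i * (a i * b i)); last first.
  apply: eq_bigr => i _; rewrite mulrACA; congr (_ * _).
  have := m0 i; rewrite le_eqVlt => /orP[/eqP <-|/powR_conj//].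
  by rewrite !powR0 ?mulr0 // invr_eq0 gt_eqF.
rewrite [X in _ <= X `^ _ * _](_ : _ = \sum_i m i * a i `^ p); last first.
  by apply: eq_bigr => i _; rewrite powRM ?powR_ge0 // powRVK.
rewrite [X in _ <= _ * X `^ _](_ : _ = \sum_i m i * b i `^ q); last first.
  apply: eq_bigr => i _; rewrite powRM ?powR_ge0 //.
  by rewrite -powRrM mulVf ?gt_eqF // powRr1.
by apply=> i; rewrite mulr_ge0 ?powR_ge0.
Qed.

(** [Z] is a real number, so its power [1 / q] may be divided out, leaving the power [1 / p] on the
    left. *)
Lemma absorb_powR (Z X c : R) : 0 <= Z -> 0 <= X -> 0 <= c ->
  Z <= c * X `^ p^-1 * Z `^ q^-1 -> Z <= c `^ p * X.
Proof.
move=> Z0 X0 c0; move: Z0; rewrite le_eqVlt => /orP[/eqP <- _|Z0].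
  by rewrite mulr_ge0 ?powR_ge0.
rewrite -[X in X <= _ -> _](powR_conj Z0) ler_pM2r ?powR_gt0 // => h.
rewrite -[leLHS]powRVK ?(ltW Z0) // -[X in _ * X]powRVK // -powRM ?powR_ge0 //.
by apply: powR_le; rewrite ?powR_ge0 // (ltW p0).
Qed.

End FiniteHoelder.

(** * Doob's maximal inequality with respect to a weight *)

Section Doob.
Variables (R : realType) (L : nat) (sg : cell L -> R).
Hypothesis sg0 : forall x, 0 < sg x.
Variable phi : cell L -> R.
Hypothesis phi0 : forall x, 0 <= phi x.
Implicit Types x y : cell L.

Definition wav k x : R := av k (fun y => sg y * phi y) x / av k sg x.

Lemma av_gt0 k x : 0 < av k sg x.
Proof.
rewrite /av mulr_gt0 ?invr_gt0 ?pow4_gt0 //.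
by rewrite (bigD1 x) ?nbxx //= ltr_wpDr // sumr_ge0 // => y _; rewrite ltW.
Qed.

Lemma wav_ge0 k x : 0 <= wav k x.
Proof.
by rewrite divr_ge0 ?(ltW (av_gt0 _ _)) // av_ge0 // => y; rewrite mulr_ge0 // ltW.
Qed.

Lemma wav_congr k x y : nb 0 k x y -> wav k x = wav k y.
Proof. by move=> n; rewrite /wav !(av_congr _ n). Qed.

Lemma wav0 x : wav 0 x = phi x.
Proof. by rewrite /wav !av0 mulrAC mulfV ?mul1r ?gt_eqF. Qed.

Lemma level_stopping k : (k <= L)%N -> @stopping L xpredT (fun=> k).
Proof. by split. Qed.

Lemma sum_wav k (G : cell L -> R) : (k <= L)%N ->
  (forall x y, nb 0 k x y -> G y = G x) ->
  \sum_x sg x * wav k x * G x = \sum_x sg x * phi x * G x.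
Proof.
move=> kL Gc; have st := level_stopping kL.
have h1 := @sum_avM R L xpredT (fun=> k) st (fun x => sg x * phi x) G (fun x y _ => Gc x y).
have h2 := @sum_avM R L xpredT (fun=> k) st sg (fun x => wav k x * G x).
rewrite h1; under eq_bigr do rewrite -mulrA; rewrite h2.
  by apply: eq_bigr => x _; rewrite mulrA /wav mulrCA mulfV ?mulr1 // gt_eqF ?av_gt0.
by move=> x y _ n; rewrite (Gc x y) // (wav_congr n).
Qed.

(** The running maximum of the martingale [wav], from coarse to fine: index [i] has seen the levels
    [L] down to [L - i]. *)
Fixpoint wmax i x : R :=
  if i is i'.+1 then Num.max (wmax i' x) (wav (L - i) x) else wav L x.

Lemma wmax_ge0 i x : 0 <= wmax i x.
Proof. by elim: i => [|i ih] /=; rewrite ?le_max ?ih // wav_ge0. Qed.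

Lemma wmax_congr i x y : (i <= L)%N -> nb 0 (L - i) x y -> wmax i x = wmax i y.
Proof.
elim: i => [|i ih] iL n /=; first by apply: wav_congr; move: n; rewrite subn0.
rewrite (wav_congr n) ih //; first exact: ltnW.
by apply: nb0_mono n; lia.
Qed.

Lemma wmax_mono i j x : (i <= j)%N -> wmax i x <= wmax j x.
Proof.
by move=> /subnK <-; elim: (j - i)%N => // d ih /=; rewrite le_max ih.
Qed.

Lemma wav_le_wmax k x : (k <= L)%N -> wav k x <= wmax L x.
Proof.
move=> kL; apply: le_trans (wmax_mono x (leq_subr k L)).
case e : (L - k)%N => [|i] /=; first by rewrite (_ : k = L) //; lia.
by rewrite le_max (_ : (L - i.+1)%N = k) ?lexx ?orbT //; lia.
Qed.

Variables p q : R.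
Hypothesis p1 : 1 < p.
Hypothesis q0 : 0 < q.
Hypothesis pq : p^-1 + q^-1 = 1.
Let p0 : 0 < p. Proof. by rewrite (lt_trans _ p1). Qed.
Let pot i x := (p - 1) * wmax i x `^ p - p * wav (L - i) x * wmax i x `^ (p - 1).

Lemma powRS (x : R) : 0 <= x -> x `^ p = x * x `^ (p - 1).
Proof.
have e : 1 + (p - 1) = p by ring.
by move=> x0; rewrite -[X in _ = X * _]powRr1 // -powRD e // gt_eqF.
Qed.

(* Burkholder's argument for Doob's inequality: [pot] decreases in the mean. *)
Lemma pot_step i x : (i < L)%N ->
  pot i.+1 x <= pot i x - p * ((wav (L - i.+1) x - wav (L - i) x) * wmax i x `^ (p - 1)).
Proof.
move=> iL; rewrite /pot /=; set S := wav (L - i.+1) x; set M := wmax i x.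
have S0 : 0 <= S by exact: wav_ge0.
have M0 : 0 <= M by exact: wmax_ge0.
rewrite maxEle; case: ifP => MS.
  have h : p * (S * M `^ (p - 1)) <= S `^ p + (p - 1) * M `^ p.
    have := @conjugate_powR R S (M `^ (p - 1)) p q S0 (powR_ge0 _ _) p0 q0 pq.
    rewrite -powRrM (conj_mulB1 p0 q0 pq) => /(ler_wpM2l (ltW p0)) /le_trans; apply.
    rewrite mulrDr [p * (_ / p)]mulrC mulfVK ?gt_eqF // lerD2l.
    by rewrite mulrCA (conj_divr p0 pq) mulrC.
  have e : p * S * S `^ (p - 1) = p * S `^ p by rewrite -mulrA -powRS.
  by rewrite e; lra.
by rewrite le_eqVlt; apply/orP; left; apply/eqP; ring.
Qed.

(** The correction in [pot_step] is a martingale difference times a factor that is constant on the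
    coarser blocks, so its weighted sum vanishes. At the start [pot] equals minus the power [p] of
    the average. *)
Lemma sum_pot i : (i <= L)%N -> \sum_x sg x * pot i x <= 0.
Proof.
elim: i => [|i ih] iL.
  apply: sumr_le0 => x _.
  rewrite pmulr_rle0 // /pot subn0 /= -mulrA -powRS ?wav_ge0 //.
  by have := powR_ge0 (wav L x) p; lra.
apply: le_trans (ih (ltnW iL)).
apply: (@le_trans _ _ (\sum_x (sg x * pot i x -
    p * (sg x * wav (L - i.+1) x * wmax i x `^ (p - 1) - sg x * wav (L - i) x * wmax i x `^ (p - 1))))).
  apply: ler_sum => x _; apply: le_trans (ler_wpM2l (ltW (sg0 x)) (pot_step x iL)) _.
  by rewrite le_eqVlt; apply/orP; left; apply/eqP; ring.
rewrite sumrB -mulr_sumr sumrB !sum_wav ?subrr ?mulr0 ?subr0 ?leq_subr //.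
  by move=> x y n; rewrite (wmax_congr (ltnW iL) n).
by move=> x y n; rewrite (@wmax_congr i x y (ltnW iL)) //; apply: nb0_mono n; lia.
Qed.

(** At the last index [sum_pot] bounds [(p - 1) * Z] by [p] times a mixed sum; Hoelder's inequality
    and absorption finish. The constant is that of the unweighted case, whatever [sg] is. *)
Lemma doob : \sum_x sg x * wmax L x `^ p <= q `^ p * \sum_x sg x * phi x `^ p.
Proof.
set Z := \sum_x _; set X := \sum_x _.
have Z0 : 0 <= Z by apply: sumr_ge0 => x _; rewrite mulr_ge0 ?powR_ge0 // ltW.
have X0 : 0 <= X by apply: sumr_ge0 => x _; rewrite mulr_ge0 ?powR_ge0 // ltW.
apply: (absorb_powR p0 pq) => //; first exact: ltW.
have h : (p - 1) * Z <= p * \sum_x sg x * (phi x * wmax L x `^ (p - 1)).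
  rewrite -subr_le0; have := sum_pot (leqnn L); congr (_ <= 0).
  rewrite /Z !mulr_sumr -sumrB; apply: eq_bigr => x _; rewrite /pot subnn wav0; ring.
have h2 : \sum_x sg x * (phi x * wmax L x `^ (p - 1)) <= X `^ p^-1 * Z `^ q^-1.
  have := @whoelder_sum R p q p0 q0 pq (cell L) sg phi (fun x => wmax L x `^ (p - 1))
    (fun x => ltW (sg0 x)) phi0 (fun x => powR_ge0 _ _).
  have eZ : \sum_x sg x * (wmax L x `^ (p - 1)) `^ q = Z.
    by apply: eq_bigr => x _; rewrite -powRrM (conj_mulB1 p0 q0 pq).
  by rewrite eZ; exact: id.
clearbody Z X; have p10 : 0 < p - 1 by rewrite subr_gt0.
have e : q = p / (p - 1) by rewrite -[X in X / _](conj_mulB1 p0 q0 pq) mulrAC divff ?mul1r ?gt_eqF.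
rewrite [X in _ <= X * _ * _]e.
rewrite [leRHS](_ : _ = p * (X `^ p^-1 * Z `^ q^-1) / (p - 1)); last by ring.
rewrite ler_pdivlMr // [leLHS]mulrC.
by apply: le_trans h _; rewrite ler_wpM2l ?(ltW p0).
Qed.

End Doob.

(* [w] and [sg] are the integrals over the cells of a weight and of its dual
   weight, normalised by the area of a cell. *)
Record dual_weights (R : realType) L (p q C1 : R) (w sg : cell L -> R) : Prop := DualWeights {
  dw_pos : forall x, 0 < w x;
  dw_dual_pos : forall x, 0 < sg x;
  dw_cell : forall x, 1 <= w x `^ p^-1 * sg x `^ q^-1;
  dw_cube : forall k x, (k <= L)%N ->
    (\sum_(y | nb 1 k x y) w y) `^ p^-1 * (\sum_(y | nb 1 k x y) sg y) `^ q^-1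
      <= C1 * 4%:R ^+ k }.

Lemma dual_weights_sym (R : realType) L (p q C1 : R) (w sg : cell L -> R) :
  dual_weights p q C1 w sg -> dual_weights q p C1 sg w.
Proof.
by case=> h1 h2 h3 h4; split => // [x|k x kL]; rewrite mulrC //; exact: h4.
Qed.

Lemma sum_sub_le (R : realType) (I : finType) (P Q : pred I) (F : I -> R) :
  (forall i, 0 <= F i) -> (forall i, P i -> Q i) ->
  \sum_(i | P i) F i <= \sum_(i | Q i) F i.
Proof.
move=> F0 PQ; rewrite [leLHS]big_mkcond [leRHS]big_mkcond /=; apply: ler_sum => i _.
by case: ifP => [/PQ ->//|_]; case: ifP.
Qed.

(** * Weighted bounds for the sparse form *)

Section Weighted.
Variables (R : realType) (L : nat) (b f g : cell L -> R).
Hypothesis f0 : forall x, 0 <= f x.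
Hypothesis g0 : forall x, 0 <= g x.
Implicit Types (x y z t : cell L) (s u v : cell L -> R).
Notation lv := (lv b f g).
Notation cr := (cr b f g).
Notation nr := (nr b f g).
Notation gen := (gen b f g).
Notation N := (genN L).

(** The mass of a block and, in [Es], of its part outside of the next generation. These parts are
    disjoint over all blocks and generations and have at least half of the cells of their blocks,
    which is the sparseness of the family. *)
Definition Qs s j x : R := \sum_(y | nb 0 (lv j x) x y) s y.
Definition Es s j x : R := \sum_(y | nb 0 (lv j x) x y && ~~ cr j.+1 y) s y.

Definition triple (H : nat -> cell L -> cell L -> R) : R :=
  \sum_(j < N) \sum_(x | cr j x) \sum_(y | nr j x y) H j x y.

Lemma tripleE H : triple H =
  \sum_(i : 'I_N * (cell L * cell L)) (if nr i.1 i.2.1 i.2.2 then H i.1 i.2.1 i.2.2 else 0).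
Proof.
rewrite -[RHS](@pair_bigA _ _ _ _ _ (fun (j : 'I_N) (c : cell L * cell L) =>
  if nr j c.1 c.2 then H j c.1 c.2 else 0)) /=.
apply: eq_bigr => j _.
rewrite -[RHS](@pair_bigA _ _ _ _ _ (fun x y => if nr j x y then H j x y else 0)) /=.
rewrite big_mkcond; apply: eq_bigr => x _; rewrite big_mkcond.
case: ifPn => // nc; rewrite big1 // => y _; case: ifPn => // /and3P[cx].
by rewrite (cx : cr j x) in nc.
Qed.

Lemma triple_sym H : triple H = triple (fun j x y => H j y x).
Proof.
rewrite !tripleE (reindex_inj (h := fun i => (i.1, (i.2.2, i.2.1)))) /=.
  by apply: eq_bigr => i _; rewrite /nr nearC.
by move=> [? [? ?]] [? [? ?]] [-> -> ->].
Qed.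

Lemma Es_ge0 s j x : (forall y, 0 <= s y) -> 0 <= Es s j x.
Proof. by move=> s0; apply: sumr_ge0. Qed.

Lemma Es_le_Qs s j x : (forall y, 0 <= s y) -> Es s j x <= Qs s j x.
Proof. by move=> s0; apply: sum_sub_le => // y /andP[]. Qed.

Lemma half_Es j x : cr j x -> 4%:R ^+ lv j x / 2%:R <= Es (fun=> 1) j x.
Proof.
move=> cx; have ar (A B C : R) : B + C = A -> B <= A / 2%:R -> A / 2%:R <= C by lra.
apply: ar (gen_small f0 g0 cx); rewrite -[RHS](sum_nb0 R x (lev_le _ _)).
by rewrite [RHS](bigID (cr j.+1)).
Qed.

Lemma sum_layers x :
  \sum_(j < N) (if cr j x && ~~ cr j.+1 x then 1 else 0) <= 1 :> R.
Proof.
suff : forall n, \sum_(j < n) (if cr j x && ~~ cr j.+1 x then 1 else 0) =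
    1 - (if cr n x then 1 else 0) :> R.
  by move=> ->; case: ifP => _; rewrite ?subr0 ?subrr ?ler01.
elim=> [|n ih]; first by rewrite big_ord0 cr0 subrr.
rewrite big_ord_recr /= ih; case E : (cr n.+1 x).
  by rewrite (crS E) /= addr0.
by case: (cr n x) => /=; rewrite ?addr0 // subrr add0r subr0.
Qed.

Lemma sum_Es s j (G : cell L -> R) : stconst (cr j) (lv j) G ->
  \sum_(x | cr j x) (4%:R ^+ lv j x)^-1 * Es s j x * G x =
  \sum_x (if cr j x && ~~ cr j.+1 x then 1 else 0) * (s x * G x).
Proof.
move=> Gc; have st : stopping (cr j) (lv j) := core_stopping (gen j).
have := sum_avM st (fun x => if cr j.+1 x then 0 else s x) Gc.
rewrite [X in _ = X -> _](_ : _ = \sum_(x | cr j x) (4%:R ^+ lv j x)^-1 * Es s j x * G x).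
  move=> <-; rewrite [LHS]big_mkcond; apply: eq_bigr => x _.
  by case: (cr j x); case: (cr j.+1 x) => /=; rewrite ?mul0r ?mul1r.
apply: eq_bigr => x _; congr (_ * _ * _); rewrite /Es big_mkcond [RHS]big_mkcond.
by apply: eq_bigr => y _; case: (nb _ _ _ _); case: (cr j.+1 y).
Qed.

(** Carleson embedding: the mass of a block is replaced by that of its disjoint part, on which the
    block average is below the maximal function, and [doob] applies. The factor 144 counts adjacent
    blocks. *)
Lemma carleson (p q D : R) s phi : 1 < p -> 0 < q -> p^-1 + q^-1 = 1 -> 0 <= D ->
  (forall x, 0 < s x) -> (forall x, 0 <= phi x) ->
  (forall j x, cr j x -> Qs s j x <= D * Es s j x) ->
  triple (fun j x y => (4%:R ^+ lv j x)^-1 * (4%:R ^+ lv j y)^-1 *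
      (Qs s j x * wav s phi (lv j x) x `^ p))
    <= 144%:R * D * q `^ p * \sum_x s x * phi x `^ p.
Proof.
move=> p1 q0 pq D0 s0 phi0 hD.
have st j : stopping (cr j) (lv j) := core_stopping (gen j).
have W0 k x : 0 <= wav s phi k x by exact: wav_ge0.
pose W j x := wav s phi (lv j x) x `^ p.
have Wst j : stconst (cr j) (lv j) (W j).
  move=> x y cx n; rewrite /W (stopping_congr (st j) cx n).2.
  by rewrite (@wav_congr _ _ _ _ _ y x) // nbC.
have p0 : 0 < p by rewrite (lt_trans _ p1).
apply: (@le_trans _ _ (\sum_(j < N) 144%:R * D *
   \sum_(x | cr j x) (4%:R ^+ lv j x)^-1 * Es s j x * W j x)).
  apply: ler_sum => j _; rewrite mulr_sumr; apply: ler_sum => x cx.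
  have P0 : 0 <= (4%:R ^+ lv j x)^-1 * (Qs s j x * W j x).
    apply: mulr_ge0; first exact: pow4V_ge0.
    by apply: mulr_ge0; [apply: sumr_ge0 => y _; exact: ltW|exact: powR_ge0].
  rewrite (eq_bigr (fun y => (4%:R ^+ lv j x)^-1 * (Qs s j x * W j x) * (4%:R ^+ lv j y)^-1)).
    rewrite -mulr_sumr; apply: le_trans (ler_wpM2l P0 (near_card R cx)) _.
    rewrite [leLHS](_ : _ = 144%:R * ((4%:R ^+ lv j x)^-1 * W j x) * Qs s j x); last by ring.
    rewrite [leRHS](_ : _ = 144%:R * ((4%:R ^+ lv j x)^-1 * W j x) * (D * Es s j x)); last by ring.
    apply: ler_wpM2l; last exact: hD.
    by apply: mulr_ge0 => //; apply: mulr_ge0; [exact: pow4V_ge0|exact: powR_ge0].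
  by move=> y _; rewrite mulrAC.
rewrite -mulr_sumr -[leRHS]mulrA; apply: ler_wpM2l; first exact: mulr_ge0.
under eq_bigr do rewrite sum_Es //.
rewrite exchange_big /=.
apply: le_trans (doob s0 phi0 p1 q0 pq).
apply: ler_sum => x _.
apply: (@le_trans _ _ (\sum_(j < N) (if cr j x && ~~ cr j.+1 x then 1 else 0) *
    (s x * wmax s phi L x `^ p))).
  apply: ler_sum => j _; apply: ler_wpM2l; first by case: ifP.
  apply: ler_wpM2l; first exact: ltW.
  apply: powR_le; rewrite ?(ltW p0) //.
  by apply: wav_le_wmax; exact: lev_le.
rewrite -mulr_suml -[leRHS]mul1r; apply: ler_wpM2r; last exact: sum_layers.
by apply: mulr_ge0; [exact: ltW|exact: powR_ge0].
Qed.

Section LamBound.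
Variables (p q C1 : R) (w sg : cell L -> R).
Hypothesis p1 : 1 < p.
Hypothesis q1 : 1 < q.
Hypothesis pq : p^-1 + q^-1 = 1.
Hypothesis C10 : 0 < C1.
Hypothesis dw : dual_weights p q C1 w sg.

Let p0 : 0 < p. Proof. exact: lt_trans ltr01 p1. Qed.
Let q0 : 0 < q. Proof. exact: lt_trans ltr01 q1. Qed.

Lemma Qs_pos s j x : (forall y, 0 < s y) -> 0 < Qs s j x.
Proof.
move=> s0; rewrite /Qs (bigD1 x) ?nbxx //= ltr_wpDr // sumr_ge0 // => y _; exact: ltW.
Qed.

Lemma Qs_le_cube s j x k y : (forall z, 0 <= s z) -> (lv j x <= k)%N -> nb 1 k y x ->
  Qs s j x <= \sum_(z | nb 1 k y z) s z.
Proof.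
move=> s0 lk n; apply: sum_sub_le => // z nz.
by apply: (nb_trans n); exact: nb0_mono nz.
Qed.

(** The $A_\infty$ property. By Hoelder's inequality half of $|Q|$ is at most
    $w(E)^{1/p}\sigma(E)^{1/q}$, where $\sigma(E)\le\sigma(Q)$, while the cube condition bounds
    $w(Q)^{1/p}\sigma(Q)^{1/q}$ by [C1] times $|Q|$. *)
Lemma Qs_Es j x : cr j x -> Qs w j x <= (2%:R * C1) `^ p * Es w j x.
Proof.
move=> cx; have w0 y := ltW (dw_pos dw y); have s0 y := ltW (dw_dual_pos dw y).
pose l : R := 4%:R ^+ lv j x.
have h1 : l / 2%:R <= Es w j x `^ p^-1 * Qs sg j x `^ q^-1.
  apply: le_trans (half_Es cx) _.
  apply: (@le_trans _ _ (\sum_y (if nb 0 (lv j x) x y && ~~ cr j.+1 y then 1 else 0) *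
     (w y `^ p^-1 * sg y `^ q^-1))).
    rewrite /Es big_mkcond; apply: ler_sum => y _; case: ifP => _; rewrite ?mul0r // mul1r.
    exact: dw_cell dw y.
  apply: le_trans (whoelder_sum p0 q0 pq _ _ _) _.
  - by move=> y; case: ifP.
  - by move=> y; exact: powR_ge0.
  - by move=> y; exact: powR_ge0.
  rewrite [X in X `^ _ * _](_ : _ = Es w j x); last first.
    rewrite /Es [RHS]big_mkcond; apply: eq_bigr => y _; rewrite powRVK //.
    by case: ifP; rewrite ?mul1r ?mul0r.
  rewrite [X in _ * X `^ _](_ : _ = Es sg j x); last first.
    rewrite /Es [RHS]big_mkcond; apply: eq_bigr => y _; rewrite powRVK //.
    by case: ifP; rewrite ?mul1r ?mul0r.
  apply: ler_wpM2l; first exact: powR_ge0.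
  by apply: powR_le; [rewrite invr_ge0 ltW|exact: Es_ge0|exact: Es_le_Qs].
have h2 : Qs w j x `^ p^-1 * Qs sg j x `^ q^-1 <= C1 * l.
  apply: le_trans (dw_cube dw x (lev_le (gen j) x)).
  have n := nbxx 1 (lv j x) x.
  by apply: ler_pM; rewrite ?powR_ge0 //; apply: powR_le;
    rewrite ?invr_ge0 ?(ltW p0) ?(ltW q0) ?(ltW (Qs_pos _ _ _)) //;
    [exact: dw_pos dw|exact: Qs_le_cube|exact: dw_dual_pos dw|exact: Qs_le_cube].
have S0 : 0 < Qs sg j x `^ q^-1 by apply: powR_gt0; apply: Qs_pos; exact: dw_dual_pos dw.
have h3 : Qs w j x `^ p^-1 <= 2%:R * C1 * Es w j x `^ p^-1.
  rewrite -(ler_pM2r S0); apply: le_trans h2 _.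
  rewrite [leRHS](_ : _ = 2%:R * C1 * (Es w j x `^ p^-1 * Qs sg j x `^ q^-1)); last by ring.
  apply: le_trans (ler_wpM2l _ h1); last by rewrite mulr_ge0 ?(ltW C10).
  by rewrite le_eqVlt; apply/orP; left; apply/eqP; field.
have E0 : 0 <= Es w j x by exact: Es_ge0.
rewrite -[leLHS](powRVK p0) ?(ltW (Qs_pos _ _ (dw_pos dw))) //.
rewrite -[X in _ * X](powRVK p0) // -powRM ?powR_ge0 ?mulr_ge0 ?(ltW C10) //.
by apply: powR_le; rewrite ?(ltW p0) ?powR_ge0.
Qed.

(** The power [p] of [dw_cell] reads [1 <= w * sg ^ (p - 1)]. It is an inequality because [w] and
    [sg] are averages over cells and the weights are exactly dual only before averaging. *)
Lemma sum_dual (u : cell L -> R) : (forall x, 0 <= u x) ->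
  \sum_x sg x * (u x / sg x) `^ p <= \sum_x u x `^ p * w x.
Proof.
move=> u0; apply: ler_sum => x _; have s0 := dw_dual_pos dw x; have w0 := dw_pos dw x.
rewrite powRM ?invr_ge0 ?(ltW s0) // mulrCA; apply: ler_wpM2l; first exact: powR_ge0.
have h : 1 <= w x * sg x `^ (p - 1).
  have := powR_le (ltW p0) ler01 (dw_cell dw x).
  rewrite powR1 powRM ?powR_ge0 // (powRVK p0) ?(ltW w0) // -powRrM.
  by rewrite [q^-1 * p]mulrC (conj_divr p0 pq).
rewrite -powR_inv1 ?(ltW s0) // -powRrM -[X in X * _]powRr1 ?(ltW s0) // -powRD ?(gt_eqF s0) ?implybT //.
rewrite (_ : 1 + -1 * p = - (p - 1)); last by ring.
by rewrite powRN -[leLHS]mul1r ler_pdivrMr ?powR_gt0.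
Qed.

End LamBound.

(** [4 * C1] is the cube condition for two adjacent blocks; the two roots are the Carleson
    embeddings for [sg] with exponent [p] and for [w] with exponent [q], the constants [D] being
    those of [Qs_Es]. *)
Definition LamC (p q C1 : R) : R :=
  4%:R * C1 * ((144%:R * (2%:R * C1) `^ q * q `^ p) `^ p^-1 *
               (144%:R * (2%:R * C1) `^ p * p `^ q) `^ q^-1).

Lemma LamC_ge0 p q C1 : 0 <= C1 -> 0 <= LamC p q C1.
Proof. by move=> C10; rewrite /LamC !mulr_ge0 ?powR_ge0. Qed.

(** With [u = sg * phi] and [v = w * psi] block averages become averages with respect to the
    weights. The mass of each block is split into its powers [1 / p] and [1 / q]: one goes into the
    cube condition, the other into Hoelder's inequality over all pairs of blocks, and [carleson] is
    used twice. *)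
Lemma Lam_bound (p q C1 : R) (w sg u v : cell L -> R) :
  1 < p -> 1 < q -> p^-1 + q^-1 = 1 -> 0 < C1 -> dual_weights p q C1 w sg ->
  (forall x, 0 <= u x) -> (forall x, 0 <= v x) ->
  Lam b f g u v <= LamC p q C1 * ((\sum_x u x `^ p * w x) `^ p^-1 *
                                  (\sum_x v x `^ q * sg x) `^ q^-1).
Proof.
move=> p1 q1 pq C10 dw u0 v0.
have p0 : 0 < p by exact: lt_trans ltr01 p1.
have q0 : 0 < q by exact: lt_trans ltr01 q1.
have qp : q^-1 + p^-1 = 1 by rewrite addrC.
have dw' := dual_weights_sym dw.
have w0 := dw_pos dw; have s0 := dw_dual_pos dw.
pose phi x := u x / sg x; pose psi x := v x / w x.
have phi0 x : 0 <= phi x by rewrite divr_ge0 ?(ltW (s0 x)).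
have psi0 x : 0 <= psi x by rewrite divr_ge0 ?(ltW (w0 x)).
have avE (s h : cell L -> R) j x : (forall y, 0 < s y) ->
    av (lv j x) h x = (4%:R ^+ lv j x)^-1 * Qs s j x * wav s (fun y => h y / s y) (lv j x) x.
  move=> sp; have a0 := av_gt0 sp (lv j x) x.
  rewrite (_ : _ * Qs s j x = av (lv j x) s x) // /wav mulrCA mulfV ?gt_eqF // mulr1.
  by apply: eq_av => y _; rewrite mulrCA mulfV ?mulr1 // gt_eqF.
pose a j x := Qs sg j x `^ p^-1 * wav sg phi (lv j x) x.
pose c j y := Qs w j y `^ q^-1 * wav w psi (lv j y) y.
have Qw0 j x : 0 < Qs w j x by exact: Qs_pos.
have Qs0 j x : 0 < Qs sg j x by exact: Qs_pos.
have a0 j x : 0 <= a j x by rewrite mulr_ge0 ?powR_ge0 // wav_ge0.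
have c0 j x : 0 <= c j x by rewrite mulr_ge0 ?powR_ge0 // wav_ge0.
pose m j x y : R := (4%:R ^+ lv j x)^-1 * (4%:R ^+ lv j y)^-1.
have m0 j x y : 0 <= m j x y by rewrite mulr_ge0 ?pow4V_ge0.
apply: (@le_trans _ _ (4%:R * C1 * triple (fun j x y => m j x y * (a j x * c j y)))).
  rewrite /triple mulr_sumr; apply: ler_sum => j _.
  rewrite mulr_sumr; apply: ler_sum => x cx.
  rewrite mulr_sumr; apply: ler_sum => y nxy.
  rewrite (avE sg u) // (avE w v) // -/phi -/psi.
  set P := wav sg phi _ x; set G := wav w psi _ y.
  have P0 : 0 <= P by exact: wav_ge0.
  have G0 : 0 <= G by exact: wav_ge0.
  (* Both blocks lie in the 3 by 3 neighbourhood of [x] at the larger of the two levels, which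
     exceeds the level of [y] by at most one; hence the factor 4. *)
  have key : Qs sg j x `^ q^-1 * Qs w j y `^ p^-1 <= C1 * (4%:R * 4%:R ^+ lv j y).
    have /and3P[_ _ nb1] := nxy.
    set K := maxn (lv j x) (lv j y); have KL : (K <= L)%N by rewrite geq_max !lev_le.
    apply: (@le_trans _ _ (C1 * 4%:R ^+ K)).
      apply: le_trans (dw_cube dw' x KL).
      apply: ler_pM; rewrite ?powR_ge0 //; apply: powR_le;
        rewrite ?invr_ge0 ?(ltW p0) ?(ltW q0) ?(ltW (Qw0 _ _)) ?(ltW (Qs0 _ _)) //;
        apply: Qs_le_cube => //.
      + by move=> z; exact: ltW.
      + exact: leq_maxl.
      + exact: nbxx.
      + by move=> z; exact: ltW.
      + exact: leq_maxr.
    rewrite ler_wpM2l ?(ltW C10) // -exprS ler_weXn2l ?ler1n //.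
    by rewrite geq_max leqnSn andbT near_lev // nearC.
  rewrite /m /a /c -/P -/G.
  rewrite -[X in _ * (_ * X * _) * _](powR_conj pq (Qs0 j x)).
  rewrite -[X in _ * (_ * _ * _) * (_ * X * _)](powR_conj pq (Qw0 j y)).
  set A := Qs sg j x `^ p^-1; set A' := Qs sg j x `^ q^-1 in key *.
  set B := Qs w j y `^ q^-1; set B' := Qs w j y `^ p^-1 in key *.
  set X := 4 ^+ lv j x; set Y := 4 ^+ lv j y in key *.
  have A0 : 0 <= A by exact: powR_ge0.
  have B0 : 0 <= B by exact: powR_ge0.
  have X0 : 0 < X by exact: pow4_gt0.
  have Y0 : 0 < Y by exact: pow4_gt0.
  clearbody A A' B B' X Y P G.
  rewrite [leLHS](_ : _ = (X^-1 * Y^-1 * (A * P * (B * G))) * (Y^-1 * (A' * B'))); last by ring.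
  rewrite [leRHS](_ : _ = (X^-1 * Y^-1 * (A * P * (B * G))) * (4%:R * C1)); last by ring.
  apply: ler_wpM2l; first by rewrite !mulr_ge0 ?invr_ge0 ?(ltW X0) ?(ltW Y0).
  by rewrite mulrC ler_pdivrMr // (le_trans key) // mulrA [C1 * _]mulrC.
rewrite /LamC -[leRHS]mulrA; apply: ler_wpM2l; first by rewrite mulr_ge0 ?(ltW C10).
rewrite tripleE.
pose I := ('I_N * (cell L * cell L))%type.
pose m' (i : I) := if nr i.1 i.2.1 i.2.2 then m i.1 i.2.1 i.2.2 else 0.
have m'0 i : 0 <= m' i by rewrite /m'; case: ifP.
have := @whoelder_sum R p q p0 q0 pq _ m' (fun i => a i.1 i.2.1) (fun i => c i.1 i.2.2) m'0
  (fun i => a0 _ _) (fun i => c0 _ _).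
rewrite [leLHS](_ : _ = \sum_(i : I) (if nr i.1 i.2.1 i.2.2
   then m i.1 i.2.1 i.2.2 * (a i.1 i.2.1 * c i.1 i.2.2) else 0)); last first.
  by apply: eq_bigr => i _; rewrite /m'; case: ifP => // _; rewrite mul0r.
move=> /le_trans; apply; rewrite mulrACA.
have Q1 := @carleson p q ((2%:R * C1) `^ q) sg phi p1 q0 pq (powR_ge0 _ _) s0 phi0
  (fun j x cx => Qs_Es q1 p1 qp C10 dw' cx).
have Q2 := @carleson q p ((2%:R * C1) `^ p) w psi q1 p0 qp (powR_ge0 _ _) w0 psi0
  (fun j x cx => Qs_Es p1 q1 pq C10 dw cx).
have ip : 0 <= p^-1 by rewrite invr_ge0 ltW.
have iq : 0 <= q^-1 by rewrite invr_ge0 ltW.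
have SU0 : 0 <= \sum_x u x `^ p * w x.
  by apply: sumr_ge0 => x _; rewrite mulr_ge0 ?powR_ge0 ?(ltW (w0 x)).
have SV0 : 0 <= \sum_x v x `^ q * sg x.
  by apply: sumr_ge0 => x _; rewrite mulr_ge0 ?powR_ge0 ?(ltW (s0 x)).
apply: ler_pM; rewrite ?powR_ge0 // -powRM ?mulr_ge0 ?powR_ge0 //; apply: powR_le => //.
- by apply: sumr_ge0 => i _; rewrite mulr_ge0 ?powR_ge0.
- rewrite [leLHS](_ : _ = triple (fun j x y => (4%:R ^+ lv j x)^-1 * (4%:R ^+ lv j y)^-1 *
      (Qs sg j x * wav sg phi (lv j x) x `^ p))).
    apply: le_trans Q1 _; apply: ler_wpM2l; first by rewrite !mulr_ge0 ?powR_ge0.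
    exact: (sum_dual p1 pq dw).
  rewrite tripleE; apply: eq_bigr => i _; rewrite /m'; case: ifP => _; last by rewrite mul0r.
  by rewrite /a powRM ?powR_ge0 ?wav_ge0 // powRVK // ltW.
- by apply: sumr_ge0 => i _; rewrite mulr_ge0 ?powR_ge0.
- rewrite [leLHS](_ : _ = triple (fun j x y => (4%:R ^+ lv j x)^-1 * (4%:R ^+ lv j y)^-1 *
      (Qs w j x * wav w psi (lv j x) x `^ q))).
    apply: le_trans Q2 _; apply: ler_wpM2l; first by rewrite !mulr_ge0 ?powR_ge0.
    exact: (sum_dual q1 qp dw').
  rewrite triple_sym tripleE; apply: eq_bigr => i _; rewrite /m'; case: ifP => _; last by rewrite mul0r.
  rewrite /c powRM ?powR_ge0 ?wav_ge0 // powRVK ?(ltW (Qw0 _ _)) // /m.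
  by rewrite [X in X * _]mulrC.
Qed.

End Weighted.

(* [nu] and [nv] are normalised integrals of the Bloom weight and of its inverse. *)
Definition bmo_cells (R : realType) L (D : R) (nv b : cell L -> R) : Prop :=
  forall k x, (k <= L)%N -> exists c,
    (\sum_(y | nb 1 k x y) `|b y - c|) * (\sum_(y | nb 0 k x y) nv y) <= D * 16%:R ^+ k.

(** * Two-weight estimate of the commutator form *)

Section Bloom.
Variables (R : realType) (L : nat) (b f g : cell L -> R).
Hypothesis f0 : forall x, 0 <= f x.
Hypothesis g0 : forall x, 0 <= g x.
Implicit Types (x y z t : cell L) (s u v : cell L -> R).
Notation lv := (lv b f g).
Notation cr := (cr b f g).
Notation nr := (nr b f g).
Notation gen := (gen b f g).
Notation N := (genN L).
Notation Es := (Es b f g).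
Notation Qs := (Qs b f g).
Notation avb := (avb b f g).
Notation dv := (dv b f g).
Notation triple := (triple b f g).

Let st j : stopping (cr j) (lv j) := core_stopping (gen j).

Lemma dv_blk j x y : cr j x -> nb 0 (lv j x) x y -> dv j y = `|b y - avb j x|.
Proof.
move=> cx n; have [_ e] := stopping_congr (st j) cx n.
by rewrite /dv /dev (e : lev (gen j) y = lv j x) -(av_congr _ n).
Qed.

Section Oscillation.
Variables (D : R) (nu nv : cell L -> R).
Hypothesis D0 : 0 <= D.
Hypothesis nu0 : forall x, 0 < nu x.
Hypothesis nv0 : forall x, 0 < nv x.
Hypothesis nuv : forall x, 1 <= nu x * nv x.
Hypothesis bmo : bmo_cells D nv b.

Lemma amgm2 (a c : R) : 0 < a -> 0 < c -> 1 <= a * c -> 2%:R <= a + c.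
Proof.
move=> a0 c0 h; rewrite leNgt; apply/negP => lt2.
have h1 : (a + c) * (a + c) < 2%:R * 2%:R.
  by apply: ltr_pM => //; rewrite addr_ge0 ?ltW.
have := sqr_ge0 (a - c); rewrite expr2; lra.
Qed.

Lemma Es_pos s j x : (forall y, 0 < s y) -> cr j x -> 0 < Es s j x.
Proof.
move=> s0 cx; have [y nxy ny] := gen_drop f0 g0 cx.
rewrite /Es (bigD1 y) ?nxy ?ny //= ltr_wpDr // sumr_ge0 // => z _; exact: ltW.
Qed.

(** Cauchy--Schwarz on the disjoint part of the block, which has at least half of its cells. It is
    obtained cell by cell from the arithmetic-geometric mean inequality, without roots. *)
Lemma Es_nuv j x : cr j x -> 16%:R ^+ lv j x <= 4%:R * (Es nu j x * Es nv j x).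
Proof.
move=> cx; have h := half_Es f0 g0 cx; set e := Es (fun=> 1) j x in h.
set A := Es nu j x; set B := Es nv j x; set X := 4 ^+ lv j x in h.
have A0 : 0 < A by exact: Es_pos.
have B0 : 0 < B by exact: Es_pos.
have X0 : 0 < X by exact: pow4_gt0.
have e0 : 0 < e by rewrite (lt_le_trans _ h) // divr_gt0.
have : 2%:R * e <= e / A * A + A / e * B.
  rewrite /e /A /B /Es -/A -/e !mulr_sumr -big_split /=; apply: ler_sum => y _.
  rewrite mulr1; apply: amgm2.
  - by rewrite mulr_gt0 ?divr_gt0.
  - by rewrite mulr_gt0 ?divr_gt0.
  rewrite (_ : _ * _ = nu y * nv y) //; field.
  by rewrite !gt_eqF.
have -> : 16%:R ^+ lv j x = X * X :> R.
  by rewrite /X -exprMn -natrM.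
clearbody e A B X.
rewrite mulfVK ?gt_eqF // => h2.
have : e <= A / e * B by lra.
rewrite mulrAC ler_pdivlMr // => h3.
have : X <= 2%:R * e by lra.
by move=> h4; apply: le_trans (_ : (2%:R * e) * (2%:R * e) <= _); [apply: ler_pM => //; exact: ltW|lra].
Qed.

(** The hypothesis multiplies the oscillation by the mass of [nv], which is at least that on the
    disjoint part; [Es_nuv] exchanges it for the mass of [nu] there. [64 = 16 * 4], with 16 for the
    level above that of the block. *)
Lemma osc_cube j x k : cr j x -> (lv j x <= k <= (lv j x).+1)%N -> (k <= L)%N ->
  exists c, \sum_(y | nb 1 k x y) `|b y - c| <= 64%:R * D * Es nu j x.
Proof.
move=> cx /andP[lk kl] kL; have [c hc] := bmo x kL; exists c.
have B0 : 0 < Es nv j x by exact: Es_pos.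
rewrite -(ler_pM2r B0).
apply: (@le_trans _ _ (D * 16%:R ^+ k)).
  apply: le_trans hc; rewrite ler_wpM2l ?sumr_ge0 //.
  apply: sum_sub_le => [y|y /andP[n _]]; first exact: ltW.
  exact: nb0_mono n.
apply: (@le_trans _ _ (D * (16%:R * 16%:R ^+ lv j x))).
  by rewrite ler_wpM2l // -exprS ler_weXn2l // ler1n.
rewrite [leRHS](_ : _ = D * (16%:R * (4%:R * (Es nu j x * Es nv j x)))); last by ring.
by rewrite !ler_wpM2l ?Es_nuv.
Qed.

(** The average of [nu] over the block, with only the disjoint part counted; sums over generations
    then become sums of [nu] over disjoint sets. *)
Definition nj j x : R := (4%:R ^+ lv j x)^-1 * Es nu j x.

Lemma nj_ge0 j x : 0 <= nj j x.
Proof. by rewrite mulr_ge0 ?pow4V_ge0 // Es_ge0 // => y; exact: ltW. Qed.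

Lemma nj_st j : stconst (cr j) (lv j) (nj j).
Proof.
move=> x y cx n; rewrite /nj /Es (stopping_congr (st j) cx n).2; congr (_ * _).
by apply: eq_bigl => z; rewrite (nb0_congr _ _ n).
Qed.

Lemma av_dist k h x (c : R) : (k <= L)%N -> `|av k h x - c| <= av k (fun y => `|h y - c|) x.
Proof.
move=> kL; rewrite -[X in `|_ - X|](av_cst c x kL) -avN -avD; exact: ler_norm_av.
Qed.

Lemma av_nb k K x y (h : cell L -> R) : (forall z, 0 <= h z) -> (k <= K)%N -> nb 1 K y x ->
  av k h x <= (4%:R ^+ k)^-1 * \sum_(z | nb 1 K y z) h z.
Proof.
move=> h0 kK n; rewrite ler_wpM2l ?pow4V_ge0 //; apply: sum_sub_le => // z nz.
by apply: (nb_trans n); exact: nb0_mono nz.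
Qed.

Lemma av_dv j x : cr j x -> av (lv j x) (dv j) x <= 128%:R * D * nj j x.
Proof.
move=> cx; have lL : (lv j x <= L)%N by exact: lev_le.
have [c hc] := @osc_cube j x (lv j x) cx (introT andP (conj (leqnn _) (leqnSn _))) lL.
pose a := av (lv j x) (fun y => `|b y - c|) x.
have ha : a <= 64%:R * D * nj j x.
  apply: (le_trans (av_nb _ (leqnn _) (nbxx 1 _ x))) => //.
  by rewrite /nj mulrCA ler_wpM2l ?pow4V_ge0.
have hb : `|avb j x - c| <= a by exact: av_dist.
apply: (@le_trans _ _ (a + a)); last by lra.
apply: (@le_trans _ _ (av (lv j x) (fun y => `|b y - c| + a) x)); last first.
  by rewrite avD av_cst.
apply: le_av => y n; rewrite (dv_blk cx n).
rewrite -[_ - _](subrKA c) (le_trans (ler_normD _ _)) // lerD2l distrC.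
exact: hb.
Qed.

(** Both averages are compared with one constant on a neighbourhood of [y] containing both blocks:
    64 for [y], and [4 * 64] for [x], whose block may be four times smaller. *)
Lemma avb_near j x y : nr j x y -> `|avb j x - avb j y| <= 320%:R * D * nj j y.
Proof.
move=> nxy; have /and3P[cx cy n] := nxy.
have xy : (lv j x <= (lv j y).+1)%N by rewrite near_lev // nearC.
have yx : (lv j y <= (lv j x).+1)%N by rewrite near_lev.
set K := maxn _ _ in n.
have KL : (K <= L)%N by rewrite geq_max !lev_le.
have Ky : (lv j y <= K <= (lv j y).+1)%N.
  by rewrite leq_max leqnn orbT geq_max leqnSn andbT.
have [c hc] := osc_cube cy Ky KL.
have hx : `|avb j x - c| <= 256%:R * D * nj j y.
  apply: le_trans (av_dist _ _ _ (lev_le _ _)) _.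
  have n' : nb 1 K y x by rewrite nbC.
  apply: (le_trans (av_nb _ (leq_maxl _ _) n')) => //.
  apply: (le_trans (ler_wpM2l (pow4V_ge0 _ _) hc)).
  rewrite /nj [leRHS](_ : _ = (4%:R * (4 ^+ lv j y)^-1) * (64%:R * D * Es nu j y)); last by ring.
  rewrite ler_wpM2r ?mulr_ge0 ?Es_ge0 // => [z|]; first exact: ltW.
  rewrite -[X in X * _]invrK -invfM lef_pV2 ?posrE ?pow4_gt0 ?mulr_gt0 ?invr_gt0 ?pow4_gt0 //.
  by rewrite mulrC ler_pdivrMr // -exprSr ler_weXn2l // ler1n.
have hy : `|avb j y - c| <= 64%:R * D * nj j y.
  apply: le_trans (av_dist _ _ _ (lev_le _ _)) _.
  apply: (le_trans (av_nb _ (leq_maxr _ _) (nbxx 1 K y))) => //.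
  by apply: (le_trans (ler_wpM2l (pow4V_ge0 _ _) hc)); rewrite /nj mulrCA.
rewrite -[_ - _](subrKA c) (le_trans (ler_normD _ _)) // [`|c - _|]distrC.
by lra.
Qed.

Definition oscC : R := 4%:R * stopA R * (128%:R * D).

Lemma oscC_ge0 : 0 <= oscC.
Proof. by rewrite /oscC !mulr_ge0 ?stopA_ge0. Qed.

(** As [dev] is a controlled function, the stopping rule bounds it off the next core and bounds its
    average over each next block; the latter controls the change of the average of [b] from one
    block to the other. Iteration dominates the deviation by [nj] summed over the blocks of this and
    later generations that contain the cell. *)
Lemma dv_step i x : cr i x ->
  dv i x <= oscC * nj i x + (if cr i.+1 x then dv i.+1 x else 0).
Proof.
move=> cx.
have := proj_next_le (controlled_ge0 b f0 g0 (gen i)) (stopA_ge1 R) 4 cx.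
rewrite /= -/(dv i) => h.
have h' : proj (cr i.+1) (lv i.+1) (dv i) x <= oscC * nj i x.
  apply: (le_trans h); rewrite /oscC -[leRHS]mulrA ler_wpM2l ?av_dv //.
  by rewrite mulr_ge0 ?stopA_ge0.
move: h'; rewrite /proj; case: ifP => cx' h'; last by rewrite addr0.
apply: (@le_trans _ _ (`|b x - avb i.+1 x| + `|avb i.+1 x - avb i x|)).
  rewrite (dv_blk cx (nbxx _ _ _)) -[X in `|X|](subrKA (avb i.+1 x)); exact: ler_normD.
rewrite addrC lerD2r; apply: le_trans h'.
apply: le_trans (av_dist _ _ _ (lev_le _ _)) _; apply: le_av => y n.
have n' : nb 0 (lv i x) x y by apply: nb0_mono n; exact: lev_next.
by rewrite (dv_blk cx n').
Qed.

Lemma dv_sum j x : (j < N)%N -> cr j x ->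
  dv j x <= oscC * \sum_(i < N) (if (j <= i)%N && cr i x then nj i x else 0).
Proof.
move=> jN cx.
have H m : dv j x <= oscC * \sum_(j <= i < j + m) (if cr i x then nj i x else 0) +
     (if cr (j + m)%N x then dv (j + m) x else 0).
  elim: m => [|m ih]; first by rewrite addn0 big_geq // mulr0 add0r cx.
  apply: (le_trans ih); rewrite addnS big_nat_recr /= ?leq_addr // mulrDr -addrA lerD2l.
  case: ifP => cm; last first.
    by rewrite mulr0 add0r; case: ifP => // cm'; rewrite (crS cm') in cm.
  exact: dv_step.
have := H (N - j)%N; rewrite subnKC ?(ltnW jN) // (negbTE (gen_end b f0 g0 x)) addr0.
move=> /le_trans; apply; rewrite ler_wpM2l ?oscC_ge0 //.
rewrite big_geq_mkord big_mkcond /=; apply: ler_sum => i _.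
by case: (j <= i)%N.
Qed.

(** The sparse operator behind [Lam], one generation at a time: the sum of [v * Htot u] over all
    cells is [Lam u v]. *)
Definition Fs u j y : R := (4%:R ^+ lv j y)^-1 * \sum_(x | nr j y x) av (lv j x) u x.
Definition Htot u x : R := \sum_(j < N) (if cr j x then Fs u j x else 0).

Lemma Fs_ge0 u j y : (forall z, 0 <= u z) -> 0 <= Fs u j y.
Proof. by move=> u0; rewrite mulr_ge0 ?pow4V_ge0 // sumr_ge0 // => x _; exact: av_ge0. Qed.

Lemma Htot_ge0 u x : (forall z, 0 <= u z) -> 0 <= Htot u x.
Proof. by move=> u0; apply: sumr_ge0 => j _; case: ifP => // _; exact: Fs_ge0. Qed.

Lemma Fs_st u j : stconst (cr j) (lv j) (Fs u j).
Proof.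
move=> x y cx n; rewrite /Fs (stopping_congr (st j) cx n).2; congr (_ * _).
by apply: eq_bigl => z; rewrite /nr (near_congr _ cx n).
Qed.

Lemma triple_Fs u (G : nat -> cell L -> R) :
  triple (fun j x y => (4%:R ^+ lv j y)^-1 * (av (lv j x) u x * G j y)) =
  \sum_(j < N) \sum_(y | cr j y) Fs u j y * G j y.
Proof.
rewrite triple_sym /triple; apply: eq_bigr => j _; apply: eq_bigr => y _.
by rewrite /Fs -mulrA mulr_suml mulr_sumr.
Qed.

(** Pairs of generations [j <= i]: the weight [nj] and the average of [v] belong to a block of
    generation [i], [Fs] to the block of generation [j] that contains it. *)
Definition Sfun u v : R :=
  \sum_(i < N) \sum_(y | cr i y) av (lv i y) v y *
     (nj i y * \sum_(j < N) (if (j <= i)%N then Fs u j y else 0)).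

(** [dv_sum] spreads the deviation over later generations. After the two sums over generations are
    exchanged, everything except [v] is constant on the smaller block, and [v] may be averaged
    there. *)
Lemma T1_le u v : (forall x, 0 <= u x) -> (forall x, 0 <= v x) ->
  triple (fun j x y => (4%:R ^+ lv j y)^-1 *
     (av (lv j x) u x * av (lv j y) (fun t => dv j t * v t) y)) <= oscC * Sfun u v.
Proof.
move=> u0 v0; rewrite (triple_Fs u (fun j y => av (lv j y) (fun t => dv j t * v t) y)).
have Hst i : stconst (cr i) (lv i)
    (fun y => nj i y * \sum_(j < N) (if (j <= i)%N then Fs u j y else 0)).
  move=> x y cx n; rewrite (nj_st cx n); congr (_ * _); apply: eq_bigr => j _.
  case: ifP => // ji; apply: (Fs_st u (cr_le ji cx)).
  by apply: nb0_mono n; exact: (lv_le ji cx).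
rewrite /Sfun [X in _ <= _ * X](eq_bigr (fun i : 'I_N => \sum_(y | cr i y) v y *
     (nj i y * \sum_(j < N) (if (j <= i)%N then Fs u j y else 0)))); last first.
  by move=> i _; rewrite (sum_avM (st i) v (Hst i)).
rewrite [X in X <= _](eq_bigr (fun j : 'I_N => \sum_(y | cr j y) dv j y * v y * Fs u j y)); last first.
  move=> j _; rewrite (sum_avM (st j) _ (@Fs_st u j)); apply: eq_bigr => y _.
  by rewrite mulrC.
apply: (@le_trans _ _ (\sum_(j < N) \sum_(y | cr j y) \sum_(i < N)
   (if (j <= i)%N && cr i y then oscC * (nj i y * v y * Fs u j y) else 0))).
  apply: ler_sum => j _; apply: ler_sum => y cy.
  apply: (@le_trans _ _ ((oscC * \sum_(i < N) (if (j <= i)%N && cr i y then nj i y else 0)) *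
     v y * Fs u j y)).
    by rewrite ler_wpM2r ?Fs_ge0 // ler_wpM2r // dv_sum.
  rewrite le_eqVlt; apply/orP; left; apply/eqP.
  rewrite -mulrA -mulrA mulr_suml mulr_sumr; apply: eq_bigr => i _.
  by case: ifP => _; rewrite ?mul0r ?mulr0 // !mulrA.
rewrite mulr_sumr.
under [leRHS]eq_bigr do rewrite mulr_sumr.
rewrite [X in X <= _](eq_bigr (fun j : 'I_N => \sum_y \sum_(i < N)
   (if [&& cr j y, (j <= i)%N & cr i y] then oscC * (nj i y * v y * Fs u j y) else 0))); last first.
  move=> j _; rewrite big_mkcond; apply: eq_bigr => y _; case: (cr j y) => //=.
  by rewrite big1.
under [leLHS]eq_bigr do rewrite exchange_big /=.
rewrite [leLHS]exchange_big /=; apply: ler_sum => i _.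
rewrite [leLHS]exchange_big /= [leRHS]big_mkcond /=; apply: ler_sum => y _.
case: ifPn => cy; last by rewrite big1 // => j _; rewrite !andbF.
rewrite le_eqVlt; apply/orP; left; apply/eqP.
rewrite !mulr_sumr; apply: eq_bigr => j _.
rewrite andbT; case: (boolP (j <= i)%N) => ji; last by rewrite andbF !mulr0.
by rewrite (cr_le ji cy) /=; ring.
Qed.

(** [avb_near] leads to the terms [j = i] of [Sfun], and the others are nonnegative. *)
Lemma T3_le u v : (forall x, 0 <= u x) -> (forall x, 0 <= v x) ->
  triple (fun j x y => (4%:R ^+ lv j y)^-1 *
     (`|avb j x - avb j y| * (av (lv j x) u x * av (lv j y) v y))) <= 320%:R * D * Sfun u v.
Proof.
move=> u0 v0.
apply: (@le_trans _ _ (320%:R * D * triple (fun j x y => (4%:R ^+ lv j y)^-1 *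
     (av (lv j x) u x * (nj j y * av (lv j y) v y))))).
  rewrite /triple mulr_sumr; apply: ler_sum => j _; rewrite mulr_sumr; apply: ler_sum => x cx.
  rewrite mulr_sumr; apply: ler_sum => y nxy.
  rewrite [leRHS](_ : _ = (4%:R ^+ lv j y)^-1 * ((320%:R * D * nj j y) *
    (av (lv j x) u x * av (lv j y) v y))); last by ring.
  by rewrite ler_wpM2l ?pow4V_ge0 // ler_wpM2r ?avb_near // mulr_ge0 ?av_ge0.
apply: ler_wpM2l; first by rewrite mulr_ge0 ?ler0n.
rewrite (triple_Fs u (fun j y => nj j y * av (lv j y) v y)).
apply: ler_sum => j _; apply: ler_sum => y cy.
rewrite [leLHS](_ : _ = av (lv j y) v y * (nj j y * Fs u j y)); last by ring.
rewrite ler_wpM2l ?av_ge0 // ler_wpM2l ?nj_ge0 // (bigD1 j) //= leqnn lerDl.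
by apply: sumr_ge0 => i _; case: ifP => // _; exact: Fs_ge0.
Qed.

Lemma Lam_diag u v : (forall x, 0 <= u x) -> (forall x, 0 <= v x) ->
  \sum_(j < N) \sum_(x | cr j x) av (lv j x) u x * av (lv j x) v x <= Lam b f g u v.
Proof.
move=> u0 v0; apply: ler_sum => j _; apply: ler_sum => x cx.
apply: (@le_trans _ _ (\sum_(y | nb 0 (lv j x) x y)
    (4%:R ^+ lv j y)^-1 * av (lv j x) u x * av (lv j y) v y)).
  rewrite (eq_bigr (fun=> (4%:R ^+ lv j x)^-1 * (av (lv j x) u x * av (lv j x) v x) * 1)).
    by rewrite -mulr_sumr sum_nb0 ?lev_le // [leRHS]mulrAC mulVf ?mul1r ?pow4_neq0.
  by move=> y n; rewrite (stopping_congr (st j) cx n).2 -(av_congr _ n) mulr1 -[LHS]mulrA.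
apply: sum_sub_le => [y|y n]; first by apply: mulr_ge0; [apply: mulr_ge0; [exact: pow4V_ge0|exact: av_ge0]|exact: av_ge0].
rewrite /nr nearC -(near_congr _ cx n); exact: nearxx.
Qed.

(** The inner sum over [j <= i] is at most [Htot], and the mass of [nu] on disjoint parts becomes a
    sum of [nu] over cells. Enlarging the disjoint parts to blocks gives the diagonal of [Lam] at
    [nu * Htot u]. *)
Lemma Sfun_le u v : (forall x, 0 <= u x) -> (forall x, 0 <= v x) ->
  Sfun u v <= Lam b f g (fun x => nu x * Htot u x) v.
Proof.
move=> u0 v0; have H0 x : 0 <= nu x * Htot u x by rewrite mulr_ge0 ?Htot_ge0 // ltW.
apply: le_trans (Lam_diag H0 v0).
apply: ler_sum => i _.
pose Hi y := \sum_(j < N) (if (j <= i)%N then Fs u j y else 0).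
have Gst : stconst (cr i) (lv i) (fun y => av (lv i y) v y * Hi y).
  move=> x y cx n; congr (_ * _); first exact: (stconst_av (st i) v cx n).
  apply: eq_bigr => j _; case: ifP => // ji; apply: (Fs_st u (cr_le ji cx)).
  by apply: nb0_mono n; exact: (lv_le ji cx).
rewrite (eq_bigr (fun y => (4%:R ^+ lv i y)^-1 * Es nu i y * (av (lv i y) v y * Hi y))); last first.
  by move=> y _; rewrite /nj /Hi; ring.
rewrite (sum_Es nu Gst).
rewrite -(sum_avM (st i) (fun x => nu x * Htot u x) (stconst_av (st i) v)).
rewrite [leRHS]big_mkcond; apply: ler_sum => x _.
have P0 : 0 <= av (lv i x) v x by exact: av_ge0.
case: (boolP (cr i x)) => cx /=; last by rewrite mul0r.
case: ifP => _; last by rewrite mul0r; apply: mulr_ge0 => //; exact: H0.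
rewrite mul1r -mulrA ler_wpM2l ?(ltW (nu0 x)) // mulrC ler_wpM2r //.
apply: ler_sum => j _; case: ifP => ji; first by rewrite (cr_le ji cx).
by case: ifP => // _; exact: Fs_ge0.
Qed.

End Oscillation.

Lemma dw_cell_le (p q C1 : R) (w sg : cell L -> R) x : 0 < p -> 0 < q -> dual_weights p q C1 w sg ->
  w x `^ p^-1 * sg x `^ q^-1 <= C1.
Proof.
move=> p0 q0 dw; have := dw_cube dw x (leq0n L); rewrite expr0 mulr1.
move=> /(le_trans _); apply.
have le1 (s : cell L -> R) : (forall y, 0 < s y) -> s x <= \sum_(y | nb 1 0 x y) s y.
  by move=> s0; rewrite (bigD1 x) ?nbxx //= lerDl sumr_ge0 // => y _; exact: ltW.
have w0 := dw_pos dw; have s0 := dw_dual_pos dw.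
by apply: ler_pM; rewrite ?powR_ge0 //; apply: powR_le;
  rewrite ?invr_ge0 ?(ltW p0) ?(ltW q0) ?(ltW (w0 _)) ?(ltW (s0 _)) ?le1.
Qed.

(** Duality: tested on [h = w * Htot u ^ (p - 1)] the left side is [Lam u h], and the power of it
    that [Lam_bound] produces is absorbed. The extra [C1] appears because on a cell [w] and [sg] are
    dual only up to this constant. *)
Lemma Htot_bound (p q C1 : R) (w sg u : cell L -> R) : 1 < p -> 1 < q -> p^-1 + q^-1 = 1 ->
  0 < C1 -> dual_weights p q C1 w sg -> (forall x, 0 <= u x) ->
  \sum_x w x * Htot u x `^ p <= (LamC p q C1 * C1) `^ p * \sum_x u x `^ p * w x.
Proof.
move=> p1 q1 pq C10 dw u0.
have p0 : 0 < p by exact: lt_trans ltr01 p1.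
have q0 : 0 < q by exact: lt_trans ltr01 q1.
have qp : q^-1 + p^-1 = 1 by rewrite addrC.
have w0 := dw_pos dw; have s0 := dw_dual_pos dw.
have H0 x : 0 <= Htot u x by exact: Htot_ge0.
set Z := \sum_x _.
have Z0 : 0 <= Z by apply: sumr_ge0 => x _; rewrite mulr_ge0 ?powR_ge0 // ltW.
have U0 : 0 <= \sum_x u x `^ p * w x.
  by apply: sumr_ge0 => x _; rewrite mulr_ge0 ?powR_ge0 // ltW.
have LC0 : 0 <= LamC p q C1 by rewrite LamC_ge0 // ltW.
apply: (absorb_powR p0 pq) => //; first by rewrite mulr_ge0 // ltW.
pose h x := w x * Htot u x `^ (p - 1).
have h0 x : 0 <= h x by rewrite mulr_ge0 ?powR_ge0 // ltW.
have eZ : Z = Lam b f g u h.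
  rewrite /Z /Lam; transitivity (triple (fun j x y => (4%:R ^+ lv j y)^-1 *
      (av (lv j x) u x * av (lv j y) h y))); last first.
    apply: eq_bigr => j _; apply: eq_bigr => x _; apply: eq_bigr => y _; by rewrite mulrA.
  rewrite (triple_Fs u (fun j y => av (lv j y) h y)).
  rewrite (eq_bigr (fun j : 'I_N => \sum_(y | cr j y) h y * Fs u j y)); last first.
    move=> j _; rewrite (sum_avM (st j) h (@Fs_st u j)); apply: eq_bigr => y _.
    by rewrite mulrC.
  under [RHS]eq_bigr do rewrite big_mkcond.
  rewrite exchange_big /=; apply: eq_bigr => x _.
  rewrite (powRS p1 (H0 x)) mulrA mulrAC -/(h x) /Htot mulr_sumr; apply: eq_bigr => j _.
  by case: ifP; rewrite ?mulr0.
rewrite [X in X <= _]eZ; apply: le_trans (Lam_bound b f0 g0 p1 q1 pq C10 dw u0 h0) _.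
have ar (A B C E : R) : A * B * C * E = A * (C * (B * E)) by ring.
rewrite ar.
rewrite ler_wpM2l // ler_wpM2l ?powR_ge0 //.
rewrite -[X in X * _](powRKV q0) ?(ltW C10) // -powRM ?powR_ge0 //.
apply: powR_le; first by rewrite invr_ge0 ltW.
  by apply: sumr_ge0 => x _; rewrite mulr_ge0 ?powR_ge0 // ltW.
rewrite /Z mulr_sumr; apply: ler_sum => x _.
rewrite /h powRM ?powR_ge0 ?(ltW (w0 x)) // -powRrM (conj_mulB1 p0 q0 pq).
rewrite (powRS q1 (ltW (w0 x))).
have key : w x `^ (q - 1) * sg x <= C1 `^ q.
  have := powR_le (ltW q0) (mulr_ge0 (powR_ge0 _ _) (powR_ge0 _ _)) (dw_cell_le x p0 q0 dw).
  rewrite powRM ?powR_ge0 // -!powRrM mulVf ?gt_eqF // powRr1 ?(ltW (s0 x)) //.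
  by rewrite [p^-1 * q]mulrC (conj_divr q0 qp).
rewrite [leLHS](_ : _ = (w x * Htot u x `^ p) * (w x `^ (q - 1) * sg x)); last by ring.
by rewrite [leRHS]mulrC ler_wpM2l // mulr_ge0 ?powR_ge0 // ltW.
Qed.

Definition bloomK (p q C1 C2 : R) : R := LamC p q C2 * C2 * (LamC p q C1 * C1).

(** Bloom's iteration: [Htot] acts on $L^p(w)$, multiplication by [nu] leads to the weight [la]
    because [nu ^ p * la <= C2 ^ p * w] on cells, and [Lam] pairs [la] with its dual [mu]. *)
Lemma Sfun_bound (p q C1 C2 : R) (w sg la mu nu u v : cell L -> R) :
  1 < p -> 1 < q -> p^-1 + q^-1 = 1 -> 0 < C1 -> 0 < C2 ->
  dual_weights p q C1 w sg -> dual_weights p q C2 la mu ->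
  (forall x, 0 < nu x) -> (forall x, nu x <= w x `^ p^-1 * mu x `^ q^-1) ->
  (forall x, 0 <= u x) -> (forall x, 0 <= v x) ->
  Sfun nu u v <= bloomK p q C1 C2 *
    ((\sum_x u x `^ p * w x) `^ p^-1 * (\sum_x v x `^ q * mu x) `^ q^-1).
Proof.
move=> p1 q1 pq C10 C20 dw dl nu0 nuw u0 v0.
have p0 : 0 < p by exact: lt_trans ltr01 p1.
have q0 : 0 < q by exact: lt_trans ltr01 q1.
have w0 := dw_pos dw; have l0 := dw_pos dl; have m0 := dw_dual_pos dl.
have H0 x : 0 <= Htot u x by exact: Htot_ge0.
have n0 x : 0 <= nu x * Htot u x by rewrite mulr_ge0 // ltW.
apply: le_trans (Sfun_le nu0 u0 v0) _.
apply: le_trans (Lam_bound b f0 g0 p1 q1 pq C20 dl n0 v0) _.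
set U := \sum_x u x `^ p * w x; set V := (\sum_x v x `^ q * mu x) `^ q^-1.
have U0 : 0 <= U by apply: sumr_ge0 => x _; rewrite mulr_ge0 ?powR_ge0 // ltW.
have V0 : 0 <= V by exact: powR_ge0.
have K0 : 0 <= LamC p q C1 * C1 by rewrite mulr_ge0 ?LamC_ge0 ?(ltW C10).
have h : \sum_x (nu x * Htot u x) `^ p * la x <= (C2 * (LamC p q C1 * C1)) `^ p * U.
  apply: (@le_trans _ _ (C2 `^ p * \sum_x w x * Htot u x `^ p)).
    rewrite mulr_sumr; apply: ler_sum => x _.
    have key : nu x `^ p * la x <= C2 `^ p * w x.
      have h1 := powR_le (ltW p0) (mulr_ge0 (powR_ge0 _ _) (powR_ge0 _ _)) (dw_cell_le x p0 q0 dl).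
      have h2 := powR_le (ltW p0) (ltW (nu0 x)) (nuw x).
      rewrite powRM ?powR_ge0 // (powRVK p0) ?(ltW (w0 x)) // in h2.
      rewrite powRM ?powR_ge0 // (powRVK p0) ?(ltW (l0 x)) // in h1.
      apply: le_trans (ler_wpM2r (ltW (l0 x)) h2) _.
      rewrite [leLHS](_ : _ = (la x * (mu x `^ q^-1) `^ p) * w x); last by ring.
      by rewrite ler_wpM2r ?(ltW (w0 x)).
    rewrite powRM ?(ltW (nu0 x)) // mulrAC mulrA.
    by rewrite ler_wpM2r ?powR_ge0.
  rewrite powRM ?(ltW C20) // -mulrA ler_wpM2l ?powR_ge0 //.
  exact: Htot_bound p1 q1 pq C10 dw u0.
have ar (A B C E F : R) : A * B * C * (E * F) = A * (B * C * E * F) by ring.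
rewrite /bloomK ar; apply: ler_wpM2l; first by rewrite LamC_ge0 // ltW.
have CK0 : 0 <= C2 * (LamC p q C1 * C1) by apply: mulr_ge0 => //; exact: ltW.
rewrite ler_wpM2r // -[X in X * _](powRKV p0 CK0).
rewrite -powRM ?powR_ge0 //; apply: powR_le => //; first by rewrite invr_ge0 ltW.
  by apply: sumr_ge0 => x _; rewrite mulr_ge0 ?powR_ge0 // ltW.
Qed.

End Bloom.

Record discrete_cz (R : realType) L (M Ck : R) (beta : cell L -> cell L -> R) : Prop :=
  DiscreteCZ {
  dcz_l2 : l2_bounded beta M;
  dcz_ker : exists kap, [/\ summable_kernel kap Ck, cancels kap beta &
                            cancels kap (fun x y => beta y x)] }.

(** * Estimates for one matrix on the grid *)

Section CoreTheorems.
Variables (R : realType) (L : nat) (M Ck : R) (beta : cell L -> cell L -> R).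
Hypothesis M0 : 0 <= M.
Hypothesis Ck0 : 0 <= Ck.
Hypothesis cz : discrete_cz M Ck beta.
Implicit Types (f g : cell L -> R).

Definition pospart (t : R) : R := Num.max t 0.

Lemma pospart_ge0 t : 0 <= pospart t.
Proof. by rewrite le_max lexx orbT. Qed.

Lemma pospart_le t : pospart t <= `|t|.
Proof. by rewrite ge_max ler_norm normr_ge0. Qed.

Lemma pospartE t : t = pospart t - pospart (- t).
Proof. by rewrite /pospart; case: (leP t 0) => h; case: (leP (- t) 0) => h'; lra. Qed.

(** Positive and negative parts of both arguments, as sparse domination is proved for nonnegative
    functions. *)
Lemma split_signs (B : (cell L -> R) -> (cell L -> R) -> R) f g (X : R) :
  (forall f f' g, B (fun x => f x - f' x) g = B f g - B f' g) ->
  (forall f g g', B f (fun x => g x - g' x) = B f g - B f g') ->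
  (forall f' g', (forall x, 0 <= f' x <= `|f x|) -> (forall x, 0 <= g' x <= `|g x|) ->
     `|B f' g'| <= X) ->
  `|B f g| <= 4%:R * X.
Proof.
move=> Bl Br h.
have p1 x : 0 <= pospart (f x) <= `|f x| by rewrite pospart_ge0 pospart_le.
have p2 x : 0 <= pospart (- f x) <= `|f x| by rewrite pospart_ge0 -normrN pospart_le.
have p3 x : 0 <= pospart (g x) <= `|g x| by rewrite pospart_ge0 pospart_le.
have p4 x : 0 <= pospart (- g x) <= `|g x| by rewrite pospart_ge0 -normrN pospart_le.
have := h _ _ p1 p3; have := h _ _ p1 p4; have := h _ _ p2 p3; have := h _ _ p2 p4.
have -> : B f g = B (fun x => pospart (f x) - pospart (- f x)) (fun x => pospart (g x) - pospart (- g x)).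
  by congr B; apply/funext => x; exact: pospartE.
rewrite Bl !Br.
set a := B _ _; set b := B _ _; set c := B _ _; set d := B _ _.
move=> h1 h2 h3 h4.
apply: le_trans (ler_normB _ _) _; apply: le_trans (lerD (ler_normB _ _) (ler_normB _ _)) _.
lra.
Qed.

Lemma bilBl f f' g : bil beta (fun x => f x - f' x) g = bil beta f g - bil beta f' g.
Proof.
rewrite /bil -sumrB; apply: eq_bigr => x _; rewrite -sumrB; apply: eq_bigr => y _.
by rewrite mulrBl mulrBl.
Qed.

Lemma bilBr f g g' : bil beta f (fun x => g x - g' x) = bil beta f g - bil beta f g'.
Proof.
rewrite /bil -sumrB; apply: eq_bigr => x _; rewrite -sumrB; apply: eq_bigr => y _.
by rewrite mulrBr mulrBl.
Qed.

Definition lp (p : R) (w f : cell L -> R) : R := (\sum_x `|f x| `^ p * w x) `^ p^-1.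

Lemma le_lp p w f f' : 0 < p -> (forall x, 0 <= w x) -> (forall x, 0 <= f' x <= `|f x|) ->
  (\sum_x f' x `^ p * w x) `^ p^-1 <= lp p w f.
Proof.
move=> p0 w0 h; apply: powR_le; first by rewrite invr_ge0 ltW.
  by apply: sumr_ge0 => x _; rewrite mulr_ge0 ?powR_ge0.
apply: ler_sum => x _; rewrite ler_wpM2r //; have /andP[h1 h2] := h x.
by apply: powR_le => //; exact: ltW.
Qed.

Theorem core_weighted (p q C1 : R) (w sg f g : cell L -> R) :
  1 < p -> 1 < q -> p^-1 + q^-1 = 1 -> 0 < C1 -> dual_weights p q C1 w sg ->
  `|bil beta f g| <= 4%:R * (sparseC Ck M * LamC p q C1 * (lp p w f * lp q sg g)).
Proof.
move=> p1 q1 pq C10 dw; apply: split_signs; [exact: bilBl|exact: bilBr|].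
move=> f' g' hf hg.
have p0 : 0 < p by exact: lt_trans ltr01 p1.
have q0 : 0 < q by exact: lt_trans ltr01 q1.
have f0 x : 0 <= f' x by case/andP: (hf x).
have g0 x : 0 <= g' x by case/andP: (hg x).
have [kap [kapP can canT]] := dcz_ker cz.
(* The generations are built with the multiplier zero, for which [dev] vanishes. *)
apply: le_trans (sparse_form (fun=> 0) f0 g0 kapP Ck0 M0 (dcz_l2 cz) can canT) _.
rewrite -mulrA; apply: ler_wpM2l; first exact: sparseC_ge0.
apply: le_trans (Lam_bound (fun=> 0) f0 g0 p1 q1 pq C10 dw f0 g0) _.
apply: ler_wpM2l; first by rewrite LamC_ge0 // ltW.
apply: ler_pM; [exact: powR_ge0|exact: powR_ge0|apply: le_lp => // x|apply: le_lp => // x].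
  exact: ltW (dw_pos dw x).
exact: ltW (dw_dual_pos dw x).
Qed.

(** [oscC] is [512 * stopA * D]. The term with the deviation on [g] and the one with the difference
    of averages share one [Sfun]. The term with the deviation on [f] is treated with the functions
    and the weights exchanged; passing from [4 ^ - lv y] to [4 ^ - lv x] there costs a factor 4,
    hence 2048. *)
Definition commC (p q C1 C2 : R) : R := sparseC Ck M *
  ((512%:R * stopA R + 320%:R) * bloomK p q C1 C2 + 2048%:R * stopA R * bloomK q p C2 C1).

Lemma bloomK_ge0 (p q C1 C2 : R) : 0 <= C1 -> 0 <= C2 -> 0 <= bloomK p q C1 C2.
Proof. by move=> h1 h2; apply: mulr_ge0; apply: mulr_ge0 => //; exact: LamC_ge0. Qed.

Theorem core_commutator (p q C1 C2 D : R) (w sg la mu nu nv b f g : cell L -> R) :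
  1 < p -> 1 < q -> p^-1 + q^-1 = 1 -> 0 < C1 -> 0 < C2 -> 0 <= D ->
  dual_weights p q C1 w sg -> dual_weights p q C2 la mu ->
  (forall x, 0 < nu x) -> (forall x, 0 < nv x) -> (forall x, 1 <= nu x * nv x) ->
  (forall x, nu x <= w x `^ p^-1 * mu x `^ q^-1) -> bmo_cells D nv b ->
  `|bil beta f (fun y => b y * g y) - bil beta (fun x => b x * f x) g| <=
    4%:R * (commC p q C1 C2 * D * (lp p w f * lp q mu g)).
Proof.
move=> p1 q1 pq C10 C20 D0 dw dl nu0 nv0 nuv nuw bmo.
pose B f g := bil beta f (fun y => b y * g y) - bil beta (fun x => b x * f x) g.
apply: (@split_signs B) => [f1 f2 g1|f1 g1 g2|].
- rewrite /B bilBl.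
  rewrite (_ : (fun x => b x * (f1 x - f2 x)) = (fun x => b x * f1 x - b x * f2 x)); last first.
    by apply/funext => x; rewrite mulrBr.
  by rewrite bilBl; ring.
- rewrite /B bilBr.
  rewrite (_ : (fun x => b x * (g1 x - g2 x)) = (fun x => b x * g1 x - b x * g2 x)); last first.
    by apply/funext => x; rewrite mulrBr.
  by rewrite bilBr; ring.
move=> f' g' hf hg.
have p0 : 0 < p by exact: lt_trans ltr01 p1.
have q0 : 0 < q by exact: lt_trans ltr01 q1.
have qp : q^-1 + p^-1 = 1 by rewrite addrC.
have f0 x : 0 <= f' x by case/andP: (hf x).
have g0 x : 0 <= g' x by case/andP: (hg x).
have [kap [kapP can canT]] := dcz_ker cz.
have -> : B f' g' = \sum_x \sum_y (b y - b x) * (f' x * g' y * beta x y).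
  rewrite /B /bil -sumrB; apply: eq_bigr => x _; rewrite -sumrB; apply: eq_bigr => y _.
  by ring.
apply: le_trans (sparse_commutator b f0 g0 kapP Ck0 M0 (dcz_l2 cz) can canT) _.
rewrite /commC -!(mulrA (sparseC Ck M)); apply: ler_wpM2l; first exact: sparseC_ge0.
set F := lp p w f; set G := lp q mu g.
have hF : (\sum_x f' x `^ p * w x) `^ p^-1 <= F.
  by apply: le_lp => // x; apply: ltW; exact: dw_pos dw x.
have hG : (\sum_x g' x `^ q * mu x) `^ q^-1 <= G.
  by apply: le_lp => // x; apply: ltW; exact: dw_dual_pos dl x.
have nuw' x : nu x <= mu x `^ q^-1 * w x `^ p^-1 by rewrite mulrC.
have S1 := Sfun_bound b f0 g0 p1 q1 pq C10 C20 dw dl nu0 nuw f0 g0.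
have S2 := Sfun_bound b f0 g0 q1 p1 qp C20 C10 (dual_weights_sym dl) (dual_weights_sym dw)
  nu0 nuw' g0 f0.
have T1 := T1_le f0 g0 D0 nu0 nv0 nuv bmo f0 g0.
have T2 := T1_le f0 g0 D0 nu0 nv0 nuv bmo g0 f0.
have T3 := T3_le f0 g0 D0 nu0 nv0 nuv bmo f0 g0.
have K1 : 0 <= bloomK p q C1 C2 by apply: bloomK_ge0; exact: ltW.
have K2 : 0 <= bloomK q p C2 C1 by apply: bloomK_ge0; exact: ltW.
have O0 := oscC_ge0 D0.
have {}S1 : Sfun b f' g' nu f' g' <= bloomK p q C1 C2 * (F * G).
  by apply: le_trans S1 _; apply: (ler_wpM2l K1); apply: ler_pM; [exact: powR_ge0|exact: powR_ge0| |].
have {}S2 : Sfun b f' g' nu g' f' <= bloomK q p C2 C1 * (F * G).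
  by apply: le_trans S2 _; apply: (ler_wpM2l K2); rewrite [leLHS]mulrC; apply: ler_pM; [exact: powR_ge0|exact: powR_ge0| |].
have {}T1 := le_trans T1 (ler_wpM2l O0 S1).
have {}T2 := le_trans T2 (ler_wpM2l O0 S2).
have D320 := mulr_ge0 (ler0n R 320) D0.
have {}T3 := le_trans T3 (ler_wpM2l D320 S1).
set t1 := triple _ _ _ _ in T1; set t2 := triple _ _ _ _ in T2; set t3 := triple _ _ _ _ in T3.
apply: (@le_trans _ _ (t1 + 4%:R * t2 + t3)).
  rewrite /t2 triple_sym /t1 /t3 /triple mulr_sumr -!big_split /=; apply: ler_sum => j _.
  rewrite mulr_sumr -!big_split /=; apply: ler_sum => x cx.
  rewrite mulr_sumr -!big_split /=; apply: ler_sum => y nxy.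
  rewrite !mulrDr; apply: lerD => //; rewrite lerD2l.
  have ar (x1 x2 x3 x4 : R) : x1 <= 4%:R * x2 -> 0 <= x3 -> 0 <= x4 ->
      x1 * (x3 * x4) <= 4%:R * (x2 * (x4 * x3)).
    by move=> h h3 h4; have := ler_wpM2r (mulr_ge0 h3 h4) h; lra.
  apply: ar.
  - rewrite -[X in X * _]invrK -invfM lef_pV2 ?posrE ?pow4_gt0 ?mulr_gt0 ?invr_gt0 ?pow4_gt0 //.
    rewrite mulrC ler_pdivrMr // -exprSr ler_weXn2l ?ler1n //.
    by apply: near_lev; rewrite nearC.
  - by apply: av_ge0 => z; apply: mulr_ge0 => //; exact: normr_ge0.
  - exact: av_ge0.
apply: le_trans (lerD (lerD T1 (ler_wpM2l _ T2)) T3) _ => //.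
rewrite le_eqVlt; apply/orP; left; apply/eqP; rewrite /oscC.
clearbody F G; move: (stopA R) (bloomK p q C1 C2) (bloomK q p C2 C1) => s k1 k2; ring.
Qed.

(** Calderon--Zygmund decomposition at height [t]. [U] is the enlarged set of large averages; tested
    on [V] off [U] the bad part is handled by cancellation, the good part, of size at most [4 * t],
    by the l2 bound. The hypothesis on the top average serves the case that the Whitney block is the
    whole grid and has no parent. *)
Theorem core_weak (t : R) f : 0 < t -> (forall x, av L (fun y => `|f y|) x <= t) ->
  exists U : pred (cell L), \sum_(x | U x) (1 : R) <= 25%:R * (\sum_x `|f x|) / t /\
    forall (V : pred (cell L)) (s : R), (forall x, V x -> ~~ U x) -> 0 < s ->
      `|bil beta f (fun y => (V y)%:R)| <= 2%:R * Ck * (\sum_x `|f x|) +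
        M * (s * (4%:R * t * \sum_x `|f x|) + s^-1 * \sum_(y | V y) 1).
Proof.
move=> t0 ft; pose F x := `|f x|.
have F0 x : 0 <= F x by exact: normr_ge0.
pose O : pred (cell L) := overnb t F; exists O.
split; first exact: weak_maximal.
move=> V s VO s0; have [kap [kapP can canT]] := dcz_ker cz.
have nov k x : (k <= L)%N -> ~~ inside O k x -> av k F x <= t.
  move=> kL; rewrite leNgt; apply: contra => h; apply/insideP => y n.
  by apply/existsP; exists x; apply/existsP; exists (Ordinal (kL : (k < L.+1)%N)); rewrite /overlev h.
have pF x : proj (core O) (lev O) F x <= 4%:R * t.
  rewrite /proj; case: ifPn => cx; last first.
    by rewrite -[leLHS]av0; apply: (le_trans (nov 0%N x _ cx)) => //; lra.
  have := lev_le O x; rewrite leq_eqVlt => /orP[/eqP ->|lL].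
    by apply: (le_trans (ft x)); lra.
  apply: (le_trans (av_mono _ _ F0)); rewrite ler_wpM2l // nov //.
  by apply/negP => /(le_lev lL); rewrite ltnn.
have st := core_stopping O.
pose P := proj (core O) (lev O) f.
rewrite (_ : bil beta f (fun y => (V y)%:R) = bil beta P (fun y => (V y)%:R) +
   \sum_x \sum_(y | core O x && V y) osc O f x * 1 * beta x y); last first.
  rewrite /bil -big_split; apply: eq_bigr => x _.
  rewrite [X in _ = _ + X]big_mkcond -big_split; apply: eq_bigr => y _ /=.
  rewrite /osc -/P; case: (boolP (core O x)) => cx /=; last by rewrite /P /proj (negbTE cx) addr0.
  by case: (V y) => /=; ring.
apply: (le_trans (ler_normD _ _)); rewrite addrC; apply: lerD.
  have := @cancel_sum _ _ _ O beta f (fun=> 1) (fun x y => core O x && V y) Ck can Ck0.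
  move=> h; apply: (le_trans (h _ _ _ _)).
  - by move=> x y /andP[].
  - move=> x y /andP[cx Vy] _; apply/negP => n; have := VO y Vy; apply/negP/negPn.
    have /insideP := inside_lev cx; apply; exact: nb_leq n.
  - by move=> x x' y cx n; rewrite cx (stopping_congr st cx n).1.
  - move=> x cx; apply: le_trans (kap_sum kapP x (lev_le O x)).
    rewrite (eq_bigr (kap (lev O x) x)) => [|y _]; last by rewrite normr1 mul1r.
    by apply: sum_sub_le => [y|y /andP[]//]; exact: (kap_ge0 kapP).
  by rewrite mulrCA mulrA.
apply: le_trans (dcz_l2 cz _ _ s0) _; rewrite ler_wpM2l // lerD //.
  rewrite ler_wpM2l ?(ltW s0) //.
  apply: (@le_trans _ _ (\sum_x 4%:R * t * proj (core O) (lev O) F x)).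
    apply: ler_sum => x _; rewrite -real_normK ?num_real // expr2.
    have h : `|P x| <= proj (core O) (lev O) F x by exact: ler_norm_proj.
    by apply: ler_pM => //; exact: le_trans h (pF x).
  by rewrite -mulr_sumr sum_proj.
rewrite ler_wpM2l ?invr_ge0 ?(ltW s0) // [leRHS]big_mkcond; apply: ler_sum => y _.
by case: (V y); rewrite ?expr1n ?expr0n.
Qed.

End CoreTheorems.

(** * Real integrable and square integrable functions *)

Section RealL2.
Context d (X : measurableType d) (R : realType) (mu : {measure set X -> \bar R}).
Implicit Types (u v h : X -> R) (A : set X).

Definition rint u : Prop := mu.-integrable setT (EFin \o u).

Definition L2 u : Prop := measurable_fun setT u /\ rint (fun x => u x ^+ 2).

Definition pr u v : R := \int[mu]_x (u x * v x).

Definition nsq u : R := \int[mu]_x (u x ^+ 2).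

Lemma rint_meas u : rint u -> measurable_fun setT u.
Proof. by move=> /measurable_int /measurable_EFinP. Qed.

Lemma rint_le u v : measurable_fun setT u -> (forall x, `|u x| <= `|v x|) -> rint v -> rint u.
Proof.
move=> mu_ h iv; apply: (le_integrable measurableT _ _ iv); first exact/measurable_EFinP.
by move=> x _ /=; rewrite lee_fin.
Qed.

Lemma rintD u v : rint u -> rint v -> rint (fun x => u x + v x).
Proof. by move=> iu iv; have := integrableD measurableT iu iv. Qed.

Lemma rintB u v : rint u -> rint v -> rint (fun x => u x - v x).
Proof. by move=> iu iv; have := integrableB measurableT iu iv. Qed.

Lemma rintZ (c : R) u : rint u -> rint (fun x => c * u x).
Proof. by move=> iu; have := integrableZl measurableT c iu. Qed.

Lemma rint_norm u : rint u -> rint (fun x => `|u x|).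
Proof. by move=> iu; exact: integrable_norm iu. Qed.

Lemma rint_sum (I : finType) (F : I -> X -> R) : (forall i, rint (F i)) ->
  rint (fun x => \sum_i F i x).
Proof.
move=> h; have := integrable_sum measurableT (index_enum I) (P := xpredT) (fun i _ => h i).
by apply: eq_integrable => // x _ /=; rewrite sumEFin.
Qed.

Lemma rint_ext u v : (forall x, u x = v x) -> rint u -> rint v.
Proof. by move=> /funext ->. Qed.

Lemma rintE u : rint u -> (\int[mu]_x u x)%:E = (\int[mu]_x (u x)%:E)%E.
Proof. by move=> iu; rewrite /Rintegral fineK //; exact: integrable_fin_num iu. Qed.

Lemma RintD u v : rint u -> rint v ->
  \int[mu]_x (u x + v x) = \int[mu]_x u x + \int[mu]_x v x.
Proof. exact: RintegralD. Qed.

Lemma RintB u v : rint u -> rint v ->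
  \int[mu]_x (u x - v x) = \int[mu]_x u x - \int[mu]_x v x.
Proof. exact: RintegralB. Qed.

Lemma RintZ (c : R) u : rint u -> \int[mu]_x (c * u x) = c * \int[mu]_x u x.
Proof. exact: RintegralZl. Qed.

Lemma Rint_le u v : rint u -> rint v -> (forall x, u x <= v x) ->
  \int[mu]_x u x <= \int[mu]_x v x.
Proof. by move=> iu iv h; apply: le_Rintegral. Qed.

Lemma Rint_norm u : rint u -> `|\int[mu]_x u x| <= \int[mu]_x `|u x|.
Proof. exact: le_normr_Rintegral. Qed.

Lemma Rint_ge0 u : (forall x, 0 <= u x) -> 0 <= \int[mu]_x u x.
Proof. by move=> h; apply: Rintegral_ge0. Qed.

Lemma Rint_sum (I : finType) (F : I -> X -> R) : (forall i, rint (F i)) ->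
  \int[mu]_x (\sum_i F i x) = \sum_i \int[mu]_x F i x.
Proof.
move=> h; elim: (index_enum I) => [|i s ih].
  under eq_Rintegral do rewrite big_nil.
  by rewrite Rintegral_cst // mul0r big_nil.
under eq_Rintegral do rewrite big_cons.
rewrite RintD // ?ih ?big_cons //.
have := integrable_sum measurableT s (P := xpredT) (fun i _ => h i).
by apply: eq_integrable => // x _ /=; rewrite sumEFin.
Qed.

Lemma Rint_ae u v : measurable_fun setT u -> measurable_fun setT v ->
  {ae mu, forall x, u x = v x} -> \int[mu]_x u x = \int[mu]_x v x.
Proof.
move=> mu_ mv uv; congr fine; apply: ae_eq_integral => //; [exact/measurable_EFinP..|].
by apply: filterS uv => x uv _; rewrite uv.
Qed.

Lemma rint_ae u v : measurable_fun setT u -> measurable_fun setT v ->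
  {ae mu, forall x, u x = v x} -> rint u -> rint v.
Proof.
move=> mu_ mv uv /integrableP[_ iu]; apply/integrableP; split; first exact/measurable_EFinP.
rewrite (ae_eq_integral (fun x => `|(EFin \o u) x|)%E) //.
- by apply: measurableT_comp => //; exact/measurable_EFinP.
- by apply: measurableT_comp => //; exact/measurable_EFinP.
- by apply: filterS uv => x /= -> _.
Qed.

Lemma rint_indic A : measurable A -> (mu A < +oo)%E -> rint \1_A.
Proof.
move=> mA fA; apply/integrableP; split; first exact/measurable_EFinP/measurable_indic.
under eq_integral do rewrite /= ger0_norm ?indicE ?ler0n // -indicE.
by rewrite integral_indic // setIT.
Qed.

Lemma rint_bounded A u (M : R) : measurable A -> (mu A < +oo)%E -> measurable_fun setT u ->
  (forall x, `|u x| <= M * \1_A x) -> rint u.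
Proof.
move=> mA fA mu_ h; apply: (@rint_le _ (fun x => M * \1_A x)) => //.
  by move=> x; apply: le_trans (h x) (ler_norm _).
by apply: rintZ; exact: rint_indic.
Qed.

Lemma rint_mul_indic A u : measurable A -> rint u -> rint (fun x => u x * \1_A x).
Proof.
move=> mA iu; apply: (rint_le _ _ iu).
  by apply: measurable_funM (rint_meas iu) _; exact: measurable_indic.
by move=> x; rewrite indicE; case: (x \in A); rewrite ?mulr1 // mulr0 normr0.
Qed.

Lemma meas_mul u v : measurable_fun setT u -> measurable_fun setT v ->
  measurable_fun setT (fun x => u x * v x).
Proof. exact: measurable_funM. Qed.

Lemma L2_bounded A u (M : R) : measurable A -> (mu A < +oo)%E -> measurable_fun setT u ->
  (forall x, `|u x| <= M * \1_A x) -> L2 u.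
Proof.
move=> mA fA mu_ h; split => //; apply: (@rint_bounded A _ (M ^+ 2)) => //.
  by apply: measurable_funX.
move=> x; have := h x; rewrite indicE normrX; case: (x \in A); rewrite ?mulr1 ?mulr0.
  by move=> hx; rewrite ler_sqr ?nnegrE // (le_trans _ hx).
by rewrite normr_le0 => /eqP ->; rewrite normr0 expr0n.
Qed.

Lemma L2_mul u v : L2 u -> L2 v -> rint (fun x => u x * v x).
Proof.
move=> [mu_ iu] [mv iv]; apply: (rint_le _ _ (rintD iu iv)); first exact: meas_mul.
move=> x; rewrite [leRHS]ger0_norm ?addr_ge0 ?sqr_ge0 // normrM.
have := sqr_ge0 (`|u x| - `|v x|); rewrite -[u x ^+ 2]real_normK ?num_real //.
by rewrite -[v x ^+ 2]real_normK ?num_real //; nra.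
Qed.

Lemma L2D u v : L2 u -> L2 v -> L2 (fun x => u x + v x).
Proof.
move=> Lu Lv; have [mu_ iu] := Lu; have [mv iv] := Lv; split; first exact: measurable_funD.
apply: rint_ext (rintD (rintD iu iv) (rintZ 2%:R (L2_mul Lu Lv))) => x; ring.
Qed.

Lemma L2Z (c : R) u : L2 u -> L2 (fun x => c * u x).
Proof.
move=> [mu_ iu]; split; first exact: measurable_funM.
by apply: rint_ext (rintZ (c ^+ 2) iu) => x; ring.
Qed.

Lemma L2B u v : L2 u -> L2 v -> L2 (fun x => u x - v x).
Proof.
move=> Lu Lv; have := L2D Lu (L2Z (-1) Lv); congr L2; apply/funext => x; ring.
Qed.

Lemma nsq_ge0 u : 0 <= nsq u.
Proof. by apply: Rint_ge0 => x; exact: sqr_ge0. Qed.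

Lemma prDl u v h : L2 u -> L2 v -> L2 h -> pr (fun x => u x + v x) h = pr u h + pr v h.
Proof.
move=> Lu Lv Lh; rewrite /pr -RintD; [|exact: L2_mul..].
by apply: eq_Rintegral => x _; rewrite mulrDl.
Qed.

Lemma prZl (c : R) u h : L2 u -> L2 h -> pr (fun x => c * u x) h = c * pr u h.
Proof.
move=> Lu Lh; rewrite /pr -RintZ; last exact: L2_mul.
by apply: eq_Rintegral => x _; rewrite mulrA.
Qed.

Lemma prC u v : pr u v = pr v u.
Proof. by apply: eq_Rintegral => x _; rewrite mulrC. Qed.

Lemma prBl u v h : L2 u -> L2 v -> L2 h -> pr (fun x => u x - v x) h = pr u h - pr v h.
Proof.
move=> Lu Lv Lh; rewrite /pr -RintB; [|exact: L2_mul..].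
by apply: eq_Rintegral => x _; rewrite mulrBl.
Qed.

Lemma pr_ae u v h : measurable_fun setT u -> measurable_fun setT v -> measurable_fun setT h ->
  {ae mu, forall x, u x = v x} -> pr u h = pr v h.
Proof.
move=> mu_ mv mh uv; apply: Rint_ae; [exact: meas_mul..|].
by apply: filterS uv => x ->.
Qed.

Lemma pr_le (s : R) u v : 0 < s -> L2 u -> L2 v ->
  `|pr u v| <= (s * nsq u + s^-1 * nsq v) / 2%:R.
Proof.
move=> s0 Lu Lv; have iuv := L2_mul Lu Lv.
apply: le_trans (Rint_norm iuv) _.
rewrite /nsq -!RintZ; [|exact: Lv.2|exact: Lu.2].
have i1 := rintZ s Lu.2; have i2 := rintZ s^-1 Lv.2.
rewrite -RintD // mulrC -RintZ; last exact: rintD.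
apply: Rint_le; [exact: rint_norm|by apply: rintZ; exact: rintD|] => x.
rewrite normrM -[u x ^+ 2]real_normK ?num_real // -[v x ^+ 2]real_normK ?num_real //.
set a := `|u x|; set b := `|v x|.
rewrite -(@ler_pM2l R 2) // mulVKf // -subr_ge0.
have -> : s * a ^+ 2 + s^-1 * b ^+ 2 - 2 * (a * b) = s * (a - s^-1 * b) ^+ 2.
  by field; rewrite gt_eqF.
by rewrite mulr_ge0 ?sqr_ge0 // ltW.
Qed.

Lemma measE u : measurable_fun setT u -> measurable_fun setT (fun x => (u x)%:E).
Proof. by move=> ?; exact/measurable_EFinP. Qed.

Lemma measurable_gt (t : R) u : measurable_fun setT u -> measurable [set x | t < u x].
Proof.
move=> mu_; have := mu_ measurableT `]t, +oo[%classic (measurable_itv _).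
by rewrite setTI; congr measurable; apply/seteqP; split => x /=; rewrite in_itv /= andbT.
Qed.

Lemma markov1 (t : R) u : 0 < t -> rint u ->
  (t%:E * mu [set x | (t < `|u x|)%R] <= (\int[mu]_x `|u x|)%:E)%E.
Proof.
move=> t0 iu; have mu_ := rint_meas iu.
have mn : measurable_fun setT (fun x => `|u x|) by apply: measurableT_comp.
have mA := measurable_gt t mn.
rewrite rintE; last exact: rint_norm.
rewrite -[X in mu X]setIT -integral_indic // -ge0_integralZl //; last first.
- by rewrite lee_fin ltW.
- by apply: measE; exact: measurable_indic.
apply: ge0_le_integral => //.
- by move=> x _; rewrite mule_ge0 // lee_fin // ltW.
- by apply: measurable_funeM; apply: measE; exact: measurable_indic.
- exact: measE.
move=> x _; rewrite -EFinM lee_fin indicE; case: (boolP (x \in _)) => [|_]; last by rewrite mulr0.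
by rewrite inE /= mulr1 => /ltW.
Qed.

Lemma borel_cantelli (u : (X -> R)^nat) (C : R) : (forall k, measurable_fun setT (u k)) ->
  (forall k, (mu [set x | ((2^-1) ^+ k < `|u k x|)%R] <= (C * (2^-1) ^+ k)%:E)%E) ->
  {ae mu, forall x, exists K, forall k, (K <= k)%N -> `|u k x| <= (2^-1) ^+ k}.
Proof.
move=> mu_ h; pose A k := [set x | (2^-1) ^+ k < `|u k x|].
have mA k : measurable (A k).
  by apply: (measurable_gt _ (u := fun x => `|u k x|)); exact: measurableT_comp.
have C0 : 0 <= C.
  by have := le_trans (measure_ge0 mu _) (h 0%N); rewrite lee_fin expr0 mulr1.
have A0 : mu (lim_sup_set A) = 0%E.
  apply: lim_sup_set_cvg0 => //.
  apply: (@le_lt_trans _ _ (\sum_(k <oo) (C * (2^-1) ^+ k)%:E)%E).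
    by apply: lee_nneseries => k *; [exact: measure_ge0|exact: h].
  rewrite (_ : (fun n => _) = eseries (fun k : nat => (2 * C / (2 ^ (k + 1))%:R)%:E)); last first.
    apply/funext => n; apply: eq_bigr => k _; congr EFin.
    by rewrite natrX addn1 exprS exprVn; field; rewrite expf_neq0.
  by rewrite (cvg_lim _ (@cvg_geometric_eseries_half R (2 * C) 0)) // ltry.
exists (lim_sup_set A); split => //.
  by apply: bigcap_measurable => // n _; apply: bigcup_measurable.
move=> x /= nx n _; apply: contrapT => hn; apply: nx.
exists n => k /= nk; rewrite leNgt; apply/negP => lt.
by apply: hn; exists k.
Qed.

(** Markov's inequality at height [2 ^ -k] leaves sets of measure at most [2 ^ -k], which are
    summable. *)
Lemma ae_cvg_of_L1 (u : (X -> R)^nat) v : (forall k, rint (u k)) -> rint v ->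
  (forall k, \int[mu]_x `|u k x - v x| <= (4^-1) ^+ k) ->
  {ae mu, forall x, u ^~ x @ \oo --> v x}.
Proof.
move=> iu iv h.
have iw k := rintB (iu k) iv.
have p0 k : 0 < (2^-1 : R) ^+ k by rewrite exprn_gt0 ?invr_gt0.
apply: filterS (borel_cantelli (u := fun k x => u k x - v x) (C := 1) _ _); last first.
- move=> k; rewrite mul1r -(@lee_pmul2l _ ((2^-1) ^+ k)%:E) ?lte_fin //.
  apply: le_trans (markov1 (p0 k) (iw k)) _; rewrite -EFinM lee_fin.
  by rewrite -exprMn (_ : 2^-1 * 2^-1 = 4^-1 :> R) ?h //; field.
- by move=> k; exact: rint_meas.
move=> x [K hK]; apply/cvgrPdist_le => e e0.
have /cvgrPdist_le/(_ e e0) [K' _ hK'] := @cvg_geometric R 1 2^-1 ltac:(by rewrite ger0_norm ?invr_ge0 // invf_lt1 // ltr1n).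
exists (maxn K K') => // k /=; rewrite geq_max => /andP[k1 k2].
rewrite distrC; apply: le_trans (hK _ k1) _.
by have := hK' k k2; rewrite sub0r normrN /= mul1r ger0_norm ?(ltW (p0 k)).
Qed.

Lemma dct (u : (X -> R)^nat) v G : (forall k, measurable_fun setT (u k)) -> measurable_fun setT v ->
  {ae mu, forall x, u ^~ x @ \oo --> v x} -> rint G ->
  (forall k x, `|u k x| <= G x) ->
  [/\ rint v & (\int[mu]_x u k x) @[k --> \oo] --> \int[mu]_x v x].
Proof.
move=> mu_ mv uv iG h.
have cv : {ae mu, forall x, setT x -> (fun k => (u k x)%:E) @ \oo --> (v x)%:E}.
  by apply: filterS uv => x hx _; apply: cvg_EFin => //; apply: nearW.
have [i1 i2 i3] := @dominated_convergence _ _ _ mu setT measurableT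
  (fun k x => (u k x)%:E) (fun x => (v x)%:E) (fun x => (G x)%:E)
  (fun k => measE (mu_ k)) (measE mv) cv iG (aeW _ (fun x k _ => h k x)).
split => //; apply: fine_cvg.
by move: i3; rewrite -(rintE i1).
Qed.

(** Fatou's lemma under the one-sided hypothesis that [v] is at most the lower limit; indicators of
    level sets satisfy no more than that. *)
Lemma fatou_bound (u : (X -> R)^nat) v (C : \bar R) : (forall k, measurable_fun setT (u k)) ->
  measurable_fun setT v -> (forall k x, 0 <= u k x) -> (forall x, 0 <= v x) ->
  {ae mu, forall x, forall e, 0 < e -> \forall k \near \oo, v x <= u k x + e} ->
  (forall k, (\int[mu]_x (u k x)%:E <= C)%E) -> (\int[mu]_x (v x)%:E <= C)%E.
Proof.
move=> mu_ mv u0 v0 uv h.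
have lb (c : \bar R) K (a : (\bar R)^nat) : (forall k, (K <= k)%N -> (c <= a k)%E) ->
    (c <= limn_einf a)%E.
  move=> ha; rewrite limn_einf_lim; apply: lime_ge; first exact: is_cvg_einfs.
  exists K => // k /= Kk; apply: le_ereal_inf_tmp => _ [j /= kj <-].
  by apply: ha; exact: leq_trans kj.
have ml : measurable_fun setT (fun x => limn_einf (fun k => (u k x)%:E)).
  rewrite (_ : (fun x => _) = (fun x => - limn_esup (fun k => (- u k x)%:E))%E); last first.
    by apply/funext => x; rewrite -limn_einfN; congr limn_einf; apply/funext => k /=; rewrite opprK.
  apply: measurableT_comp => //; apply: measurable_fun_limn_esup => k.
  by apply: measE; exact: measurableT_comp.
apply: (@le_trans _ _ (\int[mu]_x limn_einf (fun k => (u k x)%:E))%E).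
  apply: ae_ge0_le_integral => //.
  - by move=> x _; rewrite lee_fin.
  - exact: measE.
  - by move=> x _; apply: (lb _ 0%N) => k _; rewrite lee_fin.
  apply: filterS uv => x hx _; apply/lee_addgt0Pr => e e0.
  have [K _ hK] := hx e e0.
  rewrite -leeBlDr //; apply: (lb _ K) => k Kk.
  by rewrite leeBlDr // lee_fin hK.
have F : (\int[mu]_x limn_einf (fun k => (u k x)%:E) <=
    limn_einf (fun k => \int[mu]_x (u k x)%:E))%E.
  apply: fatou => // k; first exact: measE.
  by move=> x _; rewrite lee_fin.
apply: le_trans F _.
rewrite limn_einf_lim; apply: lime_le; first exact: is_cvg_einfs.
apply: nearW => k; apply: le_trans (h k).
by apply: ereal_inf_lbound; exists k => /=.
Qed.

Lemma fatou_cvg (u : (X -> R)^nat) v (C : \bar R) : (forall k, measurable_fun setT (u k)) ->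
  measurable_fun setT v -> (forall k x, 0 <= u k x) -> (forall x, 0 <= v x) ->
  {ae mu, forall x, u ^~ x @ \oo --> v x} ->
  (forall k, (\int[mu]_x (u k x)%:E <= C)%E) -> (\int[mu]_x (v x)%:E <= C)%E.
Proof.
move=> mu_ mv u0 v0 uv; apply: fatou_bound => //; apply: filterS uv => x hx e e0.
have /cvgrPdist_le/(_ _ e0) := hx; apply: filterS => k.
by move=> /(le_trans (ler_norm _)); rewrite lerBlDl.
Qed.

Lemma ae_cvg_of_L2 (u : (X -> R)^nat) v : (forall k, L2 (u k)) -> L2 v ->
  nsq (fun x => u k x - v x) @[k --> \oo] --> (0 : R) ->
  exists N : nat -> nat, {ae mu, forall x, u (N k) x @[k --> \oo] --> v x}.
Proof.
move=> Lu Lv /cvgrPdist_le cv.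
have p0 k : 0 < (4^-1 : R) ^+ k by rewrite exprn_gt0 // invr_gt0.
have /boolp.choice[N hN] k : exists n, nsq (fun x => u n x - v x) <= (4^-1) ^+ k.
  have [n _ hn] := cv _ (p0 k); exists n.
  by have /= := hn n (leqnn n); rewrite sub0r normrN => /(le_trans (ler_norm _)).
have LB k := L2B (Lu (N k)) Lv.
have i0 : rint (fun=> 0 : R).
  by apply: rint_ext (rintZ 0 Lv.2) => x; rewrite mul0r.
exists N; apply: filterS (@ae_cvg_of_L1 (fun k x => (u (N k) x - v x) ^+ 2) (fun=> 0) _ i0 _).
- move=> x /cvgrPdist_le h; apply/cvgrPdist_le => e e0.
  have := h _ (exprn_gt0 2 e0); apply: filterS => k.
  rewrite sub0r normrN ger0_norm ?sqr_ge0 // -[_ ^+ 2 <= _]ler_sqrt ?exprn_ge0 ?(ltW e0) //.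
  by rewrite !sqrtr_sqr distrC [`|e|]ger0_norm ?(ltW e0).
- by move=> k; case: (LB k).
move=> k; have := hN k; rewrite /nsq; congr (_ <= _); apply: eq_Rintegral => x _.
by rewrite subr0 ger0_norm // sqr_ge0.
Qed.
End RealL2.

(** * Grids of cells in a square and step functions *)

Section Squares.
Variable R : realType.
Local Notation mu := (@leb2 R).
Implicit Types (a z : R * R) (l s : R).

Lemma squareP a l z :
  square a l z <-> [/\ a.1 <= z.1, z.1 < a.1 + l, a.2 <= z.2 & z.2 < a.2 + l].
Proof.
rewrite /square /= !in_itv /=; split; first by move=> [/andP[? ?] /andP[? ?]].
by move=> [-> -> -> ->].
Qed.

Lemma square_sub a l b m : b.1 <= a.1 -> a.1 + l <= b.1 + m -> b.2 <= a.2 ->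
  a.2 + l <= b.2 + m -> square a l `<=` square b m.
Proof.
by move=> h1 h2 h3 h4 z /squareP[? ? ? ?]; apply/squareP; split; lra.
Qed.

Lemma measurable_square a l : measurable (square a l : set (borel2 R)).
Proof. by apply: measurableX; exact: measurable_itv. Qed.

Lemma leb2_rect t l u m : 0 <= l -> 0 <= m ->
  mu (`[t, t + l[%classic `*` `[u, u + m[%classic) = (l * m)%:E.
Proof.
move=> l0 m0; rewrite /leb2 product_measure1E; [|exact: measurable_itv..].
have lc (v n : R) : 0 <= n -> (@lebesgue_measure R `[v, (v + n)%R[%classic = n%:E)%E.
  move=> n0; rewrite lebesgue_measure_itv /= lte_fin ltrDl.
  case: ltP => [_|hn]; last by congr EFin; apply: le_anti; rewrite hn n0.
  by rewrite -EFinD; congr EFin; ring.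
by rewrite [X in (X * _)%E]lc // [X in (_ * X)%E]lc // -EFinM.
Qed.

Lemma leb2_square a l : 0 <= l -> mu (square a l) = (l ^+ 2)%:E.
Proof. by move=> l0; rewrite expr2; exact: leb2_rect. Qed.

Lemma leb2_square_fin a l : (mu (square a l) < +oo)%E.
Proof.
have [l0|l0] := leP 0 l; first by rewrite leb2_square // ltry.
rewrite (_ : square a l = set0) ?measure0 ?ltry //.
by apply/seteqP; split => // z /squareP[? ? _ _]; lra.
Qed.

Lemma rint_square a l : rint mu \1_(square a l).
Proof. by apply: rint_indic; [exact: measurable_square|exact: leb2_square_fin]. Qed.

Lemma Rint_square a l : 0 <= l -> \int[mu]_z (\1_(square a l) z : R) = l ^+ 2.
Proof.
move=> l0; rewrite /Rintegral (integral_indic mu measurableT (@measurable_square a l)) setIT.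
exact: (congr1 fine (leb2_square a l0)).
Qed.

Definition gcell L a s (x : cell L) : set (R * R) :=
  square (a.1 + s * (x.1)%:R, a.2 + s * (x.2)%:R) s.

Section Grid.
Variables (L : nat) (a : R * R) (s : R).
Hypothesis s0 : 0 < s.
Implicit Types (x y : cell L) (c : cell L -> R).
Local Notation G := (gcell a s).

Let coordP (t u : R) (n : nat) : (t + s * n%:R <= u < t + s * n%:R + s) ->
  Num.truncn ((u - t) / s) = n.
Proof.
move=> /andP[h1 h2]; apply: truncn_def; rewrite ler_pdivlMr // ltr_pdivrMr //.
by rewrite -natr1; apply/andP; split; lra.
Qed.

Lemma gcell_inj x y z : G x z -> G y z -> x = y.
Proof.
move=> /squareP/=[h1 h2 h3 h4] /squareP/=[h5 h6 h7 h8].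
have e n m : n%:R = m%:R :> R -> n = m by move/eqP; rewrite eqr_nat => /eqP.
case: x y h1 h2 h3 h4 h5 h6 h7 h8 => x1 x2 [y1 y2] /= h1 h2 h3 h4 h5 h6 h7 h8.
congr pair; apply: val_inj => /=.
  by rewrite -(@coordP a.1 z.1 x1) ?h1 // -(@coordP a.1 z.1 y1) ?h5.
by rewrite -(@coordP a.2 z.2 x2) ?h3 // -(@coordP a.2 z.2 y2) ?h7.
Qed.

Let locate1 (t u : R) : t <= u -> u < t + s * (2 ^ L)%:R ->
  exists n : 'I_(2 ^ L), t + s * n%:R <= u < t + s * n%:R + s.
Proof.
move=> h1 h2; have u0 : 0 <= (u - t) / s by rewrite divr_ge0 ?subr_ge0 // ltW.
have n0 : (Num.truncn ((u - t) / s) < 2 ^ L)%N.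
  by rewrite truncn_lt_nat // ltr_pdivrMr // mulrC; lra.
have := truncn_itv u0; exists (Ordinal n0) => /=.
by move: H; rewrite ler_pdivlMr // ltr_pdivrMr // -natr1 => /andP[? ?]; apply/andP; split; lra.
Qed.

Lemma gcell_locate z : square a (s * (2 ^ L)%:R) z -> exists x : cell L, G x z.
Proof.
move=> /squareP[h1 h2 h3 h4].
have [n1 /andP[? ?]] := locate1 h1 h2; have [n2 /andP[? ?]] := locate1 h3 h4.
by exists (n1, n2); apply/squareP.
Qed.

Lemma gcell_sub x : G x `<=` square a (s * (2 ^ L)%:R).
Proof.
have h (n : 'I_(2 ^ L)) : s * n%:R + s <= s * (2 ^ L)%:R /\ 0 <= s * n%:R.
  have : n.+1%:R <= (2 ^ L)%:R :> R by rewrite ler_nat.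
  by move=> /(ler_wpM2l (ltW s0)); rewrite -natr1 mulrDr mulr1 mulr_ge0 // ltW.
have [? ?] := h x.1; have [? ?] := h x.2.
by apply: square_sub => /=; lra.
Qed.

Lemma measurable_gcell x : measurable (G x : set (borel2 R)).
Proof. exact: measurable_square. Qed.

Definition stepf c : R * R -> R := fun z => \sum_x c x * \1_(G x) z.

Lemma stepf_in c x z : G x z -> stepf c z = c x.
Proof.
move=> hx; rewrite /stepf (bigD1 x) //= big1 => [|y yx].
  by rewrite indicE mem_set // mulr1 addr0.
rewrite indicE memNset ?mulr0 // => hy.
by move: yx; rewrite (gcell_inj hx hy) eqxx.
Qed.

Lemma stepf_out c z : ~ square a (s * (2 ^ L)%:R) z -> stepf c z = 0.
Proof.
move=> hz; rewrite /stepf big1 // => y _; rewrite indicE memNset ?mulr0 // => hy.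
exact/hz/(gcell_sub hy).
Qed.

Lemma stepf_map (F : R -> R) c z : F 0 = 0 -> F (stepf c z) = stepf (F \o c) z.
Proof.
move=> F0; have [/gcell_locate[x hx]|hz] := pselect (square a (s * (2 ^ L)%:R) z).
  by rewrite !(stepf_in _ hx).
by rewrite !stepf_out.
Qed.

Lemma stepf_map2 (F : R -> R -> R) c d z : F 0 0 = 0 ->
  F (stepf c z) (stepf d z) = stepf (fun x => F (c x) (d x)) z.
Proof.
move=> F0; have [/gcell_locate[x hx]|hz] := pselect (square a (s * (2 ^ L)%:R) z).
  by rewrite !(stepf_in _ hx).
by rewrite !stepf_out.
Qed.

Lemma stepf_1 z : stepf (fun=> 1) z = \1_(square a (s * (2 ^ L)%:R)) z.
Proof.
have [hz|hz] := pselect (square a (s * (2 ^ L)%:R) z).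
  by have [x hx] := gcell_locate hz; rewrite (stepf_in _ hx) indicE mem_set.
by rewrite stepf_out // indicE memNset.
Qed.

Lemma measurable_stepf c : measurable_fun setT (stepf c : borel2 R -> R).
Proof.
apply: measurable_sum => x; apply: measurable_funM => //.
by apply: measurable_indic; exact: measurable_gcell.
Qed.

Lemma stepf_le c M z : (forall x, `|c x| <= M) ->
  `|stepf c z| <= M * \1_(square a (s * (2 ^ L)%:R)) z.
Proof.
move=> h; rewrite -stepf_1; have [/gcell_locate[x hx]|hz] := pselect (square a (s * (2 ^ L)%:R) z).
  by rewrite !(stepf_in _ hx) mulr1.
by rewrite !stepf_out // mulr0 normr0.
Qed.

Lemma rint_stepf_mul c (w : borel2 R -> R) : (forall b m, rint mu (fun z => w z * \1_(square b m) z)) ->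
  rint mu (fun z => stepf c z * w z).
Proof.
move=> hw; have := @rint_sum _ _ _ mu _ (fun x z => c x * (w z * \1_(G x) z)) (fun x => rintZ (c x) (hw _ _)).
by congr rint; apply/funext => z; rewrite /stepf mulr_suml; apply: eq_bigr => x _; ring.
Qed.

Lemma Rint_stepf_mul c (w : borel2 R -> R) : (forall b m, rint mu (fun z => w z * \1_(square b m) z)) ->
  \int[mu]_z (stepf c z * w z) = \sum_x c x * \int[mu]_z (w z * \1_(G x) z).
Proof.
move=> hw; transitivity (\sum_x \int[mu]_z (c x * (w z * \1_(G x) z))); last first.
  by apply: eq_bigr => x _; exact: RintZ (hw _ _).
rewrite -Rint_sum; last by move=> x; apply: rintZ; exact: hw.
by apply: eq_Rintegral => z _; rewrite /stepf mulr_suml; apply: eq_bigr => x _; ring.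
Qed.

Lemma rint_1square b m : rint mu (fun z => 1 * \1_(square b m) z).
Proof. by apply: rintZ; exact: rint_square. Qed.

Lemma rint_stepf c : rint mu (stepf c).
Proof.
by have := rint_stepf_mul c rint_1square; congr rint; apply/funext => z; rewrite mulr1.
Qed.

Lemma Rint_stepf c : \int[mu]_z stepf c z = s ^+ 2 * \sum_x c x.
Proof.
have := Rint_stepf_mul c rint_1square.
under eq_Rintegral do rewrite mulr1.
move=> ->; rewrite mulr_sumr; apply: eq_bigr => x _.
by under eq_Rintegral do rewrite mul1r; rewrite Rint_square ?(ltW s0) // mulrC.
Qed.

Lemma L2_stepf c : L2 mu (stepf c).
Proof.
split; first exact: measurable_stepf.
have := rint_stepf (fun x => c x ^+ 2); congr rint; apply/funext => z.
by rewrite (@stepf_map (fun t => t ^+ 2)) ?expr0n.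
Qed.

(* The cells meeting the [3 x 3] block of level [k] around [x] lie in one cube. *)
Definition block_cube k x : set (R * R) :=
  square (a.1 + s * ((2 ^ k)%:R * ((x.1 %/ 2 ^ k)%N%:R - 1)),
          a.2 + s * ((2 ^ k)%:R * ((x.2 %/ 2 ^ k)%N%:R - 1))) (3%:R * (s * (2 ^ k)%:R)).

Lemma gcell_block k x y : nb 1 k x y -> G y `<=` block_cube k x.
Proof.
have h (i j : nat) : (i %/ 2 ^ k <= j %/ 2 ^ k + 1)%N -> (j %/ 2 ^ k <= i %/ 2 ^ k + 1)%N ->
   s * ((2 ^ k)%:R * ((i %/ 2 ^ k)%N%:R - 1)) <= s * j%:R /\
   s * j%:R + s <= s * ((2 ^ k)%:R * ((i %/ 2 ^ k)%N%:R - 1)) + 3%:R * (s * (2 ^ k)%:R).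
  move=> h1 h2; have k0 : (0 < 2 ^ k)%N by rewrite expn_gt0.
  have dj := divn_eq j (2 ^ k); have mj := ltn_pmod j k0.
  have e1 : ((i %/ 2 ^ k) * 2 ^ k <= j + 2 ^ k)%N by nia.
  have e2 : (j + 1 <= (i %/ 2 ^ k) * 2 ^ k + 2 * 2 ^ k)%N by nia.
  rewrite -(ler_nat R) natrM natrD in e1.
  rewrite -(ler_nat R) !natrD !natrM in e2.
  have s1 := ler_wpM2l (ltW s0) e1; have s2 := ler_wpM2l (ltW s0) e2.
  by move: s1 s2; rewrite !mulrDr !mulr1; set p := (2 ^ k)%:R; set d := _%:R; nra.
rewrite /nb => /and4P[h1 h2 h3 h4].
have [? ?] := h _ _ h1 h2; have [? ?] := h _ _ h3 h4.
by apply: square_sub => /=; lra.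
Qed.

Lemma sum_gcell_le (P : pred (cell L)) (J : set (R * R)) (w : borel2 R -> R) :
  (forall b m, rint mu (fun z => w z * \1_(square b m) z)) -> (forall z, 0 <= w z) ->
  rint mu (fun z => w z * \1_J z) -> (forall x, P x -> G x `<=` J) ->
  \sum_(x | P x) \int[mu]_z (w z * \1_(G x) z) <= \int[mu]_z (w z * \1_J z).
Proof.
move=> hw w0 wJ PJ.
rewrite big_mkcond (eq_bigr (fun x => (P x)%:R * \int[mu]_z (w z * \1_(G x) z))); last first.
  by move=> x _; case: (P x); rewrite ?mul1r ?mul0r.
rewrite -Rint_stepf_mul //; apply: Rint_le => //; first exact: rint_stepf_mul.
move=> z; rewrite mulrC ler_wpM2l //.
have [/gcell_locate[x hx]|hz] := pselect (square a (s * (2 ^ L)%:R) z).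
  rewrite (stepf_in _ hx); case: (boolP (P x)) => Px; last by rewrite indicE.
  by rewrite indicE mem_set //; apply: (PJ _ Px).
by rewrite stepf_out // indicE.
Qed.
End Grid.
End Squares.

(** * Truncation of values *)

Section Clamp.
Variable R : realType.
Implicit Types N t u : R.

(** Being 1-Lipschitz, this truncation does not increase mean oscillation; it reduces the multiplier
    of the commutator to a bounded one. *)
Definition clamp N t : R := Num.max (- N) (Num.min N t).

Lemma clamp_lip N t u : `|clamp N t - clamp N u| <= `|t - u|.
Proof.
have ht := ler_norm (t - u); have hu := ler_norm (u - t); rewrite distrC in hu.
rewrite ler_norml /clamp !maxEle !minEle.
by do 6?case: ifPn; rewrite -?ltNge => *; apply/andP; split; lra.
Qed.

Lemma clamp_bound N t : 0 <= N -> `|clamp N t| <= N.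
Proof.
move=> N0; rewrite ler_norml /clamp !maxEle !minEle.
by do 3?case: ifPn; rewrite -?ltNge => *; apply/andP; split; lra.
Qed.

Lemma clamp_id N t : `|t| <= N -> clamp N t = t.
Proof.
rewrite ler_norml => /andP[h1 h2]; rewrite /clamp (min_idPr h2); exact/max_idPr.
Qed.

Lemma clamp0 N : 0 <= N -> clamp N 0 = 0.
Proof. by move=> N0; apply: clamp_id; rewrite normr0. Qed.

Lemma measurable_clamp d (T : measurableType d) N (u : T -> R) : measurable_fun setT u ->
  measurable_fun setT (fun x => clamp N (u x)).
Proof. by move=> mu; apply: measurable_maxr => //; apply: measurable_minr. Qed.
End Clamp.

(** * Density of step functions and convergence of conditional expectations *)

Section Density.
Variables (R : realType) (a : R * R) (l : R).
Hypothesis l0 : 0 < l.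
Local Notation mu := (@leb2 R).
Local Notation Q := (square a l).
Local Notation I u := (\int[mu]_z (u : borel2 R -> R) z).

Definition side (L : nat) : R := l / (2 ^ L)%:R.

Lemma pow2_gt0 L : 0 < (2 ^ L)%:R :> R.
Proof. by rewrite ltr0n expn_gt0. Qed.

Lemma side_gt0 L : 0 < side L.
Proof. by rewrite divr_gt0 ?pow2_gt0. Qed.

Lemma sideK L : side L * (2 ^ L)%:R = l.
Proof. by rewrite /side mulfVK // gt_eqF ?pow2_gt0. Qed.

Lemma side_small e : 0 < e -> exists L0, forall L, (L0 <= L)%N -> side L <= e.
Proof.
move=> e0; exists (Num.truncn (l / e)).+1 => L hL; rewrite /side ler_pdivrMr ?pow2_gt0 //.
rewrite mulrC -ler_pdivrMr //; apply: ltW; apply: (@lt_le_trans _ _ (Num.truncn (l / e)).+1%:R).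
  by have /andP[] := truncn_itv (ltW (divr_gt0 l0 e0)).
by rewrite ler_nat (leq_trans hL) // ltnW // ltn_expl.
Qed.

Local Notation st L := (@stepf R L a (side L)).

(** Approximation on every sufficiently fine grid and not just on some grid, so that two
    approximable functions can be treated on a common one. *)
Definition approx (u : borel2 R -> R) : Prop := forall e, 0 < e -> exists L0, forall L,
  (L0 <= L)%N -> exists c : cell L -> R, \int[mu]_z `|u z - st L c z| <= e.

Lemma rint_st L c : rint mu (st L c).
Proof. exact: rint_stepf. Qed.

Lemma rint_dist u v : rint mu u -> rint mu v -> rint mu (fun z => `|u z - v z|).
Proof. by move=> ? ?; apply: rint_norm; exact: rintB. Qed.

Lemma approx_lim u : rint mu u ->
  (forall e, 0 < e -> exists v, [/\ rint mu v, approx v & \int[mu]_z `|u z - v z| <= e]) ->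
  approx u.
Proof.
move=> iu h e e0; have e2 : 0 < e / 2%:R by rewrite divr_gt0.
have [v [iv av uv]] := h _ e2; have [L0 hL] := av _ e2; exists L0 => L LL.
have [c hc] := hL L LL; exists c.
have ic := rint_st c.
apply: le_trans (_ : _ <= \int[mu]_z (`|u z - v z| + `|v z - st L c z|)) _.
  apply: Rint_le; [exact: rint_dist|by apply: rintD; exact: rint_dist|].
  by move=> z; apply: le_trans (ler_normD _ _); rewrite subrKA.
rewrite RintD; [|exact: rint_dist..].
by have := lerD uv hc; lra.
Qed.

Lemma approxD (k : R) u v : rint mu u -> rint mu v -> approx u -> approx v ->
  approx (fun z => k * u z + v z).
Proof.
move=> iu iv au av e e0.
have k0 : 0 < `|k| + 1 by rewrite ltr_wpDl.
have e1 : 0 < e / 2%:R / (`|k| + 1) by rewrite !divr_gt0.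
have e2 : 0 < e / 2%:R by rewrite divr_gt0.
have [L1 h1] := au _ e1; have [L2 h2] := av _ e2; exists (maxn L1 L2) => L.
rewrite geq_max => /andP[/h1[c hc] /h2[d hd]]; exists (fun x => k * c x + d x).
have ic := rint_st c; have id := rint_st d.
apply: le_trans (_ : _ <= \int[mu]_z (`|k| * `|u z - st L c z| + `|v z - st L d z|)) _.
  apply: Rint_le.
  - by apply: rint_dist; [apply: rintD => //; exact: rintZ|exact: rint_st].
  - by apply: rintD; [apply: rintZ|]; exact: rint_dist.
  move=> z; rewrite -normrM; apply: le_trans (ler_normD _ _).
  rewrite -(@stepf_map2 _ _ a (side L) (side_gt0 L) (fun s t => k * s + t)) ?mulr0 ?addr0 //.
  by rewrite le_eqVlt; apply/orP; left; apply/eqP; congr `|_|; ring.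
rewrite RintD; [|by apply: rintZ; exact: rint_dist|exact: rint_dist].
rewrite RintZ; last exact: rint_dist.
have : `|k| * \int[mu]_z `|u z - st L c z| <= e / 2%:R.
  apply: le_trans (_ : (`|k| + 1) * (e / 2%:R / (`|k| + 1)) <= _).
    by apply: ler_pM => //; [apply: Rint_ge0|rewrite lerDl].
  by rewrite mulrC mulfVK // gt_eqF.
by move: hd => /= hd h; have := lerD h hd; lra.
Qed.

Definition ind (A : set (R * R)) : borel2 R -> R := fun z => \1_A z * \1_Q z.

Lemma ind_in A z : Q z -> ind A z = \1_A z.
Proof. by move=> h; rewrite /ind [\1_Q z]indicE mem_set // mulr1. Qed.

Lemma ind_out A z : ~ Q z -> ind A z = 0.
Proof. by move=> h; rewrite /ind [\1_Q z]indicE memNset // mulr0. Qed.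

Lemma rint_ind A : measurable (A : set (borel2 R)) -> rint mu (ind A).
Proof.
move=> mA; have := rint_mul_indic mA (rint_square a l).
by congr rint; apply/funext => z; rewrite /ind mulrC.
Qed.

(** The Borel sets with approximable trace on [Q]; they form a sigma-algebra that contains the half
    planes parallel to the axes, hence are all Borel sets. *)
Let S A := measurable (A : set (borel2 R)) /\ approx (ind A).

Lemma approx_1 : approx (\1_Q).
Proof.
move=> e e0; exists 0%N => L _; exists (fun=> 1).
rewrite (_ : (fun z => _) = cst 0); first by rewrite Rintegral_cst // mul0r ltW.
by apply/funext => z; rewrite stepf_1 ?side_gt0 // sideK subrr normr0.
Qed.

Let S_C A : S A -> S (~` A).
Proof.
move=> [mA aA]; split; first exact: measurableC.
have := approxD (-1) (rint_ind mA) (rint_square a l) aA approx_1.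
congr approx; apply/funext => z; have [hQ|hQ] := pselect (Q z).
  by rewrite !ind_in // !indicE in_setC (mem_set hQ); case: (z \in A) => /=; ring.
by rewrite !ind_out // mulr0 add0r indicE memNset.
Qed.

(** Products of step functions are step functions. Clamping the factors to absolute value at most 1
    makes the error of the product at most the sum of the two errors. *)
Let S_I A B : S A -> S B -> S (A `&` B).
Proof.
move=> [mA aA] [mB aB]; split; first exact: measurableI.
move=> e e0; have e2 : 0 < e / 2%:R by rewrite divr_gt0.
have [L1 h1] := aA _ e2; have [L2 h2] := aB _ e2; exists (maxn L1 L2) => L.
rewrite geq_max => /andP[/h1[c hc] /h2[d hd]]; exists (fun x => clamp 1 (c x) * clamp 1 (d x)).
have iA := rint_dist (rint_ind mA) (rint_st c); have iB := rint_dist (rint_ind mB) (rint_st d).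
have iAB := rint_dist (rint_ind (measurableI _ _ mA mB)) (rint_st (fun x => clamp 1 (c x) * clamp 1 (d x))).
apply: le_trans (_ : _ <= \int[mu]_z (`|ind A z - st L c z| + `|ind B z - st L d z|)) _; last first.
  by rewrite RintD //; have := lerD hc hd; lra.
apply: Rint_le => //; first exact: rintD.
move=> z; rewrite -(@stepf_map2 _ _ a (side L) (side_gt0 L) (fun s t => clamp 1 s * clamp 1 t)); last first.
  by rewrite clamp0 // mulr0.
have [hQ|hQ] := pselect (Q z); last first.
  by rewrite !ind_out // !stepf_out ?side_gt0 ?sideK // clamp0 // mulr0 subrr normr0 addr0.
rewrite !ind_in // indicI /=.
set s := st L c z; set t := st L d z; set i : R := \1_A z; set j : R := \1_B z.
have i1 : clamp 1 i = i by rewrite clamp_id // /i indicE; case: (_ \in _); rewrite ?normr1 ?normr0.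
have j1 : clamp 1 j = j by rewrite clamp_id // /j indicE; case: (_ \in _); rewrite ?normr1 ?normr0.
have := clamp_lip 1 i s; have := clamp_lip 1 j t; rewrite i1 j1 => hj hi.
have ji : `|j| <= 1 by rewrite -j1 clamp_bound.
have si := @clamp_bound _ 1 s ler01.
rewrite (_ : i * j - _ = (i - clamp 1 s) * j + clamp 1 s * (j - clamp 1 t)); last by ring.
apply: le_trans (ler_normD _ _) _; rewrite !normrM; apply: lerD.
  by rewrite -[leRHS]mulr1; apply: ler_pM.
by rewrite -[leRHS]mul1r; apply: ler_pM.
Qed.

Let S_bigcup (F : (set (R * R))^nat) : (forall n, S (F n)) -> S (\bigcup_n F n).
Proof.
move=> SF; pose U n := \big[setU/set0]_(i < n) F i.
have SU n : S (U n).
  rewrite /U; elim: n => [|n ih]; last first.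
    rewrite big_ord_recr /= -[X in S X]setCK setCU; apply: S_C; apply: S_I; exact: S_C.
  rewrite big_ord0 -setCT; apply: S_C; split; first exact: measurableT.
  have := approx_1; congr approx; apply/funext => z.
  by rewrite /ind indicT mul1r.
have mF : measurable (\bigcup_n F n : set (borel2 R)).
  by apply: bigcup_measurable => n _; case: (SF n).
split => //; apply: approx_lim; first exact: rint_ind.
have [_ cv] : [/\ rint mu (fun z => 0 : R) & (\int[mu]_z `|ind (\bigcup_n F n) z - ind (U k) z|) @[k --> \oo]
    --> (\int[mu]_z (0 : R))].
  apply: (@dct _ _ _ mu (fun k z => `|ind (\bigcup_n F n) z - ind (U k) z|) _ \1_Q) => //.
  - by move=> k; apply: rint_meas; apply: rint_dist; apply: rint_ind => //; case: (SU k).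
  - apply: aeW => z; apply: cvg_near_cst.
    have [[n _ Fn]|nF] := pselect ((\bigcup_n F n) z).
      exists n.+1 => // k /= nk; rewrite (_ : ind (U k) z = ind (\bigcup_n F n) z) ?subrr ?normr0 //.
      rewrite /ind !indicE (mem_set (_ : U k z)) ?(mem_set (_ : (\bigcup_n F n) z)) //.
        by exists n.
      by rewrite /U -bigcup_mkord; exists n.
    apply: nearW => k; rewrite (_ : ind (U k) z = ind (\bigcup_n F n) z) ?subrr ?normr0 //.
    rewrite /ind !indicE (memNset nF) memNset //.
    by rewrite /U -bigcup_mkord => -[n _ Fn]; apply: nF; exists n.
  - exact: rint_square.
  move=> k z; rewrite /ind -mulrBl normrM !indicE; case: (_ \in _); case: (_ \in _);
  by case: (_ \in _); rewrite /= ?(subrr,subr0,sub0r,normrN,normr0,normr1,mulr0,mulr1,mul0r,mul1r).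
move: cv; rewrite Rintegral_cst // mul0r => /cvgrPdist_le cv e e0.
have [n _ hn] := cv e e0; have /= := hn n (leqnn n); rewrite sub0r normrN => hk.
exists (ind (U n)); split; [by apply: rint_ind; case: (SU n)|by case: (SU n)|].
exact: le_trans (ler_norm _) hk.
Qed.

(** Each cell gets the value read off at its lower left corner. Errors are confined to [E L], in the
    applications a strip of width [side L] along the line. *)
Lemma approx_line (A : set (R * R)) (b : nat -> R * R -> bool) (E : nat -> set (R * R)) :
  measurable (A : set (borel2 R)) ->
  (forall L, measurable (E L : set (borel2 R)) /\ (mu (E L) <= (side L * l)%:E)%E) ->
  (forall L (x : cell L) z, gcell a (side L) x z ->
     A z <> b L (a.1 + side L * (x.1)%:R, a.2 + side L * (x.2)%:R) -> E L z) ->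
  approx (ind A).
Proof.
move=> mA hE hA e e0; have [L0 hL] := side_small (divr_gt0 e0 l0); exists L0 => L LL.
exists (fun x : cell L => (b L (a.1 + side L * (x.1)%:R, a.2 + side L * (x.2)%:R))%:R).
set c := fun x : cell L => _; have [mE lE] := hE L.
have fE : (mu (E L) < +oo)%E by apply: le_lt_trans lE _; exact: ltry.
apply: le_trans (_ : _ <= \int[mu]_z \1_(E L) z) _.
  apply: Rint_le; [apply: rint_dist; [exact: rint_ind|exact: rint_st]|exact: rint_indic|].
  move=> z; have [hQ|hQ] := pselect (Q z); last first.
    by rewrite ind_out // stepf_out ?side_gt0 ?sideK // subrr normr0 indicE.
  have [x hx] : exists x : cell L, gcell a (side L) x z.
    by apply: (gcell_locate (side_gt0 L)); rewrite sideK.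
  rewrite ind_in // (stepf_in (side_gt0 L) _ hx) [\1_(E L) z]indicE.
  have [Ez|nE] := pselect (E L z).
    rewrite mem_set // indicE /c; case: (_ \in _); case: (b _ _);
    by rewrite /= ?(subrr,subr0,sub0r,normrN,normr0,normr1).
  rewrite memNset // indicE /c.
  have -> : (z \in A) = b L (a.1 + side L * (x.1)%:R, a.2 + side L * (x.2)%:R).
    apply/idP/idP; rewrite inE => h; apply: contrapT => nh; apply: nE; apply: (hA L x z hx) => e1.
      by apply: nh; rewrite -e1.
    by apply: nh; rewrite e1.
  by rewrite subrr normr0.
rewrite /Rintegral integral_indic // setIT.
have le2 : side L * l <= e by rewrite -ler_pdivlMr // hL.
by rewrite -lee_fin fineK ?ge0_fin_numE //; apply: le_trans lE _; rewrite lee_fin.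
Qed.

Let S_fst t : S [set z | t < z.1].
Proof.
have mS : measurable ([set z | t < z.1] : set (borel2 R)).
  by apply: measurable_gt; exact: measurable_fst.
split => //; apply: (@approx_line _ (fun _ z => t < z.1)
    (fun L => `[t, t + side L[%classic `*` `[a.2, a.2 + l[%classic)) => //.
  move=> L; split; first by apply: measurableX; exact: measurable_itv.
  by rewrite leb2_rect // ltW // side_gt0.
move=> L x z /[dup] /(gcell_sub (side_gt0 L)); rewrite sideK => /squareP[_ _ h3 h4].
move=> /squareP/=[h1 h2 _ _] ne; split; rewrite /= in_itv /=; last by rewrite h3 h4.
have [//|h] := boolP (t <= z.1 < t + side L); case: ne; congr is_true.
by apply/idP/idP; move: h; rewrite negb_and -ltNge -leNgt => /orP[] *; lra.
Qed.

Let S_snd t : S [set z | t < z.2].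
Proof.
have mS : measurable ([set z | t < z.2] : set (borel2 R)).
  by apply: measurable_gt; exact: measurable_snd.
split => //; apply: (@approx_line _ (fun _ z => t < z.2)
    (fun L => `[a.1, a.1 + l[%classic `*` `[t, t + side L[%classic)) => //.
  move=> L; split; first by apply: measurableX; exact: measurable_itv.
  by rewrite leb2_rect ?(ltW (side_gt0 L)) ?(ltW l0) // mulrC.
move=> L x z /[dup] /(gcell_sub (side_gt0 L)); rewrite sideK => /squareP[h1 h2 _ _].
move=> /squareP/=[_ _ h3 h4] ne; split; rewrite /= in_itv /=; first by rewrite h1 h2.
have [//|h] := boolP (t <= z.2 < t + side L); case: ne; congr is_true.
by apply/idP/idP; move: h; rewrite negb_and -ltNge -leNgt => /orP[] *; lra.
Qed.

Let S_sigma (pi : R * R -> R) : (forall t, S [set z | t < pi z]) ->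
  forall B : set (measurableTypeR R), measurable B -> S (pi @^-1` B).
Proof.
move=> hS B mB; have {mB} : (@RGenOInfty.G R).-sigma.-measurable B.
  by rewrite -RGenOInfty.measurableE.
move: B; apply: (smallest_sub (C := sigma_algebra setT) (X := [set B | S (pi @^-1` B)])).
  split => /=.
  - rewrite preimage_set0 -setCT; apply: S_C; split; first exact: measurableT.
    have := approx_1; congr approx; apply/funext => z.
    by rewrite /ind indicT mul1r.
  - by move=> C SC; rewrite setTD preimage_setC; exact: S_C.
  - by move=> C SC; rewrite preimage_bigcup; exact: S_bigcup.
move=> _ [t ->] /=; have := hS t; congr S.
by apply/seteqP; split => z /=; rewrite in_itv /= andbT.
Qed.

Lemma approx_ind A : measurable (A : set (borel2 R)) -> approx (ind A).
Proof.
suff: forall A, measurable (A : set (borel2 R)) -> S A by move=> h /h [].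
apply: (smallest_sub (C := sigma_algebra setT) (X := S)).
  split => /=.
  - rewrite -setCT; apply: S_C; split; first exact: measurableT.
    have := approx_1; congr approx; apply/funext => z.
    by rewrite /ind indicT mul1r.
  - by move=> C SC; rewrite setTD; exact: S_C.
  - exact: S_bigcup.
move=> _ [|] [B mB <-]; rewrite setTI; exact: S_sigma.
Qed.

Lemma approx_sum n (c : 'I_n -> R) (A : 'I_n -> set (R * R)) :
  (forall i, measurable (A i : set (borel2 R))) ->
  rint mu (fun z => \sum_(i < n) c i * ind (A i) z) /\
  approx (fun z => \sum_(i < n) c i * ind (A i) z).
Proof.
elim: n c A => [|n ih] c A mA.
  under [X in rint mu X]eq_fun do rewrite big_ord0.
  under [X in approx X]eq_fun do rewrite big_ord0.
  split; first by have := rintZ 0 (rint_square a l); congr rint; apply/funext => z; rewrite mul0r.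
  move=> e e0; exists 0%N => L _; exists (fun=> 0).
  rewrite (_ : (fun z => _) = cst 0); first by rewrite Rintegral_cst // mul0r ltW.
  by apply/funext => z; rewrite /stepf big1 ?subrr ?normr0 // => x _; rewrite mul0r.
have [i1 a1] := ih (fun i => c (widen_ord (leqnSn n) i)) (fun i => A (widen_ord (leqnSn n) i)) (fun i => mA _).
have i2 := rint_ind (mA ord_max).
split.
  have := rintD i1 (rintZ (c ord_max) i2); congr rint; apply/funext => z.
  by rewrite big_ord_recr.
have := approxD (c ord_max) i2 i1 (approx_ind (mA ord_max)) a1; congr approx; apply/funext => z.
by rewrite big_ord_recr /= addrC.
Qed.

(** The values are cut into layers of height [d = e / l ^ 2], so that the error integrates to at
    most [e] over [Q]. *)
Lemma approx_bounded (u : borel2 R -> R) M : measurable_fun setT u ->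
  (forall z, `|u z| <= M * \1_Q z) -> approx u.
Proof.
move=> mu_ h; have iu : rint mu u.
  by apply: (rint_bounded (measurable_square a l) (leb2_square_fin a l) mu_ h).
apply: approx_lim => // e e0.
have l2 : 0 < l ^+ 2 by rewrite exprn_gt0.
pose d := e / l ^+ 2; have d0 : 0 < d by rewrite divr_gt0.
have M0 : 0 <= M.
  have aQ : Q a by apply/squareP; rewrite !ltrDl.
  by have := le_trans (normr_ge0 _) (h a); rewrite indicE mem_set // mulr1.
pose N := (Num.truncn (2%:R * M / d)).+1.
pose A (i : 'I_N) : set (R * R) := [set z | i%:R * d <= u z + M < i.+1%:R * d].
have mA i : measurable (A i : set (borel2 R)).
  rewrite (_ : A i = [set z | i%:R * d - M <= u z] `&` [set z | u z < i.+1%:R * d - M]).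
    have h1 := mu_ measurableT `[i%:R * d - M, +oo[%classic (measurable_itv _).
    have h2 := mu_ measurableT `]-oo, (i.+1%:R * d - M)[%classic (measurable_itv _).
    have := measurableI _ _ h1 h2; rewrite !setTI; congr measurable.
    by apply/seteqP; split => z /=; rewrite !in_itv /= andbT.
  by apply/seteqP; split => z /=; [move=> /andP[? ?]; split; lra|move=> [? ?]; apply/andP; split; lra].
have [iv av] := @approx_sum N (fun i => i%:R * d - M) A mA.
exists (fun z => \sum_(i < N) (i%:R * d - M) * ind (A i) z); split => //.
apply: le_trans (_ : _ <= \int[mu]_z (d * \1_Q z)) _; last first.
  by rewrite RintZ ?Rint_square ?(ltW l0) // /d ?mulfVK ?gt_eqF //; exact: rint_square.
apply: Rint_le; [exact: rint_dist|by apply: rintZ; exact: rint_square|] => z.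
have [hQ|hQ] := pselect (Q z); last first.
  have := h z; rewrite indicE memNset // mulr0 normr_le0 => /eqP ->.
  by rewrite mulr0 big1 ?subr0 ?normr0 // => i _; rewrite ind_out ?mulr0.
have := h z; rewrite indicE mem_set // mulr1 mulr1 ler_norml => /andP[u1 u2].
have t0 : 0 <= (u z + M) / d by rewrite divr_ge0 ?(ltW d0) //; lra.
have /andP[] := truncn_itv t0; rewrite ler_pdivlMr // ltr_pdivrMr // => t1 t2.
have tN : (Num.truncn ((u z + M) / d) < N)%N.
  by rewrite ltnS; apply: le_truncn; rewrite ler_pM2r ?invr_gt0 //; lra.
rewrite (bigD1 (Ordinal tN)) //= big1 ?addr0 => [|i ne].
  rewrite ind_in // indicE mem_set; last by rewrite /A /= t1 t2.
  by rewrite mulr1 -natr1 mulrDl mul1r in t2 *; rewrite ler_norml; apply/andP; split; lra.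
rewrite ind_in // indicE memNset ?mulr0 // => /= hi; move: ne => /eqP; apply.
apply: val_inj => /=; apply/esym/truncn_def; rewrite ler_pdivlMr // ltr_pdivrMr //.
Qed.

Definition eavg L (u : borel2 R -> R) (x : cell L) : R :=
  (side L ^+ 2)^-1 * \int[mu]_z (u z * \1_(gcell a (side L) x) z).

Definition condE L u := st L (eavg u).

Lemma eavgB L u v x : rint mu u -> rint mu v ->
  @eavg L (fun z => u z - v z) x = eavg u x - eavg v x.
Proof.
move=> iu iv; have mG := @measurable_gcell _ L a (side L) x.
rewrite /eavg -mulrBr -RintB; [|exact: rint_mul_indic..].
by congr (_ * _); apply: eq_Rintegral => z _; rewrite mulrBl.
Qed.

Lemma eavg_st L c x : eavg (st L c) x = c x.
Proof.
have s2 : side L ^+ 2 != 0 by rewrite expf_neq0 // gt_eqF ?side_gt0.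
rewrite /eavg (_ : \int[mu]_z _ = c x * side L ^+ 2); first by rewrite mulrC mulfK.
rewrite -(Rint_square (a.1 + side L * (x.1)%:R, a.2 + side L * (x.2)%:R) (ltW (side_gt0 L))) -RintZ; last exact: rint_square.
apply: eq_Rintegral => z _; have [hz|hz] := pselect (gcell a (side L) x z).
  by rewrite (stepf_in (side_gt0 L) _ hz).
by rewrite !indicE !memNset // !mulr0.
Qed.

Lemma eavg_le L u (M : R) (x : cell L) : rint mu u -> (forall z, gcell a (side L) x z -> `|u z| <= M) ->
  `|eavg u x| <= M.
Proof.
move=> iu hu; have mG := @measurable_gcell _ L a (side L) x.
have s2 : 0 < side L ^+ 2 by rewrite exprn_gt0 ?side_gt0.
rewrite /eavg normrM ger0_norm ?invr_ge0 ?(ltW s2) // mulrC ler_pdivrMr //.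
have iuG := rint_mul_indic mG iu.
apply: le_trans (Rint_norm iuG) _.
rewrite -(Rint_square (a.1 + side L * (x.1)%:R, a.2 + side L * (x.2)%:R) (ltW (side_gt0 L))).
rewrite -RintZ; last exact: rint_square.
apply: Rint_le; [exact: rint_norm|by apply: rintZ; exact: rint_square|] => z.
rewrite normrM; have [hz|hz] := pselect (gcell a (side L) x z).
  by rewrite !indicE !mem_set // normr1 !mulr1 hu.
by rewrite !indicE !memNset // normr0 !mulr0.
Qed.

Lemma condE_contract L u : rint mu u -> \int[mu]_z `|condE L u z| <= \int[mu]_z `|u z|.
Proof.
move=> iu; have s2 : side L ^+ 2 != 0 by rewrite expf_neq0 // gt_eqF ?side_gt0.
under eq_Rintegral do rewrite (@stepf_map _ _ a (side L) (side_gt0 L) (fun t => `|t|)) ?normr0 //.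
rewrite Rint_stepf ?side_gt0 // mulr_sumr.
have mG (x : cell L) := @measurable_gcell _ L a (side L) x.
apply: le_trans (_ : _ <= \sum_(x : cell L) \int[mu]_z (`|u z| * \1_(gcell a (side L) x) z)) _.
  apply: ler_sum => x _; rewrite /= /eavg normrM ger0_norm ?invr_ge0 ?exprn_ge0 ?(ltW (side_gt0 L)) //.
  rewrite mulVKf //; apply: le_trans (Rint_norm (rint_mul_indic (mG x) iu)) _.
  apply: Rint_le; [by apply: rint_norm; exact: rint_mul_indic|
    by apply: rint_mul_indic => //; exact: rint_norm|] => z.
  by rewrite normrM [X in _ * X <= _]ger0_norm // indicE.
apply: le_trans (sum_gcell_le (J := setT) (P := xpredT) (side_gt0 L) _ _ _ _) _ => //.
- by move=> b m; apply: rint_mul_indic; [exact: measurable_square|exact: rint_norm].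
- by apply: rint_mul_indic => //; exact: rint_norm.
by apply: Rint_le; [by apply: rint_mul_indic => //; exact: rint_norm|exact: rint_norm|] => z;
  rewrite indicT mulr1.
Qed.

(** Conditional expectation fixes the step functions of its grid and contracts the $L^1$ norm, so
    density of step functions gives convergence. *)
Lemma condE_cvg (u : borel2 R -> R) (M : R) : measurable_fun setT u -> (forall z, `|u z| <= M * \1_Q z) ->
  forall e, 0 < e -> exists L0, forall L, (L0 <= L)%N -> \int[mu]_z `|condE L u z - u z| <= e.
Proof.
move=> mu_ h e e0; have iu : rint mu u.
  by apply: (rint_bounded (measurable_square a l) (leb2_square_fin a l) mu_ h).
have e2 : 0 < e / 2%:R by rewrite divr_gt0.
have [L0 hL] := approx_bounded mu_ h e2; exists L0 => L /hL[c hc].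
have ic := rint_st c; have iB := rintB iu ic.
have iE (v : borel2 R -> R) : rint mu (condE L v) by exact: rint_stepf.
pose v z := u z - st L c z.
have E z : condE L u z = condE L v z + st L c z.
  rewrite /condE (@stepf_map2 _ _ a (side L) (side_gt0 L) (fun s t => s + t)) ?addr0 //.
  by congr (st L _ z); apply/funext => x; rewrite /v eavgB // eavg_st subrK.
apply: le_trans (_ : _ <= \int[mu]_z (`|condE L v z| + `|u z - st L c z|)) _.
  apply: Rint_le; [by apply: rint_dist|by apply: rintD; apply: rint_norm|] => z.
  by rewrite E -addrA -opprB; apply: ler_normB.
rewrite RintD; [|exact: rint_norm..].
by have := condE_contract L iB; lra.
Qed.
End Density.

(** * Summability of the decay *)

Section PowerSum.
Variables (R : realType) (e : R).
Hypothesis e0 : 0 < e.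

Definition dec (n : nat) : R := (n.+1)%:R `^ (- (1 + e)).

Lemma dec_ge0 n : 0 <= dec n.
Proof. exact: powR_ge0. Qed.

(** A discrete derivative of $x^{-e}$, from which the sum of [dec] is bounded by telescoping. *)
Let dec_step (x : R) : 0 < x -> e * (x + 1) `^ (- (1 + e)) <= x `^ (- e) - (x + 1) `^ (- e).
Proof.
move=> x0; set y := x + 1; have y0 : 0 < y by rewrite addr_gt0.
have yn : y != 0 by rewrite gt_eqF.
have t0 : 0 < 1 + - y^-1.
  by rewrite -(@pmulr_lgt0 _ y) // mulrDl mul1r mulNr mulVf // /y; lra.
have xE : x = y * (1 + - y^-1) by rewrite mulrDr mulr1 mulrN mulfV // /y; ring.
rewrite {1}xE powRM ?(ltW y0) ?(ltW t0) // opprD powRD ?yn ?implybT // powR_inv1 ?(ltW y0) //.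
have h : 1 + e * y^-1 <= (1 + - y^-1) `^ (- e).
  rewrite /powR gt_eqF //; apply: le_trans (expR_ge1Dx _).
  rewrite lerD2l mulNr -mulrN ler_wpM2l ?(ltW e0) // lerNr; apply: le_ln1Dx.
  by rewrite -subr_gt0 opprK addrC.
have := ler_wpM2l (powR_ge0 y (- e)) h; set u := y `^ _; set v := _ `^ _ => hh.
by rewrite (_ : e * (y^-1 * u) = u * (1 + e / y) - u); [lra|ring].
Qed.

Lemma dec_sum N : \sum_(n < N) dec n <= 1 + e^-1.
Proof.
case: N => [|N]; first by rewrite big_ord0 addr_ge0 // invr_ge0 ltW.
apply: (@le_trans _ _ (1 + e^-1 * (1 - (N.+1)%:R `^ (- e)))); last first.
  by rewrite lerD2l ler_piMr ?invr_ge0 ?(ltW e0) // gerBl powR_ge0.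
elim: N => [|N ih]; first by rewrite big_ord1 /dec !powR1 subrr mulr0 addr0.
rewrite big_ord_recr /=; have := dec_step (ltr0Sn R N).
rewrite natr1 -/(dec N.+1) mulrC -ler_pdivlMr // [X in _ <= X]mulrC => h.
by have := lerD ih h; rewrite -addrA -mulrDr addrA subrK.
Qed.

Definition dn (i j : nat) : nat := ((i - j) + (j - i))%N.

Let dist_sum i Q : \sum_(q < Q) dec (dn i q) <= 2%:R * (1 + e^-1).
Proof.
rewrite mulrDl mul1r.
have h q : dec (dn i q) <= (if (q < i.+1)%N then dec (i - q) else 0) +
    (if (i <= q)%N then dec (q - i) else 0).
  rewrite ltnS /dn; case: (leqP q i) => qi.
    by rewrite (eqP qi) addn0 lerDl; case: ifP => // _; exact: dec_ge0.
  by rewrite (ltnW qi) add0r (eqP (ltnW qi : (i - q == 0)%N)).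
apply: le_trans (ler_sum _ (fun (q : 'I_Q) _ => h q)) _; rewrite big_split /=.
have dr (P : pred nat) (F : nat -> R) : (forall n, 0 <= F n) ->
    \sum_(q < Q) (if P q then F q else 0) <= \sum_(q < maxn Q i.+1) (if P q then F q else 0).
  move=> F0; rewrite (big_ord_widen _ (fun q => if P q then F q else 0) (leq_maxl Q i.+1)).
  rewrite [leLHS]big_mkcond; apply: ler_sum => q _.
  by case: ifP => // _; case: ifP.
apply: lerD.
  apply: le_trans (dr (fun q => (q < i.+1)%N) (fun q => dec (i - q)) (fun _ => dec_ge0 _)) _.
  rewrite -big_mkcond -(big_ord_widen _ (fun q => dec (i - q)) (leq_maxr Q i.+1)).
  rewrite (reindex_inj rev_ord_inj) /=; apply: le_trans (dec_sum i.+1).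
  by apply: ler_sum => q _; rewrite subSS subKn // -ltnS.
rewrite -big_mkcond -(big_mkord (fun q => i <= q)%N (fun q => dec (q - i))).
have [Qi|iQ] := leqP Q i.
  rewrite big_nat_cond big1 ?addr_ge0 ?invr_ge0 ?(ltW e0) // => q /andP[/andP[_ h1] h2].
  by move: (leq_trans h2 (ltnW h1)); lia.
rewrite (@big_cat_nat _ _ _ i) ?(ltnW iQ) //= big_nat_cond big1 ?add0r => [|q]; last lia.
rewrite -[X in \sum_(X <= _ < _ | _) _]add0n big_addn big_mkord; apply: le_trans (dec_sum (Q - i)).
rewrite [leLHS]big_mkcond; apply: ler_sum => q _.
by rewrite addnK; case: ifP => // _; exact: dec_ge0.
Qed.

Let block_sum (F : nat -> R) m Q : (0 < m)%N ->
  \sum_(j < Q * m) F (j %/ m)%N = m%:R * \sum_(q < Q) F q.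
Proof.
move=> m0; elim: Q => [|Q ih]; first by rewrite mul0n !big_ord0 mulr0.
rewrite big_ord_recr /= mulrDr -ih -!(big_mkord xpredT (fun j => F (j %/ m)%N)).
rewrite (@big_cat_nat _ _ _ (Q * m)) //= ?leq_mul2r ?leqnSn ?orbT //; congr (_ + _).
rewrite (eq_big_nat _ _ (F2 := fun=> F Q)) => [|j /andP[h1 h2]]; last first.
  by congr F; apply/eqP; rewrite eqn_leq leq_divRL // h1 andbT -ltnS ltn_divLR // .
by rewrite sumr_const_nat mulSn addnK mulr_natl.
Qed.

Lemma coord_sum L k i : (k <= L)%N ->
  \sum_(j < 2 ^ L) dec (dn i (j %/ 2 ^ k)) <= (2 ^ k)%:R * (2%:R * (1 + e^-1)).
Proof.
move=> kL; have -> : (2 ^ L = 2 ^ (L - k) * 2 ^ k)%N by rewrite -expnD subnK.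
by rewrite (block_sum (fun q => dec (dn i q))) ?expn_gt0 //; apply: ler_wpM2l => //; exact: dist_sum.
Qed.

(** A product of one-dimensional decays in the block distances, each with exponent above 1, so that
    the sum over the plane factors. The value of [e] used below is half of the Hoelder exponent of
    the kernel. *)
Definition decay_kap L (C : R) k (x y : cell L) : R := C * (4%:R ^+ k)^-1 *
  (dec (dn (x.1 %/ 2 ^ k) (y.1 %/ 2 ^ k)) * dec (dn (x.2 %/ 2 ^ k) (y.2 %/ 2 ^ k))).

Lemma decay_summable L C : 0 <= C ->
  summable_kernel (@decay_kap L C) (C * (2%:R * (1 + e^-1)) ^+ 2).
Proof.
move=> C0; have c0 k : 0 <= C * (4%:R ^+ k)^-1 :> R by rewrite mulr_ge0 ?invr_ge0 ?exprn_ge0.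
have k0 k (x y : cell L) : 0 <= decay_kap C k x y by rewrite !mulr_ge0 ?dec_ge0 ?c0.
split; first exact: k0.
  move=> k x y y' /and4P[h1 h2 h3 h4]; rewrite /decay_kap.
  have -> : (y.1 %/ 2 ^ k = y'.1 %/ 2 ^ k)%N by lia.
  by have -> : (y.2 %/ 2 ^ k = y'.2 %/ 2 ^ k)%N by lia.
move=> k x kL; apply: (@le_trans _ _ (\sum_y decay_kap C k x y)).
  rewrite big_mkcond; apply: ler_sum => y _; case: ifP => // _; exact: k0.
rewrite -mulr_sumr -(pair_bigA _ (fun i j : 'I_(2 ^ L) =>
  dec (dn (x.1 %/ 2 ^ k) (i %/ 2 ^ k)) * dec (dn (x.2 %/ 2 ^ k) (j %/ 2 ^ k)))) /=.
rewrite -big_distrlr /=.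
set B := 2%:R * (1 + e^-1); have B0 : 0 <= B by rewrite mulr_ge0 // addr_ge0 // invr_ge0 ltW.
have s0 i : 0 <= \sum_(j < 2 ^ L) dec (dn i (j %/ 2 ^ k)) by apply: sumr_ge0 => j _; exact: dec_ge0.
have -> : C * B ^+ 2 = C * (4%:R ^+ k)^-1 * (((2 ^ k)%:R * B) * ((2 ^ k)%:R * B)).
  rewrite natrX; have -> : (4%:R : R) = 2%:R ^+ 2 by rewrite -natrX.
  by rewrite -exprM mulnC exprM; field; rewrite expf_neq0.
by apply: ler_wpM2l => //; apply: ler_pM => //; exact: coord_sum.
Qed.
End PowerSum.

(** * Kernel estimates on blocks *)

Record kernel_reg (R : realType) (C th : R) (k : R * R -> R * R -> R) : Prop := KernelReg {
  kr_size : forall x y, `|k x y| <= C * ((x.1 - y.1) ^+ 2 + (x.2 - y.2) ^+ 2)^-1;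
  kr_fst : forall x y w, `|y.1 - w| <= `|x.1 - y.1| / 2%:R ->
    `|k x y - k x (w, y.2)| <=
      C * (`|y.1 - w| / `|x.1 - y.1|) `^ th * ((x.1 - y.1) ^+ 2 + (x.2 - y.2) ^+ 2)^-1;
  kr_snd : forall x y w, `|y.2 - w| <= `|x.2 - y.2| / 2%:R ->
    `|k x y - k x (y.1, w)| <=
      C * (`|y.2 - w| / `|x.2 - y.2|) `^ th * ((x.1 - y.1) ^+ 2 + (x.2 - y.2) ^+ 2)^-1 }.

Lemma far_dn (i j u v : nat) : ~~ [&& i <= j + 1, j <= i + 1, u <= v + 1 & v <= u + 1]%N ->
  (1 < maxn (dn i j) (dn u v))%N.
Proof.
rewrite !negb_and -!ltnNge leq_max /dn => /or4P[h|h|h|h]; apply/orP; [left|left|right|right]; lia.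
Qed.

Section KernelBlocks.
Variables (R : realType) (C th : R).
Hypotheses (C0 : 0 <= C) (th0 : 0 < th) (th1 : th <= 1).

Let powR_le (a x y : R) : 0 <= a -> 0 <= x -> x <= y -> x `^ a <= y `^ a.
Proof. by move=> a0 x0 xy; apply: ge0_ler_powR; rewrite ?nnegrE // (le_trans x0). Qed.

Let powR_le_base (b x : R) : 1 <= b -> x <= 1 -> b `^ x <= b.
Proof. by move=> b1 x1; rewrite -[leRHS]powRr1 ?ler_powR // (le_trans ler01). Qed.

(** One coordinate moves by at most the block size [h]; [N] is the block distance in this coordinate
    and [D] stands for the larger of the two. For [N >= 3] the move is at most half of the gap and
    the Hoelder bound applies. For [N < 3] the size bound is enough, since [(N + 1) ^ th <= 3];
    hence [24 = 3 * 8]. *)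
Let step_bound (N : nat) (c1 c2 A dl r r' h D : R) : 0 < h -> 0 < D ->
  `|c1| <= C * r^-1 -> `|c2| <= C * r'^-1 ->
  (dl <= A / 2%:R -> `|c1 - c2| <= C * (dl / A) `^ th * r^-1) ->
  0 <= dl -> dl <= h -> N%:R * h - h <= A -> (D * h / 2%:R) ^+ 2 <= r ->
  (D * h / 2%:R) ^+ 2 <= r' ->
  `|c1 - c2| <= 24%:R * C * (h ^+ 2)^-1 * ((D ^+ 2)^-1 * (N.+1)%:R `^ (- th)).
Proof.
move=> h0 D0 s1 s2 hol dl0 dlh NA rD rD'.
have q0 : 0 < (D * h / 2%:R) ^+ 2 by rewrite exprn_gt0 // divr_gt0 // mulr_gt0.
have qE : ((D * h / 2%:R) ^+ 2)^-1 = 4%:R * ((h ^+ 2)^-1 * (D ^+ 2)^-1).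
  by field; rewrite !gt_eqF.
have ri : r^-1 <= 4%:R * ((h ^+ 2)^-1 * (D ^+ 2)^-1).
  by rewrite -qE lef_pV2 ?posrE // (lt_le_trans q0).
have ri' : r'^-1 <= 4%:R * ((h ^+ 2)^-1 * (D ^+ 2)^-1).
  by rewrite -qE lef_pV2 ?posrE // (lt_le_trans q0).
set P := (h ^+ 2)^-1 * (D ^+ 2)^-1 in ri ri' *.
have P0 : 0 <= P by rewrite mulr_ge0 // invr_ge0 exprn_ge0 // ltW.
have N1 : 1 <= (N.+1)%:R :> R by rewrite ler1n.
have n0 : 0 < (N.+1)%:R `^ th :> R by rewrite powR_gt0 // ltr0n.
rewrite powRN; set p := (N.+1)%:R `^ th in n0 *.
have goal (c : R) : c * p <= 24%:R * (C * P) -> c <= 24%:R * C * (h ^+ 2)^-1 * ((D ^+ 2)^-1 * p^-1).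
  move=> hc; rewrite (_ : _ * (_ * p^-1) = 24%:R * (C * P) / p); first by rewrite ler_pdivlMr.
  by rewrite /P; ring.
have CP0 : 0 <= C * P by rewrite mulr_ge0.
apply: goal; have [N3|N3] := leqP 3 N.
  have NR : 3%:R <= N%:R :> R by rewrite ler_nat.
  have A0 : 0 < A by apply: lt_le_trans NA; nra.
  have dA : dl <= A / 2%:R by nra.
  have n1 : 0 < N%:R - 1 :> R by lra.
  have h1 : (dl / A) `^ th * p <= 2%:R.
    rewrite /p -powRM ?divr_ge0 ?(ltW A0) //.
    apply: le_trans (_ : _ <= 2%:R `^ th) _; last by apply: powR_le_base => //; rewrite ler1n.
    apply: powR_le; [exact: ltW|by rewrite mulr_ge0 ?divr_ge0 ?(ltW A0)|].
    by rewrite mulrAC ler_pdivrMr // -natr1; nra.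
  apply: le_trans (ler_wpM2r (ltW n0) (hol dA)) _.
  have r0 : 0 <= r^-1 by rewrite invr_ge0 (le_trans (ltW q0)).
  apply: le_trans (_ : C * (2%:R * (4%:R * P)) <= _); last by nra.
  rewrite -!mulrA ler_wpM2l // mulrA mulrAC; apply: ler_pM => //.
  by rewrite mulr_ge0 ?powR_ge0 // ltW.
have p3 : p <= 3%:R.
  apply: le_trans (_ : _ <= 3%:R `^ th) _; last by apply: powR_le_base => //; rewrite ler1n.
  by apply: powR_le; rewrite ?(ltW th0) // ler_nat.
have c8 : `|c1 - c2| <= 8%:R * (C * P).
  apply: le_trans (ler_normB _ _) _.
  have := ler_wpM2l C0 ri; have := ler_wpM2l C0 ri'; lra.
apply: le_trans (ler_pM (normr_ge0 _) (ltW n0) c8 p3) _; nra.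
Qed.

Let e : R := th / 2%:R.

(** This is the convergence in thin strips. With [e = th / 2] one has [- th = - (1 + e) + (1 - e)],
    and $D^{-2}$ pays at once for [(N1 + 1) ^ (1 - e)] and for [(N2 + 1) ^ (1 + e)], the two
    exponents adding up to 2. *)
Let prod_bound (N1 N2 : nat) (D : R) : 1 <= D -> N1%:R <= D -> N2%:R <= D ->
  (D ^+ 2)^-1 * (N1.+1)%:R `^ (- th) <= 4%:R * (dec e N1 * dec e N2).
Proof.
move=> D1 h1 h2; have D0 : 0 < D by exact: lt_le_trans ltr01 D1.
have e0 : 0 < e by rewrite divr_gt0.
have e1 : e <= 1 by rewrite /e ler_pdivrMr // mul1r (le_trans th1) // ler1n.
have aD : (N1.+1)%:R <= 2%:R * D :> R by rewrite -natr1; lra.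
have bD : (N2.+1)%:R <= 2%:R * D :> R by rewrite -natr1; lra.
have a0 : 0 < (N1.+1)%:R :> R by rewrite ltr0n.
have b0 : 0 < (N2.+1)%:R :> R by rewrite ltr0n.
rewrite mulrC ler_pdivrMr ?exprn_gt0 // /dec.
set a := (N1.+1)%:R in aD a0 *; set b := (N2.+1)%:R in bD b0 *.
have -> : a `^ (- th) = a `^ (- (1 + e)) * a `^ (1 - e).
  by rewrite -powRD ?(gt_eqF a0) ?implybT //; congr (_ `^ _); rewrite /e; field.
have h3 : a `^ (1 - e) <= (2%:R * D) `^ (1 - e) by apply: powR_le; lra.
have h4 : 1 <= b `^ (- (1 + e)) * (2%:R * D) `^ (1 + e).
  have bb : b `^ (- (1 + e)) * b `^ (1 + e) = 1.
    by rewrite -powRD ?(gt_eqF b0) ?implybT // addNr powRr0.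
  by rewrite -[leLHS]bb ler_wpM2l ?powR_ge0 //; apply: powR_le; lra.
have E : (2%:R * D) `^ (1 - e) * (2%:R * D) `^ (1 + e) = 4%:R * D ^+ 2.
  rewrite -powRD; last by apply/implyP => _; rewrite mulf_neq0 ?gt_eqF.
  rewrite (_ : 1 - e + (1 + e) = 2%:R); last by ring.
  by rewrite powR_mulrn ?mulr_ge0 ?(ltW D0) //; ring.
have u0 := powR_ge0 a (- (1 + e)); have v0 := powR_ge0 b (- (1 + e)).
set u := a `^ (- (1 + e)) in u0 *; set v := b `^ (- (1 + e)) in v0 h4 *.
rewrite (_ : 4%:R * (u * v) * D ^+ 2 = u * (v * (4%:R * D ^+ 2))); last by ring.
rewrite ler_wpM2l // -E mulrCA; apply: le_trans h3 _.
by rewrite ler_peMr ?powR_ge0.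
Qed.

Variables (L : nat) (a : R * R) (s : R).
Hypothesis s0 : 0 < s.

Let in_strip (t al h : R) (J : nat) : Prop := al + h * J%:R <= t /\ t < al + h * J%:R + h.

Let strip_of (t al : R) (j k : nat) : al + s * j%:R <= t -> t < al + s * j%:R + s ->
  in_strip t al (s * (2 ^ k)%:R) (j %/ 2 ^ k).
Proof.
move=> h1 h2; have k0 : (0 < 2 ^ k)%N by rewrite expn_gt0.
have dj := divn_eq j (2 ^ k); have mj := ltn_pmod j k0.
have e1 : ((j %/ 2 ^ k) * 2 ^ k <= j)%N by lia.
have e2 : (j + 1 <= (j %/ 2 ^ k) * 2 ^ k + 2 ^ k)%N by lia.
rewrite -(ler_nat R) natrM in e1; rewrite -(ler_nat R) !natrD natrM in e2.
have := ler_wpM2l (ltW s0) e1; have := ler_wpM2l (ltW s0) e2.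
rewrite /in_strip; set p := (2 ^ k)%:R; set d := (j %/ 2 ^ k)%:R => g1 g2.
by split; nra.
Qed.

Let strip_dist (t v al h : R) (J I : nat) : 0 < h -> in_strip t al h J -> in_strip v al h I ->
  (dn I J)%:R * h - h <= `|t - v|.
Proof.
move=> h0 [h1 h2] [h3 h4]; rewrite /dn.
have [JI|IJ] := leqP J I.
  have -> : (I - J + (J - I) = I - J)%N by rewrite (eqP JI) addn0.
  by rewrite natrB // distrC; have := ler_norm (v - t); nra.
have -> : (I - J + (J - I) = J - I)%N by rewrite (eqP (ltnW IJ : (I - J == 0)%N)).
by rewrite natrB ?(ltnW IJ) //; have := ler_norm (t - v); nra.
Qed.

Let strip_near (v w al h : R) (I : nat) : in_strip v al h I -> in_strip w al h I -> `|v - w| <= h.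
Proof. by move=> [h1 h2] [h3 h4]; rewrite ler_norml; apply/andP; split; lra. Qed.

Definition in_block (k : nat) (x0 : cell L) (v : R * R) : Prop :=
  in_strip v.1 a.1 (s * (2 ^ k)%:R) (x0.1 %/ 2 ^ k) /\
  in_strip v.2 a.2 (s * (2 ^ k)%:R) (x0.2 %/ 2 ^ k).

Lemma gcell_in_block k x0 x v : nb 0 k x0 x -> gcell a s x v -> in_block k x0 v.
Proof.
move=> /and4P[h1 h2 h3 h4] /squareP/=[g1 g2 g3 g4].
rewrite !addn0 in h1 h2 h3 h4.
have e1 : (x0.1 %/ 2 ^ k = x.1 %/ 2 ^ k)%N by apply/eqP; rewrite eqn_leq h1.
have e2 : (x0.2 %/ 2 ^ k = x.2 %/ 2 ^ k)%N by apply/eqP; rewrite eqn_leq h3.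
by rewrite /in_block e1 e2; split; exact: strip_of.
Qed.

Let far_sq k x0 y z v : ~~ nb 1 k x0 y -> gcell a s y z -> in_block k x0 v ->
  let h := s * (2 ^ k)%:R in
  let N1 := dn (x0.1 %/ 2 ^ k) (y.1 %/ 2 ^ k) in
  let N2 := dn (x0.2 %/ 2 ^ k) (y.2 %/ 2 ^ k) in
  let D := (maxn N1 N2)%:R in
  [/\ 1 <= D, N1%:R * h - h <= `|z.1 - v.1|, N2%:R * h - h <= `|z.2 - v.2| &
      (D * h / 2%:R) ^+ 2 <= (z.1 - v.1) ^+ 2 + (z.2 - v.2) ^+ 2].
Proof.
move=> nxy gz [b1 b2] h N1 N2 D; move/squareP: gz => /= [g1 g2 g3 g4].
have h0 : 0 < h by rewrite mulr_gt0 // ltr0n expn_gt0.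
have d1 := strip_dist h0 (strip_of k g1 g2) b1; have d2 := strip_dist h0 (strip_of k g3 g4) b2.
have D2 : (2 <= maxn N1 N2)%N.
  exact: far_dn nxy.
have DR : 2%:R <= D :> R by rewrite ler_nat.
split => //; first by rewrite (le_trans _ DR) // ler1n.
have q (N : nat) (u : R) : D = N%:R -> N%:R * h - h <= `|u| -> (D * h / 2%:R) ^+ 2 <= u ^+ 2.
  move=> DN hu; rewrite -[leRHS]real_normK ?num_real // ler_sqr ?nnegrE //.
    by rewrite DN in DR *; nra.
  by rewrite divr_ge0 // mulr_ge0 // ltW.
rewrite /D /maxn; case: ltnP => cmp.
  have := q N2 _ _ d2; rewrite /D /maxn cmp => /(_ erefl) hq.
  by apply: le_trans hq _; rewrite lerDr sqr_ge0.
have := q N1 _ _ d1; rewrite /D /maxn ltnNge cmp /= => /(_ erefl) hq.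
by apply: le_trans hq _; rewrite lerDl sqr_ge0.
Qed.

Variable (k : R * R -> R * R -> R).
Hypothesis kr : kernel_reg C th k.

(** A crude bound that does not depend on the positions; it provides integrability. *)
Lemma kernel_far m x0 y z v : ~~ nb 1 m x0 y -> gcell a s y z -> in_block m x0 v ->
  `|k z v| <= C * ((s / 2%:R) ^+ 2)^-1.
Proof.
move=> nxy gz bv; have [D1 _ _ hr] := far_sq nxy gz bv.
apply: le_trans (kr_size kr z v) _; rewrite ler_wpM2l //.
have s2 : 0 < s / 2%:R by rewrite divr_gt0.
set D := (maxn _ _)%:R in D1 hr.
have le : (s / 2%:R) ^+ 2 <= (D * (s * (2 ^ m)%:R) / 2%:R) ^+ 2.
  have p1 : 1 <= (2 ^ m)%:R :> R by rewrite ler1n expn_gt0.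
  have sp : s <= s * (2 ^ m)%:R by rewrite ler_peMr // ltW.
  have Dp : s * (2 ^ m)%:R <= D * (s * (2 ^ m)%:R).
    by rewrite ler_peMl // (le_trans (ltW s0)).
  have q2 : s / 2%:R <= D * (s * (2 ^ m)%:R) / 2%:R.
    by rewrite ler_pM2r ?invr_gt0 ?ltr0n // (le_trans sp).
  by rewrite ler_sqr ?nnegrE ?(ltW s2) // (le_trans (ltW s2)).
by rewrite lef_pV2 ?posrE ?exprn_gt0 // ?(le_trans le) // (lt_le_trans _ (le_trans le hr)) ?exprn_gt0.
Qed.

(** One coordinate is moved at a time, through the point [(c1, v.2)]; each move contributes
    [24 * 4], together 192. *)
Lemma kernel_block m x0 y z v c : ~~ nb 1 m x0 y -> gcell a s y z ->
  in_block m x0 v -> in_block m x0 c ->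
  `|k z v - k z c| <= (s ^+ 2)^-1 * decay_kap e (192%:R * C) m x0 y.
Proof.
move=> nxy gz bv; case: c => c1 c2 bc.
have bw : in_block m x0 (c1, v.2) by case: bv bc => [? ?] [? ?].
have [D1 n1 n2 r1] := far_sq nxy gz bv; have [_ m1 m2 r2] := far_sq nxy gz bw.
have [_ _ _ r3] := far_sq nxy gz bc; simpl in m1, m2, r2.
set h := s * _ in n1 n2 r1 m1 m2 r2 r3.
have h0 : 0 < h by rewrite mulr_gt0 // ltr0n expn_gt0.
set N1 := dn _ _ in D1 n1 n2 r1 m1 m2 r2 r3; set N2 := dn (x0.2 %/ _) _ in D1 n1 n2 r1 m1 m2 r2 r3.
set D := (maxn N1 N2)%:R in D1 r1 r2 r3; have D0 : 0 < D by exact: lt_le_trans ltr01 D1.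
have := step_bound h0 D0 (kr_size kr z v) (kr_size kr z (c1, v.2)) (kr_fst kr (x := z) (y := v) (w := c1))
  (normr_ge0 _) (strip_near bv.1 bc.1) n1 r1 r2.
have := step_bound h0 D0 (kr_size kr z (c1, v.2)) (kr_size kr z (c1, c2))
  (kr_snd kr (x := z) (y := (c1, v.2)) (w := c2)) (normr_ge0 _) (strip_near bv.2 bc.2) m2 r2.
move=> /(_ r3) s2 s1.
have p1 := prod_bound (N1 := N1) (N2 := N2) D1; have p2 := prod_bound (N1 := N2) (N2 := N1) D1.
rewrite !ler_nat !leq_maxl !leq_maxr in p1 p2; have {}p1 := p1 isT isT; have {}p2 := p2 isT isT.
rewrite -(subrKA (k z (c1, v.2))); apply: le_trans (ler_normD _ _) _.
have K0 : 0 <= 24%:R * C * (h ^+ 2)^-1 by rewrite !mulr_ge0 ?invr_ge0 ?exprn_ge0 ?ler0n // ltW.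
have t1 := le_trans s1 (ler_wpM2l K0 p1); have t2 := le_trans s2 (ler_wpM2l K0 p2).
apply: le_trans (lerD t1 t2) _; rewrite /decay_kap -/N1 -/N2 le_eqVlt; apply/orP; left; apply/eqP.
have -> : h ^+ 2 = s ^+ 2 * 4%:R ^+ m.
  by rewrite /h exprMn natrX -!exprM mulnC exprM; congr (_ * _ ^+ _); ring.
set P := dec _ _ * dec _ _; rewrite (mulrC (dec _ N2)) -/P invfM.
set u := (s ^+ 2)^-1; set t := (4%:R ^+ m)^-1.
have ar (c u' t' P' : R) : 24%:R * c * (u' * t') * (4%:R * P') + 24%:R * c * (u' * t') * (4%:R * P') =
  u' * (192%:R * c * t' * P') by ring.
exact: ar.
Qed.
End KernelBlocks.

(** * Integrals over products of squares *)

Section ProductIntegrals.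
Variable R : realType.
Local Notation mu := (@leb2 R).
Local Notation pm := (@leb2 R \x @leb2 R)%E.

Lemma Rint_swap (F : borel2 R * borel2 R -> R) : rint pm F -> rint pm (fun z => F (z.2, z.1)) ->
  \int[pm]_z F (z.2, z.1) = \int[pm]_z F z.
Proof.
move=> iF iG; rewrite /Rintegral -(integral12_prod_meas1 iG) -(integral21_prod_meas1 iF).
by [].
Qed.

Lemma Rint_fst_mul (F : borel2 R -> R) (A : set (borel2 R)) : rint mu F -> measurable A ->
  (mu A < +oo)%E -> rint pm (fun z => F z.1 * \1_A z.2) ->
  \int[pm]_z (F z.1 * \1_A z.2) = \int[mu]_z F z * fine (mu A).
Proof.
move=> iF mA fA iFA; rewrite /Rintegral -(integral12_prod_meas1 iFA) mulrC.
rewrite -[RHS](RintZ (fine (mu A)) iF); congr fine; apply: eq_integral => x _.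
rewrite /fubini_F /=; under eq_integral do rewrite EFinM.
rewrite integralZl // ?integral_indic // ?setIT; last exact: (rint_indic mA fA).
by rewrite muleC EFinM fineK // ge0_fin_numE.
Qed.

Lemma rint_pm_bounded (F : borel2 R * borel2 R -> R) (B : R) a l b m :
  measurable_fun setT F ->
  (forall z, `|F z| <= B * (\1_(square b m) z.2 * \1_(square a l) z.1)) -> rint pm F.
Proof.
move=> mF h; apply: (@rint_bounded _ _ _ pm (square a l `*` square b m) _ B) => //.
- by apply: measurableX; exact: measurable_square.
- apply: (@le_lt_trans _ _ (mu (square a l) * mu (square b m))%E).
    rewrite le_eqVlt; apply/orP; left; apply/eqP.
    by apply: product_measure1E; exact: measurable_square.
  by rewrite lte_mul_pinfty ?ge0_fin_numE ?leb2_square_fin.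
move=> z; apply: le_trans (h z) _; rewrite !indicE.
rewrite (_ : (z \in _) = (z.1 \in square a l) && (z.2 \in square b m)); last exact: in_setX.
by case: (_ \in square a l); case: (_ \in square b m); rewrite /= ?(mulr0n,mulr1n,mulr0,mul0r,mulr1).
Qed.

Lemma Rint_cells a l b m : 0 <= l -> 0 <= m ->
  \int[pm]_z (\1_(square b m) z.2 * \1_(square a l) z.1 : R) = l ^+ 2 * m ^+ 2.
Proof.
move=> l0 m0; under eq_Rintegral do rewrite mulrC.
rewrite Rint_fst_mul; [|exact: rint_square|exact: measurable_square|exact: leb2_square_fin|].
  by rewrite Rint_square // [mu _](leb2_square b m0).
apply: (@rint_pm_bounded _ 1 a l b m) => [|z].
  by apply: measurable_funM; (apply: measurableT_comp; [exact: measurable_indic (measurable_square _ _)|]);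
    [exact: measurable_fst|exact: measurable_snd].
by rewrite mul1r mulrC ger0_norm // mulr_ge0 // indicE.
Qed.
End ProductIntegrals.

(** * Matrix entries away from the diagonal *)

Section CellKernel.
Variables (R : realType) (C th : R).
Hypotheses (C0 : 0 <= C) (th0 : 0 < th) (th1 : th <= 1).
Local Notation mu := (@leb2 R).
Local Notation pm := (@leb2 R \x @leb2 R)%E.
Variables (L : nat) (a : R * R) (s : R).
Hypothesis s0 : 0 < s.
Local Notation G := (gcell a s).
Variable (k : R * R -> R * R -> R).
Hypothesis kr : kernel_reg C th k.
Hypothesis mk : measurable_fun setT (fun z : borel2 R * borel2 R => k z.1 z.2).

Let mpre (A : set (borel2 R)) (f : borel2 R * borel2 R -> borel2 R) : measurable A ->
  measurable_fun setT f -> measurable_fun setT (fun z => \1_A (f z) : R).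
Proof. by move=> mA mf; apply: measurableT_comp => //; exact: measurable_indic. Qed.

Definition corner m (x0 : cell L) : R * R :=
  (a.1 + s * (2 ^ m)%:R * (x0.1 %/ 2 ^ m)%:R, a.2 + s * (2 ^ m)%:R * (x0.2 %/ 2 ^ m)%:R).

Lemma corner_in_block m x0 : in_block a s m x0 (corner m x0).
Proof. by have h0 : 0 < s * (2 ^ m)%:R; rewrite ?mulr_gt0 ?ltr0n ?expn_gt0 //; split; split => //=; lra. Qed.

Let bound : R := C * ((s / 2%:R) ^+ 2)^-1.

Lemma rint_kernel_cells m x0 (x y : cell L) : nb 0 m x0 x -> ~~ nb 1 m x0 y ->
  rint pm (fun z => k z.1 z.2 * \1_(G x) z.2 * \1_(G y) z.1).
Proof.
move=> nx ny; have mG t := @measurable_gcell R L a s t.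
apply: (@rint_pm_bounded _ _ bound (a.1 + s * (y.1)%:R, a.2 + s * (y.2)%:R) s
  (a.1 + s * (x.1)%:R, a.2 + s * (x.2)%:R) s).
  by apply: measurable_funM; [apply: measurable_funM => //|]; apply: mpre.
move=> z; rewrite -mulrA normrM [X in _ * X]ger0_norm ?mulr_ge0 ?indicE //.
have [hx|hx] := pselect (G x z.2); last first.
  by rewrite !(memNset hx) !mul0r !mulr0.
have [hy|hy] := pselect (G y z.1); last first.
  by rewrite !(memNset hy) !mulr0.
rewrite ler_wpM2r ?mulr_ge0 //.
exact (kernel_far C0 th0 th1 s0 kr ny hy (gcell_in_block C0 th0 th1 s0 nx hx)).
Qed.

(** In the subtracted integral the second argument is frozen at the corner of the block, so it does
    not depend on the cell [x] within the block and disappears when tested on a mean zero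
    function. *)
Lemma cell_kernel m x0 (x y : cell L) : nb 0 m x0 x -> ~~ nb 1 m x0 y ->
  `|(s ^+ 2)^-1 * \int[pm]_z (k z.1 z.2 * \1_(G x) z.2 * \1_(G y) z.1) -
    \int[mu]_z (k z (corner m x0) * \1_(G y) z)| <= decay_kap (th / 2%:R) (192%:R * C) m x0 y.
Proof.
move=> nx ny; have mG t := @measurable_gcell R L a s t.
have s2 : 0 < s ^+ 2 by rewrite exprn_gt0.
set p := corner m x0; set K := decay_kap _ _ _ _ _.
have bp := corner_in_block m x0.
have mkp : measurable_fun setT (fun z : borel2 R => k z p).
  exact: (@measurable_fun_pair1 _ _ _ _ _ _ (fun z : borel2 R * borel2 R => k z.1 z.2) p mk).
have i1 := rint_kernel_cells nx ny.
have iF : rint mu (fun z => k z p * \1_(G y) z).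
  apply: (@rint_bounded _ _ _ mu (G y) _ bound) => //; first exact: leb2_square_fin.
    by apply: measurable_funM => //; exact: measurable_indic.
  move=> z; rewrite normrM [X in _ * X]ger0_norm ?indicE //.
  have [hy|hy] := pselect (G y z); last by rewrite memNset // !mulr0.
  by rewrite ler_wpM2r //; exact (kernel_far C0 th0 th1 s0 kr ny hy bp).
have i2 : rint pm (fun z => (k z.1 p * \1_(G y) z.1) * \1_(G x) z.2).
  apply: (@rint_pm_bounded _ _ bound (a.1 + s * (y.1)%:R, a.2 + s * (y.2)%:R) s
    (a.1 + s * (x.1)%:R, a.2 + s * (x.2)%:R) s).
    by apply: measurable_funM; [apply: measurable_funM|]; [exact: (measurableT_comp mkp)|exact: mpre..].
  move=> z; rewrite -mulrA normrM [X in _ * X]ger0_norm ?mulr_ge0 ?indicE // [X in _ <= _ * X]mulrC.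
  have [hy|hy] := pselect (G y z.1); last first.
    by rewrite !(memNset hy) !mul0r !mulr0.
  by rewrite ler_wpM2r ?mulr_ge0 //; exact (kernel_far C0 th0 th1 s0 kr ny hy bp).
have e2 : \int[mu]_z (k z p * \1_(G y) z) =
    (s ^+ 2)^-1 * \int[pm]_z ((k z.1 p * \1_(G y) z.1) * \1_(G x) z.2).
  rewrite (Rint_fst_mul iF (mG x) (leb2_square_fin _ _) i2).
  by rewrite [mu _](leb2_square _ (ltW s0)) /= mulrC mulfK // gt_eqF.
rewrite e2 -mulrBr -RintB // normrM ger0_norm ?invr_ge0 ?(ltW s2) // mulrC ler_pdivrMr //.
apply: le_trans (Rint_norm (rintB i1 i2)) _.
have K0 : 0 <= K by rewrite !mulr_ge0 ?dec_ge0 ?invr_ge0 ?exprn_ge0 // ler0n.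
have iB : rint pm (fun z => \1_(G x) z.2 * \1_(G y) z.1).
  apply: (@rint_pm_bounded _ _ 1 (a.1 + s * (y.1)%:R, a.2 + s * (y.2)%:R) s
    (a.1 + s * (x.1)%:R, a.2 + s * (x.2)%:R) s); first by apply: measurable_funM; exact: mpre.
  by move=> z; rewrite mul1r ger0_norm // mulr_ge0 // indicE.
apply: le_trans (_ : _ <= \int[pm]_z ((s ^+ 2)^-1 * K * (\1_(G x) z.2 * \1_(G y) z.1))) _.
  apply: Rint_le; [by apply: rint_norm; exact: rintB|exact: rintZ|] => z.
  rewrite (_ : _ - _ = (k z.1 z.2 - k z.1 p) * (\1_(G x) z.2 * \1_(G y) z.1)); last by ring.
  rewrite normrM [X in _ * X <= _]ger0_norm ?mulr_ge0 ?indicE //.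
  have [hx|hx] := pselect (G x z.2); last by rewrite (memNset hx) !mul0r !mulr0.
  have [hy|hy] := pselect (G y z.1); last by rewrite (memNset hy) !mulr0.
  rewrite ler_wpM2r ?mulr_ge0 //.
  exact (kernel_block C0 th0 th1 s0 kr ny hy (gcell_in_block C0 th0 th1 s0 nx hx) bp).
rewrite RintZ // Rint_cells ?(ltW s0) // le_eqVlt; apply/orP; left; apply/eqP.
by field; rewrite gt_eqF.
Qed.
End CellKernel.

(** * Real operators and their matrices *)

(** What is kept of the real or the imaginary part of the operator. The kernel represents it on step
    functions of one grid without common cells; on the diagonal the operator is seen through [rc_bd]
    alone. *)
Record real_cz (R : realType) (M C th : R) (S : (borel2 R -> R) -> borel2 R -> R)
    (k : R * R -> R * R -> R) : Prop := RealCZ {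
  rc_L2 : forall u, L2 (@leb2 R) u -> L2 (@leb2 R) (S u);
  rc_lin : forall (c : R) u v, L2 (@leb2 R) u -> L2 (@leb2 R) v ->
    {ae @leb2 R, forall x, S (fun t => c * u t + v t) x = c * S u x + S v x};
  rc_bd : forall u, L2 (@leb2 R) u -> nsq (@leb2 R) (S u) <= M ^+ 2 * nsq (@leb2 R) u;
  rc_ker : forall L a s (c d : cell L -> R), 0 < s -> (forall x, c x = 0 \/ d x = 0) ->
    pr (@leb2 R) (S (stepf a s c)) (stepf a s d) =
    \int[(@leb2 R \x @leb2 R)%E]_z (k z.1 z.2 * stepf a s c z.2 * stepf a s d z.1);
  rc_reg : kernel_reg C th k;
  rc_regT : kernel_reg C th (fun x y => k y x);
  rc_meas : measurable_fun setT (fun z : borel2 R * borel2 R => k z.1 z.2) }.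

Lemma le_double (R : realType) (x y z : R) : x <= y -> 0 <= y -> 0 <= z -> x + z <= (y + z) * 2%:R.
Proof. by move=> *; lra. Qed.

Section RealOperator.
Variables (R : realType) (M C th : R) (S : (borel2 R -> R) -> borel2 R -> R).
Variable (k : R * R -> R * R -> R).
Hypotheses (M0 : 0 < M) (C0 : 0 <= C) (th0 : 0 < th) (th1 : th <= 1).
Hypothesis rc : real_cz M C th S k.
Local Notation mu := (@leb2 R).
Local Notation pm := (@leb2 R \x @leb2 R)%E.

Lemma prS_lin (c : R) u v h : L2 mu u -> L2 mu v -> L2 mu h ->
  pr mu (S (fun t => c * u t + v t)) h = c * pr mu (S u) h + pr mu (S v) h.
Proof.
move=> Lu Lv Lh; have Lc := L2D (L2Z c Lu) Lv.
have [[Su Sv] Sc] := (rc_L2 rc Lu, rc_L2 rc Lv, rc_L2 rc Lc).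
rewrite (@pr_ae _ _ _ mu _ (fun x => c * S u x + S v x)).
- by rewrite prDl ?prZl //; exact: L2Z.
- by case: Sc.
- by case: (L2D (L2Z c Su) Sv).
- by case: Lh.
- exact: rc_lin rc c _ _ Lu Lv.
Qed.

Lemma prS_bound u v (t : R) : 0 < t -> L2 mu u -> L2 mu v ->
  `|pr mu (S u) v| <= M * (t * nsq mu u + t^-1 * nsq mu v).
Proof.
move=> t0 Lu Lv; have tM : 0 < t / M by rewrite divr_gt0.
apply: le_trans (pr_le tM (rc_L2 rc Lu) Lv) _.
have h := rc_bd rc Lu; have n0 := nsq_ge0 mu u; have m0 := nsq_ge0 mu v.
have h1 : t / M * nsq mu (S u) <= M * (t * nsq mu u).
  rewrite (_ : M * _ = t / M * (M ^+ 2 * nsq mu u)); last by field; rewrite gt_eqF.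
  by rewrite ler_wpM2l // ltW.
rewrite ler_pdivrMr // (_ : (t / M)^-1 = M * t^-1); last by field; rewrite !gt_eqF.
have ti : 0 <= t^-1 by rewrite invr_ge0 ltW.
have h2 := mulr_ge0 (ltW M0) (mulr_ge0 ti m0).
have h3 := mulr_ge0 (ltW M0) (mulr_ge0 (ltW t0) n0).
by rewrite [M * (_ + _)]mulrDr -[M * t^-1 * _]mulrA; exact: le_double h1 h3 h2.
Qed.

Section Discrete.
Variables (L : nat) (a : R * R) (s : R).
Hypothesis s0 : 0 < s.
Local Notation st := (@stepf R L a s).
Local Notation ee x := (st (fun t : cell L => (t == x)%:R)).

(** Normalised so that pairing step functions gives [s ^ 2] times the form; the $L^2$ bound then
    becomes [l2_bounded] with the same [M] on every grid. *)
Definition cbeta (x y : cell L) : R := (s ^+ 2)^-1 * pr mu (S (ee x)) (ee y).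

Lemma stepf_delta x : (ee x) = \1_(gcell a s x).
Proof.
apply/funext => z; rewrite /stepf (bigD1 x) //= eqxx mul1r big1 ?addr0 // => y /negPf ->.
by rewrite mul0r.
Qed.

Lemma prS_stepf (f : cell L -> R) v : L2 mu v ->
  pr mu (S (st f)) v = \sum_x f x * pr mu (S (ee x)) v.
Proof.
move=> Lv; have Le x : L2 mu (ee x) by exact: L2_stepf.
have L0 : L2 mu (fun=> 0 : R).
  rewrite (_ : (fun=> 0) = (fun z => 0 * st (fun=> 0) z)); last by apply/funext => z; rewrite mul0r.
  by apply: L2Z; exact: L2_stepf.
have S0 : pr mu (S (fun=> 0)) v = 0.
  have E0 : (fun t : borel2 R => 1 * (0 : R) + 0) = fun=> 0.
    by apply/funext => t; rewrite mulr0 addr0.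
  have := prS_lin 1 L0 L0 Lv; rewrite /= E0 mul1r.
  by move=> h; apply: (@addrI _ (pr mu (S (fun=> 0)) v)); rewrite addr0 -h.
have E : st f = fun z => \sum_(x : cell L) f x * (ee x) z.
  by apply/funext => z; apply: eq_bigr => x _; rewrite stepf_delta.
rewrite E; elim: (index_enum _) => [|x r ih].
  rewrite big_nil; under eq_fun do rewrite big_nil; exact: S0.
rewrite big_cons -ih -prS_lin //.
  by congr (pr mu (S _) v); apply/funext => z; rewrite big_cons.
elim: r {ih} => [|y r ih]; first by under eq_fun do rewrite big_nil.
by under eq_fun do rewrite big_cons; apply: L2D => //; exact: L2Z.
Qed.

Lemma prS_bil (f g : cell L -> R) : pr mu (S (st f)) (st g) = s ^+ 2 * bil cbeta f g.
Proof.
have s2 : s ^+ 2 != 0 by rewrite expf_neq0 // gt_eqF.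
rewrite prS_stepf; last exact: L2_stepf.
rewrite /bil mulr_sumr; apply: eq_bigr => x _; rewrite mulr_sumr.
have LS : L2 mu (S (ee x)) by apply: (rc_L2 rc); exact: L2_stepf.
have iw b m : rint mu (fun z => S (ee x) z * \1_(square b m) z).
  apply: L2_mul => //; apply: (L2_bounded (measurable_square b m) (leb2_square_fin b m) (M := 1)).
    exact: measurable_indic (measurable_square _ _).
  by move=> z; rewrite mul1r ger0_norm // indicE.
rewrite prC /pr Rint_stepf_mul // mulr_sumr; apply: eq_bigr => y _.
rewrite /cbeta /pr !stepf_delta; set I := \int[mu]_z _.
have ar (u v i c : R) : c != 0 -> u * (v * i) = c * (u * v * (c^-1 * i)) by move=> h; field.
exact: ar.
Qed.

Lemma cbeta_ker x y : x != y -> cbeta x y = (s ^+ 2)^-1 *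
  \int[pm]_z (k z.1 z.2 * \1_(gcell a s x) z.2 * \1_(gcell a s y) z.1).
Proof.
move=> xy; rewrite /cbeta (rc_ker rc) // ?stepf_delta //.
move=> t; case: (eqVneq t x) => [->|_]; [right|by left].
by rewrite (negPf xy).
Qed.

Let e : R := th / 2%:R.

(** None of the constants depends on [L], [a] or [s]. The transposed condition follows from
    regularity in the other variable of the kernel, after the two variables of integration are
    exchanged. *)
Lemma cbeta_cz : discrete_cz M (192%:R * C * (2%:R * (1 + e^-1)) ^+ 2) cbeta.
Proof.
have e0 : 0 < e by rewrite divr_gt0.
have s2 : 0 < s ^+ 2 by rewrite exprn_gt0.
have far_ne m x0 (x y : cell L) : nb 0 m x0 x -> ~~ nb 1 m x0 y -> x != y.
  by move=> nx ny; apply/eqP => xy; move: ny; rewrite -xy (nb_leq _ nx).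
(* A part [al] of the entry that is the same for all cells [x] of the block is annihilated by the
   mean zero function. *)
have gen (be : cell L -> cell L -> R) (kap : nat -> cell L -> cell L -> R)
    (al : nat -> cell L -> cell L -> R) :
    (forall m x0 x y, nb 0 m x0 x -> ~~ nb 1 m x0 y -> `|be x y - al m x0 y| <= kap m x0 y) ->
    cancels kap be.
  move=> h m x0 b y mL bs sb ny.
  rewrite (_ : \sum_x _ = \sum_x b x * (be x y - al m x0 y)); last first.
    under [RHS]eq_bigr do rewrite mulrBr.
    by rewrite big_split /= sumrN -mulr_suml sb mul0r subr0.
  apply: le_trans (ler_norm_sum _ _ _) _; rewrite mulr_sumr; apply: ler_sum => x _.
  rewrite normrM mulrC; have [nx|nx] := boolP (nb 0 m x0 x); last by rewrite bs // normr0 !mulr0.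
  by rewrite ler_wpM2r // h.
split.
  move=> f g t t0; rewrite -(ler_pM2l s2) -[X in X * `|_|](ger0_norm (ltW s2)) -normrM -prS_bil.
  apply: le_trans (prS_bound t0 (L2_stepf a s0 f) (L2_stepf a s0 g)) _.
  rewrite /nsq; under eq_Rintegral do rewrite (@stepf_map _ _ a s s0 (fun t => t ^+ 2)) ?expr0n //.
  rewrite Rint_stepf //; under eq_Rintegral do rewrite (@stepf_map _ _ a s s0 (fun t => t ^+ 2)) ?expr0n //.
  rewrite Rint_stepf //= le_eqVlt; apply/orP; left; apply/eqP.
  by set F := \sum_x f x ^+ 2; set G := \sum_x g x ^+ 2; ring.
exists (@decay_kap R e L (192%:R * C)); split.
- by apply: decay_summable => //; rewrite mulr_ge0 ?ler0n.
- apply: (gen _ _ (fun m x0 y => \int[mu]_z (k z (corner a s m x0) * \1_(gcell a s y) z))).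
  move=> m x0 x y nx ny; rewrite (cbeta_ker (far_ne _ _ _ _ nx ny)).
  exact (cell_kernel C0 th0 th1 a s0 (rc_reg rc) (rc_meas rc) nx ny).
apply: (gen _ _ (fun m x0 y => \int[mu]_z (k (corner a s m x0) z * \1_(gcell a s y) z))).
move=> m x0 x y nx ny; have yx := far_ne _ _ _ _ nx ny; rewrite eq_sym in yx.
have mT : measurable_fun setT (fun z : borel2 R * borel2 R => k z.2 z.1).
  by have := measurableT_comp (rc_meas rc) (@measurable_swap _ _ (borel2 R) (borel2 R)).
rewrite (cbeta_ker yx).
pose F (z : borel2 R * borel2 R) := k z.1 z.2 * \1_(gcell a s y) z.2 * \1_(gcell a s x) z.1.
have nyx : ~~ nb 1 m y x.
  by apply: contra ny => nyx; rewrite nbC; apply: (nb_trans nyx); rewrite nbC.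
have iF : rint pm F.
  exact (@rint_kernel_cells R C th C0 th0 th1 L a s s0 k (rc_reg rc) (rc_meas rc) m y y x (nbxx 0 m y) nyx).
have iG : rint pm (fun z => F (z.2, z.1)).
  have := @rint_kernel_cells R C th C0 th0 th1 L a s s0 _ (rc_regT rc) mT _ _ _ _ nx ny; congr rint; apply/funext => z.
  by rewrite /F /= mulrAC.
rewrite -(Rint_swap iF iG) /F /=.
have := cell_kernel C0 th0 th1 a s0 (rc_regT rc) mT nx ny.
by under eq_Rintegral do rewrite mulrAC.
Qed.
End Discrete.
End RealOperator.

(** * Hoelder's inequality and powers under integrals *)

Section Hoelder.
Context d (X : measurableType d) (R : realType) (mu : {measure set X -> \bar R}).
Variables (p q : R).
Hypotheses (p1 : 1 < p) (q1 : 1 < q) (pq : p^-1 + q^-1 = 1).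

Let p0 : 0 < p. Proof. exact: lt_trans p1. Qed.
Let q0 : 0 < q. Proof. exact: lt_trans q1. Qed.

Lemma measurable_powR_pos (r : R) (u : X -> R) : measurable_fun setT u ->
  measurable_fun setT (fun x => u x `^ r).
Proof. by move=> mu_; exact: (measurableT_comp (measurable_powR r) mu_). Qed.

Lemma young_root (x y : R) : 0 <= x -> 0 <= y -> x `^ p^-1 * y `^ q^-1 <= x + y.
Proof.
move=> x0 y0; have := conjugate_powR (powR_ge0 x p^-1) (powR_ge0 y q^-1) p0 q0 pq.
rewrite -!powRrM !mulVf ?gt_eqF // !powRr1 // => h; apply: le_trans h _.
by apply: lerD; rewrite ler_pdivrMr // ler_peMr // ltW.
Qed.

Lemma Rint_hoelder (u v : X -> R) : (forall x, 0 <= u x) -> (forall x, 0 <= v x) ->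
  rint mu u -> rint mu v ->
  rint mu (fun x => u x `^ p^-1 * v x `^ q^-1) /\
  \int[mu]_x (u x `^ p^-1 * v x `^ q^-1) <= (\int[mu]_x u x) `^ p^-1 * (\int[mu]_x v x) `^ q^-1.
Proof.
move=> u0 v0 iu iv.
have mf := measurable_powR_pos p^-1 (rint_meas iu).
have mg := measurable_powR_pos q^-1 (rint_meas iv).
have ifg : rint mu (fun x => u x `^ p^-1 * v x `^ q^-1).
  apply: (rint_le (v := fun x => u x + v x)); [exact: measurable_funM| |exact: rintD].
  by move=> x; rewrite !ger0_norm ?addr_ge0 ?mulr_ge0 ?powR_ge0 // young_root.
split => //.
have LN (r : R) (h : X -> R) : 0 < r -> (forall x, 0 <= h x) -> rint mu h ->
    ('N[mu]_r%:E[EFin \o (fun x => (h x `^ r^-1)%R)] = ((\int[mu]_x h x) `^ r^-1)%:E)%E.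
  move=> r0 h0 ih; have rn : r != 0 by rewrite gt_eqF.
  rewrite -[LHS](poweRe1 (Lnorm_ge0 _ _ _)) -(mulfV rn) poweRrM powR_Lnorm //.
  rewrite (_ : (\int[mu]_x _)%E = (\int[mu]_x h x)%:E) ?poweR_EFin //.
  rewrite rintE //; apply: eq_integral => x _.
  change ((`|(h x `^ r^-1)|%R)%:E `^ r = (h x)%:E)%E.
  by rewrite poweR_EFin ger0_norm ?powR_ge0 // -powRrM mulVf // powRr1.
have H := hoelder mu mf mg p0 q0 pq.
rewrite (LN p u) // (LN q v) // Lnorm1 in H.
rewrite -lee_fin EFinM; apply: le_trans _ H; rewrite rintE //.
rewrite le_eqVlt; apply/orP; left; apply/eqP; apply: eq_integral => x _.
by rewrite /= ger0_norm // mulr_ge0 ?powR_ge0.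
Qed.

(** Convexity of the power, read off from Young's inequality without derivatives; it yields the
    Lipschitz bound and the continuity below. *)
Lemma powR_tangent (x y : R) : 0 <= x -> 0 <= y -> y `^ p - x `^ p <= p * y `^ (p - 1) * (y - x).
Proof.
move=> x0 y0; have q_n : q != 0 by rewrite gt_eqF.
have p_n : p != 0 by rewrite gt_eqF.
have e1 : (p - 1) * q = p.
  have : p * q * (p^-1 + q^-1) = p * q by rewrite pq mulr1.
  by rewrite mulrDr mulrAC mulfV // mul1r -mulrA mulfV // mulr1 => ?; lra.
have e2 : p / q = p - 1 by rewrite -{1}e1 mulfK.
have := conjugate_powR x0 (powR_ge0 y (p - 1)) p0 q0 pq.
rewrite -powRrM e1 => h.
have yE : y `^ p = y `^ (p - 1) * y.
  by have := @powRD R y (p - 1) 1; rewrite subrK (negPf p_n) powRr1 // => ->.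
have := ler_wpM2l (ltW p0) h.
rewrite mulrDr mulrCA (mulrC p (_ / p)) mulfVK // [p * (_ / q)]mulrCA e2.
move: yE; set a := y `^ p; set b := x `^ p; set c := y `^ (p - 1) => -> ?.
by nra.
Qed.

Lemma powR_lip (M x y : R) : 0 <= x <= M -> 0 <= y <= M ->
  `|y `^ p - x `^ p| <= p * M `^ (p - 1) * `|y - x|.
Proof.
have h s t : 0 <= s <= M -> 0 <= t <= M -> t `^ p - s `^ p <= p * M `^ (p - 1) * `|t - s|.
  move=> /andP[s0 sM] /andP[t0 tM]; apply: le_trans (powR_tangent s0 t0) _.
  apply: le_trans (ler_wpM2l _ (ler_norm _)) _; first by rewrite mulr_ge0 ?powR_ge0 ?(ltW p0).
  rewrite ler_wpM2r // ler_wpM2l ?(ltW p0) //; apply: ge0_ler_powR; rewrite ?nnegrE ?subr_ge0 ?(ltW p1) //.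
  exact: le_trans tM.
by move=> hx hy; rewrite ler_norml lerNl opprB [`|y - x|]distrC h // distrC h.
Qed.

Lemma cvg_powR_nneg (u : nat -> R) (v : R) : (forall k, 0 <= u k) -> 0 <= v ->
  u @ \oo --> v -> (fun k => u k `^ p) @ \oo --> v `^ p.
Proof.
move=> hu hv uv; apply/cvgrPdist_le => e e0.
have K0 : 0 < p * (v + 1) `^ (p - 1) + 1 by rewrite ltr_wpDl // mulr_ge0 ?powR_ge0 ?(ltW p0).
have /cvgrPdist_le/(_ _ (divr_gt0 e0 K0)) h1 := uv.
have /cvgrPdist_le/(_ _ ltr01) h2 := uv.
apply: filterS2 h1 h2 => k; rewrite ler_pdivlMr // => h hk.
have uM : u k <= v + 1 by move: hk; rewrite distrC => /(le_trans (ler_norm _)); rewrite lerBlDl.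
have vM : v <= v + 1 by rewrite lerDl.
apply: le_trans (@powR_lip (v + 1) (u k) v _ _) _; rewrite ?hu ?hv //.
by apply: le_trans _ h; rewrite mulrC ler_wpM2l // lerDl.
Qed.
End Hoelder.

(** * Weights and their averages on grids *)

Section WeightPairs.
Variables (R : realType) (p q : R).
Hypotheses (p1 : 1 < p) (q1 : 1 < q) (pq : p^-1 + q^-1 = 1).
Local Notation mu := (@leb2 R).

Let p0 : 0 < p. Proof. exact: lt_trans p1. Qed.
Let q0 : 0 < q. Proof. exact: lt_trans q1. Qed.

Definition sqint (w : borel2 R -> R) (a : R * R) l : R := \int[mu]_z (w z * \1_(square a l) z).

Record local_weight (w : borel2 R -> R) : Prop := LocalWeight {
  lw_gt0 : forall z, 0 < w z;
  lw_meas : measurable_fun setT w;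
  lw_int : forall a l, rint mu (fun z => w z * \1_(square a l) z) }.

(** The symmetric form of the Muckenhoupt condition: [sg] is the dual weight and [C1] corresponds to
    the [p]-th root of the constant. *)
Record weight_pair (C1 : R) (w sg : borel2 R -> R) : Prop := WeightPair {
  wp_w : local_weight w;
  wp_sg : local_weight sg;
  wp_one : forall z, w z `^ p^-1 * sg z `^ q^-1 = 1;
  wp_cube : forall a l, 0 < l -> sqint w a l `^ p^-1 * sqint sg a l `^ q^-1 <= C1 * l ^+ 2 }.

Lemma sqint_hoelder (u v : borel2 R -> R) a l : local_weight u -> local_weight v ->
  rint mu (fun z => u z `^ p^-1 * v z `^ q^-1 * \1_(square a l) z) /\
  sqint (fun z => u z `^ p^-1 * v z `^ q^-1) a l <= sqint u a l `^ p^-1 * sqint v a l `^ q^-1.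
Proof.
move=> lu lv; have h (w : borel2 R -> R) : local_weight w -> forall z, 0 <= w z * \1_(square a l) z.
  by move=> lw z; rewrite mulr_ge0 ?indicE // ltW // lw_gt0.
have E z : u z `^ p^-1 * v z `^ q^-1 * \1_(square a l) z =
    (u z * \1_(square a l) z) `^ p^-1 * (v z * \1_(square a l) z) `^ q^-1.
  rewrite indicE; case: (z \in _); rewrite ?mulr1 // !mulr0 powR0 ?mul0r // invr_neq0 // gt_eqF //.
have [i1 i2] := Rint_hoelder p1 q1 pq (h u lu) (h v lv) (lw_int lu a l) (lw_int lv a l).
by rewrite /sqint; under [X in rint _ X]eq_fun do rewrite E; under eq_Rintegral do rewrite E.
Qed.

Lemma local_weight_prod u v : local_weight u -> local_weight v ->
  local_weight (fun z => u z `^ p^-1 * v z `^ q^-1).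
Proof.
move=> lu lv; split.
- by move=> z; rewrite mulr_gt0 // powR_gt0 // lw_gt0.
- apply: measurable_funM; first exact: measurable_powR_pos (lw_meas lu).
  exact: measurable_powR_pos (lw_meas lv).
- by move=> a l; have [] := sqint_hoelder a l lu lv.
Qed.

Lemma sqint_ge0 w a l : local_weight w -> 0 <= sqint w a l.
Proof. by move=> lw; apply: Rint_ge0 => z; rewrite mulr_ge0 ?indicE // ltW // lw_gt0. Qed.

Lemma sqint_one u v a l : local_weight u -> local_weight v ->
  (forall z, u z `^ p^-1 * v z `^ q^-1 = 1) -> 0 < l ->
  [/\ l ^+ 2 <= sqint u a l `^ p^-1 * sqint v a l `^ q^-1, 0 < sqint u a l & 0 < sqint v a l].
Proof.
move=> lu lv uv l0; have [_] := sqint_hoelder a l lu lv.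
rewrite {1}/sqint; under eq_Rintegral do rewrite uv mul1r.
rewrite Rint_square ?(ltW l0) // => h; split => //.
  rewrite lt0r sqint_ge0 // andbT; apply/eqP => u0; move: h.
  by rewrite u0 powR0 ?mul0r ?invr_neq0 ?gt_eqF // leNgt exprn_gt0.
rewrite lt0r sqint_ge0 // andbT; apply/eqP => v0; move: h.
by rewrite v0 powR0 ?mulr0 ?invr_neq0 ?gt_eqF // leNgt exprn_gt0.
Qed.

Section OnGrid.
Variables (L : nat) (a : R * R) (l : R).
Hypothesis l0 : 0 < l.
Local Notation s := (side l L).
Local Notation av w := (@eavg R a l L w).

Let s0 : 0 < s. Proof. exact: side_gt0. Qed.
Let s2 : 0 < s ^+ 2. Proof. exact: exprn_gt0. Qed.

Let conj_pow (x : R) : 0 < x -> x `^ p^-1 * x `^ q^-1 = x.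
Proof. by move=> x0; rewrite -powRD ?(gt_eqF x0) ?implybT // pq powRr1 // ltW. Qed.

Lemma eavg_sqint w (x : cell L) :
  av w x = (s ^+ 2)^-1 * sqint w (a.1 + s * (x.1)%:R, a.2 + s * (x.2)%:R) s.
Proof. by []. Qed.

Lemma eavg_hoelder u v x : local_weight u -> local_weight v ->
  av (fun z => u z `^ p^-1 * v z `^ q^-1) x <= av u x `^ p^-1 * av v x `^ q^-1.
Proof.
move=> lu lv; rewrite !eavg_sqint.
have [_ h] := sqint_hoelder (a.1 + s * (x.1)%:R, a.2 + s * (x.2)%:R) s lu lv.
have i0 : 0 < (s ^+ 2)^-1 by rewrite invr_gt0.
rewrite !powRM ?sqint_ge0 ?(ltW i0) // mulrACA conj_pow //.
by apply: ler_wpM2l => //; exact: ltW.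
Qed.

Lemma eavg_one u v x : local_weight u -> local_weight v ->
  (forall z, u z `^ p^-1 * v z `^ q^-1 = 1) ->
  [/\ 1 <= av u x `^ p^-1 * av v x `^ q^-1, 0 < av u x & 0 < av v x].
Proof.
move=> lu lv uv; rewrite !eavg_sqint.
have [h hu hv] := sqint_one (a.1 + s * (x.1)%:R, a.2 + s * (x.2)%:R) lu lv uv s0.
have i0 : 0 < (s ^+ 2)^-1 by rewrite invr_gt0.
split; [|exact: mulr_gt0|exact: mulr_gt0].
rewrite !powRM ?sqint_ge0 ?(ltW i0) // mulrACA conj_pow // -[leLHS](@mulVf _ (s ^+ 2)) ?gt_eqF //.
by apply: ler_wpM2l => //; exact: ltW.
Qed.

Lemma eavg_block w (P : pred (cell L)) k x : local_weight w -> (forall y, P y -> nb 1 k x y) ->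
  \sum_(y | P y) av w y <= (s ^+ 2)^-1 * sqint w
    (a.1 + s * ((2 ^ k)%:R * ((x.1 %/ 2 ^ k)%N%:R - 1)),
     a.2 + s * ((2 ^ k)%:R * ((x.2 %/ 2 ^ k)%N%:R - 1))) (3%:R * (s * (2 ^ k)%:R)).
Proof.
move=> lw hP; rewrite -mulr_sumr; apply: ler_wpM2l; first by rewrite invr_ge0 ltW.
apply: (sum_gcell_le (J := block_cube a s k x) s0 (lw_int lw)) => //.
- by move=> z; rewrite ltW // lw_gt0.
- exact: lw_int.
- by move=> y Py; apply: gcell_block => //; exact: hP.
Qed.

Let blk_side k : 0 < 3%:R * (s * (2 ^ k)%:R).
Proof. by rewrite !mulr_gt0 ?ltr0n // expn_gt0. Qed.

Let blk_sq k : (s ^+ 2)^-1 * (3%:R * (s * (2 ^ k)%:R)) ^+ 2 = 9%:R * 4%:R ^+ k.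
Proof.
have -> : (3%:R * (s * (2 ^ k)%:R)) ^+ 2 = s ^+ 2 * (9%:R * ((2 ^ k)%:R) ^+ 2) by ring.
rewrite mulKf ?gt_eqF // natrX -exprM mulnC exprM; congr (_ * _ ^+ _); ring.
Qed.

(** A 3 by 3 neighbourhood of level [k] lies in one cube of side [3 * 2 ^ k * s], hence [9 = 3 ^ 2].
    The lower bound on single cells is Hoelder's inequality. *)
Lemma dual_weights_eavg C1 w sg : weight_pair C1 w sg ->
  dual_weights p q (9%:R * C1) (av w) (av sg).
Proof.
move=> [lw lsg one cube]; have h x := eavg_one x lw lsg one.
have i0 : 0 < (s ^+ 2)^-1 by rewrite invr_gt0.
split; [by move=> x; case: (h x)|by move=> x; case: (h x)|by move=> x; case: (h x)|].
move=> k x kL; set b := (a.1 + s * ((2 ^ k)%:R * ((x.1 %/ 2 ^ k)%N%:R - 1)),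
     a.2 + s * ((2 ^ k)%:R * ((x.2 %/ 2 ^ k)%N%:R - 1))).
have pw (u : borel2 R -> R) (r : R) : 0 < r -> local_weight u ->
    (\sum_(y | nb 1 k x y) av u y) `^ r^-1 <=
    ((s ^+ 2)^-1 * sqint u b (3%:R * (s * (2 ^ k)%:R))) `^ r^-1.
  move=> r0 lu; have sm := eavg_block (P := nb 1 k x) (k := k) (x := x) lu (fun y h => h).
  apply: ge0_ler_powR; rewrite ?nnegrE ?invr_ge0 ?(ltW r0) //; last by apply: le_trans sm; apply: sumr_ge0 => y _;
    rewrite eavg_sqint mulr_ge0 ?sqint_ge0 // ltW.
  by apply: sumr_ge0 => y _; rewrite eavg_sqint mulr_ge0 ?sqint_ge0 // ltW.
apply: le_trans (ler_pM (powR_ge0 _ _) (powR_ge0 _ _) (pw _ _ p0 lw) (pw _ _ q0 lsg)) _.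
rewrite !powRM ?sqint_ge0 ?(ltW i0) // mulrACA conj_pow //.
apply: le_trans (ler_wpM2l (ltW i0) (cube b _ (blk_side k))) _.
by rewrite mulrCA blk_sq mulrCA mulrA.
Qed.

(** The oscillation over the cube is at most [B] times the mass of $w^{1/p}m^{1/q}$; the other
    factor is at most the mass of $\lambda^{1/p}\sigma^{1/q}$, $\lambda$ and $\sigma$ being [la] and
    [sg]. By Hoelder's inequality the four masses regroup into the cube conditions of the two pairs;
    [81 = 9 ^ 2]. *)
Lemma bmo_cells_eavg C1 C2 w sg la m (b : borel2 R -> R) (B : R) :
  weight_pair C1 w sg -> weight_pair C2 la m -> 0 <= B ->
  (forall a l, rint mu (fun z => b z * \1_(square a l) z)) ->
  (forall c r, 0 < r -> exists k, \int[mu]_z (`|b z - k| * \1_(square c r) z) <=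
     B * sqint (fun z => w z `^ p^-1 * m z `^ q^-1) c r) ->
  bmo_cells (81%:R * B * C1 * C2) (av (fun z => la z `^ p^-1 * sg z `^ q^-1)) (av b).
Proof.
move=> [lw lsg _ c1] [lla lm _ c2] B0 ib hb k x kL.
have i0 : 0 < (s ^+ 2)^-1 by rewrite invr_gt0.
set c := (a.1 + s * ((2 ^ k)%:R * ((x.1 %/ 2 ^ k)%N%:R - 1)),
     a.2 + s * ((2 ^ k)%:R * ((x.2 %/ 2 ^ k)%N%:R - 1))).
set r := 3%:R * (s * (2 ^ k)%:R); have r0 : 0 < r by exact: blk_side.
have [t ht] := hb c r r0; exists t.
have lnv := local_weight_prod lla lsg.
have ibt c' r' : rint mu (fun z => `|b z - t| * \1_(square c' r') z).
  have := rint_norm (rintB (ib c' r') (rintZ t (rint_square c' r'))).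
  congr rint; apply/funext => z; rewrite -mulrBl normrM; congr (_ * _).
  by rewrite ger0_norm // indicE.
have h1 : \sum_(y | nb 1 k x y) `|av b y - t| <= (s ^+ 2)^-1 * (B * (sqint w c r `^ p^-1 * sqint m c r `^ q^-1)).
  apply: le_trans (_ : _ <= \sum_(y | nb 1 k x y) (s ^+ 2)^-1 * \int[mu]_z (`|b z - t| * \1_(gcell a s y) z)) _.
    apply: ler_sum => y _; have -> : av b y - t = (s ^+ 2)^-1 * \int[mu]_z ((b z - t) * \1_(gcell a s y) z).
      under eq_Rintegral do rewrite mulrBl.
      rewrite RintB; [|exact: ib|by apply: rintZ; exact: rint_square].
      rewrite RintZ ?Rint_square ?(ltW s0) //; last exact: rint_square.
      by rewrite mulrBr mulrCA mulVf ?mulr1 // gt_eqF.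
    rewrite normrM ger0_norm ?(ltW i0) //; apply: ler_wpM2l; first exact: ltW.
    have ibt' : rint mu (fun z => (b z - t) * \1_(gcell a s y) z).
      apply: rint_ext (rintB (ib (a.1 + s * (y.1)%:R, a.2 + s * (y.2)%:R) s)
        (rintZ t (rint_square (a.1 + s * (y.1)%:R, a.2 + s * (y.2)%:R) s))) => z.
      by rewrite -mulrBl.
    apply: le_trans (Rint_norm ibt') _.
    apply: Rint_le; [exact: rint_norm|exact: ibt|] => z.
    by rewrite normrM [X in _ * X]ger0_norm // indicE.
  rewrite -mulr_sumr; apply: ler_wpM2l; first exact: ltW.
  apply: le_trans (sum_gcell_le (J := block_cube a s k x) s0 ibt _ _ _) _ => //.
    exact: ibt.
    by move=> y ny; exact: gcell_block.
  apply: le_trans ht _; apply: ler_wpM2l => //.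
  by have [] := sqint_hoelder c r lw lm.
have h2 : \sum_(y | nb 0 k x y) av (fun z => la z `^ p^-1 * sg z `^ q^-1) y <=
    (s ^+ 2)^-1 * (sqint la c r `^ p^-1 * sqint sg c r `^ q^-1).
  apply: le_trans (eavg_block (P := nb 0 k x) (k := k) (x := x) lnv _) _.
    by move=> y; apply: nb_leq.
  apply: ler_wpM2l; first exact: ltW.
  by have [] := sqint_hoelder c r lla lsg.
apply: le_trans (ler_pM _ _ h1 h2) _; [exact: sumr_ge0| |].
  apply: sumr_ge0 => y _; rewrite eavg_sqint mulr_ge0 ?sqint_ge0 // ltW //.
have c1' := c1 c r r0; have c2' := c2 c r r0.
set W := sqint w c r `^ _ in c1' *; set G := sqint sg c r `^ _ in c1' *.
set A := sqint la c r `^ _ in c2' *; set N := sqint m c r `^ _ in c2' *.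
have W0 : 0 <= W * G by rewrite mulr_ge0 ?powR_ge0.
have A0 : 0 <= A * N by rewrite mulr_ge0 ?powR_ge0.
have key := ler_pM W0 A0 c1' c2'.
have ar1 (i b' w' n a' g : R) : i * (b' * (w' * n)) * (i * (a' * g)) = i ^+ 2 * b' * (w' * g * (a' * n)) by ring.
rewrite ar1; apply: le_trans (ler_wpM2l _ key) _; first by rewrite mulr_ge0 // exprn_ge0 // ltW.
have E := blk_sq k; rewrite -/r in E.
have ar2 (i b' x1 x2 t' : R) : i ^+ 2 * b' * (x1 * t' * (x2 * t')) = b' * x1 * x2 * (i * t') ^+ 2 by ring.
rewrite ar2 E exprMn -exprM mulnC exprM.
have -> : (4%:R ^+ 2) = 16%:R :> R by rewrite -natrX.
have -> : (9%:R ^+ 2) = 81%:R :> R by rewrite -natrX.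
have ar3 (b' x1 x2 u v : R) : b' * x1 * x2 * (u * v) = u * b' * x1 * x2 * v by ring.
by rewrite ar3.
Qed.
End OnGrid.
End WeightPairs.

(** * Bounded functions with bounded support *)

Section BoundedSupport.
Variable R : realType.
Local Notation mu := (@leb2 R).

Definition box (N : nat) : set (R * R) := square (- (N.+1)%:R, - (N.+1)%:R) (2%:R * (N.+1)%:R).

Definition bsupp (u : borel2 R -> R) : Prop := measurable_fun setT u /\
  exists N, forall z, `|u z| <= (N.+1)%:R * \1_(box N) z.

Lemma box_sub N N' : (N <= N')%N -> box N `<=` box N'.
Proof.
move=> NN; have h : (N.+1)%:R <= (N'.+1)%:R :> R by rewrite ler_nat.
by apply: square_sub => /=; lra.
Qed.

Lemma box_side N : 0 < 2%:R * (N.+1)%:R :> R.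
Proof. by rewrite mulr_gt0 // ltr0n. Qed.

Lemma bsupp_mono (u : borel2 R -> R) N N' : (N <= N')%N ->
  (forall z, `|u z| <= (N.+1)%:R * \1_(box N) z) -> forall z, `|u z| <= (N'.+1)%:R * \1_(box N') z.
Proof.
move=> NN h z; apply: le_trans (h z) _; rewrite !indicE.
have [hz|hz] := pselect (box N z); last by rewrite memNset // mulr0 mulr_ge0.
by rewrite !mem_set ?mulr1 ?ler_nat //; exact: box_sub hz.
Qed.

Lemma bsupp_L2 u : bsupp u -> L2 mu u.
Proof.
by move=> [m [N h]]; exact: L2_bounded (measurable_square _ _) (leb2_square_fin _ _) m h.
Qed.

Lemma bsupp_rint u : bsupp u -> rint mu u.
Proof.
by move=> [m [N h]]; exact: rint_bounded (measurable_square _ _) (leb2_square_fin _ _) m h.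
Qed.

Lemma bsupp_mul (b u : borel2 R -> R) (B : R) : measurable_fun setT b -> (forall z, `|b z| <= B) ->
  bsupp u -> bsupp (fun z => b z * u z).
Proof.
move=> mb hb [m [N h]]; split; first exact: measurable_funM.
have B0 : 0 <= B := le_trans (normr_ge0 _) (hb (0, 0)).
pose n := Num.truncn B; have nB : B <= (n.+1)%:R by have /andP[_ /ltW] := truncn_itv B0.
exists (n.+1 * N.+1)%N => z; rewrite normrM.
have [hz|hz] := pselect (box N z); last first.
  have := h z; rewrite [\1_(box N) z]indicE memNset // mulr0 normr_le0 => /eqP ->.
  by rewrite normr0 mulr0 mulr_ge0 ?indicE.
have bz : box (n.+1 * N.+1) z by apply: box_sub hz; rewrite (leq_trans (leqnSn N)) // leq_pmull.
rewrite indicE mem_set // mulr1; have := h z; rewrite indicE mem_set // mulr1 => hu.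
apply: le_trans (ler_pM (normr_ge0 _) (normr_ge0 _) (le_trans (hb z) nB) hu) _.
by rewrite -natrM ler_nat.
Qed.

(** Large values are set to 0 rather than clipped. At each point the truncations are eventually
    equal to [u], and they never exceed it in absolute value. *)
Definition trunc (N : nat) (u : borel2 R -> R) : borel2 R -> R :=
  fun z => if `|u z| <= (N.+1)%:R then u z * \1_(box N) z else 0.

Lemma trunc_bsupp N u : measurable_fun setT u -> bsupp (trunc N u).
Proof.
move=> m; split.
  apply: measurable_fun_ifT => //.
    by apply: measurable_fun_ler => //; exact: measurableT_comp.
  by apply: measurable_funM => //; exact: measurable_indic (measurable_square _ _).
exists N => z; rewrite /trunc; case: ifP => [h|_]; last by rewrite normr0 mulr_ge0 ?indicE.
by rewrite normrM [X in _ * X <= _]ger0_norm ?indicE // ler_wpM2r.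
Qed.

Lemma trunc_le N u z : `|trunc N u z| <= `|u z|.
Proof.
rewrite /trunc; case: ifP => _; last by rewrite normr0.
by rewrite normrM indicE; case: (_ \in _); rewrite ?normr1 ?mulr1 // normr0 mulr0.
Qed.

Lemma in_box (z : R * R) : exists N, forall k, (N <= k)%N -> box k z.
Proof.
pose n := Num.truncn (`|z.1| + `|z.2|); exists n => k nk; apply: (box_sub nk).
have /andP[_ h] := truncn_itv (addr_ge0 (normr_ge0 z.1) (normr_ge0 z.2)).
rewrite -/n in h; have := ler_norm z.1; have := ler_norm (- z.1).
have := ler_norm z.2; have := ler_norm (- z.2); rewrite !normrN => *.
have := normr_ge0 z.1; have := normr_ge0 z.2 => *.
by apply/squareP => /=; split; lra.
Qed.

Lemma trunc_eventually u z : exists N, forall k, (N <= k)%N -> trunc k u z = u z.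
Proof.
have [N hN] := in_box z; pose n := Num.truncn `|u z|.
exists (maxn N n) => k; rewrite geq_max => /andP[Nk nk]; rewrite /trunc.
have /andP[_ h] := truncn_itv (normr_ge0 (u z)); rewrite -/n in h.
rewrite (le_trans (ltW h)) ?ler_nat // indicE mem_set ?mulr1 //; exact: hN.
Qed.

Lemma trunc_cvg u z : trunc k u z @[k --> \oo] --> u z.
Proof.
apply: cvg_near_cst; have [N hN] := trunc_eventually u z.
by exists N => // k /= /hN.
Qed.

Lemma trunc_L2 u : L2 mu u -> nsq mu (fun z => trunc k u z - u z) @[k --> \oo] --> (0 : R).
Proof.
move=> [m i]; rewrite -[X in _ --> X](_ : \int[mu]_z (0 : R) = 0); last first.
  by rewrite Rintegral_cst // mul0r.
apply: (proj2 (dct _ _ _ (G := fun z => 4%:R * u z ^+ 2) _ _)) => //.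
- move=> k; apply: measurable_funX; apply: measurable_funB => //.
  by have [] := trunc_bsupp k m.
- apply: aeW => z; apply: cvg_near_cst; have [N hN] := trunc_eventually u z.
  by exists N => // k /= /hN ->; rewrite subrr expr0n.
- exact: rintZ.
move=> k z; rewrite normrX; apply: le_trans (_ : (2%:R * `|u z|) ^+ 2 <= _).
  rewrite ler_sqr ?nnegrE ?mulr_ge0 //; apply: le_trans (ler_normB _ _) _.
  by rewrite mulrDl mul1r lerD2r trunc_le.
by rewrite exprMn real_normK ?num_real // -natrX.
Qed.
End BoundedSupport.

Lemma le_quarters (R : realType) (e a b c : R) : 0 < e -> a <= e / 4%:R -> b <= e / 4%:R ->
  c <= e / 4%:R -> a + b + c <= e.
Proof. by move=> *; lra. Qed.

(** * Passage from grids to functions on one square *)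

Section BilinearLimits.
Variables (R : realType) (M C th : R) (S : (borel2 R -> R) -> borel2 R -> R).
Variable (k : R * R -> R * R -> R).
Hypotheses (M0 : 0 < M) (C0 : 0 <= C) (th0 : 0 < th) (th1 : th <= 1).
Hypothesis rc : real_cz M C th S k.
Local Notation mu := (@leb2 R).

Lemma prS_cvg (F G : nat -> borel2 R -> R) f g : (forall n, L2 mu (F n)) -> (forall n, L2 mu (G n)) ->
  L2 mu f -> L2 mu g ->
  nsq mu (fun z => F n z - f z) @[n --> \oo] --> (0 : R) ->
  nsq mu (fun z => G n z - g z) @[n --> \oo] --> (0 : R) ->
  pr mu (S (F n)) (G n) @[n --> \oo] --> pr mu (S f) g.
Proof.
move=> LF LG Lf Lg cF cG; apply/cvgrPdist_le => e e0.
have n0 := nsq_ge0 mu f; have m0 := nsq_ge0 mu g.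
(* With [t] this large the terms that contain the fixed [f] or [g] contribute little; the distances
   of the arguments are then taken small in comparison with [1 + t]. *)
set t := 4%:R * M * (nsq mu f + nsq mu g + 1) / e.
have t0 : 0 < t by rewrite divr_gt0 // !mulr_gt0 // ltr_wpDl // addr_ge0.
have d0 : 0 < e / (4%:R * M * (1 + t)) by rewrite divr_gt0 // !mulr_gt0 // ltr_wpDl // ltW.
have /cvgrPdist_le/(_ _ d0) hF := cF; have /cvgrPdist_le/(_ _ d0) hG := cG.
apply: filterS2 hF hG => n; rewrite sub0r normrN (ger0_norm (nsq_ge0 _ _)) => hF.
rewrite sub0r normrN (ger0_norm (nsq_ge0 _ _)) => hG.
have LFf := L2B (LF n) Lf; have LGg := L2B (LG n) Lg.
have e1 : pr mu (S (F n)) (G n) = pr mu (S (fun z => F n z - f z)) (G n) + pr mu (S f) (G n).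
  have := prS_lin rc 1 LFf Lf (LG n); rewrite mul1r => <-.
  by congr (pr mu (S _) _); apply/funext => z; rewrite mul1r subrK.
have e2 u : L2 mu u -> pr mu (S u) (G n) = pr mu (S u) (fun z => G n z - g z) + pr mu (S u) g.
  move=> Lu; have LSu := rc_L2 rc Lu; rewrite prC [X in _ = X + _]prC [X in _ = _ + X]prC -prDl //.
  by congr (pr mu _ _); apply/funext => z; rewrite subrK.
rewrite e1 (e2 _ LFf) (e2 _ Lf).
have b1 := prS_bound M0 rc ltr01 LFf LGg; have b2 := prS_bound M0 rc t0 LFf Lg.
have ti : 0 < t^-1 by rewrite invr_gt0.
have b3 := prS_bound M0 rc ti Lf LGg; rewrite invrK invr1 in b1 b3.
set a := nsq mu _ in hF b1 b2; set b := nsq mu _ in hG b1 b3.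
set x := pr mu _ _ in b1 *; set y := pr mu (S _) g in b2 *; set v := pr mu (S f) _ in b3 *.
have tE : M * (t^-1 * (nsq mu f + nsq mu g)) <= e / 4%:R.
  rewrite mulrCA mulrC ler_pdivrMr // [leRHS](_ : _ = M * (nsq mu f + nsq mu g + 1)).
    by rewrite ler_wpM2l ?(ltW M0) // lerDl.
  by rewrite /t; field; rewrite gt_eqF.
have aE : M * ((1 + t) * a) <= e / 4%:R.
  move: hF; rewrite ler_pdivlMr; last by rewrite !mulr_gt0 // ltr_wpDl // ltW.
  by move=> h; rewrite ler_pdivlMr // [leLHS](_ : _ = a * (4%:R * M * (1 + t))) //; ring.
have bE : M * ((1 + t) * b) <= e / 4%:R.
  move: hG; rewrite ler_pdivlMr; last by rewrite !mulr_gt0 // ltr_wpDl // ltW.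
  by move=> h; rewrite ler_pdivlMr // [leLHS](_ : _ = b * (4%:R * M * (1 + t))) //; ring.
rewrite (_ : _ - _ = - (x + y + v)); last by ring.
rewrite normrN; apply: le_trans (ler_normD _ _) _.
apply: le_trans (lerD (ler_normD _ _) (lexx _)) _.
apply: le_trans (lerD (lerD b1 b2) b3) _.
rewrite [leLHS](_ : _ = M * ((1 + t) * a) + M * ((1 + t) * b) + M * (t^-1 * (nsq mu f + nsq mu g))); last by ring.
exact: le_quarters.
Qed.

Section OneRoot.
Variables (a : R * R) (l : R).
Hypothesis l0 : 0 < l.
Local Notation Q := (square a l).
Local Notation E := (@condE R a l).

Definition on_root (u : borel2 R -> R) : Prop := measurable_fun setT u /\
  exists B : R, 0 <= B /\ forall z, `|u z| <= B * \1_Q z.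

Lemma on_root_rint u : on_root u -> rint mu u.
Proof.
by move=> [m [B [_ h]]]; exact: rint_bounded (measurable_square _ _) (leb2_square_fin _ _) m h.
Qed.

Lemma on_root_L2 u : on_root u -> L2 mu u.
Proof.
by move=> [m [B [_ h]]]; exact: L2_bounded (measurable_square _ _) (leb2_square_fin _ _) m h.
Qed.

Lemma condE_bound u (B : R) L z : 0 <= B -> on_root u -> (forall z, `|u z| <= B * \1_Q z) ->
  `|E L u z| <= B * \1_Q z.
Proof.
move=> B0 ru h; have := @stepf_le R L a (side l L) (side_gt0 l0 L) (eavg a l u) B z.
rewrite sideK //; apply => x; apply: eavg_le => //; first exact: on_root_rint.
by move=> t _; apply: le_trans (h t) _; rewrite indicE; case: (_ \in _); rewrite ?mulr1 ?mulr0.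
Qed.

(** The levels are chosen for fast $L^1$ convergence of all three functions at once, so that a
    single subsequence serves them. *)
Lemma condE_ae u v b : on_root u -> on_root v -> on_root b ->
  exists N : nat -> nat, [/\ {ae mu, forall z, E (N n) u z @[n --> \oo] --> u z},
    {ae mu, forall z, E (N n) v z @[n --> \oo] --> v z} &
    {ae mu, forall z, E (N n) b z @[n --> \oo] --> b z}].
Proof.
move=> ru rv rb.
have p0 n : 0 < (4^-1 : R) ^+ n by rewrite exprn_gt0 // invr_gt0.
have /boolp.choice[N hN] n : exists L, [/\ \int[mu]_z `|E L u z - u z| <= (4^-1) ^+ n,
      \int[mu]_z `|E L v z - v z| <= (4^-1) ^+ n &
      \int[mu]_z `|E L b z - b z| <= (4^-1) ^+ n].
  have h w : on_root w -> exists L0, forall L, (L0 <= L)%N ->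
      \int[mu]_z `|E L w z - w z| <= (4^-1) ^+ n.
    by move=> [m [B [_ hB]]]; exact: (condE_cvg l0 m hB (p0 n)).
  have [L1 h1] := h _ ru; have [L2 h2] := h _ rv; have [L3 h3] := h _ rb.
  exists (maxn L1 (maxn L2 L3)); split; [apply: h1|apply: h2|apply: h3];
  by rewrite ?leq_max ?leqnn ?orbT.
have iE L w : rint mu (E L w) by exact: rint_stepf.
exists N; split; apply: ae_cvg_of_L1 => //; try exact: on_root_rint.
- by move=> n; case: (hN n).
- by move=> n; case: (hN n).
- by move=> n; case: (hN n).
Qed.

Lemma dct_root (F : nat -> borel2 R -> R) (u : borel2 R -> R) (B : R) : (forall n, measurable_fun setT (F n)) ->
  measurable_fun setT u ->
  (forall n z, `|F n z| <= B * \1_Q z) -> (forall z, `|u z| <= B * \1_Q z) ->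
  {ae mu, forall z, F n z @[n --> \oo] --> u z} ->
  nsq mu (fun z => F n z - u z) @[n --> \oo] --> (0 : R).
Proof.
move=> mF m hF hu cv.
have i0 : \int[mu]_z (0 : R) = 0 by rewrite Rintegral_cst // mul0r.
rewrite -[X in _ --> X]i0.
have [] // := @dct _ _ _ mu (fun n z => (F n z - u z) ^+ 2) (fun=> 0)
  (fun z => (2%:R * B) ^+ 2 * \1_Q z) _ _ _ _ _.
- by move=> n; apply: measurable_funX; exact: measurable_funB.
- apply: filterS cv => z hz.
  have h : (F n z - u z) @[n --> \oo] --> (0 : R).
    by rewrite -[X in _ --> X](subrr (u z)); apply: cvgB => //; exact: cvg_cst.
  by have := cvgM h h; rewrite mulr0; apply.
- by apply: rintZ; exact: rint_square.
move=> n z; rewrite normrX.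
have h : `|F n z - u z| <= 2%:R * B * \1_Q z.
  by apply: le_trans (ler_normB _ _) _; rewrite -mulrA mulrDl mul1r lerD.
apply: le_trans (_ : (2%:R * B * \1_Q z) ^+ 2 <= _).
  by rewrite ler_sqr ?nnegrE // (le_trans (normr_ge0 _) h).
by rewrite exprMn indicE; case: (_ \in _); rewrite ?expr1n ?expr0n.
Qed.
End OneRoot.
End BilinearLimits.

Lemma le_cvg_le (R : realType) (u v : nat -> R) (x y : R) : u @ \oo --> x -> v @ \oo --> y ->
  (forall n, u n <= v n) -> x <= y.
Proof.
move=> /cvgrPdist_le ux /cvgrPdist_le vy uv; apply/ler_addgt0Pr => e e0.
have e2 : 0 < e / 2%:R by rewrite divr_gt0.
have [n [h1 h2]] : exists n, `|x - u n| <= e / 2%:R /\ `|y - v n| <= e / 2%:R.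
  have [n1 _ h1] := ux _ e2; have [n2 _ h2] := vy _ e2; exists (maxn n1 n2).
  by split; [apply: h1|apply: h2]; rewrite /= ?leq_maxl ?leq_maxr.
rewrite distrC in h2; have := uv n.
by have := le_trans (ler_norm _) h1; have := le_trans (ler_norm _) h2; lra.
Qed.

Lemma ae_mp2 d (X : measurableType d) (R : realType) (mu : {measure set X -> \bar R})
    (P1 P2 P3 : X -> Prop) : {ae mu, forall x, P1 x} -> {ae mu, forall x, P2 x} ->
  (forall x, P1 x -> P2 x -> P3 x) -> {ae mu, forall x, P3 x}.
Proof. by move=> h1 h2 h; apply: filterS2 h1 h2. Qed.

Lemma absorb_half (R : realType) (H K A t u : R) : K * u = 2^-1 -> H <= K * (t * A + u * H) ->
  H <= 2%:R * K * t * A.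
Proof.
move=> Ku; rewrite mulrDr [K * (u * H)]mulrA Ku => h.
have -> : 2%:R * K * t * A = 2%:R * (K * (t * A)) by ring.
by move: h; set x := K * (t * A) => ?; lra.
Qed.

(** * Weighted bounds by duality *)

Section WeightedLimits.
Variables (R : realType) (p q : R).
Hypotheses (p1 : 1 < p) (q1 : 1 < q) (pq : p^-1 + q^-1 = 1).
Local Notation mu := (@leb2 R).

Let p0 : 0 < p. Proof. exact: lt_trans p1. Qed.
Let q0 : 0 < q. Proof. exact: lt_trans q1. Qed.

Definition wint (r : R) (w u : borel2 R -> R) : R := \int[mu]_z (`|u z| `^ r * w z).

(** The product of norms is linearised with a free [t], so that bounds pass to limits of integrals;
    [t] is chosen only in the duality argument. *)
Lemma young_scale (A B t : R) : 0 <= A -> 0 <= B -> 0 < t ->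
  A `^ p^-1 * B `^ q^-1 <= t * A + t `^ (- (q / p)) * B.
Proof.
move=> A0 B0 t0; have u0 : 0 < t `^ (- (q / p)) by exact: powR_gt0.
have h1 := mulr_ge0 (ltW t0) A0; have h2 := mulr_ge0 (ltW u0) B0.
apply: le_trans (young_root p1 q1 pq h1 h2).
rewrite (powRM _ (ltW t0) A0) (powRM _ (ltW u0) B0) -powRrM mulrACA.
rewrite (_ : - (q / p) * q^-1 = - p^-1); last by field; rewrite !gt_eqF.
by rewrite powRN mulfV ?mul1r // gt_eqF // powR_gt0.
Qed.

Section Root.
Variables (a : R * R) (l : R).
Hypothesis l0 : 0 < l.
Local Notation Q := (square a l).

Lemma rint_wint (r : R) w (u : borel2 R -> R) (B : R) : 0 < r -> local_weight w -> measurable_fun setT u ->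
  (forall z, `|u z| <= B * \1_Q z) -> rint mu (fun z => `|u z| `^ r * w z).
Proof.
move=> r0 lw m h; apply: (rint_le (v := fun z => B `^ r * (w z * \1_Q z))).
- apply: measurable_funM; last exact: lw_meas lw.
  by apply: measurable_powR_pos; exact: measurableT_comp.
- move=> z; rewrite [leLHS]ger0_norm ?mulr_ge0 ?powR_ge0 ?(ltW (lw_gt0 lw z)) //.
  rewrite [leRHS]ger0_norm ?mulr_ge0 ?powR_ge0 ?indicE ?(ltW (lw_gt0 lw z)) //.
  have := h z; rewrite indicE; case: (_ \in _).
    rewrite !mulr1 => hB; rewrite ler_wpM2r ?(ltW (lw_gt0 lw z)) //.
    by apply: powR_le; rewrite ?(ltW r0).
  by rewrite !mulr0 normr_le0 => /eqP ->; rewrite normr0 powR0 ?gt_eqF // mul0r.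
by apply: rintZ; exact: lw_int.
Qed.

Lemma wint_cvg (r : R) w (F : nat -> borel2 R -> R) (u : borel2 R -> R) (B : R) :
  1 < r -> local_weight w -> (forall n, measurable_fun setT (F n)) -> measurable_fun setT u ->
  (forall n z, `|F n z| <= B * \1_Q z) -> (forall z, `|u z| <= B * \1_Q z) ->
  {ae mu, forall z, F n z @[n --> \oo] --> u z} ->
  wint r w (F n) @[n --> \oo] --> wint r w u.
Proof.
move=> r1 lw mF m hF hu cv; have r0 : 0 < r by exact: lt_trans r1.
have mw (v : borel2 R -> R) : measurable_fun setT v -> measurable_fun setT (fun z : borel2 R => `|v z| `^ r * w z).
  move=> mv; apply: measurable_funM; last exact: lw_meas lw.
  by apply: measurable_powR_pos; exact: measurableT_comp.
have s1 : (r / (r - 1))^-1 = 1 - r^-1.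
  by rewrite invf_div mulrBl mulfV ?gt_eqF // mul1r.
have [] // := @dct _ _ _ mu (fun n z => `|F n z| `^ r * w z) (fun z => `|u z| `^ r * w z)
  (fun z => B `^ r * (w z * \1_Q z)) _ _ _ _ _.
- by move=> n; exact: mw.
- exact: mw.
- apply: filterS cv => z hz; apply: cvgM; last exact: cvg_cst.
  apply: (@cvg_powR_nneg _ r (r / (r - 1))) => //; last exact: cvg_norm.
  + by rewrite ltr_pdivlMr ?subr_gt0 // mul1r ltrBlDr ltrDl.
  + by rewrite s1 addrC subrK.
- by apply: rintZ; exact: lw_int.
move=> n z; rewrite ger0_norm ?mulr_ge0 ?powR_ge0 ?(ltW (lw_gt0 lw z)) //.
have := hF n z; rewrite indicE; case: (_ \in _).
  rewrite !mulr1 => hB; rewrite ler_wpM2r ?(ltW (lw_gt0 lw z)) //.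
  by apply: powR_le; rewrite ?(ltW r0).
by rewrite !mulr0 normr_le0 => /eqP ->; rewrite normr0 powR0 ?gt_eqF // mul0r.
Qed.

Lemma wint_stepf (r : R) w L (c : cell L -> R) : 0 < r -> local_weight w ->
  wint r w (stepf a (side l L) c) = side l L ^+ 2 * \sum_x `|c x| `^ r * eavg a l w x.
Proof.
move=> r0 lw; have s0 := side_gt0 l0 L; rewrite /wint.
under eq_Rintegral do rewrite (@stepf_map _ _ a (side l L) s0 (fun t => `|t| `^ r)) ?normr0 ?powR0 ?gt_eqF //.
rewrite Rint_stepf_mul //; last exact: lw_int.
rewrite mulr_sumr; apply: eq_bigr => x _; rewrite /eavg /= mulrCA; congr (_ * _).
by rewrite mulVKf // expf_neq0 // gt_eqF.
Qed.

Lemma lp_young w v L (f g : cell L -> R) t : local_weight w -> local_weight v -> 0 < t ->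
  side l L ^+ 2 * (lp p (eavg a l w (L:=L)) f * lp q (eavg a l v (L:=L)) g) <=
  t * wint p w (stepf a (side l L) f) + t `^ (- (q / p)) * wint q v (stepf a (side l L) g).
Proof.
move=> lw lv t0; have s2 : 0 < side l L ^+ 2 by rewrite exprn_gt0 // side_gt0.
have e0 u x : local_weight u -> 0 <= @eavg R a l L u x.
  by move=> lu; rewrite eavg_sqint mulr_ge0 ?sqint_ge0 // invr_ge0 ltW.
rewrite !wint_stepf // /lp; set A := \sum_x _; set B := \sum_x _.
have A0 : 0 <= A by apply: sumr_ge0 => x _; rewrite mulr_ge0 ?powR_ge0 ?e0.
have B0 : 0 <= B by apply: sumr_ge0 => x _; rewrite mulr_ge0 ?powR_ge0 ?e0.
apply: le_trans (young_scale (mulr_ge0 (ltW s2) A0) (mulr_ge0 (ltW s2) B0) t0).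
by rewrite (powRM _ (ltW s2) A0) (powRM _ (ltW s2) B0) [leRHS]mulrACA -powRD ?(gt_eqF s2) ?implybT // pq powRr1 // ltW.
Qed.
End Root.

Lemma wint_ge0 r w u : local_weight w -> 0 <= wint r w u.
Proof. by move=> lw; apply: Rint_ge0 => z; rewrite mulr_ge0 ?powR_ge0 // ltW // lw_gt0. Qed.

(* Duality, tested on [g = |h|^(p-1) sgn h w] restricted to sets where it is bounded. *)
Lemma dual_bound (C1 K A : R) w sg (h : borel2 R -> R) : weight_pair p q C1 w sg ->
  L2 mu h -> 0 <= K -> 0 <= A ->
  (forall g t, bsupp g -> 0 < t -> `|pr mu h g| <= K * (t * A + t `^ (- (q / p)) * wint q sg g)) ->
  (\int[mu]_z (`|h z| `^ p * w z)%:E <= ((2%:R * K) `^ p * A)%:E)%E.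
Proof.
move=> [lw lsg one _] Lh K0 A0 H; have mh := Lh.1; have mw := lw_meas lw.
have [w0 s0] : (forall z, 0 <= w z) /\ (forall z, 0 <= sg z).
  by split=> z; rewrite ltW // lw_gt0.
have eq1 : q / p = q - 1.
  have : q * (p^-1 + q^-1) = q by rewrite pq mulr1.
  by rewrite mulrDr mulfV ?gt_eqF // => ?; lra.
have eq2 : (p - 1) * q = p.
  have : p * q * (p^-1 + q^-1) = p * q by rewrite pq mulr1.
  by rewrite mulrDr mulrAC mulfV ?gt_eqF // mul1r -mulrA mulfV ?gt_eqF // mulr1 => ?; lra.
have sgE z : w z `^ q * sg z = w z.
  have wz := lw_gt0 lw z; have sz := lw_gt0 lsg z.
  have : (w z `^ p^-1 * sg z `^ q^-1) `^ q = 1 by rewrite one powR1.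
  rewrite powRM ?powR_ge0 // -!powRrM mulVf ?gt_eqF // powRr1 // [p^-1 * q]mulrC eq1 => e1.
  have := @powRD R (w z) (q - 1) 1; rewrite subrK (gt_eqF wz) implybT powRr1 // => -> //.
  by rewrite mulrAC e1 mul1r.
(* The cut-off bounds [h], [w] and the support, which makes the test functions admissible and the
   integrals finite. *)
pose G (N : nat) (z : borel2 R) : R := (((`|h z| <= N.+1%:R) && (w z <= N.+1%:R))%:R) * \1_(box N) z.
have mG N : measurable_fun setT (G N : borel2 R -> R).
  apply: measurable_funM; last exact: measurable_indic (measurable_square _ _).
  rewrite (_ : (fun z => _) = (fun z => if (`|h z| <= N.+1%:R) && (w z <= N.+1%:R) then 1 else 0 : R)).
    apply: measurable_fun_ifT => //; apply: measurable_and;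
    apply: measurable_fun_ler => //; exact: measurableT_comp.
  by apply/funext => z; case: (_ && _).
have G01 N z : G N z = 0 \/ (G N z = 1 /\ `|h z| <= N.+1%:R /\ w z <= N.+1%:R /\ box N z).
  rewrite /G indicE; have [hz|hz] := pselect (box N z); last by left; rewrite memNset // mulr0.
  rewrite mem_set // mulr1; case: (boolP (_ && _)) => [/andP[? ?]|_]; by [right|left].
pose g (N : nat) (z : borel2 R) : R := Num.sg (h z) * `|h z| `^ (p - 1) * w z * G N z.
have hg N z : h z * g N z = `|h z| `^ p * w z * G N z.
  rewrite /g; have -> : h z * (Num.sg (h z) * `|h z| `^ (p - 1) * w z * G N z) =
    (Num.sg (h z) * h z) * `|h z| `^ (p - 1) * w z * G N z by ring.
  rewrite -normrEsg; have := @powRD R `|h z| 1 (p - 1).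
  by rewrite addrC subrK (gt_eqF p0) powRr1 // => ->.
have mg N : measurable_fun setT (g N : borel2 R -> R).
  apply: measurable_funM => //; apply: measurable_funM => //; apply: measurable_funM.
    rewrite (_ : (fun z => _) = (fun z => if 0 < h z then 1 else if h z < 0 then -1 else 0 : R)).
      apply: measurable_fun_ifT => //; first exact: measurable_fun_ltr.
      by apply: measurable_fun_ifT => //; exact: measurable_fun_ltr.
    by apply/funext => z; case: sgrP.
  by apply: measurable_powR_pos; exact: measurableT_comp.
have absg N z : `|g N z| <= `|h z| `^ (p - 1) * w z * G N z.
  have G0 : 0 <= G N z by case: (G01 N z) => [->|[-> _]].
  rewrite /g normrM (ger0_norm G0) ler_wpM2r // normrM (ger0_norm (w0 z)) ler_wpM2r //.
  rewrite normrM (ger0_norm (powR_ge0 _ _)) ler_piMl ?powR_ge0 //.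
  by rewrite normr_sg; case: (_ != _).
have gq N z : `|g N z| `^ q * sg z <= `|h z| `^ p * w z * G N z.
  have G0 : 0 <= G N z by case: (G01 N z) => [->|[-> _]].
  apply: le_trans (ler_wpM2r (s0 z) (powR_le (ltW q0) (normr_ge0 _) (absg N z))) _.
  case: (G01 N z) => [->|[-> _]]; first by rewrite !mulr0 powR0 ?gt_eqF // mul0r.
  by rewrite !mulr1 powRM ?powR_ge0 // -powRrM eq2 -mulrA sgE.
have bg N : bsupp (g N).
  split => //; pose B := (N.+1)%:R `^ (p - 1) * (N.+1)%:R : R.
  have B0 : 0 <= B by rewrite mulr_ge0 ?powR_ge0.
  pose n := maxn N (Num.truncn B); exists n => z; apply: le_trans (absg N z) _.
  case: (G01 N z) => [->|[-> [h1 [h2 h3]]]]; first by rewrite mulr0 mulr_ge0 ?indicE.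
  rewrite mulr1 indicE mem_set ?mulr1; last by apply: box_sub h3; exact: leq_maxl.
  apply: le_trans (_ : B <= _).
    by apply: ler_pM => //; rewrite ?powR_ge0 //; apply: powR_le; rewrite ?subr_ge0 ?(ltW p1).
  have /andP[_ /ltW] := truncn_itv B0; move=> /le_trans; apply; rewrite ler_nat ltnS leq_maxr //.
pose I N := \int[mu]_z (`|h z| `^ p * w z * G N z).
have prI N : pr mu h (g N) = I N by apply: eq_Rintegral => z _; exact: hg.
have iI N : rint mu (fun z => `|h z| `^ p * w z * G N z).
  by apply: rint_ext (L2_mul Lh (bsupp_L2 (bg N))) => z; exact: hg.
have I0 N : 0 <= I N.
  by apply: Rint_ge0 => z; rewrite !mulr_ge0 ?powR_ge0 //; case: (G01 N z) => [->|[-> _]].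
have wI N : wint q sg (g N) <= I N.
  have [m [n hn]] := bg N; apply: Rint_le => //.
  by apply: rint_wint (lsg) m hn; exact: q0.
have IA N : I N <= (2%:R * K) `^ p * A.
  have [K00|Kn] := eqVneq K 0.
    have := H (g N) 1 (bg N) ltr01; rewrite K00 mul0r prI (ger0_norm (I0 N)) => h0.
    by apply: le_trans h0 _; rewrite mulr_ge0 ?powR_ge0.
  have Kp : 0 < K by rewrite lt0r Kn.
  have K2 : 0 < 2%:R * K by rewrite mulr_gt0.
  (* With this [t] the integral on the right carries the factor [1 / (2 * K)], so half of the left
     side is absorbed. *)
  pose t := (2%:R * K) `^ (p / q); have t0 : 0 < t by exact: powR_gt0.
  have tE : t `^ (- (q / p)) = (2%:R * K)^-1.
    rewrite /t -powRrM (_ : p / q * - (q / p) = -1); last by field; rewrite !gt_eqF.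
    by rewrite powR_inv1 // ltW.
  have := H (g N) t (bg N) t0; rewrite prI (ger0_norm (I0 N)) tE => h1.
  have h2 : I N <= K * (t * A + (2%:R * K)^-1 * I N).
    apply: le_trans h1 _; apply: ler_wpM2l => //; rewrite lerD2l.
    by apply: ler_wpM2l => //; rewrite invr_ge0 ltW.
  have h3 := absorb_half (_ : K * (2%:R * K)^-1 = 2^-1) h2.
  apply: le_trans (h3 _) _; first by field.
  rewrite /t le_eqVlt; apply/orP; left; apply/eqP; congr (_ * A).
  have := @powRD R (2%:R * K) 1 (p / q); rewrite (gt_eqF K2) implybT powRr1 ?(ltW K2) // => <- //.
  by congr (_ `^ _); rewrite -{1}eq2 mulfK ?gt_eqF //; ring.
apply: (@fatou_cvg _ _ _ mu (fun N z => `|h z| `^ p * w z * G N z)).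
- by move=> N; exact: rint_meas (iI N).
- apply: measurable_funM => //; apply: measurable_powR_pos; exact: measurableT_comp.
- by move=> N z; rewrite !mulr_ge0 ?powR_ge0 //; case: (G01 N z) => [->|[-> _]].
- by move=> z; rewrite mulr_ge0 ?powR_ge0.
- apply: aeW => z; apply: cvg_near_cst; have [N hN] := in_box z.
  exists (maxn N (maxn (Num.truncn `|h z|) (Num.truncn (w z)))) => // k /=; rewrite !geq_max => /and3P[k1 k2 k3].
  have /andP[_ /ltW u1] := truncn_itv (normr_ge0 (h z)); have /andP[_ /ltW u2] := truncn_itv (w0 z).
  have v1 : `|h z| <= (k.+1)%:R by apply: le_trans u1 _; rewrite ler_nat ltnS.
  have v2 : w z <= (k.+1)%:R by apply: le_trans u2 _; rewrite ler_nat ltnS.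
  have -> : G k z = 1 by rewrite /G v1 v2 indicE (mem_set (hN _ k1)) /= mulr1.
  by rewrite mulr1.
by move=> N; rewrite -rintE // lee_fin; exact: IA.
Qed.
End WeightedLimits.

Lemma root_half_ge1 (R : realType) (x y : R) : 0 <= x -> 0 <= y ->
  1 <= x `^ 2%:R^-1 * y `^ 2%:R^-1 -> 1 <= x * y.
Proof.
move=> x0 y0; rewrite -powRM // leNgt => /negP h1; rewrite leNgt; apply/negP => lt1; apply: h1.
have one2 : (1 : R) `^ 2%:R^-1 = 1 by rewrite powR1.
by rewrite -[X in _ < X]one2; apply: gt0_ltr_powR => //; rewrite ?nnegrE ?invr_gt0 ?ltr0n ?mulr_ge0.
Qed.

(** * Weighted and commutator bounds on one square *)

Section RealEstimates.
Variables (R : realType) (M C th : R) (S : (borel2 R -> R) -> borel2 R -> R).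
Variable (k : R * R -> R * R -> R).
Hypotheses (M0 : 0 < M) (C0 : 0 <= C) (th0 : 0 < th) (th1 : th <= 1).
Hypothesis rc : real_cz M C th S k.
Variables (p q : R).
Hypotheses (p1 : 1 < p) (q1 : 1 < q) (pq : p^-1 + q^-1 = 1).
Local Notation mu := (@leb2 R).

Definition kernelC : R := 192%:R * C * (2%:R * (1 + (th / 2%:R)^-1)) ^+ 2.

Let p0 : 0 < p. Proof. exact: lt_trans p1. Qed.
Let q0 : 0 < q. Proof. exact: lt_trans q1. Qed.

Lemma kernelC_ge0 : 0 <= kernelC.
Proof.
by apply: mulr_ge0; [exact: mulr_ge0 (ler0n R 192) C0|exact: sqr_ge0].
Qed.

Definition weightedK (C1 : R) : R := 4%:R * (sparseC kernelC M * LamC p q (9%:R * C1)).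

Definition commK (C1 C2 B : R) : R :=
  4%:R * (commC M kernelC p q (9%:R * C1) (9%:R * C2) * (81%:R * B * C1 * C2)).

Lemma commC_ge0 C1 C2 B : 0 < C1 -> 0 < C2 -> 0 <= B ->
  0 <= commC M kernelC p q (9%:R * C1) (9%:R * C2) * (81%:R * B * C1 * C2).
Proof.
move=> C10 C20 B0; have C91 : 0 < 9%:R * C1 by rewrite mulr_gt0 ?ltr0n.
have C92 : 0 < 9%:R * C2 by rewrite mulr_gt0 ?ltr0n.
have D0 : 0 <= 81%:R * B * C1 * C2.
  by apply: mulr_ge0 (ltW C20); apply: mulr_ge0 (ltW C10); exact: mulr_ge0 (ler0n R 81) B0.
apply: mulr_ge0 D0; rewrite /commC; apply: mulr_ge0; first exact: sparseC_ge0 kernelC_ge0 (ltW M0).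
apply: addr_ge0; apply: mulr_ge0; try (by apply: bloomK_ge0; exact: ltW).
  by apply: addr_ge0; [apply: mulr_ge0 (stopA_ge0 R); exact: ler0n|exact: ler0n].
by apply: mulr_ge0 (stopA_ge0 R); exact: ler0n.
Qed.

Section Root.
Variables (a : R * R) (l : R).
Hypothesis l0 : 0 < l.
Local Notation Q := (square a l).

Lemma grid_young (K : R) w v L (f g : cell L -> R) (be : R) t : 0 <= K ->
  local_weight w -> local_weight v -> 0 < t ->
  `|be| <= 4%:R * (K * (lp p (eavg a l w (L:=L)) f * lp q (eavg a l v (L:=L)) g)) ->
  `|side l L ^+ 2 * be| <= 4%:R * K * (t * wint p w (stepf a (side l L) f) +
    t `^ (- (q / p)) * wint q v (stepf a (side l L) g)).
Proof.
move=> K0 lw lv t0 h; have s2 : 0 < side l L ^+ 2 by rewrite exprn_gt0 // side_gt0.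
rewrite normrM (ger0_norm (ltW s2)); apply: le_trans (ler_wpM2l (ltW s2) h) _.
have ar (s u x y : R) : s * (u * (x * y)) = u * x * (s * y) by ring.
rewrite [leLHS](ar _ 4%:R K); apply: ler_wpM2l; first exact: mulr_ge0 (ler0n R 4) K0.
exact: lp_young.
Qed.

Lemma root_weighted C1 w sg f g t : 0 < C1 -> weight_pair p q C1 w sg -> on_root a l f ->
  on_root a l g -> 0 < t ->
  `|pr mu (S f) g| <= weightedK C1 * (t * wint p w f + t `^ (- (q / p)) * wint q sg g).
Proof.
move=> C10 wp rf rg t0; have [lw lsg _ _] := wp.
have [N [cf cg _]] := condE_ae l0 rf rg rf.
have [mf [Bf [Bf0 hf]]] := rf; have [mg [Bg [Bg0 hg]]] := rg.
set F : nat -> borel2 R -> R := fun n => condE a l (N n) f.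
set G : nat -> borel2 R -> R := fun n => condE a l (N n) g.
have mF n : measurable_fun setT (F n) by exact: measurable_stepf.
have mG n : measurable_fun setT (G n) by exact: measurable_stepf.
have hF n z : `|F n z| <= Bf * \1_Q z by exact: condE_bound.
have hG n z : `|G n z| <= Bg * \1_Q z by exact: condE_bound.
have LF n : L2 mu (F n) by apply: L2_stepf; exact: side_gt0.
have LG n : L2 mu (G n) by apply: L2_stepf; exact: side_gt0.
have lim := prS_cvg M0 rc LF LG (on_root_L2 rf) (on_root_L2 rg)
  (dct_root mF mf hF hf cf) (dct_root mG mg hG hg cg).
apply: (le_cvg_le (cvg_norm lim)
  (v := fun n => weightedK C1 * (t * wint p w (F n) + t `^ (- (q / p)) * wint q sg (G n)))).
  apply: cvgM; first exact: cvg_cst.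
  apply: cvgD; apply: cvgM; [exact: cvg_cst| |exact: cvg_cst|].
    exact: (wint_cvg p1 lw mF mf hF hf cf).
  exact: (wint_cvg q1 lsg mG mg hG hg cg).
move=> n; have s0 := side_gt0 l0 (N n).
have cz := cbeta_cz M0 C0 th0 th1 rc (N n) a s0.
have C9 : 0 < 9%:R * C1 by rewrite mulr_gt0 ?ltr0n.
have bound := core_weighted (ltW M0) kernelC_ge0 cz (eavg a l f) (eavg a l g) p1 q1 pq C9
  (dual_weights_eavg p1 q1 pq (N n) a l0 wp).
rewrite /F /G /condE (prS_bil rc) //; apply: (grid_young _ lw lsg t0 bound).
by apply: mulr_ge0; [exact: sparseC_ge0 kernelC_ge0 (ltW M0)|exact: LamC_ge0 (ltW C9)].
Qed.

Lemma eavg_indic L (u : borel2 R -> R) x : eavg a l (fun z => u z * \1_Q z) x = @eavg R a l L u x.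
Proof.
rewrite /eavg; congr (_ * _); apply: eq_Rintegral => z _.
have [hz|hz] := pselect (gcell a (side l L) x z); last by rewrite !indicE (memNset hz) !mulr0.
rewrite [\1_Q z]indicE mem_set ?mulr1 //.
by have := gcell_sub (side_gt0 l0 L) hz; rewrite sideK.
Qed.

(** On the grid the multiplier is replaced by its cell averages. As [b] is bounded, products of
    conditional expectations converge in $L^2$ to the products, and the matrix estimate passes to
    the limit. *)
Lemma root_commutator C1 C2 w sg la m f g (b : borel2 R -> R) (B Bb : R) t : 0 < C1 -> 0 < C2 ->
  weight_pair p q C1 w sg -> weight_pair p q C2 la m -> 0 <= B ->
  measurable_fun setT b -> (forall z, `|b z| <= Bb) ->
  (forall c r, 0 < r -> exists k, \int[mu]_z (`|b z - k| * \1_(square c r) z) <=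
     B * sqint (fun z => w z `^ p^-1 * m z `^ q^-1) c r) ->
  on_root a l f -> on_root a l g -> 0 < t ->
  `|pr mu (S f) (fun z => b z * g z) - pr mu (S (fun z => b z * f z)) g| <=
    commK C1 C2 B * (t * wint p w f + t `^ (- (q / p)) * wint q m g).
Proof.
move=> C10 C20 wp lp2 B0 mb hb osc rf rg t0.
have [lw lsg ow _] := wp; have [lla lm ola _] := lp2.
have Bb0 : 0 <= Bb := le_trans (normr_ge0 _) (hb (0, 0)).
set bQ : borel2 R -> R := fun z => b z * \1_Q z.
have hbQ z : `|bQ z| <= Bb * \1_Q z.
  by rewrite normrM [X in _ * X <= _]ger0_norm ?indicE // ler_wpM2r.
have mbQ : measurable_fun setT bQ.
  by apply: measurable_funM => //; exact: measurable_indic (measurable_square _ _).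
have rb : on_root a l bQ by split => //; exists Bb.
have [N [cf cg cb]] := condE_ae l0 rf rg rb.
have [mf [Bf [Bf0 hf]]] := rf; have [mg [Bg [Bg0 hg]]] := rg.
set F : nat -> borel2 R -> R := fun n => condE a l (N n) f.
set G : nat -> borel2 R -> R := fun n => condE a l (N n) g.
set W : nat -> borel2 R -> R := fun n => condE a l (N n) bQ.
have mE n u : measurable_fun setT (condE a l (N n) u : borel2 R -> R) by exact: measurable_stepf.
have hF n z : `|F n z| <= Bf * \1_Q z by exact: condE_bound.
have hG n z : `|G n z| <= Bg * \1_Q z by exact: condE_bound.
have hW n z : `|W n z| <= Bb * \1_Q z by exact: condE_bound.
have LE n u : L2 mu (condE a l (N n) u) by apply: L2_stepf; exact: side_gt0.
have WE n (u : borel2 R -> R) : (fun z => W n z * condE a l (N n) u z) =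
    stepf a (side l (N n)) (fun x : cell (N n) => eavg a l b x * eavg a l u x).
  apply/funext => z; rewrite /W /condE (@stepf_map2 _ _ a _ (side_gt0 l0 (N n)) (fun s t => s * t)) ?mulr0 //.
  by congr (@stepf R (N n) a (side l (N n)) _ z); apply/funext => x; rewrite eavg_indic.
have LWE n u : L2 mu (fun z => W n z * condE a l (N n) u z).
  by rewrite WE; apply: L2_stepf; exact: side_gt0.
have bu (u : borel2 R -> R) (Bu : R) : measurable_fun setT u -> 0 <= Bu -> (forall z, `|u z| <= Bu * \1_Q z) ->
    {ae mu, forall z, condE a l (N n) u z @[n --> \oo] --> u z} ->
    L2 mu (fun z => b z * u z) /\
    nsq mu (fun z => W n z * condE a l (N n) u z - b z * u z) @[n --> \oo] --> (0 : R).
  move=> mu_ Bu0 hu cu; have ru : on_root a l u by split => //; exists Bu.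
  have mul1 (s s' z : R) (i : bool) : 0 <= s -> 0 <= s' -> z <= (s * i%:R) * (s' * i%:R) -> z <= s * s' * i%:R.
    by case: i; rewrite ?mulr1 ?mulr0 ?mul0r.
  have hbu z : `|b z * u z| <= Bb * Bu * \1_Q z.
    by rewrite normrM -mulrA; apply: ler_pM.
  have mbu : measurable_fun setT (fun z => b z * u z) by exact: measurable_funM.
  split; first by exact: L2_bounded (measurable_square _ _) (leb2_square_fin _ _) mbu hbu.
  apply: (dct_root (B := Bb * Bu)) => //.
  - by move=> n; apply: measurable_funM; exact: mE.
  - move=> n z; rewrite normrM; have h1 := hW n z.
    have h2 : `|condE a l (N n) u z| <= Bu * \1_Q z by exact: condE_bound.
    have := ler_pM (normr_ge0 _) (normr_ge0 _) h1 h2; rewrite indicE; exact: mul1.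
  - apply: (ae_mp2 cb cu) => z hcb hcu.
    have -> : b z * u z = bQ z * u z.
      have [Qz|nQz] := pselect (Q z); first by rewrite /bQ indicE mem_set // mulr1.
      by have := hu z; rewrite indicE memNset // mulr0 normr_le0 => /eqP ->; rewrite !mulr0.
    exact: cvgM.
have [Lbg cbg] := bu g Bg mg Bg0 hg cg; have [Lbf cbf] := bu f Bf mf Bf0 hf cf.
have LF n : L2 mu (F n) := LE n f; have LG n : L2 mu (G n) := LE n g.
have dF := dct_root (fun n => mE n f) mf hF hf cf; have dG := dct_root (fun n => mE n g) mg hG hg cg.
have lim1 := prS_cvg M0 rc LF (fun n => LWE n g) (on_root_L2 rf) Lbg dF cbg.
have lim2 := prS_cvg M0 rc (fun n => LWE n f) LG Lbf (on_root_L2 rg) cbf dG.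
apply: (le_cvg_le (cvg_norm (cvgB lim1 lim2))
  (v := fun n => commK C1 C2 B * (t * wint p w (F n) + t `^ (- (q / p)) * wint q m (G n)))).
  apply: cvgM; first exact: cvg_cst.
  apply: cvgD; apply: cvgM; [exact: cvg_cst| |exact: cvg_cst|].
    exact: (wint_cvg p1 lw (fun n => mE n f) mf hF hf cf).
  exact: (wint_cvg q1 lm (fun n => mE n g) mg hG hg cg).
move=> n; have s0 := side_gt0 l0 (N n).
have cz := cbeta_cz M0 C0 th0 th1 rc (N n) a s0.
have C91 : 0 < 9%:R * C1 by rewrite mulr_gt0 ?ltr0n.
have C92 : 0 < 9%:R * C2 by rewrite mulr_gt0 ?ltr0n.
set nu := fun z => w z `^ p^-1 * m z `^ q^-1; set nv := fun z => la z `^ p^-1 * sg z `^ q^-1.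
have lnu : local_weight nu by exact: local_weight_prod.
have lnv : local_weight nv by exact: local_weight_prod.
have half : (2%:R : R)^-1 + 2%:R^-1 = 1 by field.
have two1 : 1 < 2%:R :> R by rewrite ltr1n.
(* The two Bloom weights are inverse to each other pointwise; Cauchy--Schwarz, in the form of
   [eavg_one] with both exponents 2, then bounds products of their cell averages from below. *)
have nn z : nu z `^ 2%:R^-1 * nv z `^ 2%:R^-1 = 1.
  rewrite -powRM ?(ltW (lw_gt0 lnu z)) ?(ltW (lw_gt0 lnv z)) //.
  have ar (x y u v : R) : x * v = 1 -> u * y = 1 -> x * y * (u * v) = 1.
    move=> h1 h2; have e1 : x * y * (u * v) = (x * v) * (u * y) by rewrite -!mulrA [v * _]mulrCA [y * _]mulrCA [y * v]mulrC.
    by rewrite e1 h1 h2 mulr1.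
  by rewrite /nu /nv (ar _ _ _ _ (ow z) (ola z)) powR1.
have hn (x : cell (N n)) := eavg_one two1 two1 half a l0 x lnu lnv nn.
have D0 : 0 <= 81%:R * B * C1 * C2.
  by apply: mulr_ge0 (ltW C20); apply: mulr_ge0 (ltW C10); exact: mulr_ge0 (ler0n R 81) B0.
have bound := core_commutator (ltW M0) kernelC_ge0 cz (eavg a l f) (eavg a l g) p1 q1 pq C91 C92 D0
  (dual_weights_eavg p1 q1 pq (N n) a l0 wp) (dual_weights_eavg p1 q1 pq (N n) a l0 lp2)
  (nu := eavg a l nu) (nv := eavg a l nv) (b := eavg a l b) _ _ _ _ _.
have -> : `|((fun n0 => pr mu (S (F n0)) (fun z => W n0 z * condE a l (N n0) g z)) -
    (fun n0 => pr mu (S (fun z => W n0 z * condE a l (N n0) f z)) (G n0))) n| =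
  `|pr mu (S (F n)) (fun z => W n z * condE a l (N n) g z) -
    pr mu (S (fun z => W n z * condE a l (N n) f z)) (G n)| by [].
rewrite /F /G (WE n g) (WE n f) /condE !(prS_bil rc) // -mulrBr.
apply: (grid_young _ lw lm t0); last first.
  apply: bound.
  - by move=> x; case: (hn x).
  - by move=> x; case: (hn x).
  - by move=> x; case: (hn x) => h1 h2 h3; exact (root_half_ge1 (ltW h2) (ltW h3) h1).
  - by move=> x; exact: eavg_hoelder.
  - have ib c r : rint mu (fun z => b z * \1_(square c r) z).
    by apply: (rint_bounded (measurable_square c r) (leb2_square_fin c r) (M := Bb));
      [apply: measurable_funM => //; exact: measurable_indic (measurable_square _ _)|
       move=> z; rewrite normrM [X in _ * X <= _]ger0_norm ?indicE // ler_wpM2r].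
    by eapply bmo_cells_eavg; eauto.
exact: commC_ge0.
Qed.
End Root.
End RealEstimates.

Lemma Rint0 d (X : measurableType d) (R : realType) (mu : {measure set X -> \bar R}) (u : X -> R) :
  (forall x, u x = 0) -> \int[mu]_x u x = 0.
Proof. by move=> u0; under eq_Rintegral do rewrite u0; rewrite Rintegral_cst // mul0r. Qed.

Lemma ae_imp d (X : measurableType d) (R : realType) (mu : {measure set X -> \bar R})
    (P1 P2 : X -> Prop) : {ae mu, forall x, P1 x} -> (forall x, P1 x -> P2 x) -> {ae mu, forall x, P2 x}.
Proof. by move=> h1 h; apply: filterS h1. Qed.

(** * Weak type estimate *)

Lemma weak_arith (R : realFieldType) (t m n K d : R) :
  t * m - 25%:R * n <= K * n + t / 2%:R * m + d / 2%:R -> t * m <= 2%:R * (25%:R + K) * n + d.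
Proof.
rewrite [t / 2%:R * m]mulrAC; have -> : 2%:R * (25%:R + K) * n = 2%:R * (25%:R * n) + 2%:R * (K * n) by ring.
by set a := t * m; set b := 25%:R * n; set c := K * n => *; lra.
Qed.

(** [e] is the indicator of the level set, [w] that of a union of cells close to it, [u] that of the
    exceptional set. The operator is tested on the cells of [w] off [u]; the last term is the price
    of replacing [e] by [w]. *)
Lemma weak_pointwise (R : realFieldType) (t c h : R) (e w u : bool) : `|c| = 1 -> 0 < t ->
  (e -> t < c * h) ->
  t * (e%:R - u%:R) <= c * (h * (w && ~~ u)%:R) + `|h| * `|w%:R - e%:R|.
Proof.
move=> c1 t0 eh; have ch : `|c * h| = `|h| by rewrite normrM c1 mul1r.
have h1 := ler_norm (c * h); have h2 := ler_norm (- (c * h)); rewrite normrN ch in h2.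
rewrite ch in h1; have h3 := normr_ge0 h; rewrite mulrA; set x := c * h in h1 h2 eh *; set y := `|h| in h1 h2 h3 *.
case: e eh => [/(_ isT) e1|_]; case: w; case: u;
  rewrite /= ?subrr ?subr0 ?sub0r ?normr0 ?normrN ?normr1 ?mulr0 ?mulr1 ?addr0 ?add0r; lra.
Qed.

Lemma weak_final (R : realFieldType) (t m u nf c2 M w sN sl D x1 a1 a2 P v b2 : R) : 0 < t -> 0 < M -> 0 <= c2 ->
  t * (m - u) <= x1 + D -> u <= 25%:R * P / t -> P <= nf -> x1 <= a1 + a2 ->
  a1 <= c2 * P + M * (2%:R * M / t * (4%:R * t * P) + (2%:R * M / t)^-1 * v) -> v <= w ->
  a2 <= (sN + b2) / 2%:R -> b2 <= sl ->
  t * m - 25%:R * nf <= (c2 + 8%:R * M ^+ 2) * nf + t / 2%:R * w + ((sN + sl) / 2%:R + D).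
Proof.
move=> t0 M0 c20 h1 h2 Pn h3 + vw h5 h6.
have -> : c2 * P + M * (2%:R * M / t * (4%:R * t * P) + (2%:R * M / t)^-1 * v) =
    c2 * P + 8%:R * M ^+ 2 * P + t / 2%:R * v by field; rewrite !gt_eqF.
have h7 : t * u <= 25%:R * P.
  by have := ler_wpM2l (ltW t0) h2; rewrite (_ : t * (_ / t) = 25%:R * P) //; field; rewrite gt_eqF.
have h8 : c2 * P <= c2 * nf by rewrite ler_wpM2l.
have h9 : 8%:R * M ^+ 2 * P <= 8%:R * M ^+ 2 * nf by rewrite ler_wpM2l // mulr_ge0 ?sqr_ge0 ?ler0n.
have h10 : t / 2%:R * v <= t / 2%:R * w by rewrite ler_wpM2l // divr_ge0 ?ler0n // ltW.
have h11 : (8%:R * M ^+ 2 + c2) * nf = 8%:R * M ^+ 2 * nf + c2 * nf by rewrite mulrDl.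
rewrite [c2 + _]addrC h11; rewrite mulrBr in h1.
move: h1 h7 h8 h9 h10 h3 h5 h6 Pn; clear.
set A1 := t * m; set A2 := t * u; set A3 := c2 * P; set A4 := c2 * nf; set A5 := 8%:R * _ * P.
set A6 := 8%:R * _ * nf; set A7 := t / _ * v; set A8 := t / _ * w => *; lra.
Qed.

Section WeakType.
Variables (R : realType) (M C th : R) (S : (borel2 R -> R) -> borel2 R -> R).
Variable (k : R * R -> R * R -> R).
Hypotheses (M0 : 0 < M) (C0 : 0 <= C) (th0 : 0 < th) (th1 : th <= 1).
Hypothesis rc : real_cz M C th S k.
Local Notation mu := (@leb2 R).
Local Notation Ck := (kernelC C th).

Lemma nsq_opB (u v : borel2 R -> R) : L2 mu u -> L2 mu v ->
  nsq mu (fun z => S u z - S v z) <= M ^+ 2 * nsq mu (fun z => u z - v z).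
Proof.
move=> Lu Lv; have Lw := L2B Lu Lv; apply: le_trans (rc_bd rc Lw).
have ae := rc_lin rc (-1) Lv Lu.
have E : (fun t => -1 * v t + u t) = (fun z => u z - v z) by apply/funext => z; ring.
rewrite E in ae; rewrite /nsq le_eqVlt; apply/orP; left; apply/eqP; apply: Rint_ae.
- by case: (L2B (rc_L2 rc Lu) (rc_L2 rc Lv)) => m _; exact: measurable_funX.
- by case: (rc_L2 rc Lw) => m _; exact: measurable_funX.
- by apply: filterS ae => z ->; ring.
Qed.

Lemma nsq_op_cvg (F : nat -> borel2 R -> R) f : (forall n, L2 mu (F n)) -> L2 mu f ->
  nsq mu (fun z => F n z - f z) @[n --> \oo] --> (0 : R) ->
  nsq mu (fun z => S (F n) z - S f z) @[n --> \oo] --> (0 : R).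
Proof.
move=> LF Lf cF; apply: (squeeze_cvgr (f := fun=> 0) (h := fun n => M ^+ 2 * nsq mu (fun z => F n z - f z))).
- by apply: nearW => n; rewrite nsq_ge0 nsq_opB.
- exact: cvg_cst.
- by rewrite -[X in _ --> X](mulr0 (M ^+ 2)); apply: cvgM => //; exact: cvg_cst.
Qed.

Lemma op_cvg_ae (F : nat -> borel2 R -> R) f : (forall n, L2 mu (F n)) -> L2 mu f ->
  nsq mu (fun z => F n z - f z) @[n --> \oo] --> (0 : R) ->
  exists N : nat -> nat, {ae mu, forall z, S (F (N n)) z @[n --> \oo] --> S f z}.
Proof.
move=> LF Lf cF.
exact (ae_cvg_of_L2 (fun n => rc_L2 rc (LF n)) (rc_L2 rc Lf) (nsq_op_cvg LF Lf cF)).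
Qed.

Definition weakK : R := 2%:R * (25%:R + (2%:R * Ck + 8%:R * M ^+ 2)).

Section Root.
Variables (a : R * R) (l : R).
Hypothesis l0 : 0 < l.
Local Notation Q := (square a l).

Lemma grid_weak L (f : cell L -> R) (t : R) : 0 < t -> side l L ^+ 2 * \sum_x `|f x| <= t * l ^+ 2 ->
  exists U : pred (cell L), side l L ^+ 2 * (\sum_(x | U x) 1) <= 25%:R * (side l L ^+ 2 * \sum_x `|f x|) / t /\
    forall (V : pred (cell L)) (s : R), (forall x, V x -> ~~ U x) -> 0 < s ->
      `|pr mu (S (stepf a (side l L) f)) (stepf a (side l L) (fun x => (V x)%:R))| <=
      2%:R * Ck * (side l L ^+ 2 * \sum_x `|f x|) +
        M * (s * (4%:R * t * (side l L ^+ 2 * \sum_x `|f x|)) + s^-1 * (side l L ^+ 2 * \sum_(y | V y) 1)).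
Proof.
move=> t0 ft; have s0 := side_gt0 l0 L; have s2 : 0 < side l L ^+ 2 by rewrite exprn_gt0.
have cz := cbeta_cz M0 C0 th0 th1 rc L a s0.
have avt (x : cell L) : av L (fun y => `|f y|) x <= t.
  rewrite /av (eq_bigl xpredT); last by move=> y; rewrite nbL.
  rewrite -(ler_pM2l (exprn_gt0 2 l0)) mulrC [_ * t]mulrC; apply: le_trans ft.
  rewrite mulrC mulrA le_eqVlt; apply/orP; left; apply/eqP; congr (_ * _).
  by rewrite /side expr_div_n natrX -exprM mulnC exprM -(natrX R 2 2).
have [U [hU hV]] := core_weak (ltW M0) (kernelC_ge0 th C0) cz t0 avt.
exists U; split.
  by rewrite mulrCA -[X in _ <= X]mulrA ler_pM2l.
move=> V s VU s1; rewrite (prS_bil rc) // normrM [X in X * _]ger0_norm ?(ltW s2) //.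
rewrite (_ : _ + _ = side l L ^+ 2 * (2%:R * Ck * (\sum_x `|f x|) +
   M * (s * (4%:R * t * \sum_x `|f x|) + s^-1 * \sum_(y | V y) 1))); last by ring.
by rewrite (ler_pM2l s2) hV.
Qed.
(** The level set is no union of cells, so the matrix bound is tested on the cells where its average
    exceeds one half. On finer and finer grids the indicators of these cells converge to that of the
    level set, and the errors tend to 0 up to [eps]. *)
Lemma root_weak f (t c : R) : on_root a l f -> 0 < t -> \int[mu]_z `|f z| <= t * l ^+ 2 -> `|c| = 1 ->
  t * \int[mu]_z (\1_[set z | Q z /\ t < c * S f z] z) <= weakK * \int[mu]_z `|f z|.
Proof.
move=> rf t0 ft c1; set E : set (borel2 R) := [set z | _]; set nf := \int[mu]_z `|f z|.
have LSf := rc_L2 rc (on_root_L2 rf); have [mSf _] := LSf.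
have mE : measurable E.
  apply: measurableI; first exact: measurable_square.
  by apply: measurable_gt; apply: measurable_funM => //; exact: measurable_cst.
pose e : borel2 R -> R := \1_E.
have me : measurable_fun setT e by exact: measurable_indic.
have he z : `|e z| <= 1 * \1_Q z.
  rewrite /e !indicE mul1r; have [[hz _]|hz] := pselect (E z); last by rewrite memNset ?normr0 ?ler0n //.
  by rewrite (mem_set hz : (z \in Q) = true) normr_nat ler_nat leq_b1.
have re : on_root a l e by split => //; exists 1.
have [N [cf ce _]] := condE_ae l0 rf re re.
have [mf [Bf [Bf0 hf]]] := rf.
set F : nat -> borel2 R -> R := fun n => condE a l (N n) f.
have mF n : measurable_fun setT (F n) by exact: measurable_stepf.
have hF n z : `|F n z| <= Bf * \1_Q z by exact: condE_bound.
have LF n : L2 mu (F n) by apply: L2_stepf; exact: side_gt0.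
pose W n : borel2 R -> R := fun z => (2^-1 < condE a l (N n) e z)%R%:R.
have mW n : measurable_fun setT (W n).
  rewrite (_ : W n = \1_[set z | 2^-1 < condE a l (N n) e z]).
    by apply: measurable_indic; apply: measurable_gt; exact: measurable_stepf.
  by apply/funext => z; rewrite indicE /W; congr ((nat_of_bool _)%:R); apply/idP/idP => [h|]; [exact: mem_set|rewrite inE].
have hW n z : `|W n z| <= 1 * \1_Q z.
  have : `|condE a l (N n) e z| <= 1 * \1_Q z by exact: condE_bound.
  rewrite /W !mul1r !indicE.
  have [hz|hz] := pselect (Q z); first by rewrite (mem_set hz) normr_nat ler_nat leq_b1.
  by rewrite (memNset hz) !normr_le0 => /eqP ->; rewrite ltNge invr_ge0 ler0n.
have cW : {ae mu, forall z, W n z @[n --> \oo] --> e z}.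
  apply: (ae_imp ce) => z /cvgrPdist_lt cz; apply: cvg_near_cst.
  have h20 : 0 < 2^-1 :> R by rewrite invr_gt0.
  apply: filterS (cz _ h20) => n; rewrite /W /e indicE; case: (_ \in _); rewrite ?sub0r ?normrN.
    move=> /(le_lt_trans (ler_norm _)); set x := condE _ _ _ _ _ => h.
    by have -> : 2^-1 < x by (move: h; rewrite [true%:R]/=; move: x => x; lra).
  move=> /(le_lt_trans (ler_norm _)) h; case: ltP => // h'.
  by have := lt_trans h' h; rewrite ltxx.
have rQ : rint mu (fun z => 1 * \1_Q z : R) by apply: rintZ; exact: rint_square.
have LQ : L2 mu (fun z => 1 * \1_Q z).
  apply: (L2_bounded (measurable_square a l) (leb2_square_fin a l) (M := 1)).
    by apply: measurable_funM => //; exact: measurable_indic (measurable_square _ _).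
  by move=> z; rewrite ger0_norm // mul1r indicE.
have [rE limW] := dct mW me cW rQ hW.
pose D n z := `|S f z| * `|W n z - e z|.
have mD n : measurable_fun setT (D n).
  by apply: measurable_funM; apply: measurableT_comp => //; exact: measurable_funB.
have rG : rint mu (fun z => 2%:R * `|S f z * (1 * \1_Q z)|) by apply/rintZ/rint_norm/L2_mul.
have hD n z : `|D n z| <= 2%:R * `|S f z * (1 * \1_Q z)|.
  rewrite normrM !normr_id [X in _ <= _ * X]normrM mulrCA ler_wpM2l //.
  by have := ler_normB (W n z) (e z); have := hW n z; have := he z; have := ler_norm (1 * \1_Q z : R); lra.
have cD : {ae mu, forall z, D n z @[n --> \oo] --> (0 : R)}.
  apply: (ae_imp cW) => z cz; rewrite -(mulr0 `|S f z|) -(normr0 R) -(subrr (e z)).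
  by apply: cvgM; [exact: cvg_cst|apply: cvg_norm; apply: cvgB => //; exact: cvg_cst].
have [_] := dct mD (measurable_cst (0 : R)) cD rG hD; rewrite (Rint0 mu (fun=> erefl)) => limD.
have limS := nsq_op_cvg LF (on_root_L2 rf) (dct_root mF mf hF hf cf).
(* This choice makes [sg^-1 * l ^ 2] equal to [eps], the part of the error that does not tend to
   0. *)
apply/ler_addgt0Pr => eps eps0; pose sg := l ^+ 2 / eps.
have sg0 : 0 < sg by rewrite divr_gt0 // exprn_gt0.
rewrite -[X in _ + X]/eps; apply: weak_arith.
apply: (le_cvg_le (u := fun=> t * \int[mu]_z \1_E z - 25%:R * nf)
  (v := fun n => (2%:R * Ck + 8%:R * M ^+ 2) * nf + t / 2%:R * \int[mu]_z W n z +
    ((sg * nsq mu (fun z => S (F n) z - S f z) + sg^-1 * l ^+ 2) / 2%:R + \int[mu]_z D n z))).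
- exact: cvg_cst.
- apply: cvgD; first by apply: cvgD; [exact: cvg_cst|apply: cvgM => //; exact: cvg_cst].
  rewrite -[X in _ --> X]addr0; apply: cvgD => //; apply: cvgM; last exact: cvg_cst.
  rewrite (_ : eps = sg * 0 + sg^-1 * l ^+ 2); last first.
    by rewrite /sg; field; rewrite !gt_eqF.
  by apply: cvgD; [apply: cvgM => //|]; exact: cvg_cst.
move=> n; have s0 := side_gt0 l0 (N n).
pose P := side l (N n) ^+ 2 * \sum_(x : cell (N n)) `|eavg a l f x|.
have PE : P = \int[mu]_z `|F n z|.
  rewrite /F /condE; under eq_Rintegral do rewrite (@stepf_map _ _ a _ s0 (fun t => `|t|)) ?normr0 //.
  by rewrite Rint_stepf.
have Pn : P <= nf by rewrite PE; apply: condE_contract => //; exact: on_root_rint rf.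
have [U [hU hV]] := grid_weak t0 (le_trans Pn ft).
pose V : pred (cell (N n)) := fun x => (2^-1 < eavg a l e x)%R && ~~ U x.
pose s := 2%:R * M / t; have s1 : 0 < s by rewrite divr_gt0 // mulr_gt0.
have VU x : V x -> ~~ U x by case/andP.
have {}hV := hV V s VU s1.
set u1 : borel2 R -> R := stepf a (side l (N n)) (fun x : cell (N n) => (U x)%:R).
set v1 : borel2 R -> R := stepf a (side l (N n)) (fun x : cell (N n) => (V x)%:R) in hV.
have sumb (B : pred (cell (N n))) : side l (N n) ^+ 2 * (\sum_(x | B x) 1) =
    \int[mu]_z stepf a (side l (N n)) (fun x : cell (N n) => (B x)%:R) z.
  by rewrite Rint_stepf // big_mkcond; congr (_ * _); apply: eq_bigr => x _; case: (B x).
rewrite (sumb U) in hU; rewrite (sumb V) in hV; rewrite -/P in hU hV; rewrite -/u1 in hU; rewrite -/v1 in hV.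
have ru1 : rint mu u1 by exact: rint_stepf.
have Lv1 : L2 mu v1 by exact: L2_stepf.
have rv1 : rint mu v1 by exact: rint_stepf.
have rW : rint mu (W n) by exact: rint_bounded (measurable_square _ _) (leb2_square_fin _ _) (mW n) (hW n).
have rDn : rint mu (D n) by apply: rint_le rG => // z; apply: le_trans (hD n z) (ler_norm _).
have LSF : L2 mu (S (F n)) := rc_L2 rc (LF n).
have bits z : exists w u : bool, [/\ W n z = w%:R, u1 z = u%:R & v1 z = (w && ~~ u)%:R].
  exists (2^-1 < condE a l (N n) e z)%R.
  have [hz|hz] := pselect (Q z); last first.
    exists false; have nz : ~ square a (side l (N n) * (2 ^ N n)%:R) z by rewrite sideK.
    by rewrite /W /u1 /v1 /condE !(stepf_out s0 _ nz) // ltNge invr_ge0 ler0n.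
  have : square a (side l (N n) * (2 ^ N n)%:R) z by rewrite sideK.
  move=> /(gcell_locate s0)[x hx]; exists (U x).
  by rewrite /W /u1 /v1 /condE !(stepf_in s0 _ hx).
have pw z : t * (e z - u1 z) <= c * (S f z * v1 z) + D n z.
  have [w [u [E1 E2 E3]]] := bits z; rewrite /D E1 E2 E3 /e indicE; apply: weak_pointwise => //.
  by move=> /set_mem [].
have re1 : rint mu e := on_root_rint re.
have I1 : t * (\int[mu]_z \1_E z - \int[mu]_z u1 z) <= c * pr mu (S f) v1 + \int[mu]_z D n z.
  rewrite -(RintB re1 ru1) -RintZ; last exact: rintB.
  rewrite /pr -RintZ; last exact: L2_mul.
  rewrite -RintD //; last by apply: rintZ; exact: L2_mul.
  apply: Rint_le => //; first by apply: rintZ; exact: rintB.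
  by apply: rintD => //; apply: rintZ; exact: L2_mul.
have I2 : c * pr mu (S f) v1 <= `|pr mu (S (F n)) v1| + `|pr mu (fun z => S (F n) z - S f z) v1|.
  apply: le_trans (ler_norm _) _; rewrite normrM c1 mul1r.
  rewrite (prBl LSF LSf Lv1); set x := pr mu (S (F n)) v1; set y := pr mu (S f) v1.
  by have := ler_normB x (x - y); rewrite subKr.
have I3 := pr_le sg0 (L2B LSF LSf) Lv1.
have I4 : sg^-1 * nsq mu v1 <= sg^-1 * l ^+ 2.
  rewrite ler_wpM2l ?invr_ge0 ?(ltW sg0) //; rewrite -(Rint_square a (ltW l0)).
  apply: Rint_le; [by case: Lv1|exact: rint_square|] => z.
  have [w [u [E1 _ E3]]] := bits z; have := hW n z; rewrite E3 E1 mul1r.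
  by case: w {E1 E3}; case: u => //=; rewrite ?normr0 ?normr1 ?expr0n ?expr1n //= indicE ler0n.
have I5 : \int[mu]_z v1 z <= \int[mu]_z W n z.
  apply: Rint_le => // z; have [w [u [-> _ ->]]] := bits z.
  by rewrite ler_nat; case: w; case: u.
apply: (weak_final t0 M0 _ I1 hU Pn I2 hV I5 I3 I4).
by apply: mulr_ge0; [exact: ler0n|exact: kernelC_ge0].
Qed.
End Root.

Lemma bsupp_root (f g : borel2 R -> R) : bsupp f -> bsupp g -> exists N, forall n, (N <= n)%N ->
  on_root (- (n.+1)%:R, - (n.+1)%:R) (2%:R * (n.+1)%:R) f /\
  on_root (- (n.+1)%:R, - (n.+1)%:R) (2%:R * (n.+1)%:R) g.
Proof.
move=> [mf [N1 h1]] [mg [N2 h2]]; exists (maxn N1 N2) => n; rewrite geq_max => /andP[n1 n2].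
by split; split => //; exists (n.+1)%:R; split => //; [exact: bsupp_mono n1 h1|exact: bsupp_mono n2 h2].
Qed.

Lemma integral_level (t : R) (A : set (borel2 R)) : measurable A -> 0 < t ->
  (\int[mu]_z (t * \1_A z)%:E)%E = (t%:E * mu A)%E.
Proof.
move=> mA t0; under eq_integral do rewrite EFinM.
rewrite ge0_integralZl_EFin //; first by rewrite integral_indic // setIT.
- exact/measurable_EFinP/measurable_indic.
- exact: ltW.
Qed.

(** The square has to be so large that the mean of the absolute value of [f] over it is at most [t];
    it then grows to the plane. The sign [c] selects one half of the level set. *)
Let half_weak f (t c : R) : bsupp f -> 0 < t -> `|c| = 1 ->
  ((t%:E * mu [set z | t < c * S f z]%R)%E <= (weakK * \int[mu]_z `|f z|)%:E)%E.
Proof.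
move=> bf t0 c1; have [N hN] := bsupp_root bf bf; set nf := \int[mu]_z `|f z|.
have [mSf _] := rc_L2 rc (bsupp_L2 bf).
have mcS : measurable_fun setT (fun z => c * S f z) by apply: measurable_funM => //; exact: measurable_cst.
pose N1 := maxn N (Num.truncn (nf / t)).
pose E n : set (borel2 R) := [set z | box (n + N1)%N z /\ t < c * S f z].
have mE n : measurable (E n) by apply: measurableI; [exact: measurable_square|exact: measurable_gt].
have n0 : 0 <= nf by exact: Rint_ge0.
have ht n : t * \int[mu]_z (\1_(E n) z : R) <= weakK * nf.
  have Nn : (N <= n + N1)%N by rewrite (leq_trans (leq_maxl _ (Num.truncn (nf / t)))) // leq_addl.
  have [rf _] := hN _ Nn; apply: (root_weak (@box_side R (n + N1)) rf t0 _ c1).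
  have : nf / t <= ((n + N1).+1)%:R.
    have /andP[_ /ltW h] := truncn_itv (divr_ge0 n0 (ltW t0)); apply: le_trans h _.
    by rewrite ler_nat ltnS (leq_trans (leq_maxr N _)) // leq_addl.
  rewrite ler_pdivrMr // mulrC -/nf => h; apply: le_trans h _; rewrite ler_wpM2l ?(ltW t0) //.
  have h1 : 1 <= ((n + N1).+1)%:R :> R by rewrite ler1n.
  by move: h1; set x := _.+1%:R => h1; nra.
have mG : measurable [set z | t < c * S f z] by exact: measurable_gt.
rewrite -(integral_level mG t0).
apply: (fatou_cvg (u := fun n z => t * \1_(E n) z)).
- by move=> n; apply: measurable_funM => //; exact: measurable_indic.
- by apply: measurable_funM => //; exact: measurable_indic.
- by move=> n z; rewrite mulr_ge0 ?(ltW t0) // indicE.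
- by move=> z; rewrite mulr_ge0 ?(ltW t0) // indicE.
- apply: nearW => z; apply: cvg_near_cst; have [K hK] := in_box z; exists K => // n /= Kn.
  congr (t * _); rewrite !indicE; congr ((nat_of_bool _)%:R); apply/idP/idP; rewrite !inE /E //=; first by case.
  by move=> ?; split => //; apply: hK; rewrite (leq_trans Kn) // leq_addr.
move=> n; have rE : rint mu \1_(E n).
  apply: rint_indic => //; apply: le_lt_trans (leb2_square_fin (- (n + N1).+1%:R, - (n + N1).+1%:R) (2%:R * (n + N1).+1%:R)).
  apply: le_measure; rewrite ?inE //; first exact: measurable_square.
  by move=> z [].
by rewrite -rintE ?lee_fin ?RintZ //; exact: rintZ.
Qed.

Let bsupp_weak f (t : R) : bsupp f -> 0 < t ->
  ((t%:E * mu [set z | (t < `|S f z|)%R])%E <= (2%:R * weakK * \int[mu]_z `|f z|)%:E)%E.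
Proof.
move=> bf t0; have [mSf _] := rc_L2 rc (bsupp_L2 bf).
have n1 : `|1 : R| = 1 by rewrite normr1.
have n2 : `|- 1 : R| = 1 by rewrite normrN normr1.
have h1 := half_weak bf t0 n1; have h2 := half_weak bf t0 n2.
have mc c : measurable [set z | t < c * S f z].
  by apply: (measurable_gt t (u := fun z => c * S f z)); apply: measurable_funM => //; exact: measurable_cst.
rewrite -mulrA [2%:R * _]mulr_natl mulr2n EFinD; apply: le_trans (leeD h1 h2).
rewrite -ge0_muleDr //; apply: lee_wpmul2l; first by rewrite lee_fin ltW.
apply: le_trans (measureU2 _ (mc 1) (mc (-1))).
apply: le_measure; rewrite ?inE.
- by apply: (measurable_gt t (u := fun z => `|S f z|)); exact: measurableT_comp.
- exact: measurableU.
by move=> z /=; rewrite mul1r mulN1r ltr_normr => /orP.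
Qed.

Lemma weakK_ge0 : 0 <= weakK.
Proof.
apply: mulr_ge0 (ler0n R 2) _.
apply: addr_ge0 (ler0n R 25) _; apply: addr_ge0; last by apply: mulr_ge0 (ler0n R 8) (sqr_ge0 _).
by apply: mulr_ge0; [exact: ler0n|exact: kernelC_ge0].
Qed.

(** A strict inequality at the limit holds for all late members of the sequence, so the indicators
    of the level sets satisfy the one-sided hypothesis of [fatou_bound]. *)
Lemma level_fatou (h_ : nat -> borel2 R -> R) (h : borel2 R -> R) (t B : R) :
  (forall n, measurable_fun setT (h_ n)) -> measurable_fun setT h ->
  {ae mu, forall z, h_ n z @[n --> \oo] --> h z} -> 0 < t ->
  (forall n, ((t%:E * mu [set z | (t < `|h_ n z|)%R])%E <= B%:E)%E) ->
  ((t%:E * mu [set z | (t < `|h z|)%R])%E <= B%:E)%E.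
Proof.
move=> mh_ mh cN t0 hB.
have mL (u : borel2 R -> R) : measurable_fun setT u -> measurable [set z | t < `|u z|].
  by move=> mu_; apply: (measurable_gt t (u := fun z => `|u z|)); exact: measurableT_comp.
have m1 (u : borel2 R -> R) : measurable_fun setT u ->
    measurable_fun setT (fun z => t * \1_[set z | (t < `|u z|)%R] z).
  by move=> /mL mu_; apply: measurable_funM => //; exact: measurable_indic.
rewrite -(integral_level (mL _ mh) t0).
apply: (fatou_bound (u := fun n z => t * \1_[set z | (t < `|h_ n z|)%R] z)) => //.
- by move=> n; exact: m1.
- exact: m1.
- by move=> n z; rewrite mulr_ge0 ?(ltW t0) // indicE.
- by move=> z; rewrite mulr_ge0 ?(ltW t0) // indicE.
- apply: (ae_imp cN) => z cz e e0.
  have [hz|hz] := pselect (t < `|h z|); last first.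
    apply: nearW => n; rewrite [in leLHS]indicE memNset // mulr0.
    by apply: addr_ge0 (ltW e0); apply: mulr_ge0 (ltW t0) _; rewrite indicE.
  have cz1 : `|h_ n z| @[n --> \oo] --> `|h z| by apply: cvg_norm.
  have /cvgrPdist_lt cz' := cz1; have d0 : 0 < `|h z| - t by rewrite subr_gt0.
  apply: filterS (cz' _ d0) => n /(le_lt_trans (ler_norm _)) hh.
  have hn : t < `|h_ n z| by move: hh; set x := `|_|; set y := `|_| => hh; lra.
  by rewrite !indicE !mem_set // lerDl ltW.
by move=> n; rewrite (integral_level (mL _ (mh_ n)) t0).
Qed.

Lemma real_weak f (t : R) : L2 mu f -> rint mu f -> 0 < t ->
  ((t%:E * mu [set z | (t < `|S f z|)%R])%E <= (2%:R * weakK * \int[mu]_z `|f z|)%:E)%E.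
Proof.
move=> Lf rf t0; have mf := rint_meas rf.
have bt k := trunc_bsupp k mf; have Lt k := bsupp_L2 (bt k).
have [N cN] := op_cvg_ae Lt Lf (trunc_L2 Lf).
have mS u : L2 mu u -> measurable_fun setT (S u) by move=> /(rc_L2 rc)[].
apply: (level_fatou (fun n => mS _ (Lt (N n))) (mS _ Lf) cN t0) => n.
apply: le_trans (bsupp_weak (bt _) t0) _.
rewrite lee_fin; apply: ler_wpM2l; first exact: mulr_ge0 (ler0n R 2) weakK_ge0.
apply: Rint_le; [exact/rint_norm/bsupp_rint|exact: rint_norm|] => z; exact: trunc_le.
Qed.
End WeakType.

(** * Weighted bounds for real operators in the plane *)

Section RealWeighted.
Variables (R : realType) (M C th : R) (S : (borel2 R -> R) -> borel2 R -> R).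
Variable (k : R * R -> R * R -> R).
Hypotheses (M0 : 0 < M) (C0 : 0 <= C) (th0 : 0 < th) (th1 : th <= 1).
Hypothesis rc : real_cz M C th S k.
Variables (p q : R).
Hypotheses (p1 : 1 < p) (q1 : 1 < q) (pq : p^-1 + q^-1 = 1).
Local Notation mu := (@leb2 R).

Let p0 : 0 < p. Proof. exact: lt_trans p1. Qed.

Lemma weightedK_ge0 C1 : 0 < C1 -> 0 <= weightedK M C th p q C1.
Proof.
move=> C10; have C9 : 0 < 9%:R * C1 by rewrite mulr_gt0 ?ltr0n.
apply: mulr_ge0 (ler0n R 4) _; apply: mulr_ge0; last exact: LamC_ge0 (ltW C9).
by apply: sparseC_ge0 (ltW M0); exact: kernelC_ge0.
Qed.

Lemma bsupp_wint w f : local_weight w -> bsupp f -> rint mu (fun z => `|f z| `^ p * w z).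
Proof.
move=> lw [mf [N h]].
exact (rint_wint p0 lw mf h).
Qed.

Lemma weighted_op C1 w sg f : 0 < C1 -> weight_pair p q C1 w sg -> L2 mu f ->
  rint mu (fun z => `|f z| `^ p * w z) ->
  (\int[mu]_z (`|S f z| `^ p * w z)%:E <= ((2%:R * weightedK M C th p q C1) `^ p * wint p w f)%:E)%E.
Proof.
move=> C10 wp Lf iw; have [lw lsg _ _] := wp; have [mf _] := Lf.
have K0 := weightedK_ge0 C10.
have bt k := trunc_bsupp k mf; have Lt k := bsupp_L2 (bt k).
have bs u : bsupp u ->
    (\int[mu]_z (`|S u z| `^ p * w z)%:E <= ((2%:R * weightedK M C th p q C1) `^ p * wint p w u)%:E)%E.
  move=> bu; refine (dual_bound p1 q1 pq wp (rc_L2 rc (bsupp_L2 bu)) K0 (wint_ge0 p u lw) _) => g t bg t0.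
  have [N hN] := bsupp_root bu bg; have [rf rg] := hN N (leqnn N).
  exact (root_weighted M0 C0 th0 th1 rc p1 q1 pq (box_side R N) C10 wp rf rg t0).
have [N cN] := op_cvg_ae rc Lt Lf (trunc_L2 Lf).
have w0 z : 0 <= w z by rewrite ltW // lw_gt0.
have mw u : L2 mu u -> measurable_fun setT (fun z => `|S u z| `^ p * w z).
  move=> /(rc_L2 rc)[mSu _]; apply: measurable_funM; last exact: lw_meas lw.
  by apply: measurable_powR_pos; exact: measurableT_comp.
apply: (fatou_cvg (u := fun n z => `|S (trunc (N n) f) z| `^ p * w z)).
- by move=> n; exact: mw.
- exact: mw.
- by move=> n z; rewrite mulr_ge0 ?powR_ge0.
- by move=> z; rewrite mulr_ge0 ?powR_ge0.
- apply: (ae_imp cN) => z cz; apply: cvgM; last exact: cvg_cst.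
  have cn : `|S (trunc (N n) f) z| @[n --> \oo] --> `|S f z| by apply: cvg_norm.
  by apply: (cvg_powR_nneg p1 q1 pq _ _ cn).
move=> n; apply: le_trans (bs _ (bt _)) _; rewrite lee_fin.
apply: ler_wpM2l; first exact: powR_ge0.
apply: Rint_le => //; first exact: bsupp_wint.
by move=> z; rewrite ler_wpM2r // ge0_ler_powR ?nnegrE ?(ltW p0) // trunc_le.
Qed.

(** For bounded [b] the product [b * S f] is square integrable, so [dual_bound] applies, and the
    multiplication moves to the test function. *)
Lemma commutator_op C1 C2 w sg la m f (b : borel2 R -> R) (B Bb : R) : 0 < C1 -> 0 < C2 ->
  weight_pair p q C1 w sg -> weight_pair p q C2 la m -> 0 <= B ->
  measurable_fun setT b -> (forall z, `|b z| <= Bb) ->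
  (forall c r, 0 < r -> exists k, \int[mu]_z (`|b z - k| * \1_(square c r) z) <=
     B * sqint (fun z => w z `^ p^-1 * m z `^ q^-1) c r) -> bsupp f ->
  (\int[mu]_z (`|b z * S f z - S (fun t => b t * f t) z| `^ p * la z)%:E <=
    ((2%:R * commK M C th p q C1 C2 B) `^ p * wint p w f)%:E)%E.
Proof.
move=> C10 C20 wp lp2 B0 mb hb osc bf; have [lw lsg _ _] := wp.
have bbf := bsupp_mul mb hb bf; have Lbf := rc_L2 rc (bsupp_L2 bbf).
have Lf := rc_L2 rc (bsupp_L2 bf); have [mSf _] := Lf.
have LbS : L2 mu (fun z => b z * S f z).
  split; first exact: measurable_funM.
  have Bb0 : 0 <= Bb := le_trans (normr_ge0 _) (hb (0, 0)).
  apply: (rint_le _ _ (rintZ (Bb ^+ 2) (proj2 Lf))).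
    by apply: measurable_funX; exact: measurable_funM.
  move=> z; rewrite [leLHS]ger0_norm ?sqr_ge0 // [leRHS]ger0_norm; last by apply: mulr_ge0; exact: sqr_ge0.
  rewrite [leLHS]exprMn; apply: ler_wpM2r; first exact: sqr_ge0.
  by rewrite -(real_normK (num_real (b z))) ler_sqr ?nnegrE ?normr_ge0.
apply: (dual_bound p1 q1 pq lp2 (L2B LbS Lbf) _ (wint_ge0 p f lw)).
  by apply: mulr_ge0 (ler0n R 4) _; exact: commC_ge0.
move=> g t bg t0; rewrite (prBl LbS Lbf (bsupp_L2 bg)).
have -> : pr mu (fun z => b z * S f z) g = pr mu (S f) (fun z => b z * g z).
  by apply: eq_Rintegral => z _; rewrite -mulrA mulrCA.
have [N hN] := bsupp_root bf bg; have [rf rg] := hN N (leqnn N).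
exact (root_commutator M0 C0 th0 th1 rc p1 q1 pq (box_side R N) C10 C20 wp lp2 B0 mb hb osc rf rg t0).
Qed.
End RealWeighted.

(** * Measurability of the kernel *)

Section SeparateContinuity.
Variables (R : realType) (th : R).
Hypothesis th0 : 0 < th.

Lemma measurable_round d (X : measurableType d) (h : R -> X -> R) (n : nat) :
  (forall t, measurable_fun setT (h t)) ->
  measurable_fun setT (fun z : measurableTypeR R * X => h ((Num.floor (z.1 * (n.+1)%:R))%:~R / (n.+1)%:R) z.2).
Proof.
move=> mh _ B mB; rewrite setTI.
have n0 : 0 < (n.+1)%:R :> R by rewrite ltr0n.
rewrite (_ : _ @^-1` B = \bigcup_(m : int)
  (`[m%:~R / (n.+1)%:R, (m + 1)%:~R / (n.+1)%:R[%classic `*` (h (m%:~R / (n.+1)%:R) @^-1` B))); last first.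
  apply/seteqP; split => [[t x] /= Bx|[t x] [m _ [/=]]].
    exists (Num.floor (t * (n.+1)%:R)) => //; split => //=; rewrite in_itv /= ler_pdivrMr // ltr_pdivlMr //.
    exact: floor_itv.
  rewrite in_itv /= ler_pdivrMr // ltr_pdivlMr // => hm Bx.
  by rewrite (floor_def hm).
apply: countable_bigcupT_measurable => // m; apply: measurableX; first exact: measurable_itv.
by rewrite -[X in measurable X]setTI; exact: mh.
Qed.

Lemma powR_small (G e : R) : 0 <= G -> 0 < e -> exists2 s, 0 < s & forall t, 0 <= t -> t <= s -> G * t `^ th <= e.
Proof.
move=> G0 e0; have G1 : 0 < G + 1 by rewrite ltr_wpDl.
exists ((e / (G + 1)) `^ th^-1) => [|t t0 ts]; first by rewrite powR_gt0 // divr_gt0.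
apply: le_trans (_ : (G + 1) * t `^ th <= e); first by rewrite ler_wpM2r ?powR_ge0 // lerDl.
rewrite mulrC -ler_pdivlMr //; apply: le_trans (ge0_ler_powR _ _ _ ts) _; rewrite ?nnegrE ?(ltW th0) // ?powR_ge0 //.
by rewrite -powRrM mulVf ?gt_eqF // powRr1 // divr_ge0 // ltW.
Qed.

(** Rounding the first variable down to multiples of [1 / (n + 1)] gives measurable functions, which
    converge where [h] is continuous in that variable. The approximants are cut to 0 off [A], where
    [h] vanishes. *)
Lemma measurable_separate d (X : measurableType d) (h : R -> X -> R) (A : set (measurableTypeR R * X)) :
  measurable A -> (forall t, measurable_fun setT (h t)) ->
  (forall t x, A (t, x) -> exists r G, [/\ 0 < r, 0 <= G &
     forall w, `|t - w| <= r / 2%:R -> `|h t x - h w x| <= G * (`|t - w| / r) `^ th]) ->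
  (forall t x, ~ A (t, x) -> h t x = 0) ->
  measurable_fun setT (fun z : measurableTypeR R * X => h z.1 z.2).
Proof.
move=> mA mh hA hN.
pose r n (t : R) : R := (Num.floor (t * (n.+1)%:R))%:~R / (n.+1)%:R.
apply: (@measurable_fun_cvg _ _ _ setT (fun n z => h (r n z.1) z.2 * \1_A z)).
  by move=> n; apply: measurable_funM; [exact: measurable_round|exact: measurable_indic].
move=> [t x] _ /=; have [At|At] := pselect (A (t, x)); last first.
  by rewrite hN // indicE memNset //; under eq_fun do rewrite mulr0; exact: cvg_cst.
rewrite indicE mem_set //; under eq_fun do rewrite mulr1.
have [d0 [G [d00 G0 hG]]] := hA _ _ At; apply/cvgrPdist_le => e e0.
have [s s0 hs] := powR_small G0 e0.
pose m := Num.min (d0 / 2%:R) (s * d0); have m0 : 0 < m by rewrite lt_min divr_gt0 // mulr_gt0.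
exists (Num.truncn m^-1) => // n /= mn.
have n0 : 0 < (n.+1)%:R :> R by rewrite ltr0n.
have rt : `|t - r n t| <= (n.+1)%:R^-1.
  have /andP[h1 h2] := floor_itv (t * (n.+1)%:R); rewrite intrD in h2.
  have e1 : t - r n t = (t * (n.+1)%:R - (Num.floor (t * (n.+1)%:R))%:~R) / (n.+1)%:R.
    by rewrite /r mulrBl mulfK // gt_eqF.
  rewrite e1 normrM [X in _ * X]ger0_norm ?invr_ge0 ?(ltW n0) // ler_piMl ?invr_ge0 ?(ltW n0) //.
  by rewrite ger0_norm ?subr_ge0 // lerBlDl ltW.
have nm : (n.+1)%:R^-1 <= m.
  rewrite -[leRHS]invrK lef_pV2 ?posrE ?invr_gt0 //.
  have /andP[_ /ltW h1] := truncn_itv (ltW (eqbRL (invr_gt0 m) m0)).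
  by apply: le_trans h1 _; rewrite ler_nat ltnS.
have rm := le_trans rt nm; move: (rm); rewrite le_min => /andP[r1 r2].
by apply: le_trans (hG _ r1) _; apply: hs; [rewrite divr_ge0 // ltW|rewrite ler_pdivrMr].
Qed.
End SeparateContinuity.

Section KernelMeasurability.
Variables (R : realType) (C th : R) (k : R * R -> R * R -> R).
Hypotheses (C0 : 0 <= C) (th0 : 0 < th).
Hypotheses (kr : kernel_reg C th k) (krT : kernel_reg C th (fun x y => k y x)).
Hypothesis kdiag : forall x y, ~ (x.1 != y.1 /\ x.2 != y.2) -> k x y = 0.

Let measurable_neq d (X : measurableType d) (f g : X -> R) : measurable_fun setT f -> measurable_fun setT g ->
  measurable [set z | f z != g z].
Proof.
move=> mf mg; rewrite (_ : [set z | _] = [set z | 0 < `|f z - g z|]).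
  by apply: (measurable_gt 0 (u := fun z => `|f z - g z|)); apply: measurableT_comp => //; exact: measurable_funB.
by apply/funext => z /=; rewrite normr_gt0 subr_eq0.
Qed.

Let gap (a b : R) : a != b -> 0 < `|a - b|.
Proof. by rewrite normr_gt0 subr_eq0. Qed.

Let size_ge0 (x y : R * R) : 0 <= C * ((x.1 - y.1) ^+ 2 + (x.2 - y.2) ^+ 2)^-1.
Proof. by rewrite mulr_ge0 // invr_ge0 addr_ge0 ?sqr_ge0. Qed.

Let step (t w r e1 D : R) (x : R) : x <= C * (`|t - w| / r) `^ e1 * D^-1 -> x <= C * D^-1 * (`|t - w| / r) `^ e1.
Proof. by rewrite mulrAC. Qed.

(** Measurability comes from the regularity in each coordinate separately: the four real coordinates
    are released one at a time, each by [measurable_separate]. *)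
Lemma kernel_measurable : measurable_fun setT (fun z : borel2 R * borel2 R => k z.1 z.2).
Proof.
have m4 x1 (y : R * R) : measurable_fun setT (fun z : measurableTypeR R * unit => k (x1, z.1) y).
  apply: (measurable_separate th0 (h := fun x2 _ => k (x1, x2) y)
    (A := [set z | x1 != y.1 /\ z.1 != y.2])).
  - by apply: measurableI; apply: measurable_neq => //; exact: measurable_fst.
  - by move=> t; exact: measurable_cst.
  - move=> t u [/= h1 h2]; exists `|y.2 - t|, (C * ((y.1 - x1) ^+ 2 + (y.2 - t) ^+ 2)^-1).
    split; [by rewrite gap // eq_sym|exact: (size_ge0 y (x1, t))|] => w hw.
    by apply: step; exact: (kr_snd krT (x := y) (y := (x1, t))).
  - by move=> t u h; exact: kdiag.
have m3 (y : R * R) : measurable_fun setT (fun z : borel2 R => k z y).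
  rewrite (_ : (fun z : borel2 R => k z y) = (fun z => k (z.1, z.2) y)); last by apply/funext => -[].
  apply: (measurable_separate th0 (X := measurableTypeR R) (h := fun x1 x2 => k (x1, x2) y)
    (A := [set z | z.1 != y.1 /\ z.2 != y.2])).
  - by apply: measurableI; apply: measurable_neq.
  - move=> t; exact: (measurableT_comp (m4 t y) (measurable_pair2 tt)).
  - move=> t u [/= h1 h2]; exists `|y.1 - t|, (C * ((y.1 - t) ^+ 2 + (y.2 - u) ^+ 2)^-1).
    split; [by rewrite gap // eq_sym|exact: (size_ge0 y (t, u))|] => w hw.
    by apply: step; exact: (kr_fst krT (x := y) (y := (t, u))).
  - by move=> t u h; exact: kdiag.
have m2 (y1 : R) : measurable_fun setT (fun z : measurableTypeR R * borel2 R => k z.2 (y1, z.1)).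
  apply: (measurable_separate th0 (X := borel2 R) (h := fun y2 x => k x (y1, y2))
    (A := [set z | z.2.1 != y1 /\ z.2.2 != z.1])).
  - apply: measurableI; apply: measurable_neq => //.
    + exact: (measurableT_comp measurable_fst measurable_snd).
    + exact: (measurableT_comp measurable_snd measurable_snd).
  - by move=> t; exact: m3.
  - move=> t x [/= h1 h2]; exists `|x.2 - t|, (C * ((x.1 - y1) ^+ 2 + (x.2 - t) ^+ 2)^-1).
    split; [by rewrite gap|exact: (size_ge0 x (y1, t))|] => w hw.
    by apply: step; exact: (kr_snd kr (x := x) (y := (y1, t))).
  - by move=> t u h; exact: kdiag.
have m1 : measurable_fun setT (fun z : measurableTypeR R * (measurableTypeR R * borel2 R) => k z.2.2 (z.1, z.2.1)).
  apply: (measurable_separate th0 (X := (measurableTypeR R * borel2 R)%type) (h := fun y1 u => k u.2 (y1, u.1))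
    (A := [set z | z.2.2.1 != z.1 /\ z.2.2.2 != z.2.1])).
  - apply: measurableI; apply: measurable_neq => //.
    + exact: (measurableT_comp measurable_fst (measurableT_comp measurable_snd measurable_snd)).
    + exact: (measurableT_comp measurable_snd (measurableT_comp measurable_snd measurable_snd)).
    + exact: (measurableT_comp measurable_fst measurable_snd).
  - by move=> t; exact: m2.
  - move=> t [y2 x] [/= h1 h2]; exists `|x.1 - t|, (C * ((x.1 - t) ^+ 2 + (x.2 - y2) ^+ 2)^-1).
    split; [by rewrite gap|exact: (size_ge0 x (t, y2))|] => w hw.
    by apply: step; exact: (kr_fst kr (x := x) (y := (t, y2))).
  - by move=> t [y2 x] h; exact: kdiag.
pose g (z : borel2 R * borel2 R) := (z.2.1, (z.2.2, z.1)).
rewrite (_ : (fun z => _) = (fun z => k z.2.2 (z.1, z.2.1)) \o g); last by apply/funext => -[x []].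
apply: measurableT_comp m1 _; apply: measurable_fun_pair.
  exact: (measurableT_comp measurable_fst measurable_snd).
apply: measurable_fun_pair; last exact: measurable_fst.
exact: (measurableT_comp measurable_snd measurable_snd).
Qed.
End KernelMeasurability.

(** * Complex functions through their real and imaginary parts *)

Section ComplexModulus.
Variable R : realType.
Implicit Types z : R[i].
Local Notation re := (@complex.Re R).
Local Notation im := (@complex.Im R).

Lemma cmod_ge0 z : 0 <= cmod z. Proof. exact: sqrtr_ge0. Qed.

Lemma cmod_sq z : cmod z ^+ 2 = re z ^+ 2 + im z ^+ 2.
Proof. by rewrite sqr_sqrtr // addr_ge0 ?sqr_ge0. Qed.

Lemma re_le_cmod z : `|re z| <= cmod z.
Proof.
rewrite -ler_sqr ?nnegrE ?cmod_ge0 ?normr_ge0 // cmod_sq real_normK ?num_real //.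
by rewrite lerDl sqr_ge0.
Qed.

Lemma im_le_cmod z : `|im z| <= cmod z.
Proof.
rewrite -ler_sqr ?nnegrE ?cmod_ge0 ?normr_ge0 // cmod_sq real_normK ?num_real //.
by rewrite lerDr sqr_ge0.
Qed.

Lemma cmod_le z : cmod z <= `|re z| + `|im z|.
Proof.
rewrite -ler_sqr ?nnegrE ?cmod_ge0 ?addr_ge0 // cmod_sq sqrrD !real_normK ?num_real //.
by rewrite lerD2r lerDl mulrn_wge0 // mulr_ge0.
Qed.

Lemma measurable_cmod (f : R * R -> R[i]) : cmeasurable f ->
  measurable_fun setT (fun x : borel2 R => cmod (f x)).
Proof.
move=> [mr mi]; apply: (measurableT_comp (f := @Num.sqrt R)).
  by apply: continuous_measurable_fun; exact: sqrt_continuous.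
by apply: measurable_funD; exact: measurable_funX.
Qed.

Lemma reZ (a z : R[i]) : re (a * z) = re a * re z - im a * im z.
Proof. by case: a; case: z. Qed.

Lemma imZ (a z : R[i]) : im (a * z) = re a * im z + im a * re z.
Proof. by case: a => a b; case: z. Qed.

Lemma reD (a z : R[i]) : re (a + z) = re a + re z.
Proof. by case: a; case: z. Qed.

Lemma imD (a z : R[i]) : im (a + z) = im a + im z.
Proof. by case: a; case: z. Qed.
End ComplexModulus.

Section ComplexLp.
Variable R : realType.
Local Notation mu := (@leb2 R).
Local Notation re := (@complex.Re R).
Local Notation im := (@complex.Im R).
Implicit Types f : R * R -> R[i].

Definition csq f : R := nsq mu (fun z => re (f z)) + nsq mu (fun z => im (f z)).

Let e2E f : (\int[mu]_x (`|(cmod (f x))%:E| `^ 2%:R) = \int[mu]_x (re (f x) ^+ 2 + im (f x) ^+ 2)%:E)%E.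
Proof.
by apply: eq_integral => x _; rewrite /= ger0_norm ?cmod_ge0 // powR_mulrn ?cmod_ge0 // cmod_sq.
Qed.

Let rint_lty (u : borel2 R -> R) : measurable_fun setT u -> (forall x, 0 <= u x) ->
  (\int[mu]_x (u x)%:E < +oo)%E -> rint mu u.
Proof.
move=> m u0 h; apply/integrableP; split; first exact/measurable_EFinP.
by under eq_integral do rewrite /= ger0_norm //.
Qed.

Let rint_fin (u : borel2 R -> R) : rint mu u -> (\int[mu]_x (u x)%:E < +oo)%E.
Proof. by move=> iu; rewrite -rintE // ltry. Qed.

Lemma inL2P f : inL 2%:R f <-> L2 mu (fun z => re (f z)) /\ L2 mu (fun z => im (f z)).
Proof.
rewrite /inL unlock /= e2E; split=> [[[mr mi] h]|[[mr ir] [mi ii]]].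
  have ir : rint mu (fun z => re (f z) ^+ 2 + im (f z) ^+ 2).
    apply: rint_lty; first by apply: measurable_funD; exact: measurable_funX.
      by move=> x; rewrite addr_ge0 ?sqr_ge0.
    by apply: lty_poweRy h; rewrite invr_eq0 pnatr_eq0.
  split; split => //; apply: (rint_le _ _ ir); try exact: measurable_funX.
    by move=> x; rewrite !ger0_norm ?addr_ge0 ?sqr_ge0 // lerDl sqr_ge0.
  by move=> x; rewrite !ger0_norm ?addr_ge0 ?sqr_ge0 // lerDr sqr_ge0.
by split => //; apply: poweR_lty; apply: rint_fin; exact: rintD.
Qed.

Lemma Lnorm2E f : inL 2%:R f -> ('N[mu]_((2%:R)%:E)[EFin \o (@cmod R \o f)] = ((csq f) `^ 2%:R^-1)%:E)%E.
Proof.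
move=> /inL2P[[mr ir] [mi ii]]; rewrite unlock /= e2E.
by rewrite -rintE ?RintD //; exact: rintD.
Qed.

Lemma rint_cmod f : rint mu (fun z => re (f z)) -> rint mu (fun z => im (f z)) ->
  rint mu (fun z => cmod (f z)).
Proof.
move=> ir ii; apply: (rint_le _ _ (rintD (rint_norm ir) (rint_norm ii))).
  by apply: measurable_cmod; split; [exact (rint_meas ir)|exact (rint_meas ii)].
by move=> x; rewrite [leLHS]ger0_norm ?cmod_ge0 // [leRHS]ger0_norm ?addr_ge0 // cmod_le.
Qed.

Lemma inL1P f : inL 1 f <-> rint mu (fun z => re (f z)) /\ rint mu (fun z => im (f z)).
Proof.
rewrite /inL Lnorm1; split=> [[mf h]|[ir ii]].
  have ic : rint mu (fun z => cmod (f z)).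
    apply: rint_lty; [exact: measurable_cmod|by move=> x; exact: cmod_ge0|].
    by move: h; under eq_integral do rewrite /= ger0_norm ?cmod_ge0 //.
  case: mf => mr mi; split; apply: (rint_le _ _ ic) => // x; rewrite [leRHS]ger0_norm ?cmod_ge0 //.
    exact: re_le_cmod.
  exact: im_le_cmod.
split; first by split; [exact (rint_meas ir)|exact (rint_meas ii)].
by under eq_integral do rewrite /= ger0_norm ?cmod_ge0 //; exact/rint_fin/rint_cmod.
Qed.

Lemma Lnorm1E f : inL 1 f -> ('N[mu]_(1%:E)[EFin \o (@cmod R \o f)] = (\int[mu]_z cmod (f z))%:E)%E.
Proof.
move=> /inL1P[ir ii]; rewrite Lnorm1 rintE; last exact: rint_cmod.
by apply: eq_integral => x _; rewrite /= ger0_norm ?cmod_ge0.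
Qed.
End ComplexLp.

(** * Real and imaginary parts of kernel and operator *)

Section KernelParts.
Variable R : realType.
Local Notation re := (@complex.Re R).
Local Notation im := (@complex.Im R).
Local Notation mu := (@leb2 R).

Definition is_part (pi : R[i] -> R) : Prop := pi = re \/ pi = im.

Lemma partD pi z w : is_part pi -> pi (z + w) = pi z + pi w.
Proof. by case=> ->; [exact: reD|exact: imD]. Qed.

Lemma partB pi z w : is_part pi -> pi (z - w) = pi z - pi w.
Proof. by case=> ->; case: z; case: w. Qed.

Lemma partZ pi (c : R) z : is_part pi -> pi (c%:C%C * z) = c * pi z.
Proof. by case=> ->; [rewrite reZ /= mul0r subr0|rewrite imZ /= mul0r addr0]. Qed.

Lemma part_le_cmod pi z : is_part pi -> `|pi z| <= cmod z.
Proof. by case=> ->; [exact: re_le_cmod|exact: im_le_cmod]. Qed.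

Lemma part_cintegral pi d (X : measurableType d) (m : {measure set X -> \bar R}) D f : is_part pi ->
  pi (cintegral m D f) = \int[m]_(x in D) pi (f x).
Proof. by case=> ->. Qed.

Lemma L2_part pi f : is_part pi -> inL 2%:R f -> L2 mu (fun z => pi (f z)).
Proof. by move=> pp /inL2P[]; case: pp => ->. Qed.

Lemma nsq_part pi f : is_part pi -> nsq mu (fun z => pi (f z)) <= csq f.
Proof. by case=> ->; rewrite /csq ?lerDl ?lerDr nsq_ge0. Qed.

Variables (th C : R) (K : R * R -> R * R -> R[i]).
Hypotheses (th0 : 0 < th).

Definition part_kernel pi (x y : R * R) : R :=
  if (x.1 != y.1) && (x.2 != y.2) then pi (K x y) else 0.

(* With the second parameter equal to 1 the factor collapses: [D / (|a| |b|) = 1 / (a^2 + b^2)]. *)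
Lemma Dfac1 (x y : R * R) : x.1 != y.1 -> x.2 != y.2 ->
  (1 / `|x.1 - y.1|) * (1 / `|x.2 - y.2|) * Dfac 1 x y = ((x.1 - y.1) ^+ 2 + (x.2 - y.2) ^+ 2)^-1.
Proof.
move=> h1 h2; rewrite /Dfac -[(x.1 - y.1) ^+ 2]real_normK ?num_real // -[(x.2 - y.2) ^+ 2]real_normK ?num_real //.
have a0 : 0 < `|x.1 - y.1| by rewrite normr_gt0 subr_eq0.
have b0 : 0 < `|x.2 - y.2| by rewrite normr_gt0 subr_eq0.
set a := `|x.1 - y.1| in a0 *; set b := `|x.2 - y.2| in b0 *.
have s0 : 0 <= a / b + b / a by rewrite addr_ge0 // divr_ge0 // ltW.
rewrite powRN powRr1 //; field.
by rewrite !gt_eqF // addr_gt0 ?exprn_gt0.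
Qed.

(** The part of the kernel is 0 on the coordinate lines, and the bounds have to hold there as well:
    either both values vanish or the condition on [w] forbids any move. Off the lines a move by half
    of the gap does not reach them. *)
Lemma part_kernel_reg pi : is_part pi -> size_bound 1 C K -> mixed_bound th 1 C (fun x y => K y x) ->
  kernel_reg `|C| th (part_kernel pi).
Proof.
move=> pp hs [h1 h2].
have pos (x y : R * R) : 0 <= ((x.1 - y.1) ^+ 2 + (x.2 - y.2) ^+ 2)^-1.
  by rewrite invr_ge0 addr_ge0 ?sqr_ge0.
have near (t s w : R) : t != s -> `|s - w| <= `|t - s| / 2%:R -> t != w.
  move=> ts h; apply: contraTneq h => <-; rewrite -ltNge distrC ltr_pdivrMr //.
  by rewrite mulr_natr mulr2n ltrDl normr_gt0 subr_eq0 eq_sym.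
have hold (d D : R) : 0 < D -> (`|d| / D) `^ th = `|d| `^ th / D `^ th.
  by move=> D0; rewrite powRM ?invr_ge0 ?normr_ge0 ?(ltW D0) // -powR_inv1 ?(ltW D0) // -powRrM mulN1r powRN.
have fin (c dl D u F S S' : R) : 0 < D -> 1 / D * u * F = S -> S = S' -> 0 <= S' ->
    c * (`|dl| `^ th / D `^ (1 + th)) * u * F <= `|c| * (`|dl| / D) `^ th * S'.
  move=> D0 <- E; rewrite -E => S0; rewrite hold // powRD; last by rewrite (gt_eqF D0) implybT.
  rewrite powRr1 ?(ltW D0) // invfM.
  have -> : c * (`|dl| `^ th * (D^-1 * (D `^ th)^-1)) * u * F = c * (`|dl| `^ th * (D `^ th)^-1) * (1 / D * u * F).
    by ring.
  by rewrite ler_wpM2r // ler_wpM2r ?ler_norm // mulr_ge0 ?powR_ge0 // invr_ge0 powR_ge0.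
split=> [x y|x y w hw|x y w hw].
- rewrite /part_kernel; have [/andP[d1 d2]|_] := boolP ((x.1 != y.1) && (x.2 != y.2)); last first.
    by rewrite normr0 mulr_ge0.
  apply: le_trans (part_le_cmod _ pp) _; apply: le_trans (hs x y (conj d1 d2)) _.
  by rewrite -[C * _ * _]mulrA -[leLHS]mulrA Dfac1 // ler_wpM2r ?ler_norm.
- rewrite /part_kernel /=; have [d2|d2] := eqVneq x.2 y.2.
    by rewrite !andbF subrr normr0 !mulr_ge0 ?powR_ge0.
  have [d1|d1] := eqVneq x.1 y.1.
    have : `|y.1 - w| <= 0 by rewrite d1 subrr normr0 mul0r in hw.
    rewrite normr_le0 subr_eq0 => /eqP e1; have -> : (x.1 != w) = false by rewrite -e1 d1 eqxx.
    by rewrite [leLHS](_ : _ = 0) ?mulr_ge0 ?powR_ge0 //= ?andbF subrr normr0.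
  rewrite (near _ _ _ d1 hw) /= -partB //; apply: le_trans (part_le_cmod _ pp) _.
  rewrite distrC in hw; rewrite eq_sym in d1; rewrite eq_sym in d2.
  rewrite [`|x.1 - y.1|]distrC distrC in hw; have := h1 y x w (conj d1 d2) hw; move/le_trans; apply.
  have D0 : 0 < `|y.1 - x.1| by rewrite normr_gt0 subr_eq0.
  rewrite (distrC x.1 y.1); apply: (fin C (y.1 - w) _ _ _ _ _ D0 (Dfac1 d1 d2) _ (pos x y)).
  by rewrite -(sqrrN (x.1 - _)) -(sqrrN (x.2 - _)) !opprB.
- rewrite /part_kernel /=; have [d1|d1] := eqVneq x.1 y.1.
    by rewrite subrr normr0 !mulr_ge0 ?powR_ge0.
  have [d2|d2] := eqVneq x.2 y.2.
    have : `|y.2 - w| <= 0 by rewrite d2 subrr normr0 mul0r in hw.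
    rewrite normr_le0 subr_eq0 => /eqP e1; have -> : (x.2 != w) = false by rewrite -e1 d2 eqxx.
    by rewrite [leLHS](_ : _ = 0) ?mulr_ge0 ?powR_ge0 //= ?andbF subrr normr0.
  rewrite (near _ _ _ d2 hw) /= -partB //; apply: le_trans (part_le_cmod _ pp) _.
  rewrite distrC in hw; rewrite eq_sym in d1; rewrite eq_sym in d2.
  rewrite [`|x.2 - y.2|]distrC distrC in hw; have := h2 y x w (conj d1 d2) hw; move/le_trans; apply.
  have D0 : 0 < `|y.2 - x.2| by rewrite normr_gt0 subr_eq0.
  have E := Dfac1 d1 d2; rewrite [1 / _ * (1 / _)]mulrC in E.
  rewrite (distrC x.2 y.2) [C * _ * _]mulrAC; apply: (fin C (y.2 - w) _ _ _ _ _ D0 E _ (pos x y)).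
  by rewrite -(sqrrN (x.1 - _)) -(sqrrN (x.2 - _)) !opprB.
Qed.
End KernelParts.

Section OperatorParts.
Variables (R : realType) (th C M : R) (K : R * R -> R * R -> R[i]).
Variable T : (R * R -> R[i]) -> R * R -> R[i].
Hypotheses (th0 : 0 < th) (hs : size_bound 1 C K) (hK : mixed_bound th 1 C K)
  (hKT : mixed_bound th 1 C (fun x y => K y x)) (hT : L2_operator T) (hTK : has_kernel T K)
  (hM : forall f, inL 2%:R f -> csq (T f) <= M ^+ 2 * csq f).
Local Notation mu := (@leb2 R).
Local Notation re := (@complex.Re R).
Local Notation im := (@complex.Im R).

Definition clift (u : borel2 R -> R) : R * R -> R[i] := fun t => (u t)%:C%C.

Definition part_op (pi : R[i] -> R) (u : borel2 R -> R) : borel2 R -> R := fun z => pi (T (clift u) z).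

Let L20 : L2 mu (fun=> 0 : R).
Proof.
split; first exact: measurable_cst.
by apply: rint_ext (rint_indic (@measurable0 _ (borel2 R)) _); rewrite ?measure0 ?ltry // => x; rewrite indic0 expr0n.
Qed.

Lemma inL2_clift u : L2 mu u -> inL 2%:R (clift u).
Proof. by move=> Lu; apply/inL2P. Qed.

Lemma csq_clift u : csq (clift u) = nsq mu u.
Proof. by rewrite /csq /nsq /= [X in _ + X]Rint0 ?addr0 // => x; rewrite expr0n. Qed.

Lemma simple_stepf L a s (c : cell L -> R) : 0 < s -> simple_cube_fun (clift (stepf a s c)).
Proof.
move=> s0; exists #|{: cell L}|, (fun k => (c (enum_val k))%:C%C), (fun k => gcell a s (enum_val k)).
split; first by move=> k; exists (a.1 + s * (enum_val k).1%:R, a.2 + s * (enum_val k).2%:R), s.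
apply/funext => x; rewrite /clift /stepf rmorph_sum /=.
rewrite -(big_enum_val (fun y => (c y)%:C%C * (\1_(gcell a s y) x)%:C%C)) /=.
by apply: eq_bigr => y _; rewrite rmorphM.
Qed.

Lemma part_cz pi : is_part pi -> real_cz M `|C| th (part_op pi) (part_kernel K pi).
Proof.
move=> pp; have [inT linT _] := hT.
have kr := part_kernel_reg pp hs hKT.
have krT : kernel_reg `|C| th (fun x y => part_kernel K pi y x).
  rewrite (_ : (fun x y => _) = part_kernel (fun x y => K y x) pi); last first.
    by apply/funext => x; apply/funext => y; rewrite /part_kernel (eq_sym y.1) (eq_sym y.2).
  apply: part_kernel_reg => // x y [/= d1 d2].
  have := hs (x := y) (y := x); rewrite /Dfac !(distrC y.1) !(distrC y.2); apply.
  by split; rewrite eq_sym.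
have km : measurable_fun setT (fun z : borel2 R * borel2 R => part_kernel K pi z.1 z.2).
  apply: (kernel_measurable (normr_ge0 C) th0 kr krT) => x y h; rewrite /part_kernel.
  by case: andP => // [[]].
split => //.
- by move=> u Lu; apply: (L2_part pp); apply: inT; exact: inL2_clift.
- move=> c u v Lu Lv; have := linT c%:C%C _ _ (inL2_clift Lu) (inL2_clift Lv).
  rewrite (_ : (fun t => c%:C%C * clift u t + clift v t) = clift (fun t => c * u t + v t)); last first.
    by apply/funext => t; rewrite /clift rmorphD rmorphM.
  by move=> h; apply: (ae_imp h) => x; rewrite /part_op => ->; rewrite partD // partZ.
- move=> u Lu; apply: le_trans (nsq_part _ pp) _; rewrite -csq_clift; apply: hM.
  exact: inL2_clift.
move=> L a s c d s0 cd; have := hTK (simple_stepf a c s0) (simple_stepf a d s0).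
have pmul z (r : R) : pi (z * r%:C%C) = pi z * r by rewrite mulrC partZ // mulrC.
move=> h; have {}h := congr1 pi (h _); rewrite !part_cintegral // in h.
rewrite /pr /part_op; under eq_Rintegral do rewrite -pmul.
rewrite h => [|].
  rewrite Rintegral_mkcond; apply: eq_Rintegral => -[x y] _; rewrite /patch /part_kernel /=.
  case: andP => [hz|hz].
    by rewrite mem_set //= !pmul.
  by rewrite memNset ?mul0r.
apply/seteqP; split => // z [/= fz gz].
have nz r : r%:C%C != 0 :> R[i] -> r != 0 by apply: contraNN => /eqP ->.
have {}fz := nz _ fz; have {}gz := nz _ gz.
have [/(gcell_locate s0)[x hx]|hz] := pselect (square a (s * (2 ^ L)%:R) z); last first.
  by rewrite (stepf_out s0 _ hz) eqxx in fz.
rewrite !(stepf_in s0 _ hx) in fz gz.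
by case: (cd x) => e; rewrite e eqxx in fz gz.
Qed.
End OperatorParts.

Lemma L2_operator_bound (R : realType) (T : (R * R -> R[i]) -> R * R -> R[i]) : L2_operator T ->
  exists2 M : R, 0 < M & forall f, inL 2%:R f -> csq (T f) <= M ^+ 2 * csq f.
Proof.
move=> [inT _ [M0 hM]]; have M1 : 0 < `|M0| + 1 by rewrite ltr_wpDl.
(* The given bound may be negative, hence the absolute value; adding 1 makes it positive. *)
exists (`|M0| + 1) => // f hf; have := hM f hf.
rewrite (Lnorm2E hf) (Lnorm2E (inT _ hf)) -EFinM lee_fin => h.
have c0 g : 0 <= csq g by rewrite addr_ge0 ?nsq_ge0.
have sq g : csq g = (csq g `^ 2%:R^-1) ^+ 2 by rewrite -powR_mulrn ?powR_ge0 // -powRrM mulVf // powRr1.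
rewrite [leLHS]sq [csq f in leRHS]sq -exprMn ler_sqr ?nnegrE ?powR_ge0 ?mulr_ge0 ?powR_ge0 ?(ltW M1) //.
apply: le_trans h _; rewrite ler_wpM2r ?powR_ge0 //.
by have := ler_norm M0; lra.
Qed.

(** * Extension to integrable functions *)

Lemma fast_cvg (R : realType) (a : nat -> R) (K : nat) :
  (forall k, (K <= k)%N -> `|a k.+1 - a k| <= (2^-1) ^+ k) -> cvgn a.
Proof.
move=> h; pose u n := a (n + K)%N.
have c1 : cvgn (series (telescope u)).
  apply: normed_cvg; apply: (series_le_cvg (v_ := geometric 1 (2^-1))).
  - by move=> n; exact: normr_ge0.
  - by move=> n; rewrite /= mul1r exprn_ge0 // invr_ge0.
  - move=> n; rewrite /telescope /u /= mul1r addSn; apply: le_trans (h _ (leq_addl _ _)) _.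
    by rewrite ler_wiXn2l ?leq_addr ?invr_ge0 ?invf_le1 ?ler1n.
  - by apply: is_cvg_geometric_series; rewrite ger0_norm ?invr_ge0 // invf_lt1 ?ltr1n.
have c3 : u 0%N + series (telescope u) n @[n --> \oo] --> u 0%N + limn (series (telescope u)).
  by apply: cvgD; [exact: cvg_cst|exact: c1].
have E : (fun n => u 0%N + series (telescope u) n) = u.
  by apply/funext => n; rewrite telescopeK /= addrC subrK.
rewrite E in c3.
by apply/cvg_ex; exists (u 0%N + limn (series (telescope u))); rewrite -(cvg_shiftn K).
Qed.

Section L1Extension.
Variables (R : realType) (M C th : R) (S : (borel2 R -> R) -> borel2 R -> R).
Variable k : R * R -> R * R -> R.
Hypotheses (M0 : 0 < M) (C0 : 0 <= C) (th0 : 0 < th) (th1 : th <= 1).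
Hypothesis rc : real_cz M C th S k.
Local Notation mu := (@leb2 R).
Local Notation K1 := (2%:R * weakK M C th).

(** The rate [4 ^ -n] matches the weak type bound at height [2 ^ -n], which then leaves summable
    sets. The constant [c] makes the class stable under linear combinations. *)
Definition fast_approx (v : nat -> borel2 R -> R) (u : borel2 R -> R) (c : R) : Prop :=
  [/\ forall n, L2 mu (v n), forall n, rint mu (v n) &
      forall n, \int[mu]_z `|v n z - u z| <= c * (4^-1) ^+ n].

Lemma op_near (v w : nat -> borel2 R -> R) (c : R) : (forall n, L2 mu (v n)) -> (forall n, rint mu (v n)) ->
  (forall n, L2 mu (w n)) -> (forall n, rint mu (w n)) ->
  (forall n, \int[mu]_z `|v n z - w n z| <= c * (4^-1) ^+ n) ->
  {ae mu, forall z, exists K, forall n, (K <= n)%N -> `|S (v n) z - S (w n) z| <= (2^-1) ^+ n}.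
Proof.
move=> Lv rv Lw rw h; pose d n z := v n z - w n z.
have Ld n : L2 mu (d n) by exact: L2B.
have rd n : rint mu (d n) by exact: rintB.
have lin : {ae mu, forall z, forall n, S (d n) z = S (v n) z - S (w n) z}.
  apply: ae_foralln => n; have ae := rc_lin rc (-1) (Lw n) (Lv n).
  rewrite (_ : (fun t => _) = d n) in ae; last by apply/funext => z; rewrite /d mulN1r addrC.
  by apply: (ae_imp ae) => z ->; rewrite mulN1r addrC.
have K0 : 0 <= K1 by exact: mulr_ge0 (ler0n R 2) (weakK_ge0 M th C0).
have bc : {ae mu, forall z, exists K, forall n, (K <= n)%N -> `|S (d n) z| <= (2^-1) ^+ n}.
  apply: (borel_cantelli (C := K1 * c)) => [n|n]; first by case: (rc_L2 rc (Ld n)).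
  have t0 : 0 < (2^-1 : R) ^+ n by rewrite exprn_gt0 // invr_gt0.
  have := real_weak M0 C0 th0 th1 rc (Ld n) (rd n) t0; rewrite -lee_pdivlMl // => hw.
  apply: le_trans hw _; rewrite -EFinM lee_fin mulrC ler_pdivrMr //; apply: le_trans (ler_wpM2l K0 (h n)) _.
  rewrite -!mulrA ler_wpM2l // -exprMn_comm; last exact: mulrC.
  by rewrite (_ : 2^-1 * 2^-1 = 4^-1 :> R) //; field.
by apply: (ae_mp2 bc lin) => z [K hK] e; exists K => n Kn; rewrite -e hK.
Qed.

Lemma approx_trunc u : rint mu u -> exists N : nat -> nat, fast_approx (fun n => trunc (N n) u) u 1.
Proof.
move=> ru; have mu_ := rint_meas ru.
have cv : \int[mu]_z `|trunc n u z - u z| @[n --> \oo] --> (0 : R).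
  have := @dct _ _ R mu (fun n z => `|trunc n u z - u z|) (fun=> 0) (fun z => 2%:R * `|u z|) _ (measurable_cst _) _ (rintZ _ (rint_norm ru)) _.
  rewrite (Rint0 mu (fun=> erefl)); case => //.
  - by move=> n; apply: measurableT_comp => //; apply: measurable_funB => //; case: (trunc_bsupp n mu_).
  - apply: nearW => z; rewrite -(normr0 R) -(subrr (u z)); apply: cvg_norm.
    by apply: cvgB; [exact: trunc_cvg|exact: cvg_cst].
  - by move=> n z; rewrite normr_id; have := ler_normB (trunc n u z) (u z); have := trunc_le n u z; lra.
have /boolp.choice[N hN] n : exists m, \int[mu]_z `|trunc m u z - u z| <= (4^-1) ^+ n.
  move/cvgrPdist_le: cv => /(_ ((4^-1) ^+ n)); case; first by rewrite exprn_gt0 // invr_gt0.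
  move=> m _ /(_ m (leqnn m)); rewrite sub0r normrN ger0_norm; first by exists m.
  by apply: Rint_ge0.
exists N; split=> n; rewrite ?mul1r //; [exact/bsupp_L2/trunc_bsupp|exact/bsupp_rint/trunc_bsupp].
Qed.

(** The limit is demanded along every fast approximation. This fixes [E] on integrable functions up
    to null sets and reduces its linearity and its agreement with [S] to the choice of suitable
    sequences. *)
Definition is_ext (E : (borel2 R -> R) -> borel2 R -> R) : Prop :=
  (forall u, measurable_fun setT (E u)) /\
  forall u v c, rint mu u -> fast_approx v u c -> {ae mu, forall z, S (v n) z @[n --> \oo] --> E u z}.

Let approx_dist v w u c c' n : rint mu u -> fast_approx v u c -> fast_approx w u c' ->
  \int[mu]_z `|v n z - w n z| <= (c + c') * (4^-1) ^+ n.
Proof.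
move=> ru [_ rv hv] [_ rw hw]; rewrite mulrDl; apply: le_trans (lerD (hv n) (hw n)).
have i1 := rint_norm (rintB (rv n) ru); have i2 := rint_norm (rintB (rw n) ru).
rewrite -RintD //; apply: Rint_le; [exact/rint_norm/rintB|exact: rintD|] => z.
by rewrite -(subrKA (u z)) -[X in _ + X]opprB; exact: ler_normB.
Qed.

Lemma ext_exists : exists E, is_ext E.
Proof.
have /boolp.choice[E hE] (u : borel2 R -> R) : exists h : borel2 R -> R, measurable_fun setT h /\
    forall v c, rint mu u -> fast_approx v u c -> {ae mu, forall z, S (v n) z @[n --> \oo] --> h z}.
  have [ru|nru] := pselect (rint mu u); last by exists (fun=> 0); split => //; exact: measurable_cst.
  have [N ap] := approx_trunc ru; pose v0 n := trunc (N n) u; have [Lv rv hv] := ap.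
  (* The upper limit is defined and measurable everywhere, and it is the limit wherever the sequence
     converges. *)
  exists (fun z => fine (limn_esup (fun n => (S (v0 n) z)%:E))); split.
    apply: (measurableT_comp (@fine_measurable R setT measurableT)); apply: measurable_fun_limn_esup => n.
    by apply/measurable_EFinP; case: (rc_L2 rc (Lv n)).
  move=> v c _ apv; have [Lv' rv' hv'] := apv.
  have n1 := op_near Lv' rv' Lv rv (fun n => approx_dist n ru apv ap).
  have st n : \int[mu]_z `|v0 n.+1 z - v0 n z| <= 2%:R * (4^-1) ^+ n.
    have ap1 : fast_approx (fun n => v0 n.+1) u 1.
      split; [by move=> m; exact: (Lv m.+1)|by move=> m; exact: (rv m.+1)|move=> m].
      apply: (le_trans (hv m.+1)); rewrite !mul1r exprS ler_piMl ?exprn_ge0 ?invr_ge0 //.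
      by rewrite invf_le1 ?ler1n.
    by have := approx_dist n ru ap1 ap; rewrite (_ : 1 + 1 = 2%:R :> R).
  have n2 := op_near (fun n => Lv n.+1) (fun n => rv n.+1) Lv rv st.
  apply: (ae_mp2 n1 n2) => z [K1' h1] [K2 h2].
  have cz := fast_cvg h2.
  have e0 : S (v n) z - S (v0 n) z @[n --> \oo] --> (0 : R).
    apply/cvgrPdist_le => e e0; have g0 : (2^-1 : R) ^+ n @[n --> \oo] --> (0 : R).
      by apply: cvg_expr; rewrite ger0_norm ?invr_ge0 // invf_lt1 ?ltr1n.
    move/cvgrPdist_le: g0 => /(_ e e0)[m _ hm]; exists (maxn K1' m) => // n /=.
    rewrite geq_max => /andP[Kn mn]; rewrite sub0r normrN; apply: le_trans (h1 n Kn) _.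
    by have := hm n mn; rewrite sub0r normrN ger0_norm ?exprn_ge0 ?invr_ge0.
  have cE : (S (v0 n) z)%:E @[n --> \oo] --> (limn (fun n => S (v0 n) z))%:E by apply: cvg_EFin => //; exact: nearW.
  rewrite (cvg_limn_einf_sup cE).2 /=.
  rewrite -[X in _ --> X]add0r (_ : (fun n => S (v n) z) = (fun n => (S (v n) z - S (v0 n) z) + S (v0 n) z)).
    exact: cvgD.
  by apply/funext => n; rewrite subrK.
by exists E; split => [u|u v c]; [case: (hE u)|case: (hE u) => _; exact].
Qed.

Variable E : (borel2 R -> R) -> borel2 R -> R.
Hypothesis ext : is_ext E.

Lemma ext_lin (c : R) u v : rint mu u -> rint mu v ->
  {ae mu, forall z, E (fun t => c * u t + v t) z = c * E u z + E v z}.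
Proof.
move=> ru rv; have [N au] := approx_trunc ru; have [N' av] := approx_trunc rv.
have rw : rint mu (fun t => c * u t + v t) by apply: rintD => //; exact: rintZ.
have [L1 r1 h1] := au; have [L2_ r2 h2] := av.
have aw : fast_approx (fun n t => c * trunc (N n) u t + trunc (N' n) v t) (fun t => c * u t + v t) (`|c| + 1).
  split=> n; [by apply: L2D => //; exact: L2Z|by apply: rintD => //; exact: rintZ|].
  have i1 := rint_norm (rintB (r1 n) ru); have i2 := rint_norm (rintB (r2 n) rv).
  have := h1 n; have := h2 n; rewrite !mul1r => g2 g1; rewrite mulrDl mul1r.
  apply: le_trans (lerD (ler_wpM2l (normr_ge0 c) g1) g2).
  rewrite -RintZ // -RintD //; last exact: rintZ.
  apply: Rint_le; [by apply/rint_norm/rintB => //; apply: rintD => //; exact: rintZ|by apply: rintD => //; exact: rintZ|] => z.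
  by rewrite -normrM (_ : _ - _ = c * (trunc (N n) u z - u z) + (trunc (N' n) v z - v z)) ?ler_normD //; ring.
have lin : {ae mu, forall z, forall n, S (fun t => c * trunc (N n) u t + trunc (N' n) v t) z =
    c * S (trunc (N n) u) z + S (trunc (N' n) v) z}.
  by apply: ae_foralln => n; exact: rc_lin rc c _ _ (L1 n) (L2_ n).
have h := ext.2 _ _ _ rw aw; have hu := ext.2 _ _ _ ru au; have hv := ext.2 _ _ _ rv av.
have H1 := ae_mp2 h lin (fun z a b => conj a b); have H2 := ae_mp2 hu hv (fun z a b => conj a b).
apply: (ae_mp2 H1 H2) => z [c1 e1] [c2 c3].
have c4 : c * S (trunc (N n) u) z + S (trunc (N' n) v) z @[n --> \oo] --> c * E u z + E v z.
  by apply: cvgD => //; apply: cvgM => //; exact: cvg_cst.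
have E1 : (fun n => S (fun t => c * trunc (N n) u t + trunc (N' n) v t) z) =
    (fun n => c * S (trunc (N n) u) z + S (trunc (N' n) v) z) by apply/funext => n; rewrite e1.
by rewrite E1 in c1; exact: (cvg_unique _ c1 c4).
Qed.

(** The constant sequence is a fast approximation. *)
Lemma ext_L2 u : L2 mu u -> rint mu u -> {ae mu, forall z, E u z = S u z}.
Proof.
move=> Lu ru; have au : fast_approx (fun=> u) u 1.
  split => // n; rewrite Rint0 ?mul1r ?exprn_ge0 ?invr_ge0 // => z; by rewrite subrr normr0.
apply: (ae_imp (ext.2 _ _ _ ru au)) => z cz.
have c0 : S u z @[n --> \oo] --> S u z by exact: cvg_cst.
exact: (cvg_unique _ cz c0).
Qed.

Lemma ext_weak u (t : R) : rint mu u -> 0 < t ->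
  ((t%:E * mu [set z | (t < `|E u z|)%R])%E <= (K1 * \int[mu]_z `|u z|)%:E)%E.
Proof.
move=> ru t0; have [N au] := approx_trunc ru; have [L1 r1 _] := au.
have mS n : measurable_fun setT (S (trunc (N n) u)) by case: (rc_L2 rc (L1 n)).
apply: (level_fatou mS (ext.1 u) (ext.2 _ _ _ ru au) t0) => n.
apply: le_trans (real_weak M0 C0 th0 th1 rc (L1 n) (r1 n) t0) _; rewrite lee_fin; apply: ler_wpM2l.
  exact: mulr_ge0 (ler0n R 2) (weakK_ge0 M th C0).
by apply: Rint_le; [exact: rint_norm|exact: rint_norm|] => z; exact: trunc_le.
Qed.
End L1Extension.

(** * Muckenhoupt weights and oscillation with respect to the Bloom weight *)

Section Weights.
Variable R : realType.
Local Notation mu := (@leb2 R).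
Implicit Types (w : R * R -> R).

Lemma int_squareE (u : borel2 R -> R) c r :
  (\int[mu]_(x in square c r) (u x)%:E = \int[mu]_x (u x * \1_(square c r) x)%:E)%E.
Proof.
rewrite integral_mkcond; apply: eq_integral => x _; rewrite /patch indicE.
by case: (x \in _); rewrite ?mulr1 ?mulr0.
Qed.

Lemma rint_local (u : borel2 R -> R) c r : measurable_fun setT u ->
  (forall A, compact A -> (\int[mu]_(x in A) `|(u x)%:E| < +oo)%E) ->
  rint mu (fun z => u z * \1_(square c r) z).
Proof.
move=> mu_ h.
pose A : set (R * R) := `[c.1, c.1 + r]%classic `*` `[c.2, c.2 + r]%classic.
have cA : compact A by apply: compact_setX; exact: segment_compact.
have mA : measurable (A : set (borel2 R)) by apply: measurableX; exact: measurable_itv.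
have iA : mu.-integrable A (EFin \o u).
  apply/integrableP; split; last exact: h.
  by apply/measurable_EFinP; apply: measurable_funTS.
have sA : square c r `<=` A.
  move=> z [/=]; rewrite !in_itv /= => /andP[h1 h2] /andP[h3 h4].
  by split; rewrite /= in_itv /=; [rewrite h1 ltW|rewrite h3 ltW].
have := integrableS mA (measurable_square c r) sA iA.
move=> /(integrable_mkcond _ (measurable_square c r)); congr (mu.-integrable _ _).
by apply/funext => x; rewrite /patch /= indicE; case: (x \in _); rewrite ?mulr1 ?mulr0.
Qed.

(** A weight is positive almost everywhere only; this representative is positive everywhere, as
    [local_weight] demands. *)
Definition posw w : borel2 R -> R := fun z => if 0 < w z then w z else 1.

Lemma posw_gt0 w z : 0 < posw w z.
Proof. by rewrite /posw; case: ifP. Qed.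

Lemma measurable_posw w : measurable_fun setT (w : borel2 R -> R) -> measurable_fun setT (posw w).
Proof.
by move=> mw; apply: measurable_fun_ifT => //; apply: measurable_fun_ltr => //; exact: measurable_cst.
Qed.

Lemma posw_ae w : is_weight w -> {ae mu, forall z, posw w z = w z}.
Proof. by case=> _ h _; apply: (ae_imp h) => z hz; rewrite /posw hz. Qed.

Lemma posw_local w : is_weight w -> local_weight (posw w).
Proof.
move=> hw; have [mw _ hi] := hw; split; [exact: posw_gt0|exact: measurable_posw|].
move=> c r; have mi : measurable_fun setT (\1_(square c r) : borel2 R -> R).
  exact: measurable_indic (measurable_square c r).
apply: (rint_ae _ _ _ (rint_local c r mw hi)); try (by apply: measurable_funM => //; exact: measurable_posw).
by apply: (ae_imp (posw_ae hw)) => z ->.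
Qed.

Lemma measurable_powR_c (u : borel2 R -> R) (e : R) : measurable_fun setT u ->
  measurable_fun setT (fun z => u z `^ e).
Proof.
move=> mu_; apply: (measurableT_comp (f := fun x : R => x `^ e)) => //.
Qed.

Lemma sqint_gt0 w c r : local_weight w -> 0 < r -> 0 < sqint w c r.
Proof.
move=> lw r0; rewrite lt_neqAle sqint_ge0 // andbT; apply/eqP => e.
have iw := lw_int lw c r.
have e0 : (\int[mu]_(x in square c r) `|(w x)%:E| = 0)%E.
  under eq_integral do rewrite /= ger0_norm ?(ltW (lw_gt0 lw _)) //.
  by rewrite int_squareE -rintE // -/(sqint w c r) -e.
have mD : measurable_fun (square c r : set (borel2 R)) (EFin \o w).
  by apply/measurable_EFinP; apply: measurable_funTS; exact: lw_meas lw.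
have /(ae_eq_integral_abs mu (measurable_square c r) mD) h := e0.
have : mu.-negligible (square c r : set (borel2 R)).
  apply: (negligibleS _ h) => z hz /= hh; have := lw_gt0 lw z.
  by move: (EFin_inj (hh hz)) => ->; rewrite ltxx.
move=> /(negligibleP mu (measurable_square c r)) e2.
have := EFin_inj (etrans (esym (leb2_square c (ltW r0))) e2); move/eqP.
by rewrite gt_eqF // exprn_gt0.
Qed.

Section Pair.
Variables (p : R) (w : R * R -> R).
Hypotheses (p1 : 1 < p) (hw : in_Ap p w).
Let q := p / (p - 1).
Let W := fine (Ap_const p w).

Definition dualw : borel2 R -> R := fun z => posw w z `^ (- (p - 1)^-1).

Let pm : 0 < p - 1. Proof. by rewrite subr_gt0. Qed.
Let p0 : 0 < p. Proof. exact: lt_trans p1. Qed.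

Lemma conj_exponents : [/\ 1 < q, p^-1 + q^-1 = 1 & q^-1 = (p - 1) / p].
Proof.
split; first by rewrite /q ltr_pdivlMr // mul1r ltrBlDr ltrDl.
  by rewrite /q; field; rewrite !gt_eqF.
by rewrite /q invf_div.
Qed.

Let q0 : 0 < q. Proof. by rewrite divr_gt0. Qed.

Let mdual : measurable_fun setT dualw.
Proof. by case: hw => [[mw _ _] _]; apply: measurable_powR_c; exact: measurable_posw. Qed.

Let dual_gt0 z : 0 < dualw z. Proof. by rewrite powR_gt0 // posw_gt0. Qed.

Let lw : local_weight (posw w). Proof. by case: hw => h _; exact: posw_local. Qed.

Let avg_dual a l : 0 < l ->
  (((l ^+ 2)^-1 * sqint (posw w) a l)%:E *
   ((l ^+ 2)^-1%:E * \int[mu]_x (dualw x * \1_(square a l) x)%:E) `^ (p - 1) <= Ap_const p w)%E.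
Proof.
move=> l0; have l2 : 0 < l ^+ 2 by rewrite exprn_gt0.
have [[mw hp hi] _] := hw; have wae := posw_ae (proj1 hw).
apply: le_trans (ereal_sup_ubound _); last first.
  by exists (square a l); [exists a, l|reflexivity].
rewrite le_eqVlt; apply/orP; left; apply/eqP; rewrite /avg.
have inv : ((@leb2 R (square a l))^-1 = ((l ^+ 2)^-1)%:E)%E.
  by rewrite leb2_square ?(ltW l0) // inver gt_eqF.
rewrite inv EFinM; congr (_ * _ * (_ * _) `^ _)%E.
  rewrite int_squareE /sqint rintE; last exact: lw_int lw a l.
  apply: ae_eq_integral => //.
  - by apply/measurable_EFinP; exact: rint_meas (lw_int lw a l).
  - by apply/measurable_EFinP; apply: measurable_funM => //; exact: measurable_indic (measurable_square a l).
  - by apply: (ae_imp wae) => z -> _.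
rewrite int_squareE; apply: ae_eq_integral => //.
- by apply/measurable_EFinP; apply: measurable_funM => //; exact: measurable_indic (measurable_square a l).
- apply/measurable_EFinP; apply: measurable_funM; first exact: measurable_powR_c.
  exact: measurable_indic (measurable_square a l).
- by apply: (ae_imp wae) => z e _; rewrite /dualw e.
Qed.

(** Were the integral of the dual weight infinite, so would be the product in the constant, its
    other factor being positive. *)
Let dual_int_pos a l : 0 < l -> rint mu (fun z => dualw z * \1_(square a l) z).
Proof.
move=> l0; have l2 : 0 < (l ^+ 2)^-1 by rewrite invr_gt0 exprn_gt0.
have A0 : 0 < (l ^+ 2)^-1 * sqint (posw w) a l by rewrite mulr_gt0 // sqint_gt0.
have := le_lt_trans (avg_dual a l0) (proj2 hw).
set X := (\int[mu]_x _)%E => hX.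
have X0 : (0 <= X)%E.
  by apply: integral_ge0 => z _; rewrite lee_fin mulr_ge0 ?(ltW (dual_gt0 z)) // indicE.
have Xoo : (X < +oo)%E.
  rewrite ltey; apply/eqP => e; move: hX; rewrite e.
  by rewrite gt0_muley ?lte_fin // poweRyr ?gt_eqF // gt0_muley ?lte_fin.
apply/integrableP; split.
  by apply/measurable_EFinP; apply: measurable_funM => //; exact: measurable_indic (measurable_square a l).
by under eq_integral do rewrite /= ger0_norm ?mulr_ge0 ?(ltW (dual_gt0 _)) // ?indicE // -indicE.
Qed.

Let ldual : local_weight dualw.
Proof.
split => // a l; have [l0|l0] := ltP 0 l; first exact: dual_int_pos.
apply: rint_ext (rint_bounded (measurable_square a l) (leb2_square_fin a l) (measurable_cst (0 : R)) (M := 0) _).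
  move=> z /=; rewrite indicE memNset ?mulr0 // => -[/=]; rewrite in_itv /= => /andP[h1 h2].
  by have := le_lt_trans h1 h2; rewrite ltrDl ltNge l0.
by move=> z; rewrite normr0 mul0r.
Qed.

Let dual_one z : posw w z `^ p^-1 * dualw z `^ q^-1 = 1.
Proof.
have [_ _ ->] := conj_exponents; rewrite /dualw -powRrM.
rewrite (_ : - (p - 1)^-1 * ((p - 1) / p) = - p^-1); last by field; rewrite !gt_eqF.
by rewrite powRN mulfV // gt_eqF // powR_gt0 // posw_gt0.
Qed.

Let Wfin a l : 0 < l -> ((l ^+ 2)^-1 * sqint (posw w) a l) * ((l ^+ 2)^-1 * sqint dualw a l) `^ (p - 1) <= W.
Proof.
move=> l0; have := avg_dual a l0; rewrite -rintE; last exact: dual_int_pos.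
rewrite -[X in (_ * X `^ _)%E]EFinM poweR_EFin -EFinM => h.
have hf : Ap_const p w \is a fin_num.
  rewrite fin_numElt (proj2 hw) andbT; apply: lt_le_trans h; exact: ltNyr.
by rewrite -lee_fin /W fineK.
Qed.

Lemma Ap_weight_pair : weight_pair p q (W `^ p^-1) (posw w) dualw.
Proof.
split => // a l l0; have [q1 pq qE] := conj_exponents.
have l2 : 0 < l ^+ 2 by rewrite exprn_gt0.
have A0 := sqint_ge0 a l lw; have X0 := sqint_ge0 a l ldual.
have i0 : 0 <= (l ^+ 2)^-1 by rewrite invr_ge0 ltW.
have pi0 : 0 <= p^-1 by rewrite invr_ge0 ltW.
have h := Wfin a l0.
have h0 : 0 <= ((l ^+ 2)^-1 * sqint (posw w) a l) * ((l ^+ 2)^-1 * sqint dualw a l) `^ (p - 1).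
  by rewrite mulr_ge0 ?powR_ge0 // mulr_ge0.
have := ge0_ler_powR pi0 _ _ h; rewrite !nnegrE => /(_ h0 (le_trans h0 h)).
rewrite (powRM _ (mulr_ge0 i0 A0) (powR_ge0 _ _)) -powRrM -qE (powRM _ i0 A0) (powRM _ i0 X0) mulrACA.
rewrite -powRD ?pq; last by rewrite oner_eq0.
by rewrite powRr1 // mulrC ler_pdivrMr.
Qed.

(** Hoelder's inequality on the unit square. It permits larger powers of the constant to replace
    smaller ones. *)
Lemma Ap_const_ge1 : 1 <= W.
Proof.
have [_ _ _ cube] := Ap_weight_pair.
have [q1 pq _] := conj_exponents.
have [h _ _] := sqint_one p1 q1 pq (0, 0) lw ldual dual_one ltr01.
have := le_trans h (cube (0, 0) 1 ltr01); rewrite expr1n mulr1 => h1.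
rewrite leNgt; apply/negP => W1; move: h1; rewrite leNgt => /negP; apply.
have W0 : 0 <= W.
  apply: le_trans (Wfin (0, 0) ltr01); apply: mulr_ge0 (powR_ge0 _ _).
  by apply: mulr_ge0; [rewrite invr_ge0 expr1n|exact: sqint_ge0].
have one2 : (1 : R) `^ p^-1 = 1 by rewrite powR1.
by rewrite -[X in _ < X]one2; apply: gt0_ltr_powR => //; rewrite ?nnegrE ?invr_gt0.
Qed.
End Pair.

Section Oscillation.
Variables (p : R) (w la : R * R -> R) (b : R * R -> R[i]).
Hypotheses (p1 : 1 < p) (hw : in_Ap p w) (hla : in_Ap p la) (hb : L1loc b).
Local Notation q := (p / (p - 1)).
Local Notation nu := (fun x => w x `^ p^-1 * la x `^ (- p^-1)).
Local Notation nu' := (fun z => posw w z `^ p^-1 * dualw p la z `^ q^-1).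

Lemma rint_L1loc pi c r : is_part pi -> rint mu (fun z => pi (b z) * \1_(square c r) z).
Proof.
move=> pp; have [mb hi] := hb; have mc := measurable_cmod mb.
have rc : rint mu (fun z => cmod (b z) * \1_(square c r) z).
  apply: rint_local => // A cA; apply: le_lt_trans (hi A cA); rewrite le_eqVlt; apply/orP; left; apply/eqP.
  by apply: eq_integral => x _; rewrite /= ger0_norm // cmod_ge0.
apply: (rint_le _ _ rc).
  apply: measurable_funM; last exact: measurable_indic (measurable_square c r).
  by case: mb => mr mi; case: pp => ->.
by move=> z; rewrite !normrM ler_wpM2r // [leRHS]ger0_norm ?cmod_ge0 // part_le_cmod.
Qed.

Let lnu : local_weight nu'.
Proof.
have [q1 pq _] := conj_exponents p1.
have [l1 _ _ _] := Ap_weight_pair p1 hw; have [_ l2 _ _] := Ap_weight_pair p1 hla.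
exact: local_weight_prod p1 q1 pq _ _ l1 l2.
Qed.

Let nuE c r : (\int[mu]_(x in square c r) (nu x)%:E = (sqint nu' c r)%:E)%E.
Proof.
have [[mw _ _] _] := hw; have [[ml _ _] _] := hla.
rewrite int_squareE /sqint rintE; last exact: lw_int lnu c r.
apply: ae_eq_integral => //.
- apply/measurable_EFinP; apply: measurable_funM; last exact: measurable_indic (measurable_square c r).
  by apply: measurable_funM; exact: measurable_powR_c.
- by apply/measurable_EFinP; exact: rint_meas (lw_int lnu c r).
apply: (ae_mp2 (posw_ae (proj1 hw)) (posw_ae (proj1 hla))) => z e1 e2 _.
have [_ _ qE] := conj_exponents p1.
rewrite /dualw e1 e2 -powRrM qE (_ : - (p - 1)^-1 * ((p - 1) / p) = - p^-1) //.
by field; rewrite (gt_eqF (lt_trans ltr01 p1)) subr_eq0 gt_eqF.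
Qed.

Let osc_int c r : rint mu (fun z => cmod (b z - cavg (square c r) b) * \1_(square c r) z).
Proof.
have [[mr mi] _] := hb; set k := cavg _ _.
have rD (u : borel2 R -> R) (t : R) : rint mu (fun z => u z * \1_(square c r) z) ->
    rint mu (fun z => `|(u z - t) * \1_(square c r) z|).
  move=> ru; apply: rint_norm; apply: rint_ext (rintB ru (rintZ t (rint_square c r))) => z.
  by rewrite mulrBl.
have i1 := rD _ (complex.Re k) (rint_L1loc c r (or_introl erefl)).
have i2 := rD _ (complex.Im k) (rint_L1loc c r (or_intror erefl)).
apply: (rint_le _ _ (rintD i1 i2)).
  apply: measurable_funM; last exact: measurable_indic (measurable_square c r).
  apply: measurable_cmod; split.
    by rewrite (_ : (fun x => _) = (fun x => complex.Re (b x) - complex.Re k));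
      [apply: measurable_funB => //; exact: measurable_cst|apply/funext => x; rewrite (partB _ _ (or_introl erefl))].
  by rewrite (_ : (fun x => _) = (fun x => complex.Im (b x) - complex.Im k));
    [apply: measurable_funB => //; exact: measurable_cst|apply/funext => x; rewrite (partB _ _ (or_intror erefl))].
move=> z; rewrite [leRHS]ger0_norm ?addr_ge0 // !normrM -mulrDl ler_wpM2r // ger0_norm ?cmod_ge0 //.
by apply: le_trans (cmod_le _) _; rewrite (partB _ _ (or_introl erefl)) (partB _ _ (or_intror erefl)).
Qed.

Hypothesis bmo : (bmo_norm nu b < +oo)%E.
Let B := fine (bmo_norm nu b).

Let osc_le c r : 0 < r ->
  (((sqint nu' c r)^-1 * \int[mu]_z (cmod (b z - cavg (square c r) b) * \1_(square c r) z))%:E <= bmo_norm nu b)%E.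
Proof.
move=> r0; apply: le_trans (ereal_sup_ubound _); last first.
  by exists (square c r); [exists c, r|reflexivity].
rewrite EFinM nuE inver gt_eqF; last exact: sqint_gt0.
by rewrite (int_squareE (fun x => cmod (b x - cavg (square c r) b))) -rintE.
Qed.

Lemma bmo_fin : [/\ 0 <= B & bmo_norm nu b = B%:E].
Proof.
have h : (0 <= bmo_norm nu b)%E.
  apply: le_trans (osc_le (0, 0) ltr01); rewrite lee_fin; apply: mulr_ge0.
    by rewrite invr_ge0; exact: sqint_ge0 lnu.
  by apply: Rint_ge0 => z; rewrite mulr_ge0 ?cmod_ge0 // indicE.
have hf : bmo_norm nu b \is a fin_num by rewrite ge0_fin_numE.
by split; [rewrite /B fine_ge0|rewrite /B fineK].
Qed.

(** The clamped mean serves as the constant; the bound is the same for all [N] because clamping is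
    1-Lipschitz. *)
Lemma clamp_osc pi (N : R) c r : is_part pi -> 0 < r ->
  exists k, \int[mu]_z (`|clamp N (pi (b z)) - k| * \1_(square c r) z) <= B * sqint nu' c r.
Proof.
move=> pp r0; exists (clamp N (pi (cavg (square c r) b))); have [_ BE] := bmo_fin.
have := osc_le c r0; rewrite BE lee_fin mulrC ler_pdivrMr; last exact: sqint_gt0.
apply: le_trans; have [mb _] := hb.
have mp : measurable_fun setT (fun z : borel2 R => pi (b z)) by case: mb => mr mi; case: pp => ->.
have h z : `|clamp N (pi (b z)) - clamp N (pi (cavg (square c r) b))| * \1_(square c r) z <=
    cmod (b z - cavg (square c r) b) * \1_(square c r) z.
  rewrite ler_wpM2r ?indicE //; apply: le_trans (clamp_lip _ _ _) _.
  by rewrite -partB //; exact: part_le_cmod.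
apply: Rint_le => //; apply: (rint_le _ _ (osc_int c r)).
  apply: measurable_funM; last exact: measurable_indic (measurable_square c r).
  apply: measurableT_comp => //; apply: measurable_funB; last exact: measurable_cst.
  exact: measurable_clamp.
move=> z; rewrite [leLHS]ger0_norm ?mulr_ge0 ?indicE // -indicE.
by apply: le_trans (h z) (ler_norm _).
Qed.
End Oscillation.
End Weights.

(** * Weighted norms of complex functions *)

Lemma sum_powR (R : realType) (I : finType) (i0 : I) (p : R) (x : I -> R) : 1 < p -> (forall i, 0 <= x i) ->
  (\sum_i x i) `^ p <= #|I|%:R `^ p * \sum_i x i `^ p.
Proof.
move=> p1 x0; have p0 : 0 <= p by rewrite ltW // (lt_trans ltr01).
have [j _ hj] := Order.TotalTheory.arg_maxP x (erefl : predT i0).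
have h1 : \sum_i x i <= #|I|%:R * x j.
  rewrite mulr_natl -sumr_const; apply: ler_sum => i _; exact: hj.
apply: le_trans (ge0_ler_powR p0 _ _ h1) _; rewrite ?nnegrE ?mulr_ge0 ?sumr_ge0 //.
rewrite powRM //; apply: ler_wpM2l; first exact: powR_ge0.
by rewrite (bigD1 j) //= lerDl sumr_ge0 // => i _; exact: powR_ge0.
Qed.

Lemma le_mul4 (R : realType) (t A : R) (a b c d : \bar R) :
  (0 <= a -> 0 <= b -> 0 <= c -> 0 <= d -> t%:E * a <= A%:E -> t%:E * b <= A%:E -> t%:E * c <= A%:E ->
   t%:E * d <= A%:E -> t%:E * ((a + b) + (c + d)) <= (4%:R * A)%:E)%E.
Proof.
move=> a0 b0 c0 d0 h1 h2 h3 h4; rewrite ge0_muleDr ?adde_ge0 // !ge0_muleDr //.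
have -> : (4%:R * A)%:E = ((A%:E + A%:E) + (A%:E + A%:E))%E by rewrite -!EFinD; congr (_%:E); ring.
by apply: leeD; exact: leeD.
Qed.

Section WeightedNorm.
Variables (R : realType) (p : R).
Hypothesis p1 : 1 < p.
Local Notation mu := (@leb2 R).

Let p0 : 0 < p. Proof. exact: lt_trans p1. Qed.

Let measurable_wpow (f : R * R -> R[i]) (w : borel2 R -> R) : cmeasurable f -> measurable_fun setT w ->
  measurable_fun setT (fun z : borel2 R => cmod (f z) `^ p * w z).
Proof.
by move=> mf mw; apply: measurable_funM => //; apply: measurable_powR_c; exact: measurable_cmod.
Qed.

Lemma Lnormw_posw w (f : R * R -> R[i]) : is_weight w -> cmeasurable f ->
  Lnormw p w f = ((\int[mu]_z (cmod (f z) `^ p * posw w z)%:E) `^ p^-1)%E.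
Proof.
move=> hw mf; have [mw _ _] := hw; congr (_ `^ _)%E; apply: ae_eq_integral => //.
- by apply/measurable_EFinP; exact: measurable_wpow.
- by apply/measurable_EFinP; apply: measurable_wpow => //; exact: measurable_posw.
- by apply: (ae_imp (posw_ae hw)) => z ->.
Qed.

Let wpow_ge0 w (f : R * R -> R[i]) z : 0 <= cmod (f z) `^ p * posw w z.
Proof. by rewrite mulr_ge0 ?powR_ge0 // ltW // posw_gt0. Qed.

Lemma inLw_rint w (f : R * R -> R[i]) : is_weight w -> inLw p w f ->
  rint mu (fun z => cmod (f z) `^ p * posw w z).
Proof.
move=> hw [mf]; rewrite (Lnormw_posw hw mf) => /lty_poweRy h.
have [mw _ _] := hw; apply/integrableP; split.
  by apply/measurable_EFinP; apply: measurable_wpow => //; exact: measurable_posw.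
under eq_integral do rewrite /= ger0_norm //.
by apply: h; rewrite invr_eq0 gt_eqF.
Qed.

(** The power of the sum costs [#|I| ^ p], and the number of integrals costs another [#|I|], which
    is at most [#|I| ^ p]; the root leaves [#|I|] twice. *)
Lemma Lnormw_sum (I : finType) (i0 : I) (A : R) (w w2 : R * R -> R) (F f : R * R -> R[i])
    (h g : I -> borel2 R -> R) : 0 <= A -> is_weight w -> is_weight w2 -> cmeasurable F -> cmeasurable f ->
  (forall i, measurable_fun setT (h i)) -> {ae mu, forall z, cmod (F z) <= \sum_i `|h i z|} ->
  (forall i, (\int[mu]_z (`|h i z| `^ p * posw w z)%:E <= (A `^ p * wint p (posw w2) (g i))%:E)%E) ->
  (forall i, measurable_fun setT (g i)) -> (forall i z, `|g i z| <= cmod (f z)) ->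
  rint mu (fun z => cmod (f z) `^ p * posw w2 z) ->
  (Lnormw p w F <= (#|I|%:R * #|I|%:R * A)%:E * Lnormw p w2 f)%E.
Proof.
move=> A0 hw hw2 mF mf mh hF hh mg hg rf.
have [mw _ _] := hw; have [mw2 _ _] := hw2; have mpw := measurable_posw mw.
rewrite (Lnormw_posw hw mF) (Lnormw_posw hw2 mf) -(rintE rf).
set G := \int[mu]_z _; have G0 : 0 <= G by apply: Rint_ge0 => z; exact: wpow_ge0.
set n : R := #|I|%:R; have n1 : 1 <= n by rewrite ler1n; apply/card_gt0P; exists i0.
have n0 : 0 <= n := le_trans ler01 n1.
have c0 : 0 <= n * n * A by rewrite mulr_ge0 // mulr_ge0.
have pw0 z : 0 <= posw w z by rewrite ltW // posw_gt0.
have mterm i : measurable_fun setT (fun z => `|h i z| `^ p * posw w z).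
  by apply: measurable_funM => //; apply: measurable_powR_c; exact: measurableT_comp.
have term0 i z : 0 <= `|h i z| `^ p * posw w z by rewrite mulr_ge0 ?powR_ge0.
have wG i : wint p (posw w2) (g i) <= G.
  have pw20 z : 0 <= posw w2 z by rewrite ltW // posw_gt0.
  have hgz z : `|g i z| `^ p * posw w2 z <= cmod (f z) `^ p * posw w2 z.
    by rewrite ler_wpM2r // ge0_ler_powR ?nnegrE ?(ltW p0) // cmod_ge0.
  have ri : rint mu (fun z => `|g i z| `^ p * posw w2 z).
    apply: (rint_le _ _ rf).
      apply: measurable_funM; last exact: measurable_posw.
      by apply: measurable_powR_c; exact: measurableT_comp.
    by move=> z; rewrite [leLHS]ger0_norm ?mulr_ge0 ?powR_ge0 // [leRHS]ger0_norm.
  exact (Rint_le ri rf hgz).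
have bound : (\int[mu]_z (cmod (F z) `^ p * posw w z)%:E <= ((n * n * A) `^ p * G)%:E)%E.
  apply: (@le_trans _ _ (\int[mu]_z (\sum_(i : I) (n `^ p)%:E * (`|h i z| `^ p * posw w z)%:E)%E)%E).
    apply: ae_ge0_le_integral => //.
    - by move=> z _; rewrite lee_fin.
    - by apply/measurable_EFinP; exact: measurable_wpow.
    - by move=> z _; apply: sume_ge0 => i _; rewrite -EFinM lee_fin mulr_ge0 ?powR_ge0.
    - by apply: emeasurable_sum => i; apply: measurable_funeM; exact/measurable_EFinP.
    apply: (ae_imp hF) => z hz _; under eq_bigr do rewrite -EFinM.
    rewrite sumEFin lee_fin -mulr_sumr -mulr_suml mulrA ler_wpM2r //.
    apply: le_trans (sum_powR i0 p1 (fun i => normr_ge0 (h i z))).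
    by rewrite ge0_ler_powR ?nnegrE ?(ltW p0) ?cmod_ge0 // sumr_ge0.
  rewrite ge0_integral_sum //; last first.
  - by move=> i z _; rewrite -EFinM lee_fin mulr_ge0 ?powR_ge0.
  - by move=> i; apply: measurable_funeM; exact/measurable_EFinP.
  apply: (@le_trans _ _ (\sum_(i : I) ((n `^ p * (A `^ p * G))%:E))%E).
    apply: lee_sum => i _; rewrite ge0_integralZl_EFin //;
      try by [exact: powR_ge0|exact/measurable_EFinP|move=> z _; rewrite lee_fin].
    rewrite EFinM; apply: lee_wpmul2l; first by rewrite lee_fin powR_ge0.
    by apply: le_trans (hh i) _; rewrite lee_fin ler_wpM2l ?powR_ge0.
  rewrite sumEFin lee_fin sumr_const -[X in X <= _]mulr_natl -/n.
  rewrite (powRM _ (mulr_ge0 n0 n0) A0) (powRM _ n0 n0) -!mulrA.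
  apply: ler_wpM2r; first by rewrite mulr_ge0 ?powR_ge0 // mulr_ge0 ?powR_ge0.
  by rewrite -[leLHS]powRr1 // ler_powR // ltW.
have r0 : 0 <= p^-1 by rewrite invr_ge0 ltW.
have X0 : 0 <= (n * n * A) `^ p * G by rewrite mulr_ge0 ?powR_ge0.
apply: (@le_trans _ _ (((n * n * A) `^ p * G)%:E `^ p^-1)%E).
  apply: gt0_ler_poweR => //; rewrite in_itv /= leey andbT.
    by apply: integral_ge0 => z _; rewrite lee_fin.
  by rewrite lee_fin.
rewrite !poweR_EFin -EFinM lee_fin (powRM _ (powR_ge0 _ _) G0) -powRrM mulfV ?gt_eqF // powRr1 //.
Qed.
End WeightedNorm.

(** * The complex operator and its weak type extension *)

Section ComplexExtension.
Variables (R : realType) (T : (R * R -> R[i]) -> R * R -> R[i]).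
Hypothesis hT : L2_operator T.
Local Notation mu := (@leb2 R).
Local Notation re := (@complex.Re R).
Local Notation im := (@complex.Im R).
Local Notation S1 := (part_op T re).
Local Notation S2 := (part_op T im).

(** A complex linear operator recovered from the two parts of its values on real functions. *)
Definition combine (P1 P2 : (borel2 R -> R) -> borel2 R -> R) (f : R * R -> R[i]) : R * R -> R[i] := fun z =>
  Complex (P1 (fun t => re (f t)) z - P2 (fun t => im (f t)) z)
          (P2 (fun t => re (f t)) z + P1 (fun t => im (f t)) z).

Lemma combineE (f : R * R -> R[i]) : inL 2%:R f -> {ae mu, forall z, T f z = combine S1 S2 f z}.
Proof.
move=> /inL2P[Lr Li]; have [_ linT _] := hT.
have := linT (Complex 0 1) _ _ (inL2_clift Li) (inL2_clift Lr).
rewrite (_ : (fun t => _ * _ + _) = f); last first.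
  apply/funext => t; apply/eqP; rewrite eq_complex reD imD reZ imZ /clift /=.
  by rewrite !mul0r !mulr0 !mul1r subr0 !addr0 !add0r !eqxx.
move=> h; apply: (ae_imp h) => z ->; apply/eqP; rewrite eq_complex reD imD reZ imZ /combine /part_op /=.
by rewrite !mul0r !mul1r sub0r add0r; apply/andP; split; apply/eqP; exact: addrC.
Qed.

Variables (M C th : R) (k1 k2 : R * R -> R * R -> R).
Hypotheses (M0 : 0 < M) (C0 : 0 <= C) (th0 : 0 < th) (th1 : th <= 1).
Hypotheses (rc1 : real_cz M C th S1 k1) (rc2 : real_cz M C th S2 k2).
Variables E1 E2 : (borel2 R -> R) -> borel2 R -> R.
Hypotheses (ext1 : is_ext S1 E1) (ext2 : is_ext S2 E2).
Local Notation K1 := (2%:R * weakK M C th).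

Let lin3 S k E (a b : R) u v s : real_cz M C th S k -> is_ext S E -> rint mu u -> rint mu v -> rint mu s ->
  {ae mu, forall z, E (fun t => a * u t + (b * v t + s t)) z = a * E u z + (b * E v z + E s z)}.
Proof.
move=> rc ext ru rv rs; have r2 : rint mu (fun t => b * v t + s t) by apply: rintD => //; exact: rintZ.
apply: (ae_mp2 (ext_lin rc ext a ru r2) (ext_lin rc ext b rv rs)) => z -> ->.
by [].
Qed.

Let weak4 f (t : R) (u : borel2 R -> R) S k E : real_cz M C th S k -> is_ext S E -> inL 1 f ->
  rint mu u -> (forall z, `|u z| <= cmod (f z)) -> 0 < t ->
  ((t%:E * mu [set z | (t / 4%:R < `|E u z|)%R])%E <= (4%:R * K1 * \int[mu]_z cmod (f z))%:E)%E.
Proof.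
move=> rc ext /inL1P[rr ri] ru hu t0; have t4 : 0 < t / 4%:R by rewrite divr_gt0.
have := ext_weak M0 C0 th0 th1 rc ext ru t4; set m := mu _ => h.
rewrite (_ : t = 4%:R * (t / 4%:R)) 1?EFinM; last by field.
rewrite -muleA -mulrA [X in (_ <= X)%E]EFinM; apply: lee_wpmul2l; first by rewrite lee_fin.
apply: le_trans h _; rewrite lee_fin; apply: ler_wpM2l; first exact: mulr_ge0 (ler0n R 2) (weakK_ge0 M th C0).
by apply: Rint_le => //; [exact: rint_norm|exact: rint_cmod].
Qed.

Lemma combine_weak11 : weak11_extension T (combine E1 E2).
Proof.
split=> [f /inL1P[rr ri]|a f g /inL1P[fr fi] /inL1P[gr gi]||f f1 f2].
- by split; [apply: measurable_funB|apply: measurable_funD]; (exact: ext1.1 || exact: ext2.1).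
- case: a => al be.
  have ER : (fun t => re (Complex al be * f t + g t)) =
      (fun t => al * re (f t) + (- be * im (f t) + re (g t))).
    by apply/funext => t; rewrite reD reZ /=; ring.
  have EI : (fun t => im (Complex al be * f t + g t)) =
      (fun t => al * im (f t) + (be * re (f t) + im (g t))).
    by apply/funext => t; rewrite imD imZ /=; ring.
  have h1 := ae_mp2 (lin3 al (- be) rc1 ext1 fr fi gr) (lin3 al be rc1 ext1 fi fr gi) (fun z x y => conj x y).
  have h2 := ae_mp2 (lin3 al (- be) rc2 ext2 fr fi gr) (lin3 al be rc2 ext2 fi fr gi) (fun z x y => conj x y).
  apply: (ae_mp2 h1 h2) => z [e1 e2] [e3 e4]; rewrite /combine ER EI e1 e2 e3 e4.
  by apply/eqP; rewrite eq_complex reD imD reZ imZ /=; apply/andP; split; apply/eqP; ring.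
(* Four real terms, each with a level set at height [t / 4]; hence [16 = 4 * 4]. *)
- exists (16%:R * K1) => f hf t t0; have hf' := hf; move/inL1P: hf' => [rr ri].
  rewrite (Lnorm1E hf) -EFinM.
  pose L (u : borel2 R -> R) : set (borel2 R) := [set z | t / 4%:R < `|u z|].
  have mL u : measurable_fun setT u -> measurable (L u).
    by move=> mu_; apply: (measurable_gt (t / 4%:R) (u := fun z => `|u z|)); exact: measurableT_comp.
  set a1 := E1 (fun t => re (f t)); set a2 := E2 (fun t => im (f t)).
  set a3 := E2 (fun t => re (f t)); set a4 := E1 (fun t => im (f t)).
  have m1 := mL a1 (ext1.1 _); have m2 := mL a2 (ext2.1 _).
  have m3 := mL a3 (ext2.1 _); have m4 := mL a4 (ext1.1 _).
  have sub : [set x | t < cmod (combine E1 E2 f x)] `<=` (L a1 `|` L a2) `|` (L a3 `|` L a4).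
    move=> z /= hz; have := le_trans (ltW hz) (cmod_le _); rewrite /= -/a1 -/a2 -/a3 -/a4 => h.
    have h' := lt_le_trans hz (cmod_le _); rewrite /= -/a1 -/a2 -/a3 -/a4 in h'.
    have := ler_normB (a1 z) (a2 z); have := ler_normD (a3 z) (a4 z) => g1 g2.
    apply: contrapT => /not_orP[/not_orP[n1 n2] /not_orP[n3 n4]].
    move: n1 n2 n3 n4; rewrite /L /= => /negP + /negP + /negP + /negP.
    rewrite -!leNgt; move: h' g1 g2.
    set x1 := `|a1 z|; set x2 := `|a2 z|; set x3 := `|a3 z|; set x4 := `|a4 z|.
    set y1 := `|a1 z - _|; set y2 := `|a3 z + _| => *; lra.
  have mc : measurable [set x | t < cmod (combine E1 E2 f x)].
    apply: (measurable_gt t (u := fun x => cmod (combine E1 E2 f x))); apply: measurable_cmod.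
    by split; [apply: measurable_funB|apply: measurable_funD]; (exact: ext1.1 || exact: ext2.1).
  have b1 := weak4 rc1 ext1 hf rr (fun z => re_le_cmod (f z)) t0.
  have b2 := weak4 rc2 ext2 hf ri (fun z => im_le_cmod (f z)) t0.
  have b3 := weak4 rc2 ext2 hf rr (fun z => re_le_cmod (f z)) t0.
  have b4 := weak4 rc1 ext1 hf ri (fun z => im_le_cmod (f z)) t0.
  apply: (@le_trans _ _ (t%:E * ((mu (L a1) + mu (L a2)) + (mu (L a3) + mu (L a4))))%E).
    apply: lee_wpmul2l; first by rewrite lee_fin ltW.
    have mU1 : measurable (L a1 `|` L a2) by exact: measurableU.
    have mU2 : measurable (L a3 `|` L a4) by exact: measurableU.
    apply: (@le_trans _ _ (mu ((L a1 `|` L a2) `|` (L a3 `|` L a4)))).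
      by apply: le_measure => //; rewrite inE //; exact: measurableU.
    apply: le_trans (measureU2 _ mU1 mU2) _.
    by apply: leeD; exact: measureU2.
  rewrite (_ : 16%:R * K1 * _ = 4%:R * (4%:R * K1 * \int[mu]_z cmod (f z))); last by ring.
  exact (le_mul4 (measure_ge0 mu (L a1)) (measure_ge0 mu (L a2)) (measure_ge0 mu (L a3)) (measure_ge0 mu (L a4)) b1 b2 b3 b4).
- have [Lr Li] := (inL2P f).1 f2; have [rr ri] := (inL1P f).1 f1.
  have h1 := ae_mp2 (ext_L2 ext1 Lr rr) (ext_L2 ext1 Li ri) (fun z x y => conj x y).
  have h2 := ae_mp2 (ext_L2 ext2 Lr rr) (ext_L2 ext2 Li ri) (fun z x y => conj x y).
  have h3 := ae_mp2 h1 h2 (fun z x y => conj x y).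
  by apply: (ae_mp2 h3 (combineE f2)) => z [[e1 e2] [e3 e4]] ->; rewrite /combine e1 e2 e3 e4.
Qed.
End ComplexExtension.

(** * Commutators with unbounded multipliers *)

Section CommutatorTerm.
Variables (R : realType) (M C th : R) (S : (borel2 R -> R) -> borel2 R -> R).
Variable k : R * R -> R * R -> R.
Hypotheses (M0 : 0 < M) (C0 : 0 <= C) (th0 : 0 < th) (th1 : th <= 1).
Hypothesis rc : real_cz M C th S k.
Variables (p q : R).
Hypotheses (p1 : 1 < p) (q1 : 1 < q) (pq : p^-1 + q^-1 = 1).
Local Notation mu := (@leb2 R).
Variable E : (borel2 R -> R) -> borel2 R -> R.
Hypothesis ext : is_ext S E.

Lemma rint_mul_bsupp (b f : borel2 R -> R) : measurable_fun setT b ->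
  (forall c r, rint mu (fun z => b z * \1_(square c r) z)) -> bsupp f -> rint mu (fun z => b z * f z).
Proof.
move=> mb ib [mf [N h]].
apply: (rint_le _ _ (rintZ (N.+1)%:R (ib (- (N.+1)%:R, - (N.+1)%:R) (2%:R * (N.+1)%:R)))).
  exact: measurable_funM.
move=> z; rewrite !normrM mulrCA ler_wpM2l //; apply: le_trans (h z) _.
by rewrite ler_pM // ler_norm.
Qed.

Lemma clamp_eventually (x : R) : exists n : nat, forall m, (n <= m)%N -> clamp m%:R x = x.
Proof.
exists (Num.truncn `|x|).+1 => m nm; apply: clamp_id.
have /andP[_ /ltW h] := truncn_itv (normr_ge0 x); apply: le_trans h _.
by rewrite ler_nat.
Qed.

(** The clamped multipliers share the oscillation bound [B]. Their products with [f] tend fast to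
    [b * f] in $L^1$, so the operator applied to them tends to the extension at [b * f] almost
    everywhere, and Fatou's lemma carries over the bound of [commutator_op]. *)
Lemma commutator_term C1 C2 w sg la m f (b : borel2 R -> R) (B : R) : 0 < C1 -> 0 < C2 ->
  weight_pair p q C1 w sg -> weight_pair p q C2 la m -> 0 <= B -> measurable_fun setT b ->
  (forall c r, rint mu (fun z => b z * \1_(square c r) z)) ->
  (forall N c r, 0 < r -> exists k, \int[mu]_z (`|clamp N (b z) - k| * \1_(square c r) z) <=
     B * sqint (fun z => w z `^ p^-1 * m z `^ q^-1) c r) -> bsupp f ->
  (\int[mu]_z (`|b z * S f z - E (fun t => b t * f t) z| `^ p * la z)%:E <=
    ((2%:R * commK M C th p q C1 C2 B) `^ p * wint p w f)%:E)%E.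
Proof.
move=> C10 C20 wp lp2 B0 mb ib osc bf; have [lla _ _ _] := lp2.
have rbf := rint_mul_bsupp mb ib bf; have mf := bf.1.
pose v (n : nat) : borel2 R -> R := fun t => clamp n%:R (b t) * f t.
have mcl (n : nat) : measurable_fun setT (fun z : borel2 R => clamp n%:R (b z)) by exact: measurable_clamp.
have bcl (n : nat) (z : borel2 R) : `|clamp n%:R (b z)| <= n%:R by exact: clamp_bound.
have bv n : bsupp (v n) by exact: bsupp_mul (mcl n) (bcl n) bf.
have cv0 z : clamp n%:R (b z) @[n --> \oo] --> b z.
  by apply: cvg_near_cst; have [n hn] := clamp_eventually (b z); exists n => // j /= /hn.
have cle n z : `|v n z| <= `|b z * f z|.
  rewrite /v !normrM ler_wpM2r // -[X in `|X| <= _]subr0 -(clamp0 (ler0n R n)).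
  by apply: le_trans (clamp_lip _ _ _) _; rewrite subr0.
have cv : \int[mu]_z `|v n z - b z * f z| @[n --> \oo] --> (0 : R).
  have := @dct _ _ R mu (fun n z => `|v n z - b z * f z|) (fun=> 0) (fun z => 2%:R * `|b z * f z|) _ (measurable_cst _) _ (rintZ _ (rint_norm rbf)) _.
  rewrite (Rint0 mu (fun=> erefl)); case => //.
  - move=> n; apply: measurableT_comp => //; apply: measurable_funB; first by case: (bv n).
    exact: measurable_funM.
  - apply: nearW => z; rewrite -(normr0 R) -(subrr (b z * f z)); apply: cvg_norm.
    by apply: cvgB; [apply: cvgM; [exact: cv0|exact: cvg_cst]|exact: cvg_cst].
  - by move=> n z; rewrite normr_id; have := ler_normB (v n z) (b z * f z); have := cle n z; lra.
(* The condition [n <= j] makes the clamping heights tend to infinity, so that the first term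
   converges as well. *)
have /boolp.choice[N hN] n : exists j, (n <= j)%N /\ \int[mu]_z `|v j z - b z * f z| <= (4^-1) ^+ n.
  move/cvgrPdist_le: cv => /(_ ((4^-1) ^+ n)); case; first by rewrite exprn_gt0 // invr_gt0.
  move=> j _ /(_ (maxn j n) (leq_maxl j n)); rewrite sub0r normrN ger0_norm; last by apply: Rint_ge0.
  by exists (maxn j n); rewrite leq_maxr.
have av : fast_approx (fun n => v (N n)) (fun z => b z * f z) 1.
  by split=> n; [exact/bsupp_L2|exact/bsupp_rint|rewrite mul1r; case: (hN n)].
have cE := ext.2 _ _ _ rbf av.
have [mSf _] := rc_L2 rc (bsupp_L2 bf).
have mpow (u : borel2 R -> R) : measurable_fun setT u -> measurable_fun setT (fun z => `|u z| `^ p * la z).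
  by move=> mu_; apply: measurable_funM (lw_meas lla); apply: measurable_powR_c; exact: measurableT_comp.
have la0 z : 0 <= la z by rewrite ltW // lw_gt0.
apply: (fatou_cvg (u := fun n z => `|clamp (N n)%:R (b z) * S f z - S (v (N n)) z| `^ p * la z)).
- move=> n; apply: mpow; apply: measurable_funB; first exact: measurable_funM.
  by case: (rc_L2 rc (bsupp_L2 (bv (N n)))).
- by apply: mpow; apply: measurable_funB; [exact: measurable_funM|exact: ext.1].
- by move=> n z; rewrite mulr_ge0 ?powR_ge0.
- by move=> z; rewrite mulr_ge0 ?powR_ge0.
- apply: (ae_imp cE) => z cz; apply: cvgM; last exact: cvg_cst.
  have cd : clamp (N n)%:R (b z) * S f z - S (v (N n)) z @[n --> \oo] --> b z * S f z - E (fun t => b t * f t) z.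
    apply: cvgB => //; apply: cvgM; last exact: cvg_cst.
    apply: cvg_near_cst; have [n hn] := clamp_eventually (b z); exists n => // j /= nj.
    by apply: hn; apply: leq_trans nj _; case: (hN j).
  have cn : `|clamp (N n)%:R (b z) * S f z - S (v (N n)) z| @[n --> \oo] -->
      `|b z * S f z - E (fun t => b t * f t) z| by apply: cvg_norm.
  by apply: (cvg_powR_nneg p1 q1 pq _ _ cn).
move=> n; exact (commutator_op M0 C0 th0 th1 rc p1 q1 pq C10 C20 wp lp2 B0 (mcl (N n)) (bcl (N n))
  (osc (N n)%:R) bf).
Qed.
End CommutatorTerm.

(** * Dependence on the weight constant and final assembly *)

Lemma LamC_scale (R : realType) (p q c : R) : 0 < p -> 0 < q -> 0 <= c ->
  LamC p q (9%:R * c) = LamC p q (9%:R * 1) * (c * ((c `^ q) `^ p^-1 * (c `^ p) `^ q^-1)).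
Proof.
move=> p0 q0 c0; rewrite /LamC mulr1.
have sc r s t : 0 <= s -> (144%:R * (2%:R * (9%:R * c)) `^ r * s) `^ t =
    (144%:R * (2%:R * 9%:R) `^ r * s) `^ t * (c `^ r) `^ t.
  move=> s0; have n18 : 0 <= 2%:R * 9%:R :> R by rewrite mulr_ge0 ?ler0n.
  rewrite [2%:R * (9%:R * c)]mulrA (powRM _ n18 c0).
  have -> : 144%:R * ((2%:R * 9%:R) `^ r * c `^ r) * s = 144%:R * (2%:R * 9%:R) `^ r * s * c `^ r by ring.
  by apply: powRM; [apply: mulr_ge0 s0; apply: mulr_ge0 (powR_ge0 _ _); exact: ler0n|exact: powR_ge0].
rewrite !sc ?powR_ge0 //.
set x := (144%:R * _ * q `^ p) `^ _; set y := (144%:R * _ * p `^ q) `^ _.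
set u := (c `^ q) `^ _; set v := (c `^ p) `^ _; ring.
Qed.

(** For [c] the [p]-th root of [W], the powers in [LamC_scale] add up to the exponent
    [1 + 1 / (p (p - 1))] of [W], which is at most [p / (p - 1) = 1 + 1 / (p - 1)]; as [1 <= W] the
    exponent may be raised. *)
Lemma weightedK_scale (R : realType) (M C th p W : R) : 0 < M -> 0 <= C -> 1 < p -> 1 <= W ->
  weightedK M C th p (p / (p - 1)) (W `^ p^-1) <=
  weightedK M C th p (p / (p - 1)) 1 * W `^ (p / (p - 1)).
Proof.
move=> M0 C0 p1 W1; have [q1 pq qE] := conj_exponents p1; set q := p / (p - 1) in q1 pq qE *.
have p0 : 0 < p by exact: lt_trans p1. have q0 : 0 < q by exact: lt_trans q1.
have pm : 0 < p - 1 by rewrite subr_gt0.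
rewrite /weightedK LamC_scale ?powR_ge0 //.
rewrite -mulrA (_ : sparseC _ _ * LamC _ _ _ * _ = sparseC (kernelC C th) M * (LamC p q (9%:R * 1) * W `^ q)); last by rewrite mulrA.
apply: ler_wpM2l; first exact: ler0n.
apply: ler_wpM2l.
  by apply: sparseC_ge0 (ltW M0); exact: kernelC_ge0.
apply: ler_wpM2l; first by apply: LamC_ge0; rewrite mulr1.
rewrite -!powRrM -!powRD ?(gt_eqF (lt_le_trans ltr01 W1)) ?implybT //; apply: ler_powR => //.
rewrite qE /q (_ : _ + _ = 1 + (p * (p - 1))^-1); last by field; rewrite !gt_eqF.
rewrite (_ : p / (p - 1) = 1 + (p - 1)^-1); last by field; rewrite gt_eqF.
by rewrite lerD2l lef_pV2 ?posrE ?mulr_gt0 // ler_peMl ?(ltW pm) // ltW.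
Qed.

Lemma commK_linear (R : realType) (M C th p q C1 C2 B : R) :
  commK M C th p q C1 C2 B = commK M C th p q C1 C2 1 * B.
Proof. by rewrite /commK; set X := commC _ _ _ _ _ _; ring. Qed.

Section BoundedSupport.
Variable R : realType.
Local Notation mu := (@leb2 R).

Lemma bounded_support_box (f : R * R -> R[i]) : bounded_compact_support f ->
  exists N, forall z, cmod (f z) <= (N.+1)%:R * \1_(box N) z.
Proof.
move=> [mf [Mf hM] [A [cA hA]]].
have [r [_ hr]] := compact_bounded cA; have r1 : r < r + 1 by rewrite ltrDl.
have hr1 := hr (r + 1) r1.
pose N := maxn (Num.truncn `|Mf|) (Num.truncn `|r + 1|); exists N => z.
have [Az|nAz] := pselect (A z); last first.
  by rewrite hA // /cmod /= !expr0n addr0 sqrtr0 mulr_ge0 // indicE.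
have tr (x : R) (n : nat) : (Num.truncn `|x| <= n)%N -> `|x| < (n.+1)%:R.
  move=> h; have /andP[_ h1] := truncn_itv (normr_ge0 x).
  by apply: lt_le_trans h1 _; rewrite ler_nat.
have h1 := tr Mf N (leq_maxl _ _); have h2 := tr (r + 1) N (leq_maxr _ _).
have zr : `|z| <= r + 1 by exact: hr1.
have [z1 z2] : `|z.1| <= r + 1 /\ `|z.2| <= r + 1.
  by move: zr; rewrite prod_normE ge_max => /andP[].
have := ler_norm (r + 1); have := ler_norm Mf => g1 g2.
have bz : box N z.
  move: z1 z2; rewrite !ler_norml => /andP[a1 a2] /andP[a3 a4].
  apply/squareP => /=; move: h2 g2 a1 a2 a3 a4; set n := (N.+1)%:R; set s := `|_|; set t := r + 1 => *.
  by split; lra.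
rewrite indicE mem_set // mulr1; apply: le_trans (hM z) _.
by apply: le_trans g1 _; exact: ltW.
Qed.
End BoundedSupport.

Lemma lee_scale (R : realType) (x y c : R) (X L : \bar R) : X = c%:E -> (0 <= L)%E -> x <= y * c ->
  (x%:E * L <= y%:E * X * L)%E.
Proof. by move=> -> L0 h; rewrite -EFinM; apply: lee_wpmul2r; rewrite ?lee_fin. Qed.

Lemma scale_assoc (R : realType) (n a b c : R) : 0 <= n -> a <= b * c ->
  n * n * (2%:R * a) <= n * n * (2%:R * b) * c.
Proof.
move=> n0 h; rewrite -[leRHS]mulrA -[2%:R * b * c]mulrA; apply: ler_wpM2l; first exact: mulr_ge0.
by apply: ler_wpM2l.
Qed.

Lemma eq_le (R : realType) (x y : R) : x = y -> x <= y.
Proof. by move=> ->. Qed.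

Section Measurability.
Variable R : realType.

Lemma cmeasurableM (f g : R * R -> R[i]) : cmeasurable f -> cmeasurable g ->
  cmeasurable (fun z => f z * g z).
Proof.
move=> [fr fi] [gr gi]; split.
  by under eq_fun do rewrite reZ; apply: measurable_funB; exact: measurable_funM.
by under eq_fun do rewrite imZ; apply: measurable_funD; exact: measurable_funM.
Qed.

Lemma cmeasurableB (f g : R * R -> R[i]) : cmeasurable f -> cmeasurable g ->
  cmeasurable (fun z => f z - g z).
Proof.
move=> [fr fi] [gr gi]; split.
  by under eq_fun do rewrite (partB _ _ (or_introl erefl)); exact: measurable_funB.
by under eq_fun do rewrite (partB _ _ (or_intror erefl)); exact: measurable_funB.
Qed.

Definition part (c : bool) : R[i] -> R := if c then @complex.Re R else @complex.Im R.

Lemma is_part_part c : is_part (part c).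
Proof. by case: c; [left|right]. Qed.

Lemma measurable_part c (f : R * R -> R[i]) : cmeasurable f ->
  measurable_fun setT (fun z : borel2 R => part c (f z)).
Proof. by case: c => -[]. Qed.

Lemma sum_bool (F : bool -> R) : \sum_(c : bool) F c = F true + F false.
Proof. by rewrite big_bool. Qed.

Lemma sum_bool2 (F : bool * bool -> R) :
  \sum_(i : bool * bool) F i = \sum_c \sum_d F (c, d).
Proof. by rewrite pair_bigA; apply: eq_bigr => -[]. Qed.

Lemma sum_bool3 (F : bool * (bool * bool) -> R) :
  \sum_(i : bool * (bool * bool)) F i = \sum_c \sum_d \sum_e F (c, (d, e)).
Proof.
have -> : \sum_c \sum_d \sum_e F (c, (d, e)) = \sum_c \sum_(i : bool * bool) F (c, i).
  by apply: eq_bigr => c _; rewrite (sum_bool2 (fun i => F (c, i))).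
by rewrite pair_bigA; apply: eq_bigr => -[].
Qed.

Lemma norm_part2 (a b c d : R) : `|a - b| + `|c + d| <= `|a| + `|d| + (`|c| + `|b|).
Proof. have := ler_normB a b; have := ler_normD c d; lra. Qed.

(** Eight real terms: a real or an imaginary part for each of the multiplier, the operator and the
    function. *)
Lemma norm_part8 (x y a b c d e f g h : R) : x = a - d - g - f -> y = c + b + e - h ->
  `|x| + `|y| <= `|a| + `|b| + (`|c| + `|d|) + (`|e| + `|f| + (`|g| + `|h|)).
Proof.
move=> -> ->; have h1 := ler_normB (a - d - g) f; have h2 := ler_normB (a - d) g.
have h3 := ler_normB a d; have h4 := ler_normB (c + b + e) h; have h5 := ler_normD (c + b) e.
have h6 := ler_normD c b; lra.
Qed.
End Measurability.

Lemma Ap_fin (R : realType) (p : R) w : 1 < p -> in_Ap p w ->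
  exists2 W, 1 <= W & Ap_const p w = W%:E /\ weight_pair p (p / (p - 1)) (W `^ p^-1) (posw w) (dualw p w).
Proof.
move=> p1 hw; exists (fine (Ap_const p w)); first exact: Ap_const_ge1.
split; last exact: Ap_weight_pair.
have W1 := Ap_const_ge1 p1 hw; have [_ ] := hw; move: W1.
by case: (Ap_const p w) => [r| |] //= W1; move: W1; rewrite ler10.
Qed.

Theorem theorem1p5 (R : realType) (theta1 : R)
    (K : R * R -> R * R -> R[i]) (T : (R * R -> R[i]) -> (R * R -> R[i]))
    (htheta1 : 0 < theta1 <= 1) (hK : CZX_kernel theta1 1 K)
    (hT : L2_operator T) (hTK : has_kernel T K) :
  (forall p : R, 1 < p ->
     exists C : R, forall w : R * R -> R, in_Ap p w ->
       forall f : R * R -> R[i], inL 2 f -> inLw p w f ->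
         (Lnormw p w (T f) <=
            C%:E * (Ap_const p w) `^ (p / (p - 1)) * Lnormw p w f)%E) /\
  (exists T1 : (R * R -> R[i]) -> (R * R -> R[i]),
     weak11_extension T T1 /\
     forall (p : R) (w lambda : R * R -> R), 1 < p ->
       in_Ap p w -> in_Ap p lambda ->
       let nu := fun x => w x `^ p^-1 * lambda x `^ (- p^-1) in
       exists C' : R, forall b : R * R -> R[i], L1loc b ->
         (bmo_norm nu b < +oo)%E ->
         forall f : R * R -> R[i], bounded_compact_support f ->
           (Lnormw p lambda (commutator T T1 b f) <=
              C'%:E * bmo_norm nu b * Lnormw p w f)%E).
Proof.
have /andP[th0 th1] := htheta1; have [C [hs hm hmT]] := hK.
have [M M0 hM] := L2_operator_bound hT; have C0 := normr_ge0 C.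
have rc c := part_cz th0 hs hm hmT hT hTK hM (is_part_part R c).
have [inT _ _] := hT.
split=> [p p1|].
  have [q1 pq qE] := conj_exponents p1.
  (* Four real terms: a part of [T] applied to a part of [f]. *)
  pose n : R := #|{: bool * bool}|%:R.
  exists (n * n * (2%:R * weightedK M `|C| theta1 p (p / (p - 1)) 1)) => w hw f f2 fw.
  have [W W1 [WE wp]] := Ap_fin p1 hw; have [hw' _] := hw.
  have C10 : 0 < W `^ p^-1 by rewrite powR_gt0 // (lt_le_trans ltr01).
  have rf := inLw_rint p1 hw' fw.
  have A0 := mulr_ge0 (ler0n R 2) (weightedK_ge0 theta1 M0 C0 p (p / (p - 1)) C10).
  have Lc c : L2 (@leb2 R) (fun z => part c (f z)) := L2_part (is_part_part R c) f2.
  have mf := f2.1; have mc c := measurable_part c mf.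
  have hg c z : `|part c (f z)| <= cmod (f z) := part_le_cmod _ (is_part_part R c).
  have pw0 z : 0 <= posw w z by rewrite ltW // posw_gt0.
  have ri c : rint (@leb2 R) (fun z => `|part c (f z)| `^ p * posw w z).
    apply: (rint_le _ _ rf).
      apply: measurable_funM; last by apply: measurable_posw; case: hw'.
      by apply: measurable_powR_c; exact: measurableT_comp.
    move=> z; rewrite [leLHS]ger0_norm ?mulr_ge0 ?powR_ge0 // [leRHS]ger0_norm ?mulr_ge0 ?powR_ge0 //.
    by rewrite ler_wpM2r // ge0_ler_powR ?nnegrE ?cmod_ge0 // ltW // (lt_trans ltr01).
  pose h (i : bool * bool) : borel2 R -> R := part_op T (part i.1) (fun t => part i.2 (f t)).
  have mh i : measurable_fun setT (h i) by case: (rc_L2 (rc i.1) (Lc i.2)).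
  have hF : {ae @leb2 R, forall z, cmod (T f z) <= \sum_i `|h i z|}.
    apply: (ae_imp (combineE hT f2)) => z ->; apply: le_trans (cmod_le _) _.
    by rewrite sum_bool2 !sum_bool; exact: norm_part2.
  have hh i := weighted_op M0 C0 th0 th1 (rc i.1) p1 q1 pq C10 wp (Lc i.2) (ri i.2).
  apply: le_trans (Lnormw_sum p1 (true, true) A0 hw' hw' (inT f f2).1 mf mh hF hh
    (fun i => mc i.2) (fun i z => hg i.2 z) rf) _.
  have XE : (Ap_const p w `^ (p / (p - 1)))%E = (W `^ (p / (p - 1)))%:E by rewrite WE.
  exact (lee_scale XE (poweR_ge0 _ _) (scale_assoc (ler0n R _) (weightedK_scale theta1 M0 C0 p1 W1))).
have [E1 ext1] := ext_exists M0 C0 th0 th1 (rc true).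
have [E2 ext2] := ext_exists M0 C0 th0 th1 (rc false).
pose E (c : bool) := if c then E1 else E2.
have ext c : is_ext (part_op T (part c)) (E c) by case: c.
exists (combine E1 E2); split.
  exact (combine_weak11 hT M0 C0 th0 th1 (rc true) (rc false) ext1 ext2).
move=> p w la p1 hw hla nu; have [q1 pq qE] := conj_exponents p1.
have [W W1 [_ wp]] := Ap_fin p1 hw; have [L L1 [_ lp]] := Ap_fin p1 hla.
have [[hw' _] [hla' _]] := (hw, hla).
have C10 : 0 < W `^ p^-1 by rewrite powR_gt0 // (lt_le_trans ltr01).
have C20 : 0 < L `^ p^-1 by rewrite powR_gt0 // (lt_le_trans ltr01).
pose n : R := #|{: bool * (bool * bool)}|%:R; set q := p / (p - 1) in q1 pq qE wp lp.
exists (n * n * (2%:R * commK M `|C| theta1 p q (W `^ p^-1) (L `^ p^-1) 1)) => b hb bmo f hf.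
have [B0 BE] := bmo_fin p1 hw hla hb bmo; set B := fine _ in B0 BE.
have [N hN] := bounded_support_box hf; have [mf _ _] := hf; have [mb _] := hb.
have bf c : bsupp (fun z => part c (f z)).
  split; first exact: measurable_part.
  by exists N => z; apply: le_trans (part_le_cmod _ (is_part_part R c)) (hN z).
have f2 : inL 2 f by apply/inL2P; split; [exact: bsupp_L2 (bf true)|exact: bsupp_L2 (bf false)].
have rf : rint (@leb2 R) (fun z => cmod (f z) `^ p * posw w z).
  have bc : bsupp (fun z => cmod (f z)).
    split; first exact: measurable_cmod.
    by exists N => z; rewrite ger0_norm ?cmod_ge0.
  by apply: rint_ext (bsupp_wint p1 (posw_local hw') bc) => z; rewrite ger0_norm ?cmod_ge0.
have ib d c r := rint_L1loc hb c r (is_part_part R d).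
have rbf d c : rint (@leb2 R) (fun z => part d (b z) * part c (f z)).
  exact: rint_mul_bsupp (measurable_part d mb) (ib d) (bf c).
pose h (i : bool * (bool * bool)) : borel2 R -> R := fun z =>
  part i.1 (b z) * part_op T (part i.2.1) (fun t => part i.2.2 (f t)) z -
  E i.2.1 (fun t => part i.1 (b t) * part i.2.2 (f t)) z.
have mh i : measurable_fun setT (h i).
  apply: measurable_funB; last by case: (ext i.2.1).
  by apply: measurable_funM; [exact: measurable_part|case: (rc_L2 (rc i.2.1) (bsupp_L2 (bf i.2.2)))].
(* The extension is linear up to null sets only, so the real and the imaginary part of [b * f] are
   split into products of parts here, outside of the pointwise estimate. *)
have linR c := ext_lin (rc c) (ext c) (-1) (rbf false false) (rbf true true).
have linI c := ext_lin (rc c) (ext c) 1 (rbf true false) (rbf false true).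
have ER : (fun t => complex.Re (b t * f t)) =
    (fun t => -1 * (part false (b t) * part false (f t)) + part true (b t) * part true (f t)).
  by apply/funext => t; rewrite reZ mulN1r addrC.
have EI : (fun t => complex.Im (b t * f t)) =
    (fun t => 1 * (part true (b t) * part false (f t)) + part false (b t) * part true (f t)).
  by apply/funext => t; rewrite imZ mul1r.
have hF : {ae @leb2 R, forall z, cmod (commutator T (combine E1 E2) b f z) <= \sum_i `|h i z|}.
  have h1 := ae_mp2 (linR true) (linR false) (fun z x y => conj x y).
  have h2 := ae_mp2 (linI true) (linI false) (fun z x y => conj x y).
  have h3 := ae_mp2 h1 h2 (fun z x y => conj x y).
  apply: (ae_mp2 h3 (combineE hT f2)) => z [[r1 r2] [i1 i2]] Tz.
  apply: le_trans (cmod_le _) _; rewrite sum_bool3 !sum_bool.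
  rewrite (partB _ _ (or_introl erefl)) (partB _ _ (or_intror erefl)) reZ imZ Tz /combine ER EI /=.
  rewrite /E in r1 r2 i1 i2; rewrite r1 r2 i1 i2; apply: norm_part8; rewrite /h /E /=; ring.
have A0 := mulr_ge0 (ler0n R 2) (mulr_ge0 (ler0n R 4) (commC_ge0 theta1 M0 C0 p q C10 C20 B0)).
have hh i := commutator_term M0 C0 th0 th1 (rc i.2.1) p1 q1 pq (ext i.2.1) C10 C20 wp lp B0
  (measurable_part i.1 mb) (ib i.1) (fun N c r => clamp_osc p1 hw hla hb bmo N c (is_part_part R i.1)) (bf i.2.2).
have mT1 : cmeasurable (combine E1 E2 (fun t => b t * f t)).
  by split; [apply: measurable_funB|apply: measurable_funD]; (exact: ext1.1 || exact: ext2.1).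
have mF : cmeasurable (commutator T (combine E1 E2) b f).
  by apply: cmeasurableB => //; apply: cmeasurableM => //; case: (inT f f2).
apply: le_trans (Lnormw_sum p1 (true, (true, true)) A0 hla' hw' mF mf mh hF hh
  (fun i => measurable_part i.2.2 mf) (fun i z => part_le_cmod _ (is_part_part R i.2.2)) rf) _.
apply: (lee_scale BE (poweR_ge0 _ _)); apply: scale_assoc (ler0n R _) _.
exact (eq_le (commK_linear M `|C| theta1 p q (W `^ p^-1) (L `^ p^-1) B)).
Qed.
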